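(* Let $L>0$, let $b_l,b_r:\mathbb{R}\to\mathbb{R}$ be $L$-periodic $C^1$ functions, and let $f_l,f_r$ be real constants with $\max b_l<f_l<f_r<\min b_r$. Set $$\Omega=\mathbb{R}\times(f_l,f_r)\subset D=\{(x,y)\in\mathbb{R}\times\mathbb{R}\mid b_l(x)<y<b_r(x)\},$$ $D_L:=D\cap([0,L)\times\mathbb{R})$ and $\Omega_L:=[0,L)\times(f_l,f_r)$. Then the following hold. (1) For each $a>0$ there is a unique $\boldsymbol{s}\in H_0^1(D_{/L})^2$ such that $$a\int_{D_L}\nabla\boldsymbol{s}:\nabla\boldsymbol{u}+\int_{D_L\setminus\Omega_L}\boldsymbol{s}\cdot\boldsymbol{u}=\int_{\Omega_L}\operatorname{div}\boldsymbol{u}\qquad\forall\,\boldsymbol{u}\in H_0^1(D_{/L})^2.$$ (2) The solution is of the form $\boldsymbol{s}(x,y)=(0,S(x,y))$, where $S\in H_0^1(D_{/L})$ is the solution of the scalar-valued equation $$a\int_{D_L}\nabla S\cdot\nabla u+\int_{D_L\setminus\Omega_L}S u=\int_{\Omega_L}u_y\qquad\forall\,u\in H_0^1(D_{/L}).$$ (3) The PDE-based thickness $T^a_{D,\Omega}:=\frac{2}{\sqrt a\,\operatorname{div}\boldsymbol{s}}$ converges to the thickness $\bar T_\Omega=f_r-f_l$ a.e. on $\Omega$ as $a\to0$. (4) Moreover, for all $a>0$, $$\left\|\frac{1}{T^a_{D,\Omega}}-\frac{1}{\bar T_\Omega}\right\|_{L^2(\Omega_L)}\le 2\frac{\sqrt{|\Omega_L|}}{T^2}\sqrt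 a+2\frac{\sqrt L}{\sqrt m}\exp\left(-\frac{m}{\sqrt a}\right),$$ where $T:=\bar T_\Omega=f_r-f_l>0$, $|\Omega_L|:=LT>0$ is the area of $\Omega_L$, and $m:=\min\{\min b_r-f_r,\ f_l-\max b_l\}>0$.
   Context: For a domain $\Omega\subset\mathbb{R}^N$, the (local) thickness is $\bar T_\Omega(\boldsymbol{x}):=\sup\{\text{diameter of the closed ball } B\mid \boldsymbol{x}\in B\subset\Omega\}$ for $\boldsymbol{x}\in\Omega$; for the band it is the constant $f_r-f_l$. $H_0^1(D_{/L})$ denotes the space of functions on $D$ that are $L$-periodic in the $x$ direction, locally $H^1$ up to the boundary with $H^1$ restriction to the unit region $D_L$, and with zero trace on $\partial D$; $H_0^1(D_{/L})^2$ denotes vector fields with both components in it. $\nabla\boldsymbol{s}:\nabla\boldsymbol{u}=\sum_{i,j}s^i_{x_j}u^i_{x_j}$ is the Frobenius inner product. The inverse thickness is understood as $\frac{1}{T^a_{D,\Omega}}=\frac{\sqrt a}{2}\operatorname{div}\boldsymbol{s}$, an $L^2$ function on $\Omega_L$ (also where $\operatorname{div}\boldsymbol{s}$ vanishes). *)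

(* Defs.v *)
(* Library: MathComp and MathComp-Analysis.

   Elements of function spaces are represented by Borel functions
   R * R -> R, and two of them are equal when they agree almost everywhere on
   the domain under consideration. *)
From HB Require Import structures.
From mathcomp Require Export all_boot all_order all_algebra.
From mathcomp Require Export all_classical all_reals all_analysis.
Export Order.TTheory GRing.Theory Num.Theory.
Export numFieldNormedType.Exports.

Set Implicit Arguments.
Unset Strict Implicit.
Unset Printing Implicit Defensive.

Local Open Scope classical_set_scope.
Local Open Scope ring_scope.

(* The type ascription selects the Borel sigma-algebra on each factor; its
   carrier is convertible to R * R. *)
Definition plane_measure (R : realType) :
    {measure set (measurableTypeR R * measurableTypeR R) -> \bar R} :=
  (@lebesgue_measure R \x @lebesgue_measure R)%E.
Arguments plane_measure : clear implicits.

Section Calculus.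
Context {R : realType}.
Local Notation plane := (R * R)%type.
Local Notation mu := (plane_measure R).

Definition e_x : plane := (1, 0).
Definition e_y : plane := (0, 1).

Definition C1_line (b : R -> R) : Prop :=
  (forall x, derivable b x 1) /\ continuous (derive1 b).

Definition C1_plane (phi : plane -> R) : Prop :=
  [/\ forall p, derivable phi p e_x, forall p, derivable phi p e_y,
      continuous ('D_e_x phi) & continuous ('D_e_y phi)].

Definition C1_compact_support (D : set plane) (phi : plane -> R) : Prop :=
  C1_plane phi /\
  exists K : set plane,
    [/\ compact K, K `<=` D & forall p, ~ K p -> phi p = 0].

Definition loc_integrable (D : set plane) (u : plane -> R) : Prop :=
  forall K : set plane, compact K -> K `<=` D ->
    mu.-integrable K (EFin \o u).

(* First-order weak derivatives are tested against compactly supported C^1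
   functions, as in Gilbarg-Trudinger, section 7.3. *)
Definition is_weak_partial (D : set plane) (v : plane) (u g : plane -> R) :
    Prop :=
  [/\ loc_integrable D u, loc_integrable D g &
      forall phi, C1_compact_support D phi ->
        \int[mu]_(p in D) (u p * 'D_v phi p) =
        - \int[mu]_(p in D) (g p * phi p)].

(* A chosen representative of the weak derivative, which is unique up to a
   null subset of D; the zero function if u has no weak derivative. *)
Definition weak_partial (D : set plane) (v : plane) (u : plane -> R) :
    plane -> R :=
  xget (fun=> 0) [set g | is_weak_partial D v u g].

Definition norm2 (A : set plane) (f : plane -> R) : \bar R :=
  'N[mu]_(2%:E)[EFin \o (f \_ A)]%E.

Definition square_integrable (A : set plane) (f : plane -> R) : Prop :=
  f \_ A \in Lfun mu 2%:E.

End Calculus.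

Section Domains.
Context {R : realType}.
Local Notation plane := (R * R)%type.

Definition channel (bl br : R -> R) : set plane :=
  [set p | bl p.1 < p.2 /\ p.2 < br p.1].

Definition band (fl fr : R) : set plane := [set p | fl < p.2 /\ p.2 < fr].

Definition strip (al be : R) : set plane := [set p | al <= p.1 /\ p.1 < be].

Definition unit_region (L : R) (A : set plane) : set plane :=
  A `&` strip 0 L.

(* Euclidean ball: the library's closed balls in R * R are squares. *)
Definition disk (c : plane) (r : R) : set plane :=
  [set p | (p.1 - c.1) ^+ 2 + (p.2 - c.2) ^+ 2 <= r ^+ 2].

(* The supremum is real-valued, hence meaningful only when the diameters of
   the disks contained in Om are bounded. *)
Definition thickness (Om : set plane) (p : plane) : R :=
  sup [set d | exists c r, [/\ 0 < r, d = 2 * r, disk c r p &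
                               disk c r `<=` Om]].

End Domains.

Section Sobolev.
Context {R : realType}.
Local Notation plane := (R * R)%type.
Local Notation mu := (plane_measure R).
Variables (L : R) (bl br : R -> R).
Let D := channel bl br.
Let DL := unit_region L D.

Definition H1per (u : plane -> R) : Prop :=
  [/\ {ae mu, forall p, D p -> u (p + (L, 0)) = u p},
      exists g, is_weak_partial D e_x u g,
      exists g, is_weak_partial D e_y u g &
      forall al be, let A := D `&` strip al be in
        [/\ square_integrable A u,
            square_integrable A (weak_partial D e_x u) &
            square_integrable A (weak_partial D e_y u)]].

(* Squared distance in L^2 of one period of the graph of b, with respect to
   arc length, between the restriction of phi and x |-> g x. *)
Definition graph_sqdist (b : R -> R) (phi : plane -> R) (g : R -> R) :
    \bar R :=
  (\int[lebesgue_measure]_(x in `[0%R, L[)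
     ((phi (x, b x) - g x) ^+ 2 * Num.sqrt (1 + derive1 b x ^+ 2))%:E)%E.

(* The trace operator is the continuous extension to H^1 of the restriction
   to the boundary of functions that are C^1 up to the boundary: gl and gr
   are the traces of u on the graphs of bl and br (parametrized by x) iff
   they are the L^2 limits of the boundary values of C^1 functions that
   approximate u in H^1. *)
Definition has_trace (u : plane -> R) (gl gr : R -> R) : Prop :=
  exists phi : nat -> plane -> R,
    (forall n, C1_plane (phi n) /\ periodic (phi n) (L, 0)) /\
    [/\ norm2 DL (phi n \- u) @[n --> \oo] --> 0%E,
        norm2 DL ('D_e_x (phi n) \- weak_partial D e_x u) @[n --> \oo] --> 0%E,
        norm2 DL ('D_e_y (phi n) \- weak_partial D e_y u) @[n --> \oo] --> 0%E,
        graph_sqdist bl (phi n) gl @[n --> \oo] --> 0%E &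
        graph_sqdist br (phi n) gr @[n --> \oo] --> 0%E].

Definition H10per (u : plane -> R) : Prop :=
  H1per u /\ has_trace u (fun=> 0) (fun=> 0).

Definition H10per_vec (s : plane -> plane) : Prop :=
  H10per (fst \o s) /\ H10per (snd \o s).

Definition grad_dot (S u : plane -> R) (p : plane) : R :=
  weak_partial D e_x S p * weak_partial D e_x u p +
  weak_partial D e_y S p * weak_partial D e_y u p.

Definition grad_frobenius (s u : plane -> plane) (p : plane) : R :=
  grad_dot (fst \o s) (fst \o u) p + grad_dot (snd \o s) (snd \o u) p.

Definition divergence (s : plane -> plane) (p : plane) : R :=
  weak_partial D e_x (fst \o s) p + weak_partial D e_y (snd \o s) p.

Definition vector_solution (fl fr a : R) (s : plane -> plane) : Prop :=
  let OmL := unit_region L (band fl fr) in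
  H10per_vec s /\
  forall u, H10per_vec u ->
    a * (\int[mu]_(p in DL) grad_frobenius s u p) +
    \int[mu]_(p in DL `\` OmL) ((s p).1 * (u p).1 + (s p).2 * (u p).2) =
    \int[mu]_(p in OmL) divergence u p.

Definition scalar_solution (fl fr a : R) (S : plane -> R) : Prop :=
  let OmL := unit_region L (band fl fr) in
  H10per S /\
  forall u, H10per u ->
    a * (\int[mu]_(p in DL) grad_dot S u p) +
    \int[mu]_(p in DL `\` OmL) (S p * u p) =
    \int[mu]_(p in OmL) weak_partial D e_y u p.

(* Division by zero yields 0 here; only the inverse below is meaningful
   where the divergence vanishes. *)
Definition pde_thickness (a : R) (s : plane -> plane) (p : plane) : R :=
  2 / (Num.sqrt a * divergence s p).

Definition pde_inv_thickness (a : R) (s : plane -> plane) (p : plane) : R :=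
  Num.sqrt a / 2 * divergence s p.

End Sobolev.

(* Almost everywhere convergence as a -> 0+ of a family (f a)_a of functions
   defined up to null sets.  As the parameter a is uncountable, pointwise
   convergence depends on the representatives of the f a; the definition asks
   for representatives v a that converge outside one null set along the full
   limit a -> 0+.  This implies f (a_n) -> l a.e. for every sequence
   a_n -> 0+, whatever the representatives. *)
Definition ae_cvg_at_right0 (R : realType) (A : set (R * R))
    (f : R -> R * R -> R) (l : R * R -> R) : Prop :=
  exists v : R -> R * R -> R,
    (forall a, 0 < a ->
       {ae plane_measure R, forall p, A p -> v a p = f a p}) /\
    {ae plane_measure R, forall p, A p -> v a p @[a --> 0^'+] --> l p}.

(* Main.v *)
(* Write a triple (u, u_x, u_y) for an element of H^1_0. The transversal Poincare inequality makes the
   bilinear form coercive, and Riesz' theorem gives existence and uniqueness. The integral over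
   Omega_L of the x-derivative of a periodic function vanishes, so the first component of a solution of
   the vector problem solves the homogeneous scalar problem and is zero.

   For the error estimate, S is compared with a function W of y alone which is affine in the band,
   decays like exp(-t / sqrt a) at distance t outside of it, and vanishes with its derivative at t = m;
   the slope of W inside the band is chosen so that a W' - 1_Omega is continuous.  Outside the band W
   solves a W'' = W up to a residual proportional to exp(-3 s), s = (m - t) / sqrt a.  Testing the
   equation of the error e = S - W with exp(-t / sqrt a) e bounds the L^2(Omega_L) norm of e_y by the
   residual, and W' is explicit.

   For the almost everywhere convergence one must choose representatives for all a at once. At the
   nodes 1/(i+1) the errors (sqrt a / 2) e_y have summable squared L^2 norms, hence tend to 0 almost
   everywhere. Between two nodes, S_b is the sum of a power series in 1/(i+1) - b given by the iterates
   of the resolvent, whose y-derivative converges outside a null set independent of b; the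
   square-summability over the nodes of the majorants of these series controls the oscillation of
   sqrt b * (S_b)_y. *)
Require Import Defs.
From mathcomp Require Import ring lra zify measurable_realfun.

Set Implicit Arguments.
Unset Strict Implicit.
Unset Printing Implicit Defensive.

Local Open Scope classical_set_scope.
Local Open Scope ring_scope.

(** Weak derivatives and traces are defined through choices. Taking [space] to be the closure of
    smooth triples reduces completeness to that of L^2; the price is the identification with
    [H10per], which rests on closedness and uniqueness of weak derivatives.

    The term e^(-3s) of W is there because no combination of e^s and e^-s vanishes together with its
    derivative at s = 0. The residual it creates is largest at distance m, where the weight adds a
    factor exp(-m / sqrt a); testing with e alone would cost a factor m / sqrt a that the constants
    of (4) do not allow. In (4) one copy of sqrt(L / m) exp(-m / sqrt a) comes from the slope of W,
    the other from e_y.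

    The nodes are harmonic because the majorants scale with the squared relative gap of the nodes
    times a bound that blows up as a tends to 0, so a fixed ratio would not be summable. Coercivity
    alone bounds a times the Dirichlet energy by a multiple of 1 / a, which leaves the divergent
    harmonic series; the comparison with W improves this to a multiple of 1 / sqrt a. *)

Lemma quad_bound (R : realType) (p q d : R) :
  0 <= q -> (forall t, 0 <= 2 * t * p + t ^+ 2 * q + d) -> p ^+ 2 <= d * (q + 1).
Proof.
(* The minimizer is [- p / q]; the denominator [q + 1] stays positive when [q = 0], which is why the
   bound has [q + 1]. *)
move=> q0 /(_ (- p / (q + 1))) H.
have q1 : 0 < q + 1 by lra.
have E : 2 * (- p / (q + 1)) * p + (- p / (q + 1)) ^+ 2 * q + d
       = (d * (q + 1) ^+ 2 - p ^+ 2 * (q + 2)) / (q + 1) ^+ 2.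
  by field; lra.
move: H; rewrite E => /(mulr_ge0 (sqr_ge0 (q + 1))).
rewrite mulrCA divff ?mulr1; last by rewrite expf_neq0//; lra.
move=> H; rewrite -(ler_pM2r q1).
have : 0 <= p ^+ 2 by exact: sqr_ge0.
nra.
Qed.

(** * Riesz representation for a positive semidefinite form, by minimization *)

Section Riesz.
Context (R : realType) (E : lmodType R) (V : set E).
Context (b : E -> E -> R) (l : E -> R) (C : R).
Hypothesis V0 : V 0.
Hypothesis VL : forall k u v, V u -> V v -> V (k *: u + v).
Hypothesis bC : forall u v, V u -> V v -> b u v = b v u.
Hypothesis bL : forall k u v w, V u -> V v -> V w ->
  b (k *: u + v) w = k * b u w + b v w.
Hypothesis b_ge0 : forall u, V u -> 0 <= b u u.
Hypothesis lL : forall k u v, V u -> V v -> l (k *: u + v) = k * l u + l v.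
Hypothesis C_ge0 : 0 <= C.
Hypothesis l_bound : forall u, V u -> l u ^+ 2 <= C * b u u.
Hypothesis b_complete : forall u_ : nat -> E, (forall n, V (u_ n)) ->
  (forall n, b (u_ n.+1 - u_ n) (u_ n.+1 - u_ n) <= 4^-1 ^+ n) ->
  exists2 u, V u & forall e, 0 < e ->
    exists N, forall n, (N <= n)%N -> b (u_ n - u) (u_ n - u) < e.

Let VB u v : V u -> V v -> V (u - v).
Proof. by move=> uV vV; rewrite addrC -scaleN1r; exact: VL. Qed.

Let bLr k u v w : V u -> V v -> V w -> b w (k *: u + v) = k * b w u + b w v.
Proof. by move=> uV vV wV; rewrite bC ?bL ?(bC uV) ?(bC vV)//; exact: VL. Qed.

Let b2 t u w : V u -> V w ->
  b (t *: w + u) (t *: w + u) = b u u + 2 * t * b u w + t ^+ 2 * b w w.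
Proof.
by move=> uV wV; rewrite bL ?bLr//; [rewrite (bC wV uV); ring | exact: VL].
Qed.

Lemma psd_cauchy_schwarz u w : V u -> V w -> b u w ^+ 2 <= b u u * (b w w + 1).
Proof.
move=> uV wV; apply: quad_bound; first exact: b_ge0.
move=> t; have := b_ge0 (VL t wV uV); rewrite b2//; lra.
Qed.

Let J v := b v v - 2 * l v.

(** Direct method: by the parallelogram identity a minimizing sequence of [J] with excess
    [4^-1 * 4^-1 ^+ n] has increments of size [4^-1 ^+ n]. The form is only semidefinite, since
    functions are not identified when they agree almost everywhere; so completeness is asked for in
    the seminorm, and only along geometric sequences, the shape in which L^2 completeness is
    available. *)
Lemma riesz_symmetric : exists2 u, V u & forall w, V w -> b u w = l w.
Proof.
have Jlb v : V v -> - (C + 1) <= J v.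
  move=> vV; rewrite /J; have := l_bound vV; have := b_ge0 vV => b0 lb.
  have C0 := C_ge0; suff : 2 * l v <= b v v + C by lra.
  have [l0|l0] := ltP (l v) 0; first by lra.
  rewrite -ler_sqr ?nnegrE; [|lra|lra].
  have := sqr_ge0 (b v v - C); lra.
pose S := [set J v | v in V].
have hS : has_inf S.
  split; first by exists (J 0), 0.
  by exists (- (C + 1)) => _ [v vV <-]; exact: Jlb.
pose d := inf S.
have dJ v : V v -> d <= J v by move=> vV; apply: ge_inf; [exact: hS.2|exists v].
have ex n : exists v, V v /\ J v <= d + 4^-1 * 4^-1 ^+ n.
  have [|_ [v vV <-] /ltW vd] := @inf_adherent _ S (4^-1 * 4^-1 ^+ n) _ hS.
    by rewrite mulr_gt0// exprn_gt0.
  by exists v.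
have {ex}[u_ uP] := choice ex.
have uV n : V (u_ n) by have [] := uP n.
have uJ n : J (u_ n) <= d + 4^-1 * 4^-1 ^+ n by have [] := uP n.
have step n : b (u_ n.+1 - u_ n) (u_ n.+1 - u_ n) <= 4^-1 ^+ n.
  have := dJ _ (VL 2^-1 (uV n.+1) (VL (- 2^-1) (uV n.+1) (uV n))).
  have mid : V (2^-1 *: u_ n.+1 + 2^-1 *: u_ n).
    by rewrite -[X in _ + X]addr0; exact/VL/VL.
  move=> _; have := dJ _ mid.
  rewrite /J -[2^-1 *: u_ n]addr0.
  have V2 : V (2^-1 *: u_ n + 0) by exact: VL.
  rewrite b2// lL// lL//.
  have l0 : l 0 = 0.
    have := lL 1 V0 V0; rewrite scale1r addr0 mul1r; lra.
  have b0 w : V w -> b 0 w = 0.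
    by move=> wV; have := bL 1 V0 V0 wV; rewrite scale1r addr0 mul1r; lra.
  have := uJ n; have := uJ n.+1; rewrite /J.
  rewrite (bL _ (uV n) V0 (uV n.+1)) (b2 _ V0 (uV n)) l0 !b0// exprS.
  have -> : u_ n.+1 - u_ n = -1 *: u_ n + u_ n.+1 by rewrite scaleN1r addrC.
  rewrite b2// (bC (uV n.+1) (uV n)).
  have : 0 <= 4^-1 ^+ n :> R by rewrite exprn_ge0.
  lra.
have [u Vu uu] := b_complete uV step.
exists u => // w wV.
(* [J] at [u_ n + t *: w] is at least the infimum, so a quadratic polynomial in [t] is nonnegative:
   the Euler-Lagrange equation up to the excess of [u_ n]. *)
have half n : (b (u_ n) w - l w) ^+ 2 <= 4^-1 ^+ n * (b w w + 1).
  apply: quad_bound; first exact: b_ge0.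
  move=> t; have := dJ _ (VL t wV (uV n)); have := uJ n.
  rewrite /J b2// lL//.
  have : 0 <= 4^-1 ^+ n :> R by rewrite exprn_ge0.
  lra.
apply/eqP; rewrite -subr_eq0 -sqrf_eq0; apply/eqP/le_anti.
rewrite sqr_ge0 andbT; apply/ler_addgt0Pl => e e0; rewrite addr0.
have q0 : 0 < 4 * (b w w + 1) by have := b_ge0 wV; lra.
have [N HN] := uu (e / (4 * (b w w + 1))) (divr_gt0 e0 q0).
have : (4^-1 ^+ n : R^o) @[n --> \oo] --> (0 : R^o).
  by apply: cvg_expr; rewrite ger0_norm// invf_lt1//; lra.
move=> /cvgrPdist_lt /(_ _ (divr_gt0 e0 q0)) [M _ HM].
have := HN (maxn N M) (leq_maxl _ _).
have := HM (maxn N M) (leq_maxr _ _).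
have := half (maxn N M); set n := maxn N M.
rewrite /= sub0r normrN ger0_norm ?exprn_ge0// => h1 h2 h3.
have := psd_cauchy_schwarz (VB (uV n) Vu) wV.
have -> : b (u_ n - u) w = b (u_ n) w - b u w.
  by rewrite addrC -scaleN1r bL//; lra.
move=> h4; have q1 : 0 <= b w w + 1 by lra.
have h2' : 4^-1 ^+ n * (b w w + 1) <= e / 4.
  apply: (@le_trans _ _ (e / (4 * (b w w + 1)) * (b w w + 1))).
    by rewrite ler_wpM2r// ltW.
  by rewrite le_eqVlt; apply/orP; left; apply/eqP; field; lra.
have h3' : b (u_ n - u) (u_ n - u) * (b w w + 1) <= e / 4.
  apply: (@le_trans _ _ (e / (4 * (b w w + 1)) * (b w w + 1))).
    by rewrite ler_wpM2r// ltW.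
  by rewrite le_eqVlt; apply/orP; left; apply/eqP; field; lra.
have := sqr_ge0 (b (u_ n) w - b u w + (b (u_ n) w - l w)).
nra.
Qed.

End Riesz.

(** * Square integrable functions and their inner product *)

Section SquareIntegrable.
Context d (T : measurableType d) (R : realType) (mu : {measure set T -> \bar R}).
Implicit Types (A B : set T) (f g h : T -> R).

(** A predicate on functions rather than a quotient space; equality almost everywhere is dealt with
    by [ip0_ae] and [ae_ip]. *)
Definition L2 A f :=
  measurable_fun A f /\ mu.-integrable A (EFin \o (fun x => f x ^+ 2)).

Definition ip A f g := \int[mu]_(x in A) (f x * g x).

Lemma L2_mul A f g : measurable A -> L2 A f -> L2 A g ->
  mu.-integrable A (EFin \o (fun x => f x * g x)).
Proof.
move=> mA [mf f2] [mg g2].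
apply: le_integrable (integrableD mA f2 g2) => //.
  by apply/measurable_EFinP; exact: measurable_funM.
move=> x Ax; rewrite /= lee_fin ler_norml [X in _ && (_ <= X)]ger0_norm.
  have := sqr_ge0 (f x - g x); have := sqr_ge0 (f x + g x).
  have := sqr_ge0 (f x); have := sqr_ge0 (g x).
  by rewrite ger0_norm => *; [apply/andP; split; nra | nra].
by rewrite addr_ge0// sqr_ge0.
Qed.

Lemma L2P A f : measurable A -> measurable_fun A f ->
  (\int[mu]_(x in A) (f x ^+ 2)%:E < +oo)%E -> L2 A f.
Proof.
move=> mA mf foo; split => //; apply/integrableP; split.
  by apply/measurable_EFinP; exact: measurable_funX.
rewrite (eq_integral (fun x => (f x ^+ 2)%:E))//.
by move=> x _ /=; rewrite ger0_norm// sqr_ge0.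
Qed.

Lemma L2D A f g : measurable A -> L2 A f -> L2 A g -> L2 A (f \+ g).
Proof.
move=> mA Lf Lg; have [mf f2] := Lf; have [mg g2] := Lg.
split; first exact: measurable_funD.
have H := integrableD mA (integrableD mA f2 g2)
   (integrableZl mA 2 (L2_mul mA Lf Lg)).
apply: eq_integrable H => // x _ /=; rewrite -!EFinD; congr EFin; ring.
Qed.

Lemma L2M A f h (M : R) : measurable A -> L2 A f -> measurable_fun A h ->
  (forall x, A x -> `|h x| <= M) -> L2 A (fun x => h x * f x).
Proof.
move=> mA Lf mh hM; have [mf f2] := Lf.
have mhf : measurable_fun A (fun x => h x * f x) by exact: measurable_funM.
split => //; apply: le_integrable (integrableZl mA (M ^+ 2) f2) => //.
  by apply/measurable_EFinP; exact: measurable_funX.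
move=> x Ax; rewrite /= lee_fin exprMn !ger0_norm ?(mulr_ge0 (sqr_ge0 _) (sqr_ge0 _))//.
rewrite ler_wpM2r ?sqr_ge0// -[h x ^+ 2]ger0_norm ?sqr_ge0// normrX.
by rewrite ler_sqr ?nnegrE ?(le_trans _ (hM _ Ax))//; exact: hM.
Qed.

Lemma L2Z A f k : measurable A -> L2 A f -> L2 A (k \*o f).
Proof.
by move=> mA Lf; apply: (@L2M _ _ (cst k) `|k|) => //; exact: measurable_cst.
Qed.

Lemma L2B A f g : measurable A -> L2 A f -> L2 A g -> L2 A (f \- g).
Proof.
move=> mA Lf Lg; have := L2D mA Lf (L2Z (-1) mA Lg).
by congr L2; apply/funext => x /=; rewrite mulN1r.
Qed.

Lemma L2S A B f : measurable A -> measurable B -> B `<=` A -> L2 A f -> L2 B f.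
Proof.
move=> mA mB BA [mf f2]; split; first exact: measurable_funS BA mf.
exact: integrableS f2.
Qed.

Lemma L20 A : measurable A -> L2 A (cst 0).
Proof.
move=> mA; split; first exact: measurable_cst.
apply: (@eq_integrable _ _ _ mu A mA (cst 0%E)); last exact: integrable0.
by move=> x _ /=; rewrite expr0n.
Qed.

Lemma ipC A f g : ip A f g = ip A g f.
Proof. by rewrite /ip; apply: eq_Rintegral => x _; rewrite mulrC. Qed.

Lemma ipDl A f1 f2 g : measurable A -> L2 A f1 -> L2 A f2 -> L2 A g ->
  ip A (f1 \+ f2) g = ip A f1 g + ip A f2 g.
Proof.
move=> mA L1 L2 Lg; rewrite /ip -RintegralD//; [|exact: L2_mul..].
by apply: eq_Rintegral => x _ /=; rewrite mulrDl.
Qed.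

Lemma ipZl A f g k : measurable A -> L2 A f -> L2 A g ->
  ip A (k \*o f) g = k * ip A f g.
Proof.
move=> mA Lf Lg; rewrite /ip -RintegralZl//; last exact: L2_mul.
by apply: eq_Rintegral => x _ /=; rewrite mulrA.
Qed.

Lemma ipBl A f1 f2 g : measurable A -> L2 A f1 -> L2 A f2 -> L2 A g ->
  ip A (f1 \- f2) g = ip A f1 g - ip A f2 g.
Proof.
move=> mA L1 L2 Lg; rewrite /ip -RintegralB//; [|exact: L2_mul..].
by apply: eq_Rintegral => x _ /=; rewrite mulrBl.
Qed.

Lemma ipDr A f g1 g2 : measurable A -> L2 A f -> L2 A g1 -> L2 A g2 ->
  ip A f (g1 \+ g2) = ip A f g1 + ip A f g2.
Proof. by move=> *; rewrite ipC ipDl// !(ipC A f). Qed.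

Lemma ipZr A f g k : measurable A -> L2 A f -> L2 A g ->
  ip A f (k \*o g) = k * ip A f g.
Proof. by move=> *; rewrite ipC ipZl// ipC. Qed.

Lemma ipBr A f g1 g2 : measurable A -> L2 A f -> L2 A g1 -> L2 A g2 ->
  ip A f (g1 \- g2) = ip A f g1 - ip A f g2.
Proof. by move=> *; rewrite ipC ipBl// !(ipC A f). Qed.

Lemma ip_ge0 A f : 0 <= ip A f f.
Proof. by apply: Rintegral_ge0 => x _; rewrite -expr2 sqr_ge0. Qed.

Lemma ip_EFin A f g : measurable A -> L2 A f -> L2 A g ->
  (ip A f g)%:E = (\int[mu]_(x in A) (f x * g x)%:E)%E.
Proof.
by move=> mA Lf Lg; rewrite fineK//; apply: integrable_fin_num => //; exact: L2_mul.
Qed.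

Lemma ip_le A f g : measurable A -> L2 A f -> L2 A g ->
  (forall x, A x -> f x ^+ 2 <= g x ^+ 2) -> ip A f f <= ip A g g.
Proof.
move=> mA Lf Lg fg; apply: le_Rintegral ; [by []|exact: L2_mul|exact: L2_mul|].
by move=> x Ax; rewrite -!expr2; exact: fg.
Qed.

Lemma ip_cauchy_schwarz A f g : measurable A -> L2 A f -> L2 A g ->
  ip A f g ^+ 2 <= ip A f f * ip A g g.
Proof.
move=> mA Lf Lg.
have quad t : 0 <= 2 * t * ip A f g + t ^+ 2 * ip A g g + ip A f f.
  have := ip_ge0 A (f \+ t \*o g); have Lt := L2Z t mA Lg.
  have Lft := L2D mA Lf Lt.
  by rewrite ipDl// !ipDr// !ipZl// !ipZr// (ipC A g f); lra.
have := ip_ge0 A f; have := ip_ge0 A g.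
set p := ip A f g in quad *; set q := ip A g g in quad *; set r := ip A f f in quad *.
rewrite le_eqVlt => /orP[/eqP q0|q0 r0]; last first.
  have := quad (- p / q).
  have -> : 2 * (- p / q) * p + (- p / q) ^+ 2 * q + r = (r * q - p ^+ 2) / q.
    by field; lra.
  by rewrite pmulr_lge0 ?invr_gt0// subr_ge0.
move=> r0; rewrite -q0 mulr0.
have [->|p0] := eqVneq p 0; first by rewrite expr0n.
(* With [ip A g g = 0] the polynomial is affine in [t], and this [t] gives it the value -1. *)
have := quad (- (r + 1) / (2 * p)); rewrite -q0 mulr0 addr0.
have -> : 2 * (- (r + 1) / (2 * p)) * p + r = -1 by field.
lra.
Qed.

Lemma norm_ip_le A f g : measurable A -> L2 A f -> L2 A g ->
  `|ip A f g| <= Num.sqrt (ip A f f) * Num.sqrt (ip A g g).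
Proof.
move=> mA Lf Lg; rewrite -sqrtrM ?ip_ge0// -sqrtr_sqr ler_wsqrtr//.
exact: ip_cauchy_schwarz.
Qed.

Lemma ip_add_le A f g : measurable A -> L2 A f -> L2 A g ->
  ip A (f \+ g) (f \+ g) <= 2 * ip A f f + 2 * ip A g g.
Proof.
move=> mA Lf Lg; have Lfg := L2D mA Lf Lg.
have := ip_ge0 A (f \- g); have Lfg' := L2B mA Lf Lg.
rewrite ipBl// !ipBr// ipDl// !ipDr// (ipC A g f); lra.
Qed.

Lemma ip0_ae A f : measurable A -> L2 A f -> ip A f f = 0 ->
  {ae mu, forall x, A x -> f x = 0}.
Proof.
move=> mA Lf f0.
have mf := Lf.1; have mf2 : measurable_fun A (fun x => (f x * f x)%:E).
  by apply/measurable_EFinP; exact: measurable_funM.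
have := ip_EFin mA Lf Lf; rewrite f0 => /esym H.
have /(ae_eq_integral_abs mu mA mf2) : (\int[mu]_(x in A) `|(f x * f x)%:E| = 0)%E.
  rewrite -[RHS]H; apply: eq_integral => x _ /=.
  by rewrite ger0_norm// -expr2 sqr_ge0.
apply: filterS => x /[apply] /= [[]] /eqP.
by rewrite mulf_eq0 orbb => /eqP.
Qed.

Lemma ae_ip A f1 f2 g1 g2 : measurable A ->
  L2 A f1 -> L2 A f2 -> L2 A g1 -> L2 A g2 ->
  {ae mu, forall x, A x -> f1 x = f2 x} -> {ae mu, forall x, A x -> g1 x = g2 x} ->
  ip A f1 g1 = ip A f2 g2.
Proof.
move=> mA F1 F2 G1 G2 ff gg; congr fine; apply: ae_eq_integral => //.
- by apply/measurable_EFinP; exact: measurable_funM F1.1 G1.1.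
- by apply/measurable_EFinP; exact: measurable_funM F2.1 G2.1.
- by near=> x => Ax; rewrite (near ff)// (near gg).
Unshelve. all: by end_near. Qed.

End SquareIntegrable.

(** Cauchy-Schwarz with the weights [2^-1 ^+ i.+1], whose sum is at most 1. The factor [2 ^+ i.+1]
    is affordable when the squared norms decay like [4^-1 ^+ i]. *)
Lemma sqr_sum_le (R : realDomainType) n (x : nat -> R) :
  (\sum_(i < n) x i) ^+ 2 <= \sum_(i < n) 2 ^+ i.+1 * x i ^+ 2.
Proof.
elim: n x => [|n IH] x; first by rewrite !big_ord0 expr0n.
rewrite !big_ord_recl /= expr1.
have := IH (fun i => x i.+1).
have -> : \sum_(i < n) 2 ^+ (bump 0 i).+1 * x (bump 0 i) ^+ 2 =
          2 * \sum_(i < n) 2 ^+ i.+1 * x i.+1 ^+ 2.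
  by rewrite mulr_sumr; apply: eq_bigr => i _; rewrite /bump leq0n add1n mulrA -exprS.
rewrite (eq_bigr (fun i : 'I_n => x i.+1)); last first.
  by move=> i _; rewrite /bump leq0n add1n.
set s := \sum_(i < n) x _; set q := \sum_(i < n) _.
have := sqr_ge0 (x 0%N - s); nra.
Qed.

Lemma geometric_sum_le (R : realFieldType) (r : R) n : 0 <= r -> r <= 2^-1 ->
  \sum_(i < n) r ^+ i <= 2.
Proof.
move=> r0 r2; have rn k : 0 <= r ^+ k by exact: exprn_ge0.
suff : \sum_(i < n) r ^+ i <= 2 - 2 * r ^+ n.
  by have := rn n; lra.
elim: n => [|n IH]; first by rewrite big_ord0 expr0; lra.
by rewrite big_ord_recr /= exprS; have := rn n; nra.
Qed.

(** * Almost everywhere convergence of series and completeness of L^2 *)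

Section SeriesOfFunctions.
Context d (T : measurableType d) (R : realType) (mu : {measure set T -> \bar R}).
Implicit Types (A : set T) (f : T -> R).

Lemma ge0_series_ae A (g : nat -> T -> R) (M : R) : measurable A ->
  (forall n, measurable_fun A (g n)) -> (forall n x, A x -> 0 <= g n x) ->
  (forall N, (\sum_(n < N) \int[mu]_(x in A) (g n x)%:E <= M%:E)%E) ->
  exists h : T -> R, [/\ measurable_fun A h, forall x, A x -> 0 <= h x,
    (\int[mu]_(x in A) (h x)%:E <= M%:E)%E &
    {ae mu, forall x, A x -> forall N, \sum_(n < N) g n x <= h x}].
Proof.
move=> mA mg g0 gM.
pose H x := (\sum_(n <oo) (g n x)%:E)%E.
have H0 x : A x -> (0 <= H x)%E by move=> Ax; apply: nneseries_ge0 => n _ _; rewrite lee_fin g0.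
have mH : measurable_fun A H.
  have := @ge0_emeasurable_sum _ _ _ A (fun n x => (g n x)%:E) xpredT.
  apply; first by move=> k x Ax _; rewrite lee_fin g0.
  by move=> k _; apply/measurable_EFinP.
have iH : (\int[mu]_(x in A) H x <= M%:E)%E.
  rewrite integral_nneseries//; last by move=> n; apply/measurable_EFinP.
  apply: lime_le.
    by apply: is_cvg_nneseries => n _ _; apply: integral_ge0 => x Ax; rewrite lee_fin g0.
  by apply: nearW => N; rewrite big_mkord.
have Hint : mu.-integrable A H.
  apply/integrableP; split => //.
  rewrite (eq_integral H); first exact: le_lt_trans iH (ltry _).
  by move=> x; rewrite inE => Ax; rewrite gee0_abs// H0.
have Hfin := integrable_ae mA Hint.
exists (fine \o H); split.
- exact: measurableT_comp mH.
- by move=> x Ax; rewrite fine_ge0// H0.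
- apply: le_trans iH; apply: ae_ge0_le_integral => //.
  + by move=> x Ax; rewrite lee_fin fine_ge0// H0.
  + by apply/measurable_EFinP; exact: measurableT_comp mH.
  + by apply: filterS Hfin => x Hx Ax; rewrite /= fineK// Hx.
- apply: filterS Hfin => x Hx Ax N; rewrite -lee_fin -sumEFin/= fineK ?Hx//.
  have := @nneseries_lim_ge _ (fun n => (g n x)%:E) xpredT 0 N.
  by rewrite big_mkord; apply => n _ _; rewrite lee_fin g0.
Qed.

(** One integrable [h] bounds the squares of all partial sums of absolute values, off a single null
    set. Both the pointwise convergence and the size of the sum are read off from [h]. *)
Lemma L2_series_ae A (f : nat -> T -> R) (C : R) : measurable A ->
  (forall n, L2 mu A (f n)) -> 0 <= C ->
  (forall n, ip mu A (f n) (f n) <= C * 4^-1 ^+ n) ->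
  exists h : T -> R, [/\ measurable_fun A h, forall x, A x -> 0 <= h x,
    (\int[mu]_(x in A) (h x)%:E <= (4 * C)%:E)%E &
    {ae mu, forall x, A x -> forall N, (\sum_(n < N) `|f n x|) ^+ 2 <= h x}].
Proof.
move=> mA Lf C0 fC.
have [|n x Ax|N|h [mh h0 ih hN]] :=
    @ge0_series_ae A (fun n x => 2 ^+ n.+1 * f n x ^+ 2) (4 * C) mA.
- by move=> n; apply: measurable_funM => //; apply: measurable_funX; case: (Lf n).
- by rewrite mulr_ge0 ?sqr_ge0 ?exprn_ge0.
- apply: (@le_trans _ _ (\sum_(n < N) (2 * C * 2^-1 ^+ n)%:E)%E).
    apply: lee_sum => n _.
    have -> : (\int[mu]_(x in A) (2 ^+ n.+1 * f n x ^+ 2)%:E =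
               (2 ^+ n.+1 * ip mu A (f n) (f n))%:E)%E.
      rewrite EFinM ip_EFin// -ge0_integralZl_EFin ?exprn_ge0//.
      + by move=> x Ax; rewrite lee_fin -expr2 sqr_ge0.
      + by apply/measurable_EFinP; apply: measurable_funM; case: (Lf n).
    rewrite lee_fin (le_trans (ler_wpM2l _ (fC n))) ?exprn_ge0//.
    rewrite exprS mulrACA -exprMn.
    by have -> : (2 * 4^-1 : R) = 2^-1 by lra.
  rewrite sumEFin lee_fin -mulr_sumr.
  have /(@geometric_sum_le _ _ N) : 0 <= 2^-1 :> R by [].
  move=> /(_ (lexx _)); nra.
- exists h; split => //; apply: filterS hN => x hN Ax N.
  apply: le_trans (hN Ax N).
  apply: le_trans (sqr_sum_le N (fun n => `|f n x|)) _.
  by apply: ler_sum => i _; rewrite real_normK// num_real.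
Qed.

Lemma bounded_series_cvg (u : nat -> R) (M : R) :
  (forall N, \sum_(n < N) `|u n| <= M) -> cvgn (series (fun n => `|u n|)).
Proof.
move=> uM; apply: nondecreasing_is_cvgn; last first.
  by exists M => _ [N _ <-]; rewrite /series/= big_mkord.
by apply/nondecreasing_seqP => n; rewrite /series/= big_nat_recr//= lerDl.
Qed.

(** Riesz-Fischer for geometric sequences. The telescoping increments are summed by [L2_series_ae];
    its bound [4 * C] accounts for the factor 4 in the rate. *)
Lemma L2_complete A (f : nat -> T -> R) (C : R) : measurable A ->
  (forall n, L2 mu A (f n)) -> 0 <= C ->
  (forall n, ip mu A (f n.+1 \- f n) (f n.+1 \- f n) <= C * 4^-1 ^+ n) ->
  exists g, [/\ L2 mu A g,
    forall n, ip mu A (f n \- g) (f n \- g) <= 4 * C * 4^-1 ^+ n &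
    {ae mu, forall x, A x -> f n x @[n --> \oo] --> g x}].
Proof.
move=> mA Lf C0 fC.
(* The limit superior is measurable whether or not the sequence converges, and equals the limit
   wherever it does. *)
pose g x := fine (limn_esup (fun n => (f n x)%:E)).
have mg : measurable_fun A g.
  apply: measurableT_comp => //; apply: measurable_fun_limn_esup => n.
  by apply/measurable_EFinP; case: (Lf n).
have Ldf n : L2 mu A (f n.+1 \- f n) by exact: L2B.
have tel x k N : \sum_(n < N) (f (k + n).+1 x - f (k + n)%N x) = f (k + N)%N x - f k x.
  elim: N => [|N IH]; first by rewrite big_ord0 addn0 subrr.
  by rewrite big_ord_recr/= IH addnS; ring.
have fg : {ae mu, forall x, A x -> f n x @[n --> \oo] --> g x}.
  have [h [_ _ _]] := L2_series_ae mA Ldf C0 fC.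
  apply: filterS => x /[apply] hN.
  have cv : cvgn (series (fun n => f n.+1 x - f n x)).
    apply: normed_cvg; apply: (@bounded_series_cvg _ (h x + 1)) => N.
    have := hN N; have := sqr_ge0 (\sum_(n < N) `|f n.+1 x - f n x| - 1).
    rewrite /=; set s := \sum_(n < N) _; nra.
  have fE : (fun n => f n x) = (fun n => f 0%N x + series (fun n => f n.+1 x - f n x) n).
    apply/funext => n; rewrite /series/= big_mkord.
    by have := tel x 0%N n; under eq_bigr do rewrite add0n; rewrite add0n => ->; ring.
  have cvf : cvgn (fun n => f n x).
    by rewrite fE; apply: is_cvgD => //; exact: is_cvg_cst.
  suff -> : g x = limn (fun n => f n x) by [].
  rewrite /g; have /cvg_limn_einf_sup[_ ->//] :
    ((f n x)%:E @[n --> \oo] --> (limn (fun n => f n x))%:E)%E.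
  by apply: cvg_EFin; [exact: nearW | exact: cvf].
(* The majorant is built anew for the tail that starts at [n], so that its integral carries the
   factor [4^-1 ^+ n]. *)
have dg n : (\int[mu]_(x in A) ((f n x - g x) ^+ 2)%:E <= (4 * C * 4^-1 ^+ n)%:E)%E.
  have [|||h [mh h0 ih hN]] := @L2_series_ae A (fun k => f (n + k).+1 \- f (n + k)%N) (C * 4^-1 ^+ n) mA
    _ _ _.
  - by move=> k; exact: Ldf.
  - by rewrite mulr_ge0// exprn_ge0.
  - by move=> k; rewrite -mulrA -exprD.
  rewrite -mulrA; apply: le_trans ih; apply: ae_ge0_le_integral => //.
  - by move=> x Ax; rewrite lee_fin sqr_ge0.
  - by apply/measurable_EFinP/measurable_funX/measurable_funB => //; case: (Lf n).
  - exact/measurable_EFinP.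
  apply: filterS2 hN fg => x hN fg Ax; move/(_ Ax) : hN => hN; move/(_ Ax) : fg => fg.
  have bd N : (f (n + N)%N x - f n x) ^+ 2 <= h x.
    apply: le_trans (hN N); rewrite -tel -ler_sqrt ?sqr_ge0// !sqrtr_sqr.
    by rewrite [leRHS]ger0_norm ?sumr_ge0// ler_norm_sum.
  have fgn : f (n + N)%N x @[N --> \oo] --> g x by apply: cvg_comp fg; exact: cvg_addnl.
  have : (f (n + N)%N x - f n x) ^+ 2 @[N --> \oo] --> (g x - f n x) ^+ 2.
    apply: cvgM; apply: cvgB; try exact: cvg_cst; exact: fgn.
  move=> cv; rewrite lee_fin -sqrrN opprB.
  rewrite -(cvg_lim (@Rhausdorff R) cv); apply: limr_le; last exact: nearW.
  exact: cvgP cv.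
have Lfg n : L2 mu A (f n \- g).
  apply: L2P => //.
    by apply: measurable_funB => //; case: (Lf n).
  exact: le_lt_trans (dg n) (ltry _).
exists g; split => //.
- have := L2B mA (Lf 0%N) (Lfg 0%N); congr L2.
  by apply/funext => x /=; ring.
- by move=> n; rewrite -lee_fin ip_EFin//; exact: dg.
Qed.

End SeriesOfFunctions.

(** * Topology and Borel sets of the plane *)

Section Plane.
Context {R : realType}.
Local Notation plane := (R * R)%type.
Local Notation mplane := (measurableTypeR R * measurableTypeR R)%type.
Local Notation mu := (plane_measure R).

(** The closed boxes are compact, as local integrability demands, and the open ones cover; being
    countably many, they turn statements about boxes into statements about open sets, both for
    measurability and for null sets. *)
Definition rat_box (q : (rat * rat) * (rat * rat)) : set plane :=
  `[ratr q.1.1, ratr q.1.2] `*` `[ratr q.2.1, ratr q.2.2].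

Definition rat_obox (q : (rat * rat) * (rat * rat)) : set plane :=
  `]ratr q.1.1, ratr q.1.2[ `*` `]ratr q.2.1, ratr q.2.2[.

Lemma rat_oboxW q : rat_obox q `<=` rat_box q.
Proof.
move=> [x y] [] /=; rewrite !in_itv/= => /andP[? ?] /andP[? ?].
by split => /=; rewrite in_itv/= !ltW.
Qed.

Lemma measurable_box (i j : interval R) : measurable ([set` i] `*` [set` j] : set mplane).
Proof. by apply: measurableX; exact: measurable_itv. Qed.

Lemma open_rat_box (O : set plane) p : open O -> O p ->
  exists q, rat_obox q p /\ rat_box q `<=` O.
Proof.
move=> oO Op; have := oO _ Op.
rewrite -nbhs_ballE => -[e /= e0 sO].
have box (x : R) : exists ab : rat * rat, ratr ab.1 < x < ratr ab.2 /\
    forall z : R, ratr ab.1 <= z <= ratr ab.2 -> ball x e z.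
  have [|a] := @rat_in_itvoo R (x - e) x; first by rewrite ltrBlDr ltrDl.
  have [|b] := @rat_in_itvoo R x (x + e); first by rewrite ltrDl.
  rewrite !in_itv/= => /andP[xb be] /andP[ea ax]; exists (a, b); split => /=.
    by rewrite ax.
  move=> z /andP[az zb]; rewrite /ball/= ltr_norml.
  by apply/andP; split; lra.
have [[a b] [/= ab1 ab2]] := box p.1; have [[c d] [/= cd1 cd2]] := box p.2.
exists ((a, b), (c, d)); split; first by split; rewrite /= in_itv.
move=> [x y] [] /=; rewrite !in_itv /= => xab ycd.
by apply: sO; split => /=; [exact: ab2 | exact: cd2].
Qed.

Lemma countable_rat4 : countable [set: (rat * rat) * (rat * rat)].
Proof. exact: countableP. Qed.

Lemma open_plane_measurable (O : set plane) : open O -> measurable (O : set mplane).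
Proof.
move=> oO.
have -> : O = \bigcup_q (if `[< rat_box q `<=` O >] then rat_box q else set0).
  apply/seteqP; split => [p Op|p [q _]].
    have [q [pq qO]] := open_rat_box oO Op; exists q => //.
    by rewrite asboolT//; exact: rat_oboxW.
  by case: asboolP => // qO /qO.
apply: countable_bigcupT_measurable; first exact: countable_rat4.
by move=> q; case: asboolP => // _; exact: measurable_box.
Qed.

Lemma continuous_plane_measurable (f : plane -> R) : continuous f ->
  measurable_fun [set: mplane] f.
Proof.
move=> cf; apply: (measurability _ (RGenOInfty.measurableE R)) => //.
move=> _ [_ [a ->] <-]; rewrite setTI; apply: open_plane_measurable.
by apply: open_comp => //; move=> *; exact: cf.
Qed.

Lemma compact_box a b c d : compact (`[a, b] `*` `[c, d] : set plane).
Proof. by apply: compact_setX; exact: segment_compact. Qed.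

Lemma compact_in_box (K : set plane) : compact K ->
  exists2 M : R, 0 < M & forall p, K p -> `|p.1| < M /\ `|p.2| < M.
Proof.
move=> /compact_bounded[M [_ KM]].
exists (`|M| + 2) => [|p Kp]; first by rewrite ltr_wpDl.
have := KM (`|M| + 1); rewrite (le_lt_trans (ler_norm _)) ?ltrDl//= => /(_ isT) _.
have /= := KM (`|M| + 1) (le_lt_trans (ler_norm _) _) p Kp.
rewrite ltrDl ltr01 => /(_ isT); rewrite prod_normE/= ge_max => /andP[h1 h2].
by split; apply: le_lt_trans; [exact: h1|lra|exact: h2|lra].
Qed.

Lemma compact_plane_measurable (K : set plane) : compact K -> measurable (K : set mplane).
Proof.
move=> cK; rewrite -(setCK K); apply: measurableC; apply: open_plane_measurable.
by apply: closed_openC; apply: compact_closed cK; exact: norm_hausdorff.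
Qed.

Lemma plane_measure_prod (A B : set (measurableTypeR R)) : measurable A -> measurable B ->
  mu (A `*` B) = (lebesgue_measure A * lebesgue_measure B)%E.
Proof. by move=> mA mB; exact: product_measure1E. Qed.

Lemma box_finite (i j : R * R) :
  (mu (`[i.1, i.2] `*` `[j.1, j.2]) < +oo)%E.
Proof.
rewrite plane_measure_prod; [|exact: measurable_itv|exact: measurable_itv].
have fin (k : R * R) : (lebesgue_measure `[k.1, k.2] < +oo :> \bar R)%E.
  by rewrite lebesgue_measure_itv/=; case: ifPn => // _; rewrite -EFinD ltry.
by rewrite lte_mul_pinfty// ge0_fin_numE.
Qed.

Lemma compact_finite (K : set plane) : compact K -> (mu K < +oo)%E.
Proof.
move=> cK; have [M M0 KM] := compact_in_box cK.
apply: le_lt_trans (box_finite (- M, M) (- M, M)); apply: le_measure.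
- by rewrite inE; exact: compact_plane_measurable.
- by rewrite inE; exact: measurable_box.
- move=> [x y] /KM [/= + +]; rewrite !ltr_norml => /andP[? ?] /andP[? ?].
  by split; rewrite /= in_itv/=; apply/andP; split; exact: ltW.
Qed.

Lemma continuous_compact_bounded (f : plane -> R) (K : set plane) : continuous f ->
  compact K -> exists2 M : R, 0 <= M & forall p, K p -> `|f p| <= M.
Proof.
move=> cf cK.
have /compact_bounded[M [_ fM]] : compact (f @` K).
  by apply: continuous_compact cK; exact: continuous_subspaceT.
exists (`|M| + 1) => [|p Kp]; first by rewrite addr_ge0.
by apply: (fM (`|M| + 1)); [rewrite (le_lt_trans (ler_norm _))// ltrDl|exists p].
Qed.

Lemma continuous_on_compact_integrable (f : plane -> R) (K : set plane) : continuous f ->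
  compact K -> mu.-integrable K (EFin \o f).
Proof.
move=> cf cK; have [M _ fM] := continuous_compact_bounded cf cK.
apply: measurable_bounded_integrable.
- exact: compact_plane_measurable.
- exact: compact_finite.
- by apply: measurable_funTS; exact: continuous_plane_measurable.
- exists M; split => [|N MN p Kp]; first exact: num_real.
  by apply: le_trans (ltW MN); exact: fM.
Qed.

Lemma continuous_compact_L2 (f : plane -> R) (K : set plane) : continuous f ->
  compact K -> L2 mu K f.
Proof.
move=> cf cK; split.
  by apply: measurable_funTS; exact: continuous_plane_measurable.
apply: continuous_on_compact_integrable cK => p.
by apply: cvgM; exact: cf.
Qed.

End Plane.

(** * C^1 functions of one and two variables *)

Section Calculus.
Context {R : realType}.
Local Notation plane := (R * R)%type.

Definition C1_fun (f df : R -> R) :=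
  (forall x : R, is_derive x (1 : R) f (df x)) /\ continuous df.

(** The partial derivatives are carried as data, so that those of sums and products are computed
    rather than recovered from the operator ['D_v]. *)
Definition C1_on (phi dx dy : plane -> R) :=
  [/\ forall p, is_derive p e_x phi (dx p), forall p, is_derive p e_y phi (dy p),
      continuous dx & continuous dy].

Lemma C1_onE phi dx dy : C1_on phi dx dy ->
  [/\ C1_plane phi, 'D_e_x phi = dx & 'D_e_y phi = dy].
Proof.
move=> [hx hy cx cy].
have ex : 'D_e_x phi = dx by apply/funext => p; exact: derive_val.
have ey : 'D_e_y phi = dy by apply/funext => p; exact: derive_val.
split => //; split; rewrite ?ex ?ey//.
Qed.

Lemma C1_planeP phi : C1_plane phi -> C1_on phi ('D_e_x phi) ('D_e_y phi).
Proof.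
move=> [dx dy cx cy]; split; [|  |exact: cx|exact: cy].
  by move=> p; apply: derivableP; exact: dx.
by move=> p; apply: derivableP; exact: dy.
Qed.

Lemma is_derive_sliceX (phi : plane -> R) (p : plane) (d : R) :
  is_derive p e_x phi d <-> is_derive (p.1 : R) (1 : R) (fun x => phi (x, p.2)) d.
Proof.
have E : (fun h : R => h^-1 *: (phi (h *: e_x + p) - phi p)) =
    (fun h : R => h^-1 *: (phi (h *: (1 : R) + p.1, p.2) - phi (p.1, p.2))).
  apply/funext => h; congr (_ *: (phi _ - phi _)); last by case: p.
  by case: p => x y; apply: injective_projections => //=; rewrite scaler0 add0r.
split => -[dv df]; split.
- by rewrite /derivable -E.
- by rewrite -df /derive -E.
- by rewrite /derivable E.
- by rewrite -df /derive E.
Qed.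

Lemma is_derive_sliceY (phi : plane -> R) (p : plane) (d : R) :
  is_derive p e_y phi d <-> is_derive (p.2 : R) (1 : R) (fun y => phi (p.1, y)) d.
Proof.
have E : (fun h : R => h^-1 *: (phi (h *: e_y + p) - phi p)) =
    (fun h : R => h^-1 *: (phi (p.1, h *: (1 : R) + p.2) - phi (p.1, p.2))).
  apply/funext => h; congr (_ *: (phi _ - phi _)); last by case: p.
  by case: p => x y; apply: injective_projections => //=; rewrite scaler0 add0r.
split => -[dv df]; split.
- by rewrite /derivable -E.
- by rewrite -df /derive -E.
- by rewrite /derivable E.
- by rewrite -df /derive E.
Qed.

Lemma continuous_sliceX (f : plane -> R) y : continuous f -> continuous (fun x => f (x, y)).
Proof.
move=> cf x; apply: (@continuous_comp _ _ _ (fun x => (x, y)) f); last exact: cf.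
by apply: (@cvg_pair _ _ _ (nbhs x) (nbhs x) (nbhs y)); [exact: cvg_id|exact: cvg_cst].
Qed.

Lemma continuous_sliceY (f : plane -> R) x : continuous f -> continuous (fun y => f (x, y)).
Proof.
move=> cf y; apply: (@continuous_comp _ _ _ (fun y => (x, y)) f); last exact: cf.
by apply: (@cvg_pair _ _ _ (nbhs y) (nbhs x) (nbhs y)); [exact: cvg_cst|exact: cvg_id].
Qed.

Lemma C1_sliceX phi dx dy y : C1_on phi dx dy ->
  C1_fun (fun x => phi (x, y)) (fun x => dx (x, y)).
Proof.
move=> [hx _ cx _]; split; last exact: continuous_sliceX.
by move=> x; have /is_derive_sliceX := hx (x, y).
Qed.

Lemma C1_sliceY phi dx dy x : C1_on phi dx dy ->
  C1_fun (fun y => phi (x, y)) (fun y => dy (x, y)).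
Proof.
move=> [_ hy _ cy]; split; last exact: continuous_sliceY.
by move=> y; have /is_derive_sliceY := hy (x, y).
Qed.

Lemma C1_fun_continuous f df : C1_fun f df -> continuous f.
Proof.
move=> [hf _] x; apply: differentiable_continuous; apply/derivable1_diffP.
by have [] := hf x.
Qed.

Lemma C1_fun_eq f df dg : C1_fun f df -> df =1 dg -> C1_fun f dg.
Proof. by move=> + /funext <-. Qed.

Lemma C1_fun_lin (f df g dg : R -> R) a b : C1_fun f df -> C1_fun g dg ->
  C1_fun (fun x => a * f x + b * g x) (fun x => a * df x + b * dg x).
Proof.
move=> [hf cf] [hg cg]; split => x; last first.
  by apply: cvgD; apply: cvgM; try exact: cvg_cst; [exact: cf | exact: cg].
exact: (is_deriveD (is_deriveZ a (hf x)) (is_deriveZ b (hg x))).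
Qed.

Lemma C1_funM (f df g dg : R -> R) : C1_fun f df -> C1_fun g dg ->
  C1_fun (fun x => f x * g x) (fun x => df x * g x + f x * dg x).
Proof.
move=> Cf Cg; have [hf cf] := Cf; have [hg cg] := Cg; split => x; last first.
  apply: cvgD; apply: cvgM; [exact: cf|exact: C1_fun_continuous Cg _|
    exact: C1_fun_continuous Cf _|exact: cg].
have -> : (fun x => f x * g x) = f * g by [].
apply: is_derive_eq; rewrite addrC; congr (_ + _).
by rewrite [LHS]mulrC.
Qed.

Lemma C1_fun_comp (f df g dg : R -> R) : C1_fun f df -> C1_fun g dg ->
  C1_fun (fun x => f (g x)) (fun x => df (g x) * dg x).
Proof.
move=> Cf Cg; have [hf cf] := Cf; have [hg cg] := Cg; split => x.
  exact: is_derive1_comp.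
apply: cvgM; last exact: cg.
by apply: (@continuous_comp _ _ _ g df); [exact: C1_fun_continuous Cg _|exact: cf].
Qed.

Lemma C1_fun_cst (c : R) : C1_fun (cst c) (cst 0).
Proof. by split => x; [exact: is_derive_cst | exact: cvg_cst]. Qed.

Lemma C1_fun_id : C1_fun id (cst 1).
Proof. by split => x; [exact: is_derive_id | exact: cvg_cst]. Qed.

Lemma C1_fun_exp : C1_fun expR expR.
Proof. by split => x; [exact: is_derive_expR | exact: continuous_expR]. Qed.

Lemma C1_on_lin phi dx dy psi ex ey a b : C1_on phi dx dy -> C1_on psi ex ey ->
  C1_on (fun p => a * phi p + b * psi p)
    (fun p => a * dx p + b * ex p) (fun p => a * dy p + b * ey p).
Proof.
have lin (f g : plane -> R) : continuous f -> continuous g ->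
    continuous (fun p => a * f p + b * g p).
  move=> cf cg p; apply: cvgD; apply: cvgM; try exact: cvg_cst; [exact: cf|exact: cg].
move=> [hx hy cx cy] [kx ky dcx dcy]; split; [| |exact: lin|exact: lin] => p.
  exact: (is_deriveD (is_deriveZ a (hx p)) (is_deriveZ b (kx p))).
exact: (is_deriveD (is_deriveZ a (hy p)) (is_deriveZ b (ky p))).
Qed.

Lemma C1_on_sliceI phi dx dy : continuous dx -> continuous dy ->
  (forall y (x : R), is_derive x (1 : R) (fun x => phi (x, y)) (dx (x, y))) ->
  (forall x (y : R), is_derive y (1 : R) (fun y => phi (x, y)) (dy (x, y))) ->
  C1_on phi dx dy.
Proof.
move=> cx cy hx hy; split => // -[x y].
  by apply/is_derive_sliceX; exact: hx.
by apply/is_derive_sliceY; exact: hy.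
Qed.

Lemma C1_on_tensor f df g dg : C1_fun f df -> C1_fun g dg ->
  C1_on (fun p => f p.1 * g p.2) (fun p => df p.1 * g p.2) (fun p => f p.1 * dg p.2).
Proof.
move=> Cf Cg; have [hf cf] := Cf; have [hg cg] := Cg.
have cont (u v : R -> R) : continuous u -> continuous v ->
    continuous (fun p : plane => u p.1 * v p.2).
  move=> cu cv p; apply: cvgM.
    by apply: (@continuous_comp _ _ _ fst u); [exact: cvg_fst|exact: cu].
  by apply: (@continuous_comp _ _ _ snd v); [exact: cvg_snd|exact: cv].
apply: C1_on_sliceI.
- by apply: cont => //; exact: C1_fun_continuous Cg.
- by apply: cont => //; exact: C1_fun_continuous Cf.
- move=> y x; have := C1_funM Cf (C1_fun_cst (g y)) => -[/(_ x) + _] /=.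
  by rewrite mulr0 addr0.
- move=> x y; have := C1_funM (C1_fun_cst (f x)) Cg => -[/(_ y) + _] /=.
  by rewrite mul0r add0r.
Qed.

Lemma plane_continuousP (f : plane -> R) (x0 y0 : R) :
  {for (x0, y0), continuous f} <-> forall e : R, 0 < e -> exists2 r : R, 0 < r &
    forall x y : R, `|x0 - x| < r -> `|y0 - y| < r -> `|f (x0, y0) - f (x, y)| < e.
Proof.
split => [cf e e0|H].
  have : nbhs (x0, y0) [set q | `|f (x0, y0) - f q| < e].
    by have /cvgrPdist_lt/(_ _ e0) := cf.
  move=> /nbhs_ballP[r /= r0 Hr]; exists r => // x y xr yr.
  by apply: (Hr (x, y)); split.
apply/cvgrPdist_lt => e e0; have [r r0 Hr] := H e e0.
suff : nbhs (x0, y0) [set t | `|f (x0, y0) - f t| < e] by [].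
by apply/nbhs_ballP; exists r => // -[x y] [/= xr yr]; exact: Hr.
Qed.

Lemma line_continuousP (f : R -> R) (x0 : R) :
  {for x0, continuous f} <-> forall e : R, 0 < e -> exists2 r : R, 0 < r &
    forall x : R, `|x0 - x| < r -> `|f x0 - f x| < e.
Proof.
split => [cf e e0|H].
  have : nbhs x0 [set q | `|f x0 - f q| < e].
    by have /cvgrPdist_lt/(_ _ e0) := cf.
  by move=> /nbhs_ballP[r /= r0 Hr]; exists r.
apply/cvgrPdist_lt => e e0; have [r r0 Hr] := H e e0.
suff : nbhs x0 [set t | `|f x0 - f t| < e] by [].
by apply/nbhs_ballP; exists r.
Qed.

(** Derivability along the two axes does not by itself give continuity. One leg of the path to
    [(x, y)] is handled by continuity of the slice at [x0], the other by the mean value theorem in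
    [x], with [dx] bounded near the point. *)
Lemma C1_on_continuous phi dx dy : C1_on phi dx dy -> continuous phi.
Proof.
move=> C [x0 y0]; have [_ _ cx _] := C.
apply/plane_continuousP => e e0.
have [r r0 Hr] := (plane_continuousP dx x0 y0).1 (cx (x0, y0)) 1 ltr01.
set M := `|dx (x0, y0)| + 1; have M0 : 0 < M by rewrite ltr_wpDl.
have cs0 : continuous (fun y => phi (x0, y)) by exact: C1_fun_continuous (C1_sliceY x0 C).
have [r' r'0 Hr'] := (line_continuousP _ y0).1 (cs0 y0) _ (divr_gt0 e0 (ltr0n R 2)).
exists (Num.min (Num.min r r') (e / (2 * M))).
  by rewrite !lt_min r0 r'0 divr_gt0// mulr_gt0.
move=> x y; rewrite !lt_min => /andP[/andP[xr _] xe] /andP[/andP[yr yr'] _].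
have bdx z : `|x0 - z| <= `|x0 - x| -> `|dx (z, y)| <= M.
  move=> zx; have := Hr z y (le_lt_trans zx xr) yr.
  rewrite /M; have := ler_normB (dx (x0, y0)) (dx (x0, y0) - dx (z, y)).
  by rewrite opprB addrC subrK => h1 h2; lra.
have h1 : `|phi (x0, y) - phi (x, y)| <= M * `|x0 - x|.
  have [hx _] := C1_sliceX y C.
  have cs : continuous (fun x => phi (x, y)) by exact: C1_fun_continuous (C1_sliceX y C).
  have [xx0|x0x] := leP x x0.
    have [|z] := @MVT_segment R (fun x => phi (x, y)) (fun x => dx (x, y)) x x0 xx0.
    - exact: continuous_subspaceT.
    - rewrite in_itv/= => /andP[xz zx0] ->; rewrite normrM ler_wpM2r// bdx//.
      by rewrite !ger0_norm; lra.
  have [|z] := @MVT_segment R (fun x => phi (x, y)) (fun x => dx (x, y)) x0 x (ltW x0x).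
  - exact: continuous_subspaceT.
  - rewrite in_itv/= distrC (distrC x0) => /andP[xz zx0] ->; rewrite normrM ler_wpM2r// bdx//.
    by rewrite !ler0_norm; lra.
have h2 : `|phi (x0, y0) - phi (x0, y)| < e / 2 by apply: Hr'.
have h3 : M * `|x0 - x| < e / 2.
  apply: (@lt_le_trans _ _ (M * (e / (2 * M)))); first by rewrite ltr_pM2l.
  by rewrite le_eqVlt; apply/orP; left; apply/eqP; field; lra.
have := ler_normD (phi (x0, y0) - phi (x0, y)) (phi (x0, y) - phi (x, y)).
by rewrite addrA subrK; lra.
Qed.

Lemma C1_onM phi dx dy psi ex ey : C1_on phi dx dy -> C1_on psi ex ey ->
  C1_on (fun p => phi p * psi p) (fun p => dx p * psi p + phi p * ex p)
    (fun p => dy p * psi p + phi p * ey p).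
Proof.
move=> C1 C2; have [_ _ cx cy] := C1; have [_ _ dcx dcy] := C2.
have c1 := C1_on_continuous C1; have c2 := C1_on_continuous C2.
have cont (f g h k : plane -> R) : continuous f -> continuous g -> continuous h ->
    continuous k -> continuous (fun p => f p * g p + h p * k p).
  move=> cf cg ch ck p; apply: cvgD; apply: cvgM; [exact: cf|exact: cg|exact: ch|exact: ck].
apply: C1_on_sliceI; [exact: cont|exact: cont| |].
- by move=> y x; have [] := C1_funM (C1_sliceX y C1) (C1_sliceX y C2).
- by move=> x y; have [] := C1_funM (C1_sliceY x C1) (C1_sliceY x C2).
Qed.

Lemma FTC (F f : R -> R) (a b : R) : C1_fun F f -> a <= b ->
  (\int[lebesgue_measure]_(x in `[a, b]) (f x)%:E = (F b - F a)%:E)%E.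
Proof.
move=> C; rewrite le_eqVlt => /orP[/eqP <-|ab].
  by rewrite set_itv1 integral_set1 subrr.
have cF := C1_fun_continuous C; have [hF cf] := C.
rewrite (@continuous_FTC2 _ f F)//.
- exact: continuous_subspaceT.
- split; first by move=> x _; have [] := hF x.
  + by apply: cvg_at_right_filter; exact: cF.
  + by apply: cvg_at_left_filter; exact: cF.
- by move=> x _; rewrite derive1E; exact: derive_val.
Qed.

Lemma continuous_itv_integrable (f : R -> R) (a b : R) : continuous f ->
  lebesgue_measure.-integrable `[a, b] (EFin \o f).
Proof.
by move=> cf; apply: continuous_compact_integrable;
  [exact: segment_compact|exact: continuous_subspaceT].
Qed.

Lemma RFTC (F f : R -> R) (a b : R) : C1_fun F f -> a <= b ->
  \int[lebesgue_measure]_(x in `[a, b]) f x = F b - F a.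
Proof. by move=> C ab; rewrite /Rintegral (FTC C ab). Qed.

End Calculus.

(** The measure lives on a product of [measurableTypeR R], convertible to [R * R]; the instance lets
    filter reasoning apply to statements quantified over [R * R]. *)
#[export] Instance ae_plane_filter (R : realType) :
  @Filter (R * R) (nbhs (almost_everywhere (plane_measure R))).
Proof.
exact: (@ae_filter_ringOfSetsType _ (measurableTypeR R * measurableTypeR R)%type R
  (plane_measure R)).
Qed.

(** * Fubini on regions, integrals of derivatives, translation invariance *)

Section PlaneIntegrals.
Context {R : realType}.
Local Notation plane := (R * R)%type.
Local Notation mline := (measurableTypeR R).
Local Notation mplane := (measurableTypeR R * measurableTypeR R)%type.
Local Notation mu := (plane_measure R).
Local Notation leb := (@lebesgue_measure R).

Lemma patch_sectionY (E : set plane) (f : plane -> \bar R) x :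
  (fun y => (f \_ E) (x, y)) = (fun y => f (x, y)) \_ [set y | E (x, y)].
Proof. by apply/funext => y; rewrite !patchE; congr (if _ then _ else _); apply/idP/idP; rewrite !inE. Qed.

Lemma patch_sectionX (E : set plane) (f : plane -> \bar R) y :
  (fun x => (f \_ E) (x, y)) = (fun x => f (x, y)) \_ [set x | E (x, y)].
Proof. by apply/funext => x; rewrite !patchE; congr (if _ then _ else _); apply/idP/idP; rewrite !inE. Qed.

Lemma tonelli_region (E : set mplane) (f : plane -> \bar R) : measurable E ->
  measurable_fun E f -> (forall p, E p -> 0 <= f p)%E ->
  (\int[mu]_(p in E) f p = \int[leb]_x \int[leb]_(y in [set y | E (x, y)]) f (x, y))%E.
Proof.
move=> mE mf f0; rewrite integral_mkcond.
have mfE : measurable_fun [set: mplane] (f \_ E) by apply/(measurable_restrictT f).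
rewrite [LHS](@fubini_tonelli1 _ _ _ _ _ leb leb (f \_ E) mfE); last first.
  by move=> p; rewrite patchE; case: ifPn => //; rewrite inE => /f0.
apply: eq_integral => x _; rewrite /fubini_F [RHS]integral_mkcond.
by rewrite -patch_sectionY.
Qed.

Lemma fubini_region (E : set mplane) (f : plane -> \bar R) : measurable E ->
  mu.-integrable E f ->
  (\int[mu]_(p in E) f p = \int[leb]_x \int[leb]_(y in [set y | E (x, y)]) f (x, y))%E /\
  (\int[mu]_(p in E) f p = \int[leb]_y \int[leb]_(x in [set x | E (x, y)]) f (x, y))%E.
Proof.
move=> mE fi; have fE : mu.-integrable setT (f \_ E) by rewrite -integrable_mkcond.
rewrite integral_mkcond; split.
  rewrite -[LHS](@integral12_prod_meas1 _ _ _ _ _ leb leb (f \_ E) fE).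
  apply: eq_integral => x _; rewrite /fubini_F [RHS]integral_mkcond.
  by rewrite -patch_sectionY.
rewrite -[LHS](@integral21_prod_meas1 _ _ _ _ _ leb leb (f \_ E) fE).
apply: eq_integral => x _; rewrite /fubini_G [RHS]integral_mkcond.
by rewrite -patch_sectionX.
Qed.

Lemma integral_section (A : set mline) (P : set R) (F : R -> set R -> \bar R) :
  (forall x, F x set0 = 0%E) ->
  (\int[leb]_x F x [set y | A x /\ P y] = \int[leb]_(x in A) F x P)%E.
Proof.
move=> F0; rewrite [RHS]integral_mkcond; apply: eq_integral => x _.
rewrite patchE; case: ifPn => [|]; rewrite ?inE ?notin_setE => Ax.
  by congr F; apply/seteqP; split => [y []|y Py].
by rewrite -[RHS](F0 x); congr F; apply/seteqP; split => [y []|].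
Qed.

Lemma fubini_rect (A B : set mline) (f : plane -> \bar R) :
  measurable A -> measurable B -> mu.-integrable (A `*` B) f ->
  (\int[mu]_(p in A `*` B) f p = \int[leb]_(x in A) \int[leb]_(y in B) f (x, y))%E /\
  (\int[mu]_(p in A `*` B) f p = \int[leb]_(y in B) \int[leb]_(x in A) f (x, y))%E.
Proof.
move=> mA mB fi; have [E1 E2] := fubini_region (measurableX mA mB) fi; split.
  rewrite E1.
  rewrite -(@integral_section A B (fun x Q => \int[leb]_(y in Q) f (x, y))%E)//.
  by move=> x; rewrite integral_set0.
rewrite E2.
rewrite -(@integral_section B A (fun y Q => \int[leb]_(x in Q) f (x, y))%E); last first.
  by move=> y; rewrite integral_set0.
apply: eq_integral => y _; congr (integral _ _ _).
by apply/seteqP; split => x /= [].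
Qed.

Lemma tonelli_rect (A B : set mline) (f : plane -> \bar R) :
  measurable A -> measurable B -> measurable_fun (A `*` B : set mplane) f ->
  (forall p, (A `*` B) p -> 0 <= f p)%E ->
  (\int[mu]_(p in A `*` B) f p = \int[leb]_(x in A) \int[leb]_(y in B) f (x, y))%E.
Proof.
move=> mA mB mf f0; rewrite (tonelli_region (measurableX mA mB) mf f0).
rewrite -(@integral_section A B (fun x Q => \int[leb]_(y in Q) f (x, y))%E)//.
by move=> x; rewrite integral_set0.
Qed.

Lemma integral_vanish (A B : set mplane) (f : plane -> \bar R) : B `<=` A ->
  (forall p, A p -> ~ B p -> f p = 0%E) ->
  (\int[mu]_(p in A) f p = \int[mu]_(p in B) f p)%E.
Proof.
move=> BA f0; rewrite [LHS]integral_mkcond [RHS]integral_mkcond.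
apply: eq_integral => p _; rewrite !patchE; case: ifPn; rewrite ?inE ?notin_setE => Ap.
  by case: ifPn => //; rewrite notin_setE => Bp; rewrite f0.
by case: ifPn => //; rewrite inE => /BA.
Qed.

Lemma derive_vanish (phi : plane -> R) (K : set plane) v p : compact K ->
  (forall q, ~ K q -> phi q = 0) -> ~ K p -> 'D_v phi p = 0.
Proof.
move=> cK phi0 Kp; rewrite (@near_eq_derive _ _ _ phi (cst 0)) ?derive_cst//.
have oK : open (~` K) by apply: closed_openC; apply: compact_closed cK; exact: norm_hausdorff.
by apply: filterS (open_nbhs_nbhs (conj oK Kp)) => q /phi0.
Qed.

Lemma integral_derive_compact_support (D : set mplane) (phi : plane -> R) :
  C1_compact_support D phi ->
  (\int[mu]_(p in D) ('D_e_x phi p)%:E = 0)%E /\ (\int[mu]_(p in D) ('D_e_y phi p)%:E = 0)%E.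
Proof.
move=> [C [K [cK KD phi0]]]; have [M M0 KM] := compact_in_box cK.
have C1 := C1_planeP C; have [_ _ cx cy] := C1.
pose B : set plane := `[- M, M] `*` `[- M, M].
have KB : K `<=` B.
  move=> p /KM[]; rewrite !ltr_norml => /andP[? ?] /andP[? ?].
  by split; rewrite /= in_itv/= !ltW.
have red (v : plane) : (\int[mu]_(p in D) ('D_v phi p)%:E =
              \int[mu]_(p in B) ('D_v phi p)%:E)%E.
  rewrite (@integral_vanish D K)//; last by move=> p _ Kp; rewrite (derive_vanish _ cK phi0).
  rewrite -(@integral_vanish B K)//.
  by move=> p _ Kp; rewrite (derive_vanish _ cK phi0).
have cB := @compact_box R (- M) M (- M) M.
have M2 : - M <= M by lra.
(* The inequalities in [KM] are strict, hence the boundary of the box lies outside [K]. *)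
have bd0 x y : (`|x| = M \/ `|y| = M) -> phi (x, y) = 0.
  by move=> xy; apply: phi0 => /KM/= [xM yM]; case: xy => E; rewrite E ltxx in xM yM.
have MM : `|M| = M by rewrite ger0_norm// ltW.
have MN : `|- M| = M by rewrite normrN.
split; rewrite red.
  have [_ ->] := fubini_rect (measurable_itv `[- M, M]) (measurable_itv `[- M, M])
    (continuous_on_compact_integrable cx cB).
  rewrite integral0_eq// => y _; rewrite (FTC (C1_sliceX y C1) M2).
  by rewrite !bd0 ?subrr//; left.
have [-> _] := fubini_rect (measurable_itv `[- M, M]) (measurable_itv `[- M, M])
  (continuous_on_compact_integrable cy cB).
rewrite integral0_eq// => x _; rewrite (FTC (C1_sliceY x C1) M2).
by rewrite !bd0 ?subrr//; right.
Qed.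

Definition shift (c : R) (p : plane) : plane := (p.1 + c, p.2).

Lemma measurable_shift c : measurable_fun [set: mplane] (shift c : mplane -> mplane).
Proof.
apply/measurable_fun_pairP; split.
  by apply: measurable_funD => //; exact: measurable_cst.
exact: measurable_snd.
Qed.

Lemma lebesgue_measure_shift (c : R) (A : set mline) : measurable A ->
  leb ((fun x => x + c) @^-1` A) = leb A.
Proof.
move=> mA; have mc : measurable_fun [set: mline] (fun x : mline => x + c).
  by apply: measurable_funD => //; exact: measurable_cst.
apply/esym; pose nu := [the measure _ _ of pushforward leb (fun x : mline => x + c : mline)].
apply: (@lebesgue_measure_unique _ (nu mc)) => // X [[a b] _ <-] /=.
rewrite /pushforward; have -> : (fun x => x + c) @^-1` `]a, b] = `]a - c, b - c]%classic.
  by apply/seteqP; split => x /=; rewrite !in_itv/= => /andP[? ?]; apply/andP; split; lra.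
rewrite !lebesgue_measure_itv/= !lte_fin ltrD2r; case: ifPn => // _.
by rewrite -!EFinD; congr EFin; ring.
Qed.

Lemma plane_measure_shift c (A : set mplane) : measurable A ->
  mu (shift c @^-1` A) = mu A.
Proof.
move=> mA; apply/esym.
have ms := measurable_shift c.
pose nu := [the measure _ _ of pushforward mu (shift c : mplane -> mplane)].
apply: (@product_measure_unique _ _ _ _ _ leb leb (nu ms)) => // X Y mX mY.
rewrite /= /pushforward.
have -> : shift c @^-1` (X `*` Y) = ((fun x => x + c) @^-1` X) `*` Y by [].
rewrite plane_measure_prod//; first by rewrite lebesgue_measure_shift.
rewrite -[X in measurable X]setTI; apply: measurable_funD => //; exact: measurable_cst.
Qed.

Lemma integral_shift c (A : set mplane) (f : plane -> \bar R) : measurable A ->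
  measurable_fun A f -> (forall p, A p -> 0 <= f p)%E ->
  (\int[mu]_(p in shift c @^-1` A) f (shift c p) = \int[mu]_(p in A) f p)%E.
Proof.
move=> mA mf f0.
transitivity (\int[pushforward mu (shift c : mplane -> mplane)]_(p in A) f p)%E.
  apply/esym.
  apply: (@ge0_integral_pushforward _ _ mplane mplane R _ (measurable_shift c) mu A f mA mf).
  by move=> p; rewrite inE => /f0.
apply: (@eq_measure_integral _ mplane _ A mu); first exact: measurable_shift.
by move=> ? X mX _; exact: plane_measure_shift.
Qed.

Lemma negligible_shift c (N : set mplane) : mu.-negligible N ->
  mu.-negligible (shift c @^-1` N).
Proof.
move=> [B [mB B0 NB]]; exists (shift c @^-1` B); split.
- by rewrite -[X in measurable X]setTI; exact: measurable_shift.
- by rewrite plane_measure_shift.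
- by move=> p /NB.
Qed.

Lemma ae_shift c (P : set plane) : {ae mu, forall p, P p} ->
  {ae mu, forall p, P (shift c p)}.
Proof. by move=> /(negligible_shift c). Qed.

End PlaneIntegrals.

(** * C^1 approximations of the indicator function of an interval *)

Section Bump.
Context {R : realType}.

Lemma max0_lipschitz (a b : R) : `|Num.max a 0 - Num.max b 0| <= `|a - b|.
Proof.
have := ler_norm (a - b); have := ler_norm (b - a); rewrite (distrC b) ler_norml.
by case: (leP a 0) => ?; case: (leP b 0) => ? ? ?; apply/andP; split; lra.
Qed.

Lemma continuous_max0 : continuous (fun t : R => Num.max t 0).
Proof.
move=> t; apply/line_continuousP => e e0; exists e => // s.
exact/le_lt_trans/max0_lipschitz.
Qed.

(** Only [t = 0] needs an argument: there each difference quotient of the composition is either 0 or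
    the one of [H], and the latter tends to [dH 0 = 0]. *)
Lemma C1_fun_pos (H dH : R -> R) : C1_fun H dH -> H 0 = 0 -> dH 0 = 0 ->
  C1_fun (fun t => H (Num.max t 0)) (fun t => dH (Num.max t 0)).
Proof.
move=> [hH cH] H0 dH0; split => t; last first.
  by apply: (@continuous_comp R R R (fun t : R => Num.max t 0) dH);
    [exact: continuous_max0|exact: cH].
have [t0|t0|->] := ltgtP t 0.
- rewrite dH0.
  apply: (@near_eq_is_derive _ _ _ (cst 0)) (is_derive_cst _ _ _).
  near=> s; rewrite max_r ?H0//; apply: ltW; near: s.
  exact: lt_nbhsl.
-
  apply: (@near_eq_is_derive _ _ _ H) (hH t).
  near=> s; rewrite max_l//; apply: ltW; near: s.
  exact: lt_nbhsr.
- rewrite dH0.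
  suff cv : (fun h : R => h^-1 *: (H (Num.max (h *: (1 : R) + 0) 0) - H (Num.max 0 0)))
      @ 0^' --> (0 : R).
    by split; [apply/cvg_ex; exists 0|exact: cvg_lim cv].
  have [dv dE] := hH 0.
  have : (fun h : R => h^-1 *: (H (h *: (1 : R) + 0) - H 0)) @ 0^' --> 'D_1 H (0 : R).
    exact: dv.
  rewrite dE dH0 => /cvgrPdist_lt cv; apply/cvgrPdist_lt => e e0.
  apply: filterS (cv e e0) => h; rewrite !sub0r !normrN; apply: le_lt_trans.
  rewrite maxxx H0 !subr0 !addr0 !normrM ler_wpM2l//.
  rewrite [_ *: _]mulr1; have [h0|h0] := leP h 0; last by [].
  by rewrite H0 normr0.
Unshelve. all: by end_near. Qed.

Definition bump_base (a b x : R) : R := (Num.max (x - a) 0) ^+ 2 * (Num.max (b - x) 0) ^+ 2.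

(** [bump_base] is C^1 because squared positive parts are, and it is positive exactly on the open
    interval. Hence [bump] has values in [0, 1] and tends pointwise to the indicator as [n] grows,
    which suits dominated convergence. *)
Definition bump (a b : R) (n : nat) (x : R) : R := 1 - expR (- (n%:R * bump_base a b x)).

Lemma C1_bump a b n : exists d, C1_fun (bump a b n) d.
Proof.
have C2 : C1_fun (fun x : R => x ^+ 2) (fun x => 2 * x).
  apply: (@C1_fun_eq _ _ (fun x => 1 * x + x * 1)).
    have -> : (fun x : R => x ^+ 2) = (fun x => id x * id x) by apply/funext => x; rewrite expr2.
    exact: C1_funM (C1_fun_id) (C1_fun_id).
  by move=> x; ring.
have Cp := C1_fun_pos C2 (expr0n _ _) (mulr0 _).
have C1 := C1_fun_comp Cp (C1_fun_lin 1 1 C1_fun_id (C1_fun_cst (- a))).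
have C3 := C1_fun_comp Cp (C1_fun_lin (-1) 1 C1_fun_id (C1_fun_cst b)).
have C4 := C1_fun_comp C1_fun_exp (C1_fun_lin (- n%:R) 0 (C1_funM C1 C3) (C1_fun_cst 0)).
have C5 := C1_fun_lin 1 (-1) (C1_fun_cst 1) C4.
eexists; have -> : bump a b n = (fun x => 1 * cst 1 x + -1 * expR
   (- n%:R * (Num.max (1 * id x + 1 * cst (- a) x) 0 ^+ 2 *
              Num.max (-1 * id x + 1 * cst b x) 0 ^+ 2) + 0 * cst 0 x)).
  apply/funext => x; rewrite /bump /bump_base /=.
  have -> : 1 * x + 1 * - a = x - a by ring.
  have -> : -1 * x + 1 * b = b - x by ring.
  by rewrite mulr1 mulN1r; congr (1 - expR _); ring.
exact: C5.
Qed.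

Lemma bump_base_ge0 (a b x : R) : 0 <= bump_base a b x.
Proof. by rewrite mulr_ge0// sqr_ge0. Qed.

Lemma bump_bound a b n x : 0 <= bump a b n x <= 1.
Proof.
apply/andP; split; last by rewrite /bump lerBlDr lerDl expR_ge0.
by rewrite /bump subr_ge0 -expR0 ler_expR oppr_le0 mulr_ge0 ?bump_base_ge0.
Qed.

Lemma bump_out a b n x : ~ (a < x < b) -> bump a b n x = 0.
Proof.
move=> H; suff -> : bump a b n x = 1 - expR 0 by rewrite expR0 subrr.
rewrite /bump; congr (1 - expR _); apply/eqP; rewrite oppr_eq0 mulf_eq0; apply/orP; right.
rewrite /bump_base; have [xa|ax] := leP x a.
  by rewrite max_r ?subr_le0// expr0n mul0r.
have [bx|xb] := leP b x; last by exfalso; apply: H; rewrite ax.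
by rewrite [X in _ * X ^+ _]max_r ?subr_le0// expr0n mulr0.
Qed.

Lemma cvg_bump (a b x : R) : a < x < b -> bump a b n x @[n --> \oo] --> (1 : R).
Proof.
move=> /andP[ax xb]; rewrite -[X in _ --> X](subr0 1).
apply: cvgB; first exact: cvg_cst.
have u0 : 0 < bump_base a b x.
  by rewrite mulr_gt0// exprn_gt0// lt_max subr_gt0 ?ax ?xb.
have -> : (fun n => expR (- (n%:R * bump_base a b x))) =
          (fun n => expR (- bump_base a b x) ^+ n).
  by apply/funext => n; rewrite -expRM_natl mulrN.
by apply: cvg_expr; rewrite ger0_norm ?expR_ge0// expR_lt1 oppr_lt0.
Qed.

End Bump.

(** * Vanishing of integrals over a generated sigma-algebra *)

Section LambdaSystem.
Context {R : realType}.
Local Notation plane := (R * R)%type.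
Local Notation mplane := (measurableTypeR R * measurableTypeR R)%type.
Local Notation mu := (plane_measure R).

(** Dynkin's argument for a signed integrand, so that increasing unions need dominated rather than
    monotone convergence. The map [psi] allows the extension to be made one coordinate at a time,
    and afterwards from rectangles to all measurable sets of the plane. *)
Lemma integral_eq0_generated d (T : measurableType d) (G : set (set T))
    (psi : mplane -> T) (C : set mplane) (g : plane -> \bar R) :
  d.-measurable = <<s G >> -> setI_closed G -> measurable_fun setT psi ->
  measurable C -> mu.-integrable setT g -> (\int[mu]_(p in C) g p = 0)%E ->
  (forall A, G A -> \int[mu]_(p in C `&` psi @^-1` A) g p = 0)%E ->
  (forall A, measurable A -> \int[mu]_(p in C `&` psi @^-1` A) g p = 0)%E.
Proof.
move=> dG GI mpsi mC ig C0 G0.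
pose H : set (set T) := [set A | measurable A /\ (\int[mu]_(p in C `&` psi @^-1` A) g p = 0)%E].
have mpre A : measurable A -> measurable (C `&` psi @^-1` A).
  by move=> mA; apply: measurableI => //; rewrite -[X in measurable X]setTI; exact: mpsi.
have iS A : measurable A -> mu.-integrable A g.
  by move=> mA; apply: integrableS ig.
have HS : lambda_system setT H.
  split => //.
  - by split => //; rewrite preimage_setT setIT.
  - move=> A B BA [mA A0] [mB B0]; split; first exact: measurableD.
    have mAB := measurableD mA mB.
    have E : C `&` psi @^-1` A = (C `&` psi @^-1` (A `\` B)) `|` (C `&` psi @^-1` B).
      apply/seteqP; split => [p [Cp Ap]|p [[Cp [Ap _]]|[Cp /BA Ap]]] //.
      by have [Bp|Bp] := pselect (B (psi p)); [right|left].
    have := A0; rewrite E integral_setU ?B0 ?adde0//.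
    + exact: mpre.
    + exact: mpre.
    + by rewrite -E; apply: (measurable_int mu); apply: iS; exact: mpre.
    + by rewrite disj_set2E; apply/eqP/seteqP; split => // p [[_ []]] _ ? [].
  - move=> F ndF HF; have mF n : measurable (F n) by have [] := HF n.
    split; first exact: bigcup_measurable.
    pose gn n := g \_ (C `&` psi @^-1` F n).
    pose gg := g \_ (C `&` psi @^-1` (\bigcup_n F n)).
    have mU := bigcup_measurable (fun n (_ : setT n) => mF n).
    have [|||||_ _] := @dominated_convergence _ _ _ mu setT measurableT gn gg (abse \o g).
    + move=> n; apply/(measurable_restrictT _ _).1; first exact: mpre.
      by apply: (measurable_int mu); apply: iS; exact: mpre.
    + apply/(measurable_restrictT _ _).1; first exact: mpre.
      by apply: (measurable_int mu); apply: iS; exact: mpre.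
    + apply: aeW => p _; rewrite /gn /gg patchE; case: ifPn; rewrite ?inE ?notin_setE => Hp.
        have [Cp [k _ Fk]] := Hp; apply: cvg_near_cst; exists k => // n /= kn.
        rewrite patchE ifT// inE; split => //; have := ndF _ _ kn.
        by move=> /subsetPset; apply.
      apply: cvg_near_cst; apply: nearW => n; rewrite patchE ifF//; apply/negbTE.
      by rewrite notin_setE => -[Cp Fp]; apply: Hp; split => //; exists n.
    + exact: integrable_abse.
    + apply: aeW => p n _; rewrite /gn patchE; case: ifPn => _ //=.
      by rewrite normr0 abse_ge0.
    have -> : (fun n => \int[mu]_(x in setT) gn n x)%E = cst 0%E.
      by apply/funext => n; rewrite -integral_mkcond; have [] := HF n.
    move=> cv; rewrite integral_mkcond -/gg.
    by apply: (cvg_unique (@ereal_hausdorff R) cv); exact: cvg_cst.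
move=> A mA; suff [] : H A by [].
have : <<s setT, G>> A by rewrite -dG.
apply: (lambda_system_subset GI HS) => // X GX; split; last exact: G0.
by rewrite dG; exact: sub_gen_smallest.
Qed.

End LambdaSystem.

(** * Fundamental lemma of the calculus of variations *)

Section FundamentalLemma.
Context {R : realType}.
Local Notation plane := (R * R)%type.
Local Notation mline := (measurableTypeR R).
Local Notation mplane := (measurableTypeR R * measurableTypeR R)%type.
Local Notation mu := (plane_measure R).

Lemma loc_integrableM (K : set plane) (g phi : plane -> R) : compact K ->
  mu.-integrable K (EFin \o g) -> continuous phi ->
  mu.-integrable K (EFin \o (fun p => g p * phi p)).
Proof.
move=> cK ig cphi; have [M M0 hM] := continuous_compact_bounded cphi cK.
have mK := compact_plane_measurable cK.
have mg : measurable_fun (K : set mplane) g by apply/measurable_EFinP; exact: measurable_int ig.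
apply: (le_integrable mK _ _ (integrableZl mK M ig)).
  apply/measurable_EFinP; apply: measurable_funM => //.
  by apply: measurable_funTS; exact: continuous_plane_measurable.
move=> p Kp; rewrite /= lee_fin normrM mulrC normrM.
by rewrite ler_wpM2r// (le_trans (hM _ Kp))// ler_norm.
Qed.

Lemma Rintegral_vanish (A B : set mplane) (f : plane -> R) : B `<=` A ->
  (forall p, A p -> ~ B p -> f p = 0) ->
  \int[mu]_(p in A) f p = \int[mu]_(p in B) f p.
Proof.
by move=> BA f0; congr fine; apply: integral_vanish => // p Ap Bp; rewrite f0.
Qed.

Variables (D : set plane) (g : plane -> R).
Hypothesis g_loc : loc_integrable D g.
Hypothesis g_test : forall phi, C1_compact_support D phi -> \int[mu]_(p in D) (g p * phi p) = 0.

(** Products of bumps are admissible test functions supported in the closed box and converge to the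
    indicator of the open one; [g] restricted to the closed box dominates. *)
Lemma box_integral0 a b c d : `[a, b] `*` `[c, d] `<=` D ->
  (\int[mu]_(p in `]a, b[ `*` `]c, d[) (g p)%:E = 0)%E.
Proof.
move=> KD; set K : set plane := `[a, b] `*` `[c, d].
have cK : compact K by exact: compact_box.
have mK := compact_plane_measurable cK.
have igK : mu.-integrable K (EFin \o g) by exact: g_loc.
pose phi n (p : plane) := bump a b n p.1 * bump c d n p.2.
have Cphi n : exists dx dy, C1_on (phi n) dx dy.
  have [u Cu] := C1_bump a b n; have [v Cv] := C1_bump c d n.
  by do 2 eexists; exact: C1_on_tensor Cu Cv.
have cphi n : continuous (phi n).
  by have [dx [dy C]] := Cphi n; exact: C1_on_continuous C.
have phi0 n p : ~ K p -> phi n p = 0.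
  move=> Kp; rewrite /phi.
  have [ab|/negP ab] := boolP (a < p.1 < b); last by rewrite bump_out// mul0r.
  have [cd|/negP cd] := boolP (c < p.2 < d); last by rewrite (@bump_out _ c d)// mulr0.
  exfalso; apply: Kp; move/andP: ab => [? ?]; move/andP: cd => [? ?].
  by split; rewrite /= in_itv/= !ltW.
have int0 n : (\int[mu]_(p in K) (g p * phi n p)%:E = 0)%E.
  have : C1_compact_support D (phi n).
    split; first by have [dx [dy C]] := Cphi n; have [] := C1_onE C.
    by exists K; split => // p /phi0.
  move=> /g_test; rewrite (@Rintegral_vanish D K)//; last by move=> p _ /phi0 ->; rewrite mulr0.
  move=> E; rewrite -[LHS]fineK; first by congr EFin.
  by apply: integrable_fin_num => //; exact: loc_integrableM.
have mO : measurable (`]a, b[ `*` `]c, d[ : set mplane) by exact: measurable_box.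
have OK : `]a, b[ `*` `]c, d[ `<=` K.
  move=> p [/=]; rewrite !in_itv/= => /andP[? ?] /andP[? ?].
  by split; rewrite /= in_itv/= !ltW.
have mgO : measurable_fun (`]a, b[ `*` `]c, d[ : set mplane) (EFin \o g).
  exact: (measurable_funS mK OK (measurable_int mu igK)).
have mgO' : measurable_fun (setT : set mplane) ((EFin \o g) \_ (`]a, b[ `*` `]c, d[)).
  by apply/(measurable_restrictT _ _).1; [exact: mO|exact: mgO].
have [|||||_ _ cv] := @dominated_convergence _ _ _ mu K mK (fun n p => (g p * phi n p)%:E)
    ((EFin \o g) \_ (`]a, b[ `*` `]c, d[)) (abse \o (EFin \o g)).
- by move=> n; apply: (measurable_int mu); exact: loc_integrableM.
- exact: measurable_funTS.
- apply: aeW => p Kp; rewrite patchE; case: ifPn; rewrite ?inE ?notin_setE => Op.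
    apply: cvg_EFin; first exact: nearW.
    rewrite -[X in _ --> X]mulr1 -[X in _ * X]mulr1; apply: cvgM; first exact: cvg_cst.
    by case: Op; rewrite /= !in_itv/= => ab cd; apply: cvgM; exact: cvg_bump.
  apply: cvg_near_cst; apply: nearW => n; rewrite /phi.
  have [ab|/negP ab] := boolP (a < p.1 < b); last by rewrite bump_out// mul0r mulr0.
  have [cd|/negP cd] := boolP (c < p.2 < d); last by rewrite (@bump_out _ c d)// !mulr0.
  by exfalso; apply: Op; split; rewrite /= in_itv.
- exact: integrable_abse.
- apply: aeW => p n Kp; rewrite /= lee_fin normrM ler_piMr//.
  have /andP[u0 u1] := bump_bound a b n p.1; have /andP[v0 v1] := bump_bound c d n p.2.
  by rewrite ger0_norm ?mulr_ge0// mulr_ile1.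
have E : (\int[mu]_(p in K) (((EFin \o g) \_ (`]a, b[ `*` `]c, d[)) p) =
      \int[mu]_(p in `]a, b[ `*` `]c, d[) (g p)%:E)%E.
  rewrite (@integral_vanish _ K (`]a, b[%classic `*` `]c, d[%classic))//; last first.
    by move=> p _ Op; rewrite patchE ifF//; apply/negbTE; rewrite notin_setE.
  by apply: eq_integral => p Op; rewrite patchE Op.
move: cv; rewrite E.
have -> : (fun n => \int[mu]_(x in K) (g x * phi n x)%:E)%E = cst 0%E by apply/funext.
by move=> cv; apply: (cvg_unique (@ereal_hausdorff R) cv); exact: cvg_cst.
Qed.

(** Extended by zero off the open box, [g] is integrable on the whole plane and its integrals over
    upper right quadrants vanish by [box_integral0]. Quadrants generate, so all its integrals
    vanish. *)
Lemma weak_fundamental_box (q : (rat * rat) * (rat * rat)) : rat_box q `<=` D ->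
  {ae mu, forall p, rat_obox q p -> g p = 0}.
Proof.
case: q => [[qa qb] [qc qd]] /= qD.
pose a : R := ratr qa; pose b : R := ratr qb; pose c : R := ratr qc; pose d : R := ratr qd.
set O : set mplane := rat_obox ((qa, qb), (qc, qd)).
have mO : measurable O by exact: measurable_box.
have cQ : compact (rat_box ((qa, qb), (qc, qd)) : set plane) by exact: compact_box.
have igO : mu.-integrable O (EFin \o g).
  apply: integrableS (g_loc cQ qD) => //; first exact: compact_plane_measurable.
  exact: rat_oboxW.
have ig : mu.-integrable setT ((EFin \o g) \_ O) by rewrite -integrable_mkcond.
have sub x y : (\int[mu]_(p in `]x, b[ `*` `]y, d[) ((EFin \o g) \_ O) p = 0)%E.
  rewrite (@integral_vanish _ _ (`]Num.max x a, b[%classic `*` `]Num.max y c, d[%classic)).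
  - rewrite -[RHS](@box_integral0 (Num.max x a) b (Num.max y c) d).
    + apply: eq_integral => p; rewrite inE/= => -[]; rewrite !in_itv/= !gt_max.
      move=> /andP[/andP[? ?] ?] /andP[/andP[? ?] ?]; rewrite patchE ifT// inE.
      by split; rewrite /= in_itv/=; apply/andP.
    + move=> p [/=]; rewrite !in_itv/= !ge_max => /andP[/andP[? ?] ?] /andP[/andP[? ?] ?].
      by apply: qD; split; rewrite /= in_itv/=; apply/andP.
  - move=> p [/=]; rewrite !in_itv/= !gt_max => /andP[/andP[? ?] ?] /andP[/andP[? ?] ?].
    by split; apply/andP.
  - move=> p [/=]; rewrite !in_itv/= => /andP[? ?] /andP[? ?] H; rewrite patchE ifF//.
    apply/negbTE; rewrite notin_setE => -[/=]; rewrite !in_itv/= => /andP[? ?] /andP[? ?].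
    by apply: H; rewrite !gt_max; split; do 2 (apply/andP; split => //).
(* Since the integrand vanishes off [O], half-planes and boxes may replace each other as soon as
   they cut [O] in the same set. *)
have half (A B : set mplane) : (forall p, O p -> A p <-> B p) ->
    (\int[mu]_(p in A) ((EFin \o g) \_ O) p = \int[mu]_(p in B) ((EFin \o g) \_ O) p)%E.
  move=> AB; rewrite [LHS]integral_mkcond [RHS]integral_mkcond; apply: eq_integral => p _.
  rewrite !patchE; have [Op|Op] := boolP (p \in O); last by rewrite !if_same.
  by congr (if _ then _ else _); apply/idP/idP; rewrite !inE => /AB; apply; rewrite -inE.
pose above (y : R) : set mplane := [set p | y < p.2].
pose rightof (x : R) : set R := `]x, +oo[%classic.
have ixy (x y : R) : (\int[mu]_(p in above y `&` fst @^-1` (rightof x)) ((EFin \o g) \_ O) p = 0)%E.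
  rewrite -[RHS](sub x y); apply: half => p [/=]; rewrite !in_itv/= => /andP[? pb] /andP[? pd].
  by rewrite /above /rightof /= in_itv/= andbT pb pd !andbT; split => [[]|[]].
have mG : measurable = <<s @RGenOInfty.G R >> by exact: RGenOInfty.measurableE.
have GI : setI_closed (@RGenOInfty.G R).
  move=> _ _ [x ->] [y ->]; exists (Num.max x y); apply/seteqP; split => z /=.
    by rewrite !in_itv/= !andbT gt_max => -[-> ->].
  by rewrite !in_itv/= !andbT gt_max => /andP[].
have mhalf y : measurable (above y).
  have -> : above y = setT `*` `]y, +oo[.
    by apply/seteqP; split => p /=; rewrite in_itv/= andbT => //; case.
  by apply: measurableX => //; exact: measurable_itv.
have s1 (y : R) A : measurable (A : set mline) ->
    (\int[mu]_(p in above y `&` fst @^-1` A) ((EFin \o g) \_ O) p = 0)%E.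
  apply: (integral_eq0_generated mG GI measurable_fst (mhalf y) ig).
    rewrite -[RHS](ixy a y); apply: half => p [/=]; rewrite !in_itv/= => /andP[pa _] _.
    by rewrite /above /rightof /= in_itv/= andbT pa; split => [|[]].
  by move=> _ [x ->]; exact: ixy.
have mfst A : measurable (A : set mline) -> measurable (fst @^-1` A : set mplane).
  by move=> mA; rewrite -[X in measurable X]setTI; exact: measurable_fst.
have s2 (A B : set mline) : measurable A -> measurable B ->
    (\int[mu]_(p in fst @^-1` A `&` snd @^-1` B) ((EFin \o g) \_ O) p = 0)%E.
  move=> mA; apply: (integral_eq0_generated mG GI measurable_snd (mfst _ mA) ig).
    rewrite -[RHS](s1 c A mA); apply: half => p [/=]; rewrite !in_itv/= => _ /andP[pc _].
    by split => [|[]].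
  by move=> _ [y ->]; rewrite setIC -[RHS](s1 y A mA); apply: half => p _ /=; rewrite in_itv/= andbT.
have s3 (A : set mplane) : measurable A -> (\int[mu]_(p in A) ((EFin \o g) \_ O) p = 0)%E.
  move=> mA; rewrite -[A]setTI.
  have mG2 := @measurable_prod_measurableType _ _ mline mline.
  apply: (@integral_eq0_generated _ _ mplane _ id setT _ mG2 _ _ _ ig) => //.
  - move=> _ _ [A1 mA1 [B1 mB1 <-]] [A2 mA2 [B2 mB2 <-]].
    exists (A1 `&` A2); first exact: measurableI.
    by exists (B1 `&` B2); [exact: measurableI|rewrite setXI].
  - by rewrite -[RHS](s2 setT setT measurableT measurableT); apply: half.
  - move=> _ [A1 mA1 [B1 mB1 <-]]; rewrite -[RHS](s2 A1 B1 mA1 mB1).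
    by apply: half => p _ /=; split => [[]|].
have := @integral_ae_eq _ _ _ mu setT measurableT (cst 0%E) ((EFin \o g) \_ O) ig.
move=> /(_ _)[]//.
  by move=> E _ mE; rewrite s3// integral0.
move=> N [mN N0 HN]; exists N; split => // p /= Hp; apply: HN => /= H; apply: Hp => Op.
by have := H I; rewrite patchE ifT ?inE// => -[].
Qed.

Lemma weak_fundamental : open D -> {ae mu, forall p, D p -> g p = 0}.
Proof.
move=> oD.
have H q : {ae mu, forall p, rat_box q `<=` D -> rat_obox q p -> g p = 0}.
  have [qD|qD] := pselect (rat_box q `<=` D); last by apply: aeW.
  by apply: filterS (weak_fundamental_box qD) => p Hp _.
have : {ae mu, forall p, forall n : nat, if unpickle n is Some q then
    rat_box q `<=` D -> rat_obox q p -> g p = 0 else True}.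
  by apply: ae_foralln => n; case: unpickle => [q|]; [exact: H|exact: aeW].
apply: filterS => p Hp Dp; have [q [qp qD]] := open_rat_box oD Dp.
by have := Hp (pickle q); rewrite pickleK; apply.
Qed.

End FundamentalLemma.

(** * Reduction to one period in the x direction *)

Section Periodicity.
Context {R : realType}.
Local Notation plane := (R * R)%type.
Local Notation mplane := (measurableTypeR R * measurableTypeR R)%type.
Local Notation mu := (plane_measure R).

Lemma periodic_int (b : R -> R) L (k : int) x : periodic b L -> b (x + k%:~R * L) = b x.
Proof.
move=> bL; have bn n y : b (y + n%:R * L) = b y.
  by rewrite mulr_natl; exact: periodicn.
case: k => n; first exact: bn.
by rewrite NegzE mulrNz mulNr; have := bn n.+1 (x - n.+1%:R * L); rewrite subrK => ->.
Qed.

Lemma periodic_continuous_bounded (b : R -> R) L : 0 < L -> periodic b L -> continuous b ->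
  exists2 M : R, 0 <= M & forall x, `|b x| <= M.
Proof.
move=> L0 bL cb.
have /compact_bounded[M [_ bM]] : compact (b @` `[0, L]).
  by apply: continuous_compact; [exact: continuous_subspaceT|exact: segment_compact].
exists (`|M| + 1) => [|x]; first by rewrite addr_ge0.
apply: (bM (`|M| + 1)); first by rewrite (le_lt_trans (ler_norm _))// ltrDl.
have /andP[f1 f2] := floor_itv (x / L).
exists (x - (Num.floor (x / L))%:~R * L).
  rewrite /= in_itv/= subr_ge0 -ler_pdivlMr// f1/= lerBlDr.
  by move: (ltW f2); rewrite intrD1 ler_pdivrMr// mulrDl mul1r addrC.
by rewrite -mulNr -mulrNz periodic_int.
Qed.

Variables (L : R).
Hypothesis L_gt0 : 0 < L.

Definition xper (p : plane) : plane := (p.1 - (Num.floor (p.1 / L))%:~R * L, p.2).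

Lemma xper_shift p : xper p = shift (- ((Num.floor (p.1 / L))%:~R * L)) p.
Proof. by []. Qed.

Lemma xper_strip p : strip 0 L (xper p).
Proof.
have /andP[f1 f2] := floor_itv (p.1 / L); split => /=.
  by rewrite subr_ge0 -ler_pdivlMr.
by move: f2; rewrite intrD1 ltr_pdivrMr// mulrDl mul1r ltrBlDr addrC.
Qed.

Lemma xper_eq (k : int) p : strip (k%:~R * L) ((k + 1)%:~R * L) p ->
  xper p = shift (- (k%:~R * L)) p.
Proof.
move=> [/= h1 h2]; rewrite xper_shift; do 4 f_equal.
by apply: floor_def; rewrite ler_pdivlMr// h1 ltr_pdivrMr.
Qed.

Lemma xper_id p : strip 0 L p -> xper p = p.
Proof.
move=> p0; rewrite (@xper_eq 0) ?mul0r ?oppr0; last by rewrite add0r mul1r.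
by case: p p0 => x y _; rewrite /shift/= addr0.
Qed.

Lemma xper_add p : xper (p + (L, 0)) = xper p.
Proof.
have := xper_strip p; rewrite xper_shift => s.
have : strip ((Num.floor (p.1 / L) + 1)%:~R * L) ((Num.floor (p.1 / L) + 1 + 1)%:~R * L) (p + (L, 0)).
  by move: s => [/= s1 s2]; split; rewrite /= !intrD1 !mulrDl !mul1r; lra.
move=> /xper_eq ->; apply: injective_projections => /=; last by rewrite addr0.
by rewrite intrD1; ring.
Qed.

Lemma periodic_xper (phi : plane -> R) p : periodic phi (L, 0) -> phi (xper p) = phi p.
Proof.
move=> P; have Px : periodic (fun x => phi (x, p.2)) L.
  by move=> x; rewrite -[RHS]P; congr phi; apply: injective_projections; rewrite //= addr0.
by rewrite /xper -mulNr -mulrNz (@periodic_int _ _ _ _ Px); case: p {Px}.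
Qed.

Variable (D : set plane).
Hypothesis mD : measurable (D : set mplane).
Hypothesis D_per : forall p, D (p + (L, 0)) <-> D p.

Lemma shift_dom (k : int) p : D (shift (k%:~R * L) p) <-> D p.
Proof.
(* Iterated translation is known for periodic functions, so it is applied to the indicator of [D]
   along a horizontal line. *)
have P : periodic (fun x : R => if (x, p.2) \in D then 1 else 0 : R) L.
  move=> x; congr (if _ then _ else _).
  have -> : (x + L, p.2) = (x, p.2) + (L, 0).
    by apply: injective_projections; rewrite //= addr0.
  by apply/idP/idP; rewrite !inE => ?; exact/D_per.
have := periodic_int k p.1 P; rewrite -/(shift _ p).
have [Dx|Dx] := boolP (shift (k%:~R * L) p \in D); have [Dp|Dp] := boolP ((p.1, p.2) \in D).
- by move=> _; rewrite !inE in Dx Dp; case: p Dp Dx {P}.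
- by move/eqP; rewrite oner_eq0.
- by move/eqP; rewrite eq_sym oner_eq0.
- by move=> _; rewrite !notin_setE in Dx Dp; case: p Dp Dx {P}.
Qed.

Lemma xper_dom p : D (xper p) <-> D p.
Proof. by rewrite xper_shift -mulNr -mulrNz; exact: shift_dom. Qed.

Let cell (k : int) : set mplane := D `&` strip (k%:~R * L) ((k + 1)%:~R * L).

Lemma measurable_strip al be : measurable (strip al be : set mplane).
Proof.
have -> : (strip al be : set mplane) = `[al, be[ `*` setT.
  apply/seteqP; split => p /=; rewrite in_itv/=.
    by move=> [-> ->].
  by move=> [/andP[]].
by apply: measurableX => //; exact: measurable_itv.
Qed.

Lemma measurable_dom_strip al be : measurable (D `&` strip al be : set mplane).
Proof. by apply: measurableI => //; exact: measurable_strip. Qed.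

Let cellE k : cell k = shift (- (k%:~R * L)) @^-1` (D `&` strip 0 L).
Proof.
apply/seteqP; split => p [Dp ps].
  split; last by move: ps; rewrite /strip/= intrD1 mulrDl; lra.
  by apply/xper_dom; rewrite -(xper_eq ps) in Dp *; apply/xper_dom; exact/xper_dom.
have ps' : strip (k%:~R * L) ((k + 1)%:~R * L) p.
  by move: ps; rewrite /strip/= intrD1 mulrDl; lra.
by split => //; apply/xper_dom; rewrite (xper_eq ps').
Qed.

Lemma measurable_xper (f : plane -> R) : measurable_fun (D `&` strip 0 L : set mplane) f ->
  measurable_fun (D : set mplane) (f \o xper).
Proof.
move=> mf.
have -> : D = \bigcup_n (if unpickle n is Some k then cell k else set0).
  apply/seteqP; split => [p Dp|p [n _]]; last by case: unpickle => // k [].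
  exists (pickle (Num.floor (p.1 / L))); first exact: I.
  rewrite pickleK; split; first exact: Dp.
  by have /andP[f1 f2] := floor_itv (p.1 / L); split; rewrite -?ler_pdivlMr -?ltr_pdivrMr.
apply/measurable_fun_bigcup => n.
  by case: unpickle => // k; exact: measurable_dom_strip.
case: unpickle => [k|]; last exact: measurable_fun_set0.
apply: (@eq_measurable_fun _ _ _ _ _ (f \o shift (- (k%:~R * L)))).
  by move=> p; rewrite inE => -[_ ps]; rewrite /= (xper_eq ps).
apply: (measurable_comp (F := (D `&` strip 0 L : set mplane))) => //.
- exact: measurable_dom_strip.
- by move=> _ [p + <-]; rewrite cellE.
- by apply: measurable_funTS; exact: measurable_shift.
Qed.

Lemma integral_cell k (f : plane -> R) : measurable_fun (D `&` strip 0 L : set mplane) f ->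
  (forall p, D p -> 0 <= f p) ->
  (\int[mu]_(p in cell k) (f (xper p))%:E = \int[mu]_(p in D `&` strip 0 L) (f p)%:E)%E.
Proof.
move=> mf f0.
rewrite -(@integral_shift _ (- (k%:~R * L)) (D `&` strip 0 L) (EFin \o f)).
- rewrite -cellE; apply: eq_integral => p; rewrite inE => -[_ ps].
  by rewrite /= (xper_eq ps).
- exact: measurable_dom_strip.
- exact/measurable_EFinP.
- by move=> p [Dp _]; rewrite lee_fin f0.
Qed.

(** [N] counts the periods in a symmetric strip containing the given one: those numbered from
    [- K.+1] to [K]. It must not depend on [f], because the estimate is later applied to a whole
    approximating sequence. *)
Lemma integral_strip_le al be : exists N : nat, forall f : plane -> R,
  measurable_fun (D `&` strip 0 L : set mplane) f -> (forall p, D p -> 0 <= f p) ->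
  (\int[mu]_(p in D `&` strip al be) (f (xper p))%:E <=
   N%:R%:E * \int[mu]_(p in D `&` strip 0 L) (f p)%:E)%E.
Proof.
pose K := Num.truncn (Num.max `|al| `|be| / L).
have HK : Num.max `|al| `|be| < K.+1%:R * L.
  by rewrite -ltr_pdivrMr// truncnS_gt// divr_ge0// ?ltW// le_max normr_ge0.
have L0 := L_gt0; exists (K.+1 + K.+1)%N => f mf f0.
pose A n : set mplane := D `&` strip (- (K.+1%:R * L)) ((n%:R - K.+1%:R) * L).
have mA n : measurable (A n) by exact: measurable_dom_strip.
have mF : measurable_fun (D : set mplane) (EFin \o (f \o xper)).
  by apply/measurable_EFinP; exact: measurable_xper.
have f0' p : D p -> 0 <= f (xper p) by move=> /xper_dom; exact: f0.
have IA n : (\int[mu]_(p in A n) (f (xper p))%:E =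
    n%:R%:E * \int[mu]_(p in D `&` strip 0 L) (f p)%:E)%E.
  elim: n => [|n IH].
    rewrite mul0e; have -> : A 0%N = set0; last by rewrite integral_set0.
    by apply/seteqP; split => // p [_ [/= h1 h2]]; lra.
  have E : A n.+1 = A n `|` cell (n%:Z - K.+1%:Z).
    have n1 : (n.+1%:R : R) = n%:R + 1 by rewrite -natr1.
    have kE : ((n%:Z - K.+1%:Z)%:~R : R) = n%:R - K.+1%:R by rewrite intrD mulrNz.
    have K0 : 0 <= n%:R * L by rewrite mulr_ge0// ltW.
    apply/seteqP; split => [p [Dp [h1 h2]]|p [[Dp [/= h1 h2]]|[Dp [/= h1 h2]]]].
    - have [hn|hn] := ltP p.1 ((n%:R - K.+1%:R) * L); [left|right]; split => //; split => //=.
        by rewrite kE.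
      by move: h2; rewrite intrD1 kE n1; lra.
    - by split => //; split => //=; rewrite n1; lra.
    - by move: h1 h2; rewrite intrD1 kE => h1 h2; split => //; split => //=; rewrite ?n1; lra.
  have mc : measurable (cell (n%:Z - K.+1%:Z)) by exact: measurable_dom_strip.
  rewrite E ge0_integral_setU//.
  - rewrite IH integral_cell// -[n.+1]addn1 natrD EFinD ge0_muleDl ?mul1e//.
  - by apply: measurable_funS mF => // p [] [].
  - by move=> p [] [] Dp _; rewrite lee_fin f0'.
  - rewrite disj_set2E; apply/eqP/seteqP; split => // p [[_ [_ /= h2]] [_ [/= h3 _]]].
    by move: h3; rewrite intrD mulrNz; lra.
rewrite -IA; apply: ge0_subset_integral => //.
- exact: measurable_dom_strip.
- by apply: measurable_funS mF => // p [].
- by move=> p [Dp _]; rewrite lee_fin f0'.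
- move=> p [Dp [/= h1 h2]]; split => //; split => /=.
    apply: le_trans h1; rewrite lerNl (le_trans (ler_norm _))// normrN.
    by apply: le_trans (ltW HK); rewrite le_max lexx.
  apply: lt_le_trans h2 _; rewrite (le_trans (ler_norm _))//.
  rewrite natrD addrK; apply: le_trans (ltW HK); by rewrite le_max lexx orbT.
Qed.

Lemma ae_xper (P : plane -> Prop) : {ae mu, forall p, (D `&` strip 0 L) p -> P p} ->
  {ae mu, forall p, D p -> P (xper p)}.
Proof.
move=> H.
have : {ae mu, forall p, forall n : nat, if unpickle n is Some k then
    (D `&` strip 0 L) (shift (- (k%:~R * L)) p) -> P (shift (- (k%:~R * L)) p) else True}.
  apply: ae_foralln => n; case: unpickle => [k|]; last exact: aeW.
  exact: (ae_shift (- ((k : int)%:~R * L)) H).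
apply: filterS => p Hp Dp; have := Hp (pickle (Num.floor (p.1 / L))).
rewrite pickleK -xper_shift; apply; split; first exact/xper_dom.
exact: xper_strip.
Qed.

(** The relation is assumed for a single shift. The union of the integer translates of its
    exceptional set is still null, and off this union the relation can be iterated in both
    directions. *)
Lemma ae_periodic (u : plane -> R) : {ae mu, forall p, D p -> u (p + (L, 0)) = u p} ->
  {ae mu, forall p, D p -> u (xper p) = u p}.
Proof.
move=> H.
have {H} : {ae mu, forall p, forall n : nat, if unpickle n is Some k then
    D (shift (k%:~R * L) p) -> u (shift (k%:~R * L) p + (L, 0)) = u (shift (k%:~R * L) p)
    else True}.
  apply: ae_foralln => n; case: unpickle => [k|]; last exact: aeW.
  exact: (ae_shift ((k : int)%:~R * L) H).
apply: filterS => p Hp Dp.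
have {}Hp (k : int) : u (shift ((k + 1)%:~R * L) p) = u (shift (k%:~R * L) p).
  have := Hp (pickle k); rewrite pickleK => /(_ ((shift_dom k p).2 Dp)) <-.
  by congr u; apply: injective_projections; rewrite /= ?addr0// intrD1 mulrDl mul1r addrA.
have u0 : u (shift (0%:~R * L) p) = u p by rewrite mul0r /shift addr0; case: (p).
have U (k : int) : u (shift (k%:~R * L) p) = u p.
  elim/int_rect: k => [|n IH|n IH]; first exact: u0.
    by rewrite -IH -(Hp n%:Z); congr (u (shift (_%:~R * _) _)); rewrite -addn1 PoszD.
  rewrite -IH -[LHS]Hp; congr (u (shift (_%:~R * _) _)).
  by rewrite -addn1 PoszD opprD subrK.
by rewrite xper_shift -mulNr -mulrNz U.
Qed.

End Periodicity.

Lemma le0_eps (R : realFieldType) (x K : R) : 0 <= K ->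
  (forall e, 0 < e -> x <= K * e) -> x <= 0.
Proof.
move=> K0 H; rewrite leNgt; apply/negP => x0.
have K1 : 0 < 2 * (K + 1) by lra.
have := H _ (divr_gt0 x0 K1).
rewrite mulrA ler_pdivlMr//; nra.
Qed.

(** * Closedness and uniqueness of weak derivatives *)

Section WeakLimit.
Context {R : realType}.
Local Notation plane := (R * R)%type.
Local Notation mplane := (measurableTypeR R * measurableTypeR R)%type.
Local Notation mu := (plane_measure R).
Variables (L : R) (D : set plane).
Hypothesis L_gt0 : 0 < L.
Hypothesis mD : measurable (D : set mplane).
Hypothesis D_per : forall p, D (p + (L, 0)) <-> D p.
Let DL : set mplane := D `&` strip 0 L.
Let mDL : measurable DL := measurable_dom_strip mD 0 L.

Definition xperiodic (u : plane -> R) := forall p, u (xper L p) = u p.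

Lemma ip_strip al be : exists N : nat, forall u : plane -> R, xperiodic u -> L2 mu DL u ->
  L2 mu (D `&` strip al be : set mplane) u /\
  ip mu (D `&` strip al be) u u <= N%:R * ip mu DL u u.
Proof.
have [N HN] := integral_strip_le L_gt0 mD D_per al be; exists N => u uP Lu.
have mS := measurable_dom_strip mD al be.
have uE : (u \o xper L) = u by apply/funext => p; exact: uP.
have mu2 : measurable_fun DL (fun p => u p ^+ 2) by apply: measurable_funX; case: Lu.
have := HN (fun p => u p ^+ 2) mu2 (fun p _ => sqr_ge0 _).
have -> : (fun p => (u (xper L p) ^+ 2)%:E) = (fun p => (u p ^+ 2)%:E).
  by apply/funext => p; rewrite uP.
have E : (\int[mu]_(p in DL) (u p ^+ 2)%:E = (ip mu DL u u)%:E)%E.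
  by rewrite ip_EFin//; apply: eq_integral => p _; rewrite expr2.
rewrite -/DL E => le.
have LS : L2 mu (D `&` strip al be : set mplane) u.
  apply: L2P => //; last exact: le_lt_trans le (ltry _).
  have muD : measurable_fun (D : set mplane) u.
    by rewrite -uE; apply: (measurable_xper L_gt0 mD D_per); case: Lu.
  by apply: measurable_funS muD => // p [].
split => //; rewrite -lee_fin ip_EFin//; apply: le_trans le.
Qed.

Lemma compact_sub_strip (K : set plane) : compact K -> K `<=` D ->
  exists M : R, K `<=` D `&` strip (- M) M.
Proof.
move=> cK KD; have [M M0 KM] := compact_in_box cK; exists M => p Kp; split; first exact: KD.
by have [] := KM p Kp; rewrite ltr_norml => /andP[h1 h2] _; split => //=; exact: ltW.
Qed.

Lemma xperiodic_loc_integrable u : xperiodic u -> L2 mu DL u -> loc_integrable D u.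
Proof.
move=> uP Lu K cK KD; have [M KM] := compact_sub_strip cK KD.
have [N /(_ u uP Lu)[LS _]] := ip_strip (- M) M.
have mK := compact_plane_measurable cK.
have LK : L2 mu K u by exact: (L2S (measurable_dom_strip mD _ _) mK KM LS).
have L1 : L2 mu K (cst 1) by apply: continuous_compact_L2 => // p; exact: cvg_cst.
have := L2_mul mK LK L1; apply: eq_integrable => // p _ /=; by rewrite mulr1.
Qed.

Lemma C1_compact_supportM (phi psi : plane -> R) : C1_plane phi ->
  C1_compact_support D psi -> C1_compact_support D (fun p => phi p * psi p).
Proof.
move=> /C1_planeP Cphi [/C1_planeP Cpsi [K [cK KD psi0]]]; split.
  by have [] := C1_onE (C1_onM Cphi Cpsi).
by exists K; split => // p /psi0 ->; rewrite mulr0.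
Qed.

Lemma integration_by_parts_test v (phi psi : plane -> R) : v = e_x \/ v = e_y ->
  C1_plane phi -> C1_compact_support D psi ->
  \int[mu]_(p in D) (phi p * 'D_v psi p) = - \int[mu]_(p in D) ('D_v phi p * psi p).
Proof.
move=> hv Cphi Cpsi; have C1 := C1_planeP Cphi; have [/C1_planeP C2 [K [cK KD psi0]]] := Cpsi.
have [_ Ex Ey] := C1_onE (C1_onM C1 C2).
have [I1 I2] := integral_derive_compact_support (C1_compact_supportM Cphi Cpsi).
have c1 := C1_on_continuous C1; have c2 := C1_on_continuous C2.
have [_ _ cx1 cy1] := C1; have [_ _ cx2 cy2] := C2.
have cD1 : continuous ('D_v phi) by case: hv => ->; [exact: cx1|exact: cy1].
have cD2 : continuous ('D_v psi) by case: hv => ->; [exact: cx2|exact: cy2].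
have E : \int[mu]_(p in D) ('D_v phi p * psi p + phi p * 'D_v psi p) = 0.
  case: hv => ->.
    apply: (etrans _ (congr1 fine I1)); apply: eq_Rintegral => p _.
    exact: (esym (congr1 (fun f => f p) Ex)).
  apply: (etrans _ (congr1 fine I2)); apply: eq_Rintegral => p _.
  exact: (esym (congr1 (fun f => f p) Ey)).
have dpsi0 p : ~ K p -> 'D_v psi p = 0 by exact: derive_vanish.
have mK := compact_plane_measurable cK.
apply/eqP; rewrite -addr_eq0; apply/eqP; rewrite -[RHS]E.
rewrite !(@Rintegral_vanish _ D K)//; first last.
- by move=> p _ Kp; rewrite dpsi0// !mulr0.
- by move=> p _ Kp; rewrite psi0// !mulr0.
- by move=> p _ Kp; rewrite psi0// dpsi0// !mulr0 addr0.
rewrite -RintegralD//.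
- by apply: eq_Rintegral => p _; rewrite addrC.
- by apply: continuous_on_compact_integrable cK => p; apply: cvgM; [exact: c1|exact: cD2].
- by apply: continuous_on_compact_integrable cK => p; apply: cvgM; [exact: cD1|exact: c2].
Qed.

(** For a fixed test function the defect in the definition is linear in the pair [(u, g)] and
    vanishes on smooth pairs. By Cauchy-Schwarz it is controlled by the L^2 distance on the support,
    which spans finitely many periods, hence by the distance on one period. *)
Lemma weak_partial_limit v (u g : plane -> R) : v = e_x \/ v = e_y ->
  xperiodic u -> xperiodic g -> L2 mu DL u -> L2 mu DL g ->
  (forall e : R, 0 < e -> exists phi, [/\ C1_plane phi, xperiodic phi,
    xperiodic ('D_v phi), L2 mu DL phi & L2 mu DL ('D_v phi)] /\
    (ip mu DL (phi \- u) (phi \- u) < e /\ ip mu DL ('D_v phi \- g) ('D_v phi \- g) < e)) ->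
  is_weak_partial D v u g.
Proof.
move=> hv uP gP Lu Lg H; split; [exact: xperiodic_loc_integrable|exact: xperiodic_loc_integrable|].
move=> psi Cpsi; have [Cp [K [cK KD psi0]]] := Cpsi.
have [M KM] := compact_sub_strip cK KD.
have [N HN] := ip_strip (- M) M.
have C2 := C1_planeP Cp; have c2 := C1_on_continuous C2.
have [_ _ cx2 cy2] := C2.
have cD2 : continuous ('D_v psi) by case: hv => ->; [exact: cx2|exact: cy2].
have dpsi0 p : ~ K p -> 'D_v psi p = 0 by exact: derive_vanish.
have mK := compact_plane_measurable cK.
have red (f h : plane -> R) : (forall p, ~ K p -> h p = 0) ->
    \int[mu]_(p in D) (f p * h p) = ip mu K f h.
  by move=> h0; rewrite (@Rintegral_vanish _ D K)// => p _ /h0 ->; rewrite mulr0.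
have mS := measurable_dom_strip mD (- M) M.
have toK f : xperiodic f -> L2 mu DL f -> L2 mu K f /\ ip mu K f f <= N%:R * ip mu DL f f.
  move=> fP Lf; have [LS le] := HN f fP Lf.
  have LK : L2 mu K f := L2S mS mK KM LS.
  split => //; apply: le_trans le; rewrite -lee_fin !ip_EFin//.
  apply: ge0_subset_integral => //.
  - by apply/measurable_EFinP; apply: measurable_funM; case: LS.
  - by move=> p _; rewrite lee_fin -expr2 sqr_ge0.
have Lp1 : L2 mu K psi by exact: continuous_compact_L2.
have Lp2 : L2 mu K ('D_v psi) by exact: continuous_compact_L2.
rewrite !red//; apply/eqP; rewrite -addr_eq0; apply/eqP.
have [LuK _] := toK _ uP Lu; have [LgK _] := toK _ gP Lg.
set E := _ + _; set B := ip mu K psi psi + ip mu K ('D_v psi) ('D_v psi).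
have B0 : 0 <= B by rewrite addr_ge0// ip_ge0.
suff HE (e : R) : 0 < e -> E ^+ 2 <= 2 * (N%:R * B) * e.
  apply/eqP; rewrite -sqrf_eq0; apply/eqP/le_anti; rewrite sqr_ge0 andbT.
  by apply: (@le0_eps _ _ (2 * (N%:R * B))); [rewrite !mulr_ge0|exact: HE].
move=> e0; have [phi [[Cphi phiP dphiP Lphi Ldphi] [h1 h2]]] := H e e0.
have [Lphi' _] := toK _ phiP Lphi; have [Ldphi' _] := toK _ dphiP Ldphi.
have P1 : xperiodic (phi \- u) by move=> p; rewrite /= phiP uP.
have P2 : xperiodic ('D_v phi \- g) by move=> p; rewrite /= dphiP gP.
have [L1 le1] := toK _ P1 (L2B mDL Lphi Lu).
have [L2' le2] := toK _ P2 (L2B mDL Ldphi Lg).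
have := integration_by_parts_test hv Cphi Cpsi; rewrite !red// => IBP.
have -> : E = - (ip mu K (phi \- u) ('D_v psi) + ip mu K ('D_v phi \- g) psi).
  by rewrite !ipBl// IBP /E; ring.
rewrite sqrrN; have := ip_cauchy_schwarz mK L1 Lp2; have := ip_cauchy_schwarz mK L2' Lp1.
set x := ip mu K _ psi; set y := ip mu K _ ('D_v psi) => hx hy.
have hN : 0 <= N%:R :> R by [].
have hx' : x ^+ 2 <= N%:R * e * ip mu K psi psi.
  by apply: le_trans hx _; rewrite ler_wpM2r ?ip_ge0// (le_trans le2)// ler_wpM2l// ltW.
have hy' : y ^+ 2 <= N%:R * e * ip mu K ('D_v psi) ('D_v psi).
  by apply: le_trans hy _; rewrite ler_wpM2r ?ip_ge0// (le_trans le1)// ler_wpM2l// ltW.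
have := sqr_ge0 (x - y); rewrite /B; nra.
Qed.

Lemma weak_partial_unique v (u g1 g2 : plane -> R) : open D ->
  is_weak_partial D v u g1 -> is_weak_partial D v u g2 ->
  {ae mu, forall p, D p -> g1 p = g2 p}.
Proof.
move=> oD [_ l1 H1] [_ l2 H2].
have loc : loc_integrable D (g1 \- g2).
  move=> K cK KD; have mK := compact_plane_measurable cK.
  have := integrableB mK (l1 K cK KD) (l2 K cK KD).
  by apply: eq_integrable => // p _ /=.
have := @weak_fundamental R D (g1 \- g2) loc; move=> /(_ _ oD) H.
have {}H : {ae mu, forall p, D p -> (g1 \- g2) p = 0}.
  apply: H => phi Cphi; have := H1 phi Cphi; rewrite (H2 phi Cphi) => /oppr_inj.
  have [/C1_planeP/C1_on_continuous cphi [K [cK KD phi0]]] := Cphi.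
  have mK := compact_plane_measurable cK.
  rewrite !(@Rintegral_vanish _ D K)//; try by move=> p _ /phi0 ->; rewrite mulr0.
  move=> E; have := RintegralB mK (loc_integrableM cK (l1 K cK KD) cphi)
    (loc_integrableM cK (l2 K cK KD) cphi).
  rewrite E subrr => <-; by apply: eq_Rintegral => p _ /=; rewrite mulrBl.
by apply: filterS H => p /[apply] /= /eqP; rewrite subr_eq0 => /eqP.
Qed.

(** The selected representative is usable only up to null sets: it inherits properties from any
    explicit weak derivative through this comparison. *)
Lemma weak_partialP v (u g : plane -> R) : open D -> is_weak_partial D v u g ->
  is_weak_partial D v u (weak_partial D v u) /\
  {ae mu, forall p, D p -> weak_partial D v u p = g p}.
Proof.
move=> oD ug; have H : is_weak_partial D v u (weak_partial D v u).
  by rewrite /weak_partial; apply: (@xgetI _ (fun=> 0) [set g | is_weak_partial D v u g] g).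
by split => //; exact: weak_partial_unique H ug.
Qed.

(** Local integrability yields measurability on compact subsets; countably many closed rational
    boxes exhaust [D]. *)
Lemma loc_integrable_measurable (g : plane -> R) : open D -> loc_integrable D g ->
  measurable_fun (D : set mplane) g.
Proof.
move=> oD lg.
have -> : D = \bigcup_n (if unpickle n is Some q then
    (if `[< rat_box q `<=` D >] then rat_box q else set0) else set0).
  apply/seteqP; split => [p Dp|p [n _]]; last first.
    by case: unpickle => // q; case: asboolP => // qD /qD.
  have [q [qp qD]] := open_rat_box oD Dp; exists (pickle q); first exact: I.
  by rewrite pickleK asboolT//; exact: rat_oboxW.
apply/measurable_fun_bigcup => n.
  by case: unpickle => // q; case: asboolP => // _; exact: measurable_box.
case: unpickle => [q|]; last exact: measurable_fun_set0.
case: asboolP => [qD|_]; last exact: measurable_fun_set0.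
by apply/measurable_EFinP; apply: measurable_int (lg _ _ qD); exact: compact_box.
Qed.

End WeakLimit.

(** * One-dimensional Poincare inequality *)

Section SlicePoincare.
Context {R : realType}.
Local Notation leb := (@lebesgue_measure R).

Lemma Rintegral_itv_cst (a b c : R) : a <= b -> \int[leb]_(y in `[a, b]) (cst c y) = c * (b - a).
Proof.
move=> ab; have C := C1_fun_lin c 0 C1_fun_id (C1_fun_cst (0 : R)).
have := RFTC C ab; rewrite /= !mulr0 !addr0 mulr1 => ->; ring.
Qed.

(** The endpoint value is kept because the smooth approximants vanish on the boundary only in the
    limit. Write [h y ^+ 2 - h a ^+ 2] as the integral of [2 * h * dh] and split this by Young's
    inequality with [d = (2 * H)^-1]; integration over a length of at most [H] then returns half of
    the left-hand side, which is absorbed. *)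
Lemma slice_poincare (h dh : R -> R) (a b H : R) : C1_fun h dh -> a <= b -> 0 < H ->
  b - a <= H ->
  \int[leb]_(y in `[a, b]) (h y ^+ 2) <=
    2 * H * h a ^+ 2 + 4 * H ^+ 2 * \int[leb]_(y in `[a, b]) (dh y ^+ 2).
Proof.
move=> C ab H0 baH; have ch := C1_fun_continuous C; have [_ cdh] := C.
have mab : measurable (`[a, b]%classic : set (measurableTypeR R)) by exact: measurable_itv.
have sq (f : R -> R) : continuous f -> continuous (fun x => f x ^+ 2).
  by move=> cf x; apply: cvgM; exact: cf.
have i1 := continuous_itv_integrable a b (sq _ ch).
have i2 := continuous_itv_integrable a b (sq _ cdh).
set I := \int[leb]_(y in `[a, b]) (h y ^+ 2); set J := \int[leb]_(y in `[a, b]) (dh y ^+ 2).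
pose d := (2 * H)^-1; have d0 : 0 < d by rewrite invr_gt0 mulr_gt0.
pose g y := d * h y ^+ 2 + d^-1 * dh y ^+ 2.
have cg : continuous g.
  by move=> x; apply: cvgD; apply: cvgM; try exact: cvg_cst; exact: sq.
have g0 y : 0 <= g y by rewrite addr_ge0// mulr_ge0 ?sqr_ge0// ltW// invr_gt0.
have IJ : \int[leb]_(y in `[a, b]) (g y) = d * I + d^-1 * J.
  rewrite /g RintegralD//.
  - by rewrite !RintegralZl.
  - by apply: continuous_itv_integrable => x; apply: cvgM; [exact: cvg_cst|exact: sq].
  - by apply: continuous_itv_integrable => x; apply: cvgM; [exact: cvg_cst|exact: sq].
have bound y : y \in `[a, b] -> h y ^+ 2 <= h a ^+ 2 + (d * I + d^-1 * J).
  rewrite in_itv/= => /andP[ay yb].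
  have C2 := C1_funM C C; have [_ c2] := C2.
  have := RFTC C2 ay; rewrite -!expr2 => E.
  suff : \int[leb]_(x in `[a, y]) (dh x * h x + h x * dh x) <= d * I + d^-1 * J by rewrite E; lra.
  have may : measurable (`[a, y]%classic : set (measurableTypeR R)) by exact: measurable_itv.
  apply: (@le_trans _ _ (\int[leb]_(x in `[a, y]) g x)).
    apply: le_Rintegral => //; [exact: continuous_itv_integrable|exact: continuous_itv_integrable|].
    move=> x _; rewrite /g; have := sqr_ge0 (d * h x - dh x).
    have -> : (d * h x - dh x) ^+ 2 = d * (d * h x ^+ 2 + d^-1 * dh x ^+ 2 - 2 * (h x * dh x)).
      by field; rewrite gt_eqF.
    by rewrite pmulr_rge0//; lra.
  rewrite -IJ /Rintegral; apply: fine_le.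
  - by apply: integrable_fin_num => //; exact: continuous_itv_integrable.
  - by apply: integrable_fin_num => //; exact: continuous_itv_integrable.
  - apply: ge0_subset_integral => //.
    + by apply/measurable_EFinP; apply: measurable_funTS; exact: continuous_measurable_fun.
    + by move=> x _; rewrite lee_fin.
    + by move=> x /=; rewrite !in_itv/= => /andP[-> h2]; exact: le_trans h2 yb.
have : I <= (b - a) * (h a ^+ 2 + (d * I + d^-1 * J)).
  have -> : (b - a) * (h a ^+ 2 + (d * I + d^-1 * J)) =
     \int[leb]_(y in `[a, b]) (cst (h a ^+ 2 + (d * I + d^-1 * J)) y).
    by rewrite Rintegral_itv_cst// mulrC.
  apply: le_Rintegral => //; first by apply: continuous_itv_integrable => x; exact: cvg_cst.
have J0 : 0 <= J by apply: Rintegral_ge0 => x _; rewrite sqr_ge0.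
have I0 : 0 <= I by apply: Rintegral_ge0 => x _; rewrite sqr_ge0.
have X0 : 0 <= h a ^+ 2 + (d * I + d^-1 * J).
  by rewrite !addr_ge0 ?sqr_ge0// mulr_ge0// ltW// invr_gt0.
move=> /le_trans /(_ (ler_wpM2r X0 baH)).
have -> : H * (h a ^+ 2 + (d * I + d^-1 * J)) = H * h a ^+ 2 + I / 2 + 2 * H ^+ 2 * J.
  by rewrite /d; field; rewrite gt_eqF.
lra.
Qed.

End SlicePoincare.

(** * The squared boundary norm on a graph *)

Section GraphDistance.
Context {R : realType}.
Local Notation plane := (R * R)%type.
Local Notation mline := (measurableTypeR R).
Local Notation leb := (@lebesgue_measure R).
Variables (L : R) (b : R -> R).
Hypothesis b_C1 : C1_line b.

Definition graph_norm (phi : plane -> R) : \bar R := graph_sqdist L b phi (fun=> 0).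

Lemma C1_line_continuous : continuous b.
Proof.
by move=> x; apply: differentiable_continuous; apply/derivable1_diffP; exact: b_C1.1.
Qed.

Lemma graph_weight_ge1 x : 1 <= Num.sqrt (1 + derive1 b x ^+ 2).
Proof. by rewrite -[X in X <= _]sqrtr1 ler_wsqrtr// lerDl sqr_ge0. Qed.

Lemma continuous_graph_weight : continuous (fun x => Num.sqrt (1 + derive1 b x ^+ 2)).
Proof.
move=> x; apply: (@continuous_comp R R R (fun x => 1 + derive1 b x ^+ 2) Num.sqrt).
  apply: cvgD; first exact: cvg_cst.
  by apply: cvgM; exact: b_C1.2.
exact: sqrt_continuous.
Qed.

Lemma continuous_on_graph (phi : plane -> R) : continuous phi ->
  continuous (fun x => phi (x, b x)).
Proof.
move=> cphi x; apply: (@continuous_comp R (R * R)%type R (fun x => (x, b x)) phi); last exact: cphi.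
apply: (@cvg_pair _ _ _ (nbhs x) (nbhs x) (nbhs (b x))); first exact: cvg_id.
exact: C1_line_continuous.
Qed.

Lemma graph_integrand_measurable (phi : plane -> R) : continuous phi ->
  measurable_fun (`[0, L[%classic : set mline)
    (fun x => ((phi (x, b x) - 0) ^+ 2 * Num.sqrt (1 + derive1 b x ^+ 2))%:E).
Proof.
move=> cphi; apply/measurable_EFinP; apply: measurable_funTS; apply: continuous_measurable_fun.
move=> x; apply: cvgM; last exact: continuous_graph_weight.
have := continuous_on_graph cphi => c.
by apply: cvgM; apply: cvgB; try exact: cvg_cst; exact: c.
Qed.

Lemma graph_integrand_ge0 (phi : plane -> R) x :
  (0 <= ((phi (x, b x) - 0) ^+ 2 * Num.sqrt (1 + derive1 b x ^+ 2))%:E)%E.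
Proof. by rewrite lee_fin mulr_ge0 ?sqr_ge0. Qed.

Lemma graph_norm_ge0 phi : (0 <= graph_norm phi)%E.
Proof. by apply: integral_ge0 => x _; exact: graph_integrand_ge0. Qed.

Lemma graph_norm_le (phi psi chi : plane -> R) (A B : R) : 0 <= A -> 0 <= B ->
  continuous phi -> continuous psi -> continuous chi ->
  (forall x, phi (x, b x) ^+ 2 <= A * psi (x, b x) ^+ 2 + B * chi (x, b x) ^+ 2) ->
  (graph_norm phi <= A%:E * graph_norm psi + B%:E * graph_norm chi)%E.
Proof.
move=> A0 B0 c1 c2 c3 H; rewrite /graph_norm /graph_sqdist.
have mI : measurable (`[0, L[%classic : set mline) by exact: measurable_itv.
have m1 := graph_integrand_measurable c1; have m2 := graph_integrand_measurable c2.
have m3 := graph_integrand_measurable c3.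
rewrite -ge0_integralZl_EFin//; last by move=> x _; exact: graph_integrand_ge0.
rewrite -ge0_integralZl_EFin//; last by move=> x _; exact: graph_integrand_ge0.
rewrite -ge0_integralD//; first last.
- by apply: measurable_funeM.
- by move=> x _; apply: mule_ge0 => //; exact: graph_integrand_ge0.
- by apply: measurable_funeM.
- by move=> x _; apply: mule_ge0 => //; exact: graph_integrand_ge0.
apply: ge0_le_integral => //.
- by move=> x _; exact: graph_integrand_ge0.
- by apply: emeasurable_funD; exact: measurable_funeM.
- move=> x _; rewrite lee_fin !subr0 !mulrA -mulrDl ler_wpM2r ?sqrtr_ge0//.
  by rewrite -!mulrA -!expr2.
Qed.

Lemma graph_norm_cst1 : (graph_norm (cst 1%R) < +oo)%E.
Proof.
have cw := continuous_graph_weight.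
have : leb.-integrable `[0, L] (EFin \o (fun x => Num.sqrt (1 + derive1 b x ^+ 2))).
  exact: continuous_itv_integrable.
move=> /(integrable_fin_num (measurable_itv _ : measurable (`[0, L]%classic : set mline))) fin.
apply: (@le_lt_trans _ _ (\int[leb]_(x in `[0%R, L]) (Num.sqrt (1 + derive1 b x ^+ 2))%:E)%E).
  rewrite /graph_norm /graph_sqdist.
  under eq_integral do rewrite subr0 expr1n mul1r.
  apply: ge0_subset_integral => //.
  - by apply/measurable_EFinP; apply: measurable_funTS; exact: continuous_measurable_fun.
  - by move=> x /=; rewrite !in_itv/= => /andP[-> /ltW].
by rewrite ltey_eq fin.
Qed.

Lemma graph_norm_ge (phi : plane -> R) : continuous phi ->
  (\int[leb]_(x in `[0%R, L[) (phi (x, b x) ^+ 2)%:E <= graph_norm phi)%E.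
Proof.
move=> cphi; apply: ge0_le_integral => //.
- by move=> x _; rewrite lee_fin sqr_ge0.
- apply/measurable_EFinP; apply: measurable_funTS; apply: continuous_measurable_fun => x.
  by apply: cvgM; exact: continuous_on_graph.
- exact: graph_integrand_measurable.
- by move=> x _; rewrite lee_fin subr0 ler_peMr ?sqr_ge0// graph_weight_ge1.
Qed.

End GraphDistance.

(** * The energy space and its Poincare inequality *)

Section EnergySpace.
Context {R : realType}.
Local Notation plane := (R * R)%type.
Local Notation mline := (measurableTypeR R).
Local Notation mplane := (measurableTypeR R * measurableTypeR R)%type.
Local Notation mu := (plane_measure R).
Local Notation leb := (@lebesgue_measure R).

Lemma L2_lin (A : set mplane) (f g : plane -> R) k : measurable A -> L2 mu A f -> L2 mu A g ->
  L2 mu A (fun p => k * f p + g p).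
Proof. by move=> mA Lf Lg; exact: (L2D mA (L2Z k mA Lf) Lg). Qed.

Lemma ip_linl (A : set mplane) (f g h : plane -> R) k : measurable A ->
  L2 mu A f -> L2 mu A g -> L2 mu A h ->
  ip mu A (fun p => k * f p + g p) h = k * ip mu A f h + ip mu A g h.
Proof.
by move=> mA Lf Lg Lh; rewrite -ipZl// -ipDl//; exact: L2Z.
Qed.

Lemma ip_lin_le (A : set mplane) (f g : plane -> R) k : measurable A -> L2 mu A f -> L2 mu A g ->
  ip mu A (fun p => k * f p + g p) (fun p => k * f p + g p) <=
  2 * k ^+ 2 * ip mu A f f + 2 * ip mu A g g.
Proof.
move=> mA Lf Lg; have LZ := L2Z k mA Lf.
apply: le_trans (ip_add_le mA LZ Lg) _.
by rewrite ipZl// ipZr// !mulrA.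
Qed.

Definition triple := ((plane -> R^o) * (plane -> R^o) * (plane -> R^o))%type.

Variables (L : R) (bl br : R -> R) (B : R).
Hypotheses (bl_per : periodic bl L) (br_per : periodic br L).
Hypotheses (bl_C1 : C1_line bl) (br_C1 : C1_line br).
Hypothesis bl_br : forall x, bl x < br x.
Hypotheses (bl_B : forall x, `|bl x| <= B) (br_B : forall x, `|br x| <= B).

Let D : set plane := channel bl br.
Let DL : set mplane := unit_region L D.

Lemma open_channel : open D.
Proof.
have -> : D = (fun p : plane => p.2 - bl p.1) @^-1` [set t | 0 < t] `&`
              (fun p : plane => br p.1 - p.2) @^-1` [set t | 0 < t].
  by apply/seteqP; split => p; rewrite /D /channel /= !subr_gt0.
have cb (b : R -> R) : C1_line b -> continuous (fun p : plane => b p.1).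
  move=> /C1_line_continuous cb p.
  by apply: (@continuous_comp _ R R fst b); [exact: cvg_fst|exact: cb].
apply: openI; apply: open_comp; try exact: open_gt.
- by move=> p _; apply: cvgB; [exact: cvg_snd|exact: cb].
- by move=> p _; apply: cvgB; [exact: cb|exact: cvg_snd].
Qed.

Lemma measurable_channel : measurable (D : set mplane).
Proof. by apply: open_plane_measurable; exact: open_channel. Qed.

Lemma channel_per p : D (p + (L, 0)) <-> D p.
Proof. by rewrite /D /channel /= addr0 bl_per br_per. Qed.

Lemma measurable_unit_channel : measurable DL.
Proof. by apply: measurable_dom_strip; exact: measurable_channel. Qed.
Local Notation mDL := measurable_unit_channel.

Lemma unit_channel_box : DL `<=` `[0, L] `*` `[- B, B].
Proof.
move=> [x y] [[/= h1 h2] [/= h3 h4]]; split; rewrite /= in_itv/=; apply/andP; split => //.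
- exact: ltW.
- by have := bl_B x; rewrite ler_norml => /andP[h _]; apply: le_trans h (ltW h1).
- by have := br_B x; rewrite ler_norml => /andP[_ h]; apply: le_trans (ltW h2) h.
Qed.

Lemma L2_continuous (f : plane -> R) : continuous f -> L2 mu DL f.
Proof.
move=> cf; apply: (L2S (compact_plane_measurable (@compact_box _ 0 L (- B) B)) mDL) => //.
  exact: unit_channel_box.
by apply: continuous_compact_L2; [exact: cf | exact: compact_box].
Qed.

Definition smooth_triple (phi : plane -> R) : triple := (phi, 'D_e_x phi, 'D_e_y phi).

Definition L2_triple (e : triple) := [/\ L2 mu DL e.1.1, L2 mu DL e.1.2 & L2 mu DL e.2].

Definition nrm2 (e : triple) : R :=
  ip mu DL e.1.1 e.1.1 + ip mu DL e.1.2 e.1.2 + ip mu DL e.2 e.2.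

(* The triples (u, u_x, u_y) of H^1_0, without reference to weak derivatives: the zero trace is part of the
   approximation by smooth functions. *)
Definition space (e : triple) : Prop := L2_triple e /\
  forall eps : R, 0 < eps -> exists phi, [/\ C1_plane phi, periodic phi (L, 0),
    nrm2 (smooth_triple phi - e) < eps, (graph_norm L bl phi < eps%:E)%E &
    (graph_norm L br phi < eps%:E)%E].

Lemma nrm2_ge0 e : 0 <= nrm2 e.
Proof. by rewrite !addr_ge0// ip_ge0. Qed.

Lemma L2_tripleL k e f : L2_triple e -> L2_triple f -> L2_triple (k *: e + f).
Proof.
move=> [e1 e2 e3] [f1 f2 f3]; split.
- exact: (L2_lin k mDL e1 f1).
- exact: (L2_lin k mDL e2 f2).
- exact: (L2_lin k mDL e3 f3).
Qed.

Lemma L2_tripleB e f : L2_triple e -> L2_triple f -> L2_triple (e - f).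
Proof. by move=> Le Lf; rewrite addrC -scaleN1r; exact: L2_tripleL. Qed.

Lemma nrm2L k e f : L2_triple e -> L2_triple f ->
  nrm2 (k *: e + f) <= 2 * k ^+ 2 * nrm2 e + 2 * nrm2 f.
Proof.
move=> [e1 e2 e3] [f1 f2 f3].
have := ip_lin_le k mDL e1 f1; have := ip_lin_le k mDL e2 f2; have := ip_lin_le k mDL e3 f3.
move=> h3 h2 h1; have H : nrm2 (k *: e + f) <= _ := lerD (lerD h1 h2) h3.
by apply: le_trans H _; rewrite /nrm2; lra.
Qed.

Lemma nrm2D e f : L2_triple e -> L2_triple f -> nrm2 (e + f) <= 2 * nrm2 e + 2 * nrm2 f.
Proof. by move=> Le Lf; have := nrm2L 1 Le Lf; rewrite scale1r expr1n mulr1. Qed.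

Lemma L2_smooth phi : C1_plane phi -> L2_triple (smooth_triple phi).
Proof.
move=> /C1_planeP C; have [_ _ cx cy] := C.
split; apply: L2_continuous; [exact: C1_on_continuous C|exact: cx|exact: cy].
Qed.

Lemma smooth_tripleL k phi psi : C1_plane phi -> C1_plane psi ->
  C1_plane (fun p => k * phi p + psi p) /\
  smooth_triple (fun p => k * phi p + psi p) = k *: smooth_triple phi + smooth_triple psi.
Proof.
move=> /C1_planeP C1 /C1_planeP C2; have C := C1_on_lin k 1 C1 C2.
have E : (fun p => k * phi p + psi p) = (fun p => k * phi p + 1 * psi p).
  by apply/funext => p; rewrite mul1r.
have [CC Ex Ey] := C1_onE C; rewrite E; split => //.
rewrite /smooth_triple Ex Ey; congr (_, _, _); apply/funext => p; by rewrite mul1r.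
Qed.

Lemma space_lin k e f : space e -> space f -> space (k *: e + f).
Proof.
move=> [Le He] [Lf Hf]; split; first exact: L2_tripleL.
move=> eps eps0; pose K := 2 * k ^+ 2 + 2.
have K0 : 0 < K by rewrite ltr_pwDr// mulr_ge0 ?sqr_ge0.
have d0 : 0 < eps / K by rewrite divr_gt0.
have [phi [Cphi Pphi n1 g1 h1]] := He _ d0; have [psi [Cpsi Ppsi n2 g2 h2]] := Hf _ d0.
have [C E] := smooth_tripleL k Cphi Cpsi.
exists (fun p => k * phi p + psi p).
have cphi := C1_on_continuous (C1_planeP Cphi); have cpsi := C1_on_continuous (C1_planeP Cpsi).
have cc := C1_on_continuous (C1_planeP C).
have k20 : 0 <= 2 * k ^+ 2 by rewrite mulr_ge0 ?sqr_ge0.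
have Keps : 2 * k ^+ 2 * (eps / K) + 2 * (eps / K) = eps.
  by rewrite -mulrDl mulrC divfK// gt_eqF.
have gr b : C1_line b -> (graph_norm L b phi < (eps / K)%:E)%E ->
    (graph_norm L b psi < (eps / K)%:E)%E ->
    (graph_norm L b (fun p => k * phi p + psi p)%R < eps%:E)%E.
  move=> Cb b1 b2.
  apply: (@le_lt_trans _ _ ((2 * k ^+ 2)%:E * graph_norm L b phi + 2%:E * graph_norm L b psi)%E).
    apply: graph_norm_le => // x; have := sqr_ge0 (k * phi (x, b x) - psi (x, b x)); nra.
  have fin (h : plane -> R) : (graph_norm L b h < (eps / K)%:E)%E -> exists r, graph_norm L b h = r%:E.
    move=> hb; exists (fine (graph_norm L b h)); rewrite fineK// ge0_fin_numE ?graph_norm_ge0//.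
    exact: lt_trans hb (ltry _).
  have [r1 E1] := fin _ b1; have [r2 E2] := fin _ b2; move: b1 b2; rewrite E1 E2.
  by rewrite -!EFinM -EFinD !lte_fin; nra.
split => //.
- by move=> p; rewrite Pphi Ppsi.
- have LS := L2_smooth Cphi; have LS' := L2_smooth Cpsi.
  have -> : smooth_triple (fun p => k * phi p + psi p) - (k *: e + f) =
      k *: (smooth_triple phi - e) + (smooth_triple psi - f).
    by rewrite E scalerBr opprD addrACA.
  apply: le_lt_trans (nrm2L k (L2_tripleB LS Le) (L2_tripleB LS' Lf)) _.
  rewrite -Keps; apply: ler_ltD; first by rewrite ler_wpM2l// ltW.
  by rewrite ltr_pM2l.
- exact: (gr bl bl_C1 g1 g2).
- exact: (gr br br_C1 h1 h2).
Qed.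

Lemma smooth_cst0 : C1_plane (fun=> 0 : R) /\ smooth_triple (fun=> 0) = 0.
Proof.
have C : C1_on (fun=> 0 : R) (fun=> 0) (fun=> 0).
  by split => p; try exact: cvg_cst; exact: is_derive_cst.
have [CC Ex Ey] := C1_onE C; split; first exact: CC.
by apply: injective_projections; [apply: injective_projections; [|exact: Ex]|exact: Ey].
Qed.

Lemma space0 : space 0.
Proof.
have L0 := L20 mu mDL; split; first by split; exact: L0.
move=> eps e0; have [C E] := smooth_cst0; exists (fun=> 0).
have gr b : C1_line b -> (graph_norm L b (fun=> 0%R) < eps%:E)%E.
  move=> Cb; rewrite /graph_norm /graph_sqdist integral0_eq// => x _.
  by rewrite subrr expr0n mul0r.
split => //; [|exact: (gr bl bl_C1)|exact: (gr br br_C1)].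
rewrite E subrr /nrm2 /ip /= /Rintegral.
have -> : (\int[mu]_(x in DL) (0 * 0 : R)%:E = 0)%E.
  by rewrite integral0_eq// => x _; rewrite mul0r.
by rewrite !addr0.
Qed.

Lemma spaceB e f : space e -> space f -> space (e - f).
Proof. by move=> *; rewrite addrC -scaleN1r; exact: space_lin. Qed.

Lemma space_closed e : L2_triple e ->
  (forall eps : R, 0 < eps -> exists2 f, space f & nrm2 (f - e) < eps) -> space e.
Proof.
move=> Le H; split => // eps e0; have e4 : 0 < eps / 4 by lra.
have [f [Lf Hf] fe] := H _ e4; have [phi [C P n1 g1 g2]] := Hf _ e4.
have e4' : (eps / 4 < eps :> R) by lra.
exists phi; split => //.
- have -> : smooth_triple phi - e = (smooth_triple phi - f) + (f - e) by rewrite addrA subrK.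
  apply: le_lt_trans (nrm2D (L2_tripleB (L2_smooth C) Lf) (L2_tripleB Lf Le)) _; lra.
- by apply: lt_trans g1 _; rewrite lte_fin.
- by apply: lt_trans g2 _; rewrite lte_fin.
Qed.

(** Each of the three components converges in L^2 with rate [4 * C], which makes 12. The limit
    triple stays in [space] because this space is a closure by construction. *)
Lemma space_complete (u : nat -> triple) (C : R) : (forall n, space (u n)) -> 0 <= C ->
  (forall n, nrm2 (u n.+1 - u n) <= C * 4^-1 ^+ n) ->
  exists2 e, space e & forall n, nrm2 (u n - e) <= 12 * C * 4^-1 ^+ n.
Proof.
move=> Su C0 uC.
have ge := ip_ge0 mu DL.
have [g1 [L1 n1 _]] := @L2_complete _ _ _ mu DL (fun n => (u n).1.1) C mDL
  (fun n => let: And3 h _ _ := (Su n).1 in h) C0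
  (fun n => le_trans (le_trans (ler_wpDr (ge _) (ler_wpDr (ge _) (lexx _))) (lexx _)) (uC n)).
have [g2 [L2' n2 _]] := @L2_complete _ _ _ mu DL (fun n => (u n).1.2) C mDL
  (fun n => let: And3 _ h _ := (Su n).1 in h) C0
  (fun n => le_trans (ler_wpDr (ge _) (ler_wpDl (ge _) (lexx _))) (uC n)).
have [g3 [L3 n3 _]] := @L2_complete _ _ _ mu DL (fun n => (u n).2) C mDL
  (fun n => let: And3 _ _ h := (Su n).1 in h) C0
  (fun n => le_trans (ler_wpDl (addr_ge0 (ge _) (ge _)) (lexx _)) (uC n)).
have bd n : nrm2 (u n - (g1, g2, g3)) <= 12 * C * 4^-1 ^+ n.
  have := n1 n; have := n2 n; have := n3 n.
  rewrite /nrm2 /= => h3 h2 h1.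
  have -> : 12 * C * 4^-1 ^+ n = 4 * C * 4^-1 ^+ n + 4 * C * 4^-1 ^+ n + 4 * C * 4^-1 ^+ n by ring.
  by apply: lerD; [apply: lerD|].
exists (g1, g2, g3) => //; apply: space_closed; first by split.
move=> eps e0.
have cv : (4^-1 ^+ n : R) @[n --> \oo] --> (0 : R).
  by apply: cvg_expr; rewrite ger0_norm// invf_lt1//; lra.
have K0 : 0 < 12 * C + 1 by lra.
have /cvgrPdist_lt/(_ _ (divr_gt0 e0 K0)) [N _ /(_ N (leqnn _))] := cv.
rewrite /= sub0r normrN ger0_norm ?exprn_ge0// => HN.
exists (u N); first exact: Su.
apply: le_lt_trans (bd N) _; move: HN; rewrite ltr_pdivlMr//.
have : 0 <= 4^-1 ^+ N :> R by rewrite exprn_ge0.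
nra.
Qed.

Lemma section_unit_channel x : [set y | DL (x, y)] =
  if (0 <= x < L) then `]bl x, br x[%classic else set0.
Proof.
apply/seteqP; split => y /=; rewrite /DL /D /unit_region /channel /strip /=.
  by move=> [[h1 h2] [h3 h4]]; rewrite h3 h4/= in_itv/= h1 h2.
by case: ifPn => // /andP[h3 h4]; rewrite /= in_itv/= => /andP[h1 h2].
Qed.

Lemma poincare_smooth phi : C1_plane phi ->
  ((ip mu DL phi phi)%:E <= (2 * (2 * B + 1))%:E * graph_norm L bl phi +
   (4 * (2 * B + 1) ^+ 2 * ip mu DL ('D_e_y phi) ('D_e_y phi))%:E)%E.
Proof.
move=> /C1_planeP C; have [_ _ _ cy] := C; have c := C1_on_continuous C.
(* The channel has width at most [2 * B]; adding 1 keeps [H] positive. *)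
set H := 2 * B + 1; set dphi := 'D_e_y phi.
have B0 : 0 <= B := le_trans (normr_ge0 _) (bl_B 0).
have H0 : 0 < H by rewrite /H; lra.
have Lp := L2_continuous c; have Ld := L2_continuous cy.
have sqm (f : plane -> R) : continuous f -> measurable_fun (DL : set mplane) (fun p => (f p ^+ 2)%:E).
  move=> cf; apply/measurable_EFinP/measurable_funTS/measurable_funX.
  exact: continuous_plane_measurable.
have ton (f : plane -> R) : continuous f -> ((ip mu DL f f)%:E =
    \int[leb]_x \int[leb]_(y in [set y | DL (x, y)]) (f (x, y) ^+ 2)%:E)%E.
  move=> cf; rewrite ip_EFin//; [|exact: mDL|exact: L2_continuous|exact: L2_continuous].
  rewrite -(@tonelli_region R DL (fun p => (f p ^+ 2)%:E) mDL (sqm _ cf)); last first.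
    by move=> p _; rewrite lee_fin sqr_ge0.
  by apply: eq_integral => p _; rewrite expr2.
have F0 f x : (0 <= \int[leb]_(y in [set y | DL (x, y)]) (f (x, y) ^+ 2)%:E)%E.
  by apply: integral_ge0 => y _; rewrite lee_fin sqr_ge0.
have mF (f : plane -> R) : continuous f -> measurable_fun [set: mline]
    (fun x => \int[leb]_(y in [set y | DL (x, y)]) (f (x, y) ^+ 2)%:E)%E.
  move=> cf.
  have : measurable_fun [set: mplane] ((fun p => (f p ^+ 2)%:E) \_ DL).
    by apply/(measurable_restrictT _ _).1; [exact: mDL|exact: sqm].
  move=> /(@measurable_fun_fubini_tonelli_F _ _ _ _ _ leb _) /(_ _) mF.
  have {}mF : measurable_fun [set: mline] (fubini_F leb ((fun p => (f p ^+ 2)%:E) \_ DL)).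
    by apply: mF => p; rewrite patchE; case: ifPn => // _; rewrite lee_fin sqr_ge0.
  apply: eq_measurable_fun mF => x _; rewrite /fubini_F [RHS]integral_mkcond.
  by rewrite -(@patch_sectionY R DL (fun p => (f p ^+ 2)%:E) x).
pose G x := (((phi (x, bl x)) ^+ 2)%:E) : \bar R.
have mG : measurable_fun (`[0%R, L[%classic : set mline) G.
  apply/measurable_EFinP; apply: measurable_funTS; apply: continuous_measurable_fun => x.
  by apply: cvgM; exact: (continuous_on_graph bl_C1 c).
rewrite [X in (_ + X)%E]EFinM ton// ton//.
apply: (@le_trans _ _ ((2 * H)%:E * (\int[leb]_(x in `[0%R, L[) G x) + (4 * H ^+ 2)%:E *
    \int[leb]_x \int[leb]_(y in [set y | DL (x, y)]) (dphi (x, y) ^+ 2)%:E)%E); last first.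
  by rewrite leeD2r// lee_pmul2l//; [exact: graph_norm_ge|rewrite lte_fin mulr_gt0].
rewrite [X in (_ * X + _)%E]integral_mkcond.
have mGr : measurable_fun [set: mline] (G \_ `[0%R, L[).
  by apply/(measurable_restrictT _ _).1 => //; exact: measurable_itv.
have G0 x : (0 <= (G \_ `[0%R, L[) x)%E by rewrite patchE; case: ifPn => // _; rewrite lee_fin sqr_ge0.
rewrite -ge0_integralZl_EFin//; last by rewrite mulr_ge0// ltW.
rewrite -ge0_integralZl_EFin//; [|exact: mF|by rewrite mulr_ge0// sqr_ge0].
rewrite -ge0_integralD//; first last.
- by apply: measurable_funeM; exact: mF.
- by move=> x _; rewrite mule_ge0// lee_fin mulr_ge0// sqr_ge0.
- exact: measurable_funeM.
- by move=> x _; rewrite mule_ge0// lee_fin mulr_ge0// ltW.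
apply: ge0_le_integral => //.
- exact: mF.
- by apply: emeasurable_funD; [exact: measurable_funeM|apply: measurable_funeM; exact: mF].
move=> x _; rewrite section_unit_channel patchE.
have -> : (x \in `[0%R, L[%classic) = (0 <= x < L) by rewrite mem_setE in_itv.
case: ifPn => [xL|_]; last by rewrite !integral_set0 !mule0 adde0.
have Cs := C1_sliceY x C; have blr := bl_br x.
have ab : br x - bl x <= H.
  have := bl_B x; have := br_B x; rewrite !ler_norml /H => /andP[? ?] /andP[? ?]; lra.
have cl (f : R -> R) : continuous f -> (\int[leb]_(y in `]bl x, br x[) (f y ^+ 2)%:E =
    (\int[leb]_(y in `[bl x, br x]) (f y ^+ 2))%:E)%E.
  move=> cf.
  have cf2 : continuous (fun y => f y ^+ 2) by move=> y; apply: cvgM; exact: cf.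
  rewrite fineK.
    apply/esym/integral_itv_bndoo.
    by apply/measurable_EFinP; apply: measurable_funTS; exact: continuous_measurable_fun.
  apply: integrable_fin_num; first exact: measurable_itv.
  exact: continuous_itv_integrable.
have cdy : continuous (fun y => dphi (x, y)) by exact: continuous_sliceY.
have cpy : continuous (fun y => phi (x, y)) by exact: continuous_sliceY.
rewrite (cl _ cpy) (cl _ cdy) /G -!EFinM -EFinD lee_fin.
exact: slice_poincare Cs (ltW blr) H0 ab.
Qed.

(** The constant [4 * H ^+ 2] of the slices, with [H = 2 * B + 1], is doubled twice when the
    inequality is carried from a smooth approximant to the limit: once for the function, once for
    its y-derivative. *)
Definition poincare_cst : R := 16 * (2 * B + 1) ^+ 2.

Lemma poincare e : space e -> ip mu DL e.1.1 e.1.1 <= poincare_cst * ip mu DL e.2 e.2.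
Proof.
move=> [[L1 L2' L3] He].
have B0 : 0 <= B := le_trans (normr_ge0 _) (bl_B 0).
rewrite -subr_le0; set H := 2 * B + 1.
have H0 : 0 < H by rewrite /H; lra.
apply: (@le0_eps _ _ (2 + 4 * H + 16 * H ^+ 2)).
  by have := sqr_ge0 H; lra.
move=> eps e0; have [phi [C P n1 g1 _]] := He _ e0.
have [S1 S2 S3] := L2_smooth C.
have [M1 M2 M3] := L2_tripleB (L2_smooth C) (And3 L1 L2' L3).
have pc : ip mu DL phi phi <= 2 * H * eps + 4 * H ^+ 2 * ip mu DL ('D_e_y phi) ('D_e_y phi).
  rewrite -lee_fin; apply: le_trans (poincare_smooth C) _.
  rewrite [leRHS]EFinD; apply: leeD2r; rewrite [leRHS]EFinM.
  by rewrite lee_pmul2l ?lte_fin ?mulr_gt0// ltW.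
have n1' : ip mu DL (phi \- e.1.1) (phi \- e.1.1) < eps.
  by apply: le_lt_trans n1; apply: ler_wpDr (ip_ge0 _ _ _) (ler_wpDr (ip_ge0 _ _ _) (lexx _)).
have n3' : ip mu DL ('D_e_y phi \- e.2) ('D_e_y phi \- e.2) < eps.
  by apply: le_lt_trans n1; apply: ler_wpDl (addr_ge0 (ip_ge0 _ _ _) (ip_ge0 _ _ _)) (lexx _).
have a1 := ip_lin_le (-1) mDL M1 S1.
have a3 := ip_add_le mDL M3 L3.
have E1 : (fun p => -1 * (smooth_triple phi - e).1.1 p + phi p) = e.1.1.
  by apply/funext => p /=; rewrite mulN1r opprB subrK.
have E3 : ((smooth_triple phi - e).2 \+ e.2) = 'D_e_y phi.
  by apply/funext => p /=; rewrite subrK.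
rewrite E1 in a1; rewrite E3 in a3.
have a1' : ip mu DL e.1.1 e.1.1 <= 2 * eps + 2 * ip mu DL phi phi.
  apply: le_trans a1 _; rewrite sqrrN expr1n mulr1 lerD2r ler_wpM2l//.
  exact: ltW.
have a3' : ip mu DL ('D_e_y phi) ('D_e_y phi) <= 2 * eps + 2 * ip mu DL e.2 e.2.
  apply: le_trans a3 _; rewrite lerD2r ler_wpM2l//; exact: ltW.
rewrite /poincare_cst -/H; have := sqr_ge0 H; nra.
Qed.

End EnergySpace.

(** * The L^2 norm in terms of the inner product *)

Section L2Norm.
Context {R : realType}.
Local Notation plane := (R * R)%type.
Local Notation mplane := (measurableTypeR R * measurableTypeR R)%type.
Local Notation mu := (plane_measure R).

Lemma norm2E (A : set mplane) (f : plane -> R) : measurable A ->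
  norm2 A f = ((\int[mu]_(p in A) (f p ^+ 2)%:E) `^ 2^-1)%E.
Proof.
move=> mA; rewrite /norm2 unlock /=; congr (_ `^ _)%E.
rewrite [RHS]integral_mkcond; apply: eq_integral => p _.
rewrite !patchE; case: ifP => _ /=.
  by rewrite (powR_mulrn 2) // -normrX ger0_norm// sqr_ge0.
by rewrite normr0 powR0.
Qed.

Lemma norm2_L2 (A : set mplane) (f : plane -> R) : measurable A -> L2 mu A f ->
  norm2 A f = (Num.sqrt (ip mu A f f))%:E.
Proof.
move=> mA Lf; rewrite norm2E//.
have -> : (\int[mu]_(p in A) (f p ^+ 2)%:E = (ip mu A f f)%:E)%E.
  by rewrite ip_EFin//; apply: eq_integral => p _; rewrite expr2.
by rewrite poweR_EFin powR12_sqrt// ip_ge0.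
Qed.

Lemma square_integrableP (A : set mplane) (f : plane -> R) : measurable A ->
  square_integrable A f <-> L2 mu A f.
Proof.
move=> mA; rewrite /square_integrable; split.
  move=> /andP[]; rewrite !inE /= => mf fin.
  have mAf : measurable_fun A f by apply: (measurable_restrictT _ mA).2; exact: mf.
  apply: L2P => //; move: fin; rewrite /finite_norm.
  by rewrite -[X in (X < _)%E]/(norm2 A f) norm2E// => /lty_poweRy; apply; rewrite invr_neq0.
move=> Lf; apply/andP; rewrite !inE; split => /=.
  by apply: (measurable_restrictT _ mA).1; case: Lf.
by rewrite /finite_norm -[X in (X < _)%E]/(norm2 A f) norm2_L2// ltry.
Qed.

Lemma norm2_le (A : set mplane) (f : plane -> R) (e : R) : measurable A -> L2 mu A f ->
  0 <= e -> ip mu A f f <= e ^+ 2 -> (norm2 A f <= e%:E)%E.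
Proof.
move=> mA Lf e0 fe; rewrite norm2_L2// lee_fin -(ger0_norm e0) -sqrtr_sqr.
exact: ler_wsqrtr.
Qed.

Lemma norm2_lt (A : set mplane) (f : plane -> R) (e : R) : measurable A -> L2 mu A f ->
  0 < e -> (norm2 A f < (Num.sqrt e)%:E)%E -> ip mu A f f < e.
Proof. by move=> mA Lf e0; rewrite norm2_L2// lte_fin ltr_sqrt. Qed.

Lemma cvge0_lt (u : nat -> \bar R) (e : R) : u n @[n --> \oo] --> 0%E -> 0 < e ->
  \forall n \near \oo, (u n < e%:E)%E.
Proof.
move=> cu e0; apply: (cu [set y | (y < e%:E)%E]).
apply: open_nbhs_nbhs; split; first exact: open_ereal_lt_ereal.
by rewrite /= lte_fin.
Qed.

Lemma cvge0_le (u : nat -> \bar R) : (forall n, (0 <= u n)%E) ->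
  (forall n, (u n <= (n.+1%:R^-1 : R)%:E)%E) -> u n @[n --> \oo] --> 0%E.
Proof.
move=> u0 un; apply: (@squeeze_cvge _ _ _ _ (fun=> 0%E) _ (fun n => (n.+1%:R^-1 : R)%:E)).
- by near=> n; rewrite u0 un.
- exact: cvg_cst.
- apply: cvg_EFin; first by near=> n.
  exact: (@cvg_harmonic R).
Unshelve. all: by end_near. Qed.

End L2Norm.

(** * Coercivity and solvability of the weak problem *)

Section WeakProblem.
Context {R : realType}.
Local Notation plane := (R * R)%type.
Local Notation mplane := (measurableTypeR R * measurableTypeR R)%type.
Local Notation mu := (plane_measure R).
Variables (L : R) (bl br : R -> R) (B : R) (fl fr : R).
Hypotheses (bl_C1 : C1_line bl) (br_C1 : C1_line br).
Hypotheses (bl_B : forall x, `|bl x| <= B) (br_B : forall x, `|br x| <= B).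
Hypotheses (bl_fl : forall x, bl x < fl) (fl_fr : fl < fr) (fr_br : forall x, fr < br x).

Let D : set plane := channel bl br.
Let DL : set mplane := unit_region L D.
Let OmL : set mplane := unit_region L (band fl fr).
Local Notation space := (space L bl br).
Local Notation nrm2 := (nrm2 L bl br).

Lemma bl_lt_br x : bl x < br x.
Proof. by apply: lt_trans (bl_fl x) (lt_trans fl_fr (fr_br x)). Qed.

Let mDL : measurable DL := measurable_unit_channel L bl_C1 br_C1.

Lemma measurable_unit_band : measurable OmL.
Proof.
apply: measurable_dom_strip; apply: open_plane_measurable.
have -> : band fl fr = (fun p : plane => p.2) @^-1` ([set t | fl < t] `&` [set t | t < fr]) by [].
apply: open_comp; first by move=> p _; exact: cvg_snd.
by apply: openI; [exact: open_gt|exact: open_lt].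
Qed.

Lemma unit_band_sub : OmL `<=` DL.
Proof.
move=> p [[h1 h2] h3]; split => //; split; first exact: lt_trans (bl_fl _) h1.
exact: lt_trans h2 (fr_br _).
Qed.

Let Ex : set mplane := DL `\` OmL.
Lemma measurable_unit_exterior : measurable Ex.
Proof. by apply: measurableD => //; exact: measurable_unit_band. Qed.
Let mEx := measurable_unit_exterior.

Let ExDL : Ex `<=` DL. Proof. by move=> p []. Qed.

Definition form (a : R) (e f : @triple R) : R :=
  a * (ip mu DL e.1.2 f.1.2 + ip mu DL e.2 f.2) + ip mu Ex e.1.1 f.1.1.

Lemma L2_ext (f : plane -> R) : L2 mu DL f -> L2 mu Ex f.
Proof. exact: L2S. Qed.

Lemma formC a e f : form a e f = form a f e.
Proof. by rewrite /form [ip mu DL e.1.2 _]ipC [ip mu DL e.2 _]ipC [ip mu Ex _ _]ipC. Qed.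

Lemma formL a k e f g : space e -> space f -> space g ->
  form a (k *: e + f) g = k * form a e g + form a f g.
Proof.
move=> [[e1 e2 e3] _] [[f1 f2 f3] _] [[g1 g2 g3] _]; rewrite /form.
have -> := ip_linl k mDL e2 f2 g2; have -> := ip_linl k mDL e3 f3 g3.
have -> := ip_linl k mEx (L2_ext e1) (L2_ext f1) (L2_ext g1).
ring.
Qed.

Lemma poincare_cst_ge0 : 0 <= poincare_cst B.
Proof. by rewrite mulr_ge0// sqr_ge0. Qed.

Lemma form_ge0 a e : 0 <= a -> 0 <= form a e e.
Proof. by move=> a0; rewrite addr_ge0 ?mulr_ge0 ?addr_ge0 ?ip_ge0. Qed.

Lemma ip_ext_le (f : plane -> R) : L2 mu DL f -> ip mu Ex f f <= ip mu DL f f.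
Proof.
move=> Lf; have Lx := L2_ext Lf; rewrite -lee_fin !ip_EFin//.
apply: ge0_subset_integral => //; last by move=> p _; rewrite lee_fin -expr2 sqr_ge0.
by apply/measurable_EFinP; apply: measurable_funM; case: Lf.
Qed.

Lemma form_le a e : 0 <= a -> space e -> form a e e <= (a + 1) * nrm2 e.
Proof.
move=> a0 [[e1 e2 e3] _]; have := ip_ext_le e1; rewrite /form /nrm2.
have := ip_ge0 mu DL e.1.1; have := ip_ge0 mu DL e.1.2; have := ip_ge0 mu DL e.2.
move=> h3 h2 h1; nra.
Qed.

Lemma nrm2_le_grad e : space e ->
  nrm2 e <= (poincare_cst B + 1) * (ip mu DL e.1.2 e.1.2 + ip mu DL e.2 e.2).
Proof.
move=> Se; have := poincare bl_C1 br_C1 bl_lt_br bl_B br_B Se.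
rewrite /nrm2 -/D -/DL; have := ip_ge0 mu DL e.1.2; have := ip_ge0 mu DL e.2.
have := poincare_cst_ge0.
nra.
Qed.

(** The zero-order term of [form] lives on the exterior of the band only, so the L^2 norm inside the
    band has to come from the gradient through [poincare]. *)
Lemma form_coercive a e : 0 < a -> space e ->
  nrm2 e <= (poincare_cst B + 1) / a * form a e e.
Proof.
move=> a0 Se; apply: le_trans (nrm2_le_grad Se) _.
rewrite -mulrA; apply: ler_wpM2l; first by have := poincare_cst_ge0; lra.
by rewrite ler_pdivlMl// /form lerDl ip_ge0.
Qed.

(** Stated for a general bounded functional because it is needed twice: with the load of the
    original problem, and with Dirichlet products when the resolvent is iterated. *)
Lemma weak_problem_exists (a : R) (l : @triple R -> R) (C : R) : 0 < a -> 0 <= C ->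
  (forall k e f, space e -> space f -> l (k *: e + f) = k * l e + l f) ->
  (forall e, space e -> l e ^+ 2 <= C * nrm2 e) ->
  exists2 e, space e & forall f, space f -> form a e f = l f.
Proof.
move=> a0 C0 lL lC; set K := (poincare_cst B + 1) / a.
have K0 : 0 <= K.
  by apply: divr_ge0; [have := poincare_cst_ge0; lra|exact: ltW].
apply: (@riesz_symmetric R (@triple R) space (form a) l (C * K)).
- exact: space0.
- by move=> *; exact: space_lin.
- by move=> *; exact: formC.
- by move=> *; exact: formL.
- by move=> *; apply: form_ge0; exact: ltW.
- exact: lL.
- exact: mulr_ge0.
- move=> e Se; apply: le_trans (lC _ Se) _; rewrite -mulrA; apply: ler_wpM2l => //.
  exact: form_coercive.
- move=> u Su bu; have [|e Se ne] := space_complete bl_C1 br_C1 bl_B br_B Su K0.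
    move=> n; apply: le_trans (form_coercive a0 _) _; first exact: spaceB.
    by apply: ler_wpM2l.
  exists e => // eps eps0.
  have cv : (4^-1 ^+ n : R) @[n --> \oo] --> (0 : R).
    by apply: cvg_expr; rewrite ger0_norm// invf_lt1//; lra.
  have M0 : 0 < (a + 1) * (12 * K) + 1.
    have aK : 0 <= (a + 1) * (12 * K) by apply: mulr_ge0; [lra|apply: mulr_ge0].
    exact: ltr_wpDl aK ltr01.
  have /cvgrPdist_lt/(_ _ (divr_gt0 eps0 M0)) [N _ HN] := cv.
  exists N => n Nn; have := HN n Nn; rewrite /= sub0r normrN ger0_norm ?exprn_ge0//.
  rewrite ltr_pdivlMr// => HN'.
  apply: le_lt_trans (form_le (ltW a0) _) _; first exact: spaceB.
  have a1 : 0 <= a + 1 by lra.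
  apply: le_lt_trans (ler_wpM2l a1 (ne n)) _.
  have : 0 <= 4^-1 ^+ n :> R by rewrite exprn_ge0.
  move: HN'; set t := _ ^+ n; nra.
Qed.

Lemma weak_problem_unique (a : R) e e' : 0 < a -> space e -> space e' ->
  (forall f, space f -> form a e f = form a e' f) -> nrm2 (e - e') = 0.
Proof.
move=> a0 Se Se' E; have Sd : space (e - e') by exact: spaceB.
apply/eqP; rewrite eq_le nrm2_ge0 andbT.
apply: le_trans (form_coercive a0 Sd) _.
have E' : e - e' = -1 *: e' + e by rewrite scaleN1r addrC.
by rewrite {1}E' formL// -E// mulN1r addNr mulr0.
Qed.

Lemma nrm2_eq0_ae e : space e -> nrm2 e = 0 ->
  {ae mu, forall p, DL p -> [/\ e.1.1 p = 0, e.1.2 p = 0 & e.2 p = 0]}.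
Proof.
move=> [[e1 e2 e3] _]; have := ip_ge0 mu DL e.1.1; have := ip_ge0 mu DL e.1.2.
have := ip_ge0 mu DL e.2; rewrite /nrm2 -/D -/DL => h3 h2 h1 E.
have E1 : ip mu DL e.1.1 e.1.1 = 0 by lra.
have E2 : ip mu DL e.1.2 e.1.2 = 0 by lra.
have E3 : ip mu DL e.2 e.2 = 0 by lra.
have a1 := ip0_ae mDL e1 E1; have a2 := ip0_ae mDL e2 E2; have a3 := ip0_ae mDL e3 E3.
by apply: filterS3 a1 a2 a3 => p p1 p2 p3 Dp; split; auto.
Qed.

End WeakProblem.

(** * Identification of the energy space with periodic H^1 functions of zero trace *)

Section Bridge.
Context {R : realType}.
Local Notation plane := (R * R)%type.
Local Notation mplane := (measurableTypeR R * measurableTypeR R)%type.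
Local Notation mu := (plane_measure R).
Variables (L : R) (bl br : R -> R) (B : R).
Hypothesis L_gt0 : 0 < L.
Hypotheses (bl_per : periodic bl L) (br_per : periodic br L).
Hypotheses (bl_C1 : C1_line bl) (br_C1 : C1_line br).
Hypotheses (bl_B : forall x, `|bl x| <= B) (br_B : forall x, `|br x| <= B).

Let D : set plane := channel bl br.
Let DL : set mplane := unit_region L D.
Local Notation space := (space L bl br).
Local Notation nrm2 := (nrm2 L bl br).

Let mD : measurable (D : set mplane) := measurable_channel bl_C1 br_C1.
Let mDL : measurable DL := measurable_unit_channel L bl_C1 br_C1.
Let oD : open D := open_channel bl_C1 br_C1.
Let D_per : forall p, D (p + (L, 0)) <-> D p := channel_per bl_per br_per.

Definition grad_triple (u : plane -> R) : @triple R :=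
  (u, weak_partial D e_x u, weak_partial D e_y u).

Lemma H1per_L2 u : H1per L bl br u -> L2_triple L bl br (grad_triple u).
Proof.
move=> [_ _ _ /(_ 0 L) H]; have {H} [s1 s2 s3] := H; split.
- exact: (square_integrableP _ mDL).1 s1.
- exact: (square_integrableP _ mDL).1 s2.
- exact: (square_integrableP _ mDL).1 s3.
Qed.

Lemma cvge0_lt_ex (u1 u2 u3 u4 u5 : nat -> \bar R) (d e : R) :
  u1 n @[n --> \oo] --> 0%E -> u2 n @[n --> \oo] --> 0%E -> u3 n @[n --> \oo] --> 0%E ->
  u4 n @[n --> \oo] --> 0%E -> u5 n @[n --> \oo] --> 0%E -> 0 < d -> 0 < e ->
  exists n, [/\ (u1 n < d%:E)%E, (u2 n < d%:E)%E, (u3 n < d%:E)%E, (u4 n < e%:E)%E & (u5 n < e%:E)%E].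
Proof.
move=> c1 c2 c3 c4 c5 d0 e0; near \oo => n; exists n.
by split; near: n; exact: cvge0_lt.
Unshelve. all: by end_near. Qed.

Lemma H10per_space u : H10per L bl br u -> space (grad_triple u).
Proof.
move=> [H1 [phi [phiC [n1 n2 n3 g1 g2]]]]; have Lu := H1per_L2 H1; split => // eps e0.
have e3 : 0 < eps / 3 by rewrite divr_gt0.
have s3 : 0 < Num.sqrt (eps / 3) by rewrite sqrtr_gt0.
have [n [h1 h2 h3 h4 h5]] := cvge0_lt_ex n1 n2 n3 g1 g2 s3 e0.
have [C P] := phiC n; have [l1 l2 l3] := L2_tripleB bl_C1 br_C1 (L2_smooth L bl_C1 br_C1 bl_B br_B C) Lu.
exists (phi n); split; [exact: C|exact: P| |exact: h4|exact: h5].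
have -> : eps = eps / 3 + eps / 3 + eps / 3 by lra.
exact: ltrD (ltrD (norm2_lt mDL l1 e3 h1) (norm2_lt mDL l2 e3 h2)) (norm2_lt mDL l3 e3 h3).
Qed.

Lemma derive_xperiodic (phi : plane -> R) v : periodic phi (L, 0) ->
  xperiodic L ('D_v phi).
Proof.
move=> P; suff Pd : periodic ('D_v phi) (L, 0) by move=> p; exact: (periodic_xper p Pd).
move=> p; rewrite /derive P; set f1 := (X in phi \o X);
  set f2 := (X in _ = lim ((fun h => _ *: ((phi \o X) _ - _)) @ _)).
suff -> : phi \o f1 = phi \o f2 by [].
by apply/funext => h; rewrite /f1 /f2 /= /pseudometric_normed_Zmodule.shift addrA P.
Qed.

Lemma L2_xper (f : plane -> R) : L2 mu DL f -> L2 mu DL (f \o xper L).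
Proof.
move=> [mf If]; split.
  apply: (eq_measurable_fun f) => // p /set_mem [_ sp].
  by rewrite /= xper_id.
apply: eq_integrable If => // p /set_mem [_ sp].
by rewrite /= xper_id.
Qed.

Lemma ip_xper (f g : plane -> R) : ip mu DL (f \o xper L) (g \o xper L) = ip mu DL f g.
Proof.
by rewrite /ip; apply: eq_Rintegral => p /set_mem [_ sp]; rewrite /= xper_id.
Qed.

Lemma xperiodic_xper (f : plane -> R) : xperiodic L (f \o xper L).
Proof. by move=> p; rewrite /= [xper L (xper L p)]xper_id//; exact: xper_strip. Qed.

(** A triple carries information on one period only, hence the extension [e.1.1 \o xper L]. Its weak
    derivatives are L^2 limits of smooth ones and agree with the selected representatives by
    uniqueness; the approximants provided by [space] serve as the sequence required for the
    trace. *)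
Lemma space_H10per e : space e ->
  [/\ H10per L bl br (e.1.1 \o xper L),
      {ae mu, forall p, D p -> weak_partial D e_x (e.1.1 \o xper L) p = e.1.2 (xper L p)} &
      {ae mu, forall p, D p -> weak_partial D e_y (e.1.1 \o xper L) p = e.2 (xper L p)}].
Proof.
move=> Se; have [[L1 L2' L3] He] := Se; set u := e.1.1 \o xper L.
have M1 := L2_xper L1; have M2 := L2_xper L2'; have M3 := L2_xper L3.
have wl v (g : plane -> R) : v = e_x \/ v = e_y -> L2 mu DL g ->
    (forall eps : R, 0 < eps -> exists phi, [/\ C1_plane phi, periodic phi (L, 0),
      nrm2 (smooth_triple phi - e) < eps & ip mu DL ('D_v phi \- g) ('D_v phi \- g) < eps]) ->
    (forall phi, C1_plane phi -> L2 mu DL ('D_v phi)) ->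
    is_weak_partial D v u (g \o xper L).
  move=> vv Lg Hg Lv; apply: (@weak_partial_limit _ L _ L_gt0 mD D_per) => //; try exact: xperiodic_xper.
    exact: L2_xper.
  move=> eps e0; have [phi [C P n1 n2]] := Hg _ e0; exists phi; split; first split => //.
  - by move=> p; exact: periodic_xper.
  - exact: derive_xperiodic.
  - by have [] := L2_smooth L bl_C1 br_C1 bl_B br_B C.
  - exact: Lv.
  - have E1 : phi \- u = (phi \- e.1.1) \o xper L.
      by apply/funext => p; rewrite /= (periodic_xper _ P).
    have E2 : 'D_v phi \- (g \o xper L) = ('D_v phi \- g) \o xper L.
      by apply/funext => p /=; have := derive_xperiodic v P p => /= ->.
    rewrite E1 E2 !ip_xper; split => //.
    apply: le_lt_trans n1; rewrite /nrm2 /=.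
    by apply: ler_wpDr (ip_ge0 _ _ _) (ler_wpDr (ip_ge0 _ _ _) (lexx _)).
have wx : is_weak_partial D e_x u (e.1.2 \o xper L).
  apply: (wl e_x _ (or_introl erefl) L2'); [|by move=> phi C; have [] := L2_smooth L bl_C1 br_C1 bl_B br_B C].
  move=> eps e0; have [phi [C P n _ _]] := He _ e0; exists phi; split => //.
  apply: le_lt_trans n; rewrite /nrm2 /=.
  by apply: ler_wpDr (ip_ge0 _ _ _) (ler_wpDl (ip_ge0 _ _ _) (lexx _)).
have wy : is_weak_partial D e_y u (e.2 \o xper L).
  apply: (wl e_y _ (or_intror erefl) L3); [|by move=> phi C; have [] := L2_smooth L bl_C1 br_C1 bl_B br_B C].
  move=> eps e0; have [phi [C P n _ _]] := He _ e0; exists phi; split => //.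
  apply: le_lt_trans n; rewrite /nrm2 /=.
  by apply: ler_wpDl (addr_ge0 (ip_ge0 _ _ _) (ip_ge0 _ _ _)) (lexx _).
have [wx' ax] := weak_partialP oD wx; have [wy' ay] := weak_partialP oD wy.
have st (f : plane -> R) g al be : L2 mu DL f -> {ae mu, forall p, D p -> g p = f (xper L p)} ->
    measurable_fun (D : set mplane) g -> square_integrable (D `&` strip al be) g.
  move=> Lf fg mg; have mS := measurable_dom_strip mD al be; apply/square_integrableP => //.
  have [N HN] := ip_strip L_gt0 mD D_per al be.
  have [Ls _] := HN _ (@xperiodic_xper f) (L2_xper Lf).
  apply: L2P => //; first by apply: measurable_funS mg => // p [].
  have mgS : measurable_fun (D `&` strip al be : set mplane) g by apply: measurable_funS mg => // p [].
  rewrite (@ae_eq_integral _ _ _ mu _ (fun p => (((f \o xper L) p) ^+ 2)%:E)) //.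
  - have [_ /integrableP[_ I]] := Ls; apply: le_lt_trans I.
    by apply: ge0_le_integral => //; [move=> *; rewrite lee_fin sqr_ge0|apply/measurable_EFinP;
      apply: measurable_funX; case: Ls|apply: measurableT_comp => //; apply/measurable_EFinP;
        apply: measurable_funX; case: Ls|move=> p _; rewrite /= ger0_norm// sqr_ge0].
  - by apply/measurable_EFinP; apply: measurable_funX.
  - by apply/measurable_EFinP; apply: measurable_funX; case: Ls.
  - by apply: filterS fg => p Ep [Dp _]; rewrite /= Ep.
have mw v (g : plane -> R) : is_weak_partial D v u g -> measurable_fun (D : set mplane) g.
  by move=> [_ lg _]; exact: (loc_integrable_measurable oD lg).
have H1 : H1per L bl br u.
  split.
  - by apply: aeW => p _; rewrite /u /= xper_add.
  - by exists (e.1.2 \o xper L).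
  - by exists (e.2 \o xper L).
  - move=> al be /=; split.
    + apply: (st e.1.1) => //; first by apply: aeW.
      by apply: loc_integrable_measurable oD _; case: wx.
    + by apply: (st e.1.2) => //; exact: mw wx'.
    + by apply: (st e.2) => //; exact: mw wy'.
split => //; split => //.
(* [nrm2] is a squared norm while the trace definition asks for norms to tend to 0; the tolerance is
   squared so that these are at most [n.+1%:R^-1]. *)
have ge2 (n : nat) : 0 < (n.+1%:R^-1 : R) ^+ 2 by rewrite exprn_gt0// invr_gt0.
pose phi n := projT1 (cid (He _ (ge2 n))).
have Hphi n := projT2 (cid (He _ (ge2 n))).
exists phi; split; first by move=> n; have [] := Hphi n.
have [Lu1 Lu2 Lu3] := H1per_L2 H1.
have ge0 (n : nat) : 0 <= n.+1%:R^-1 :> R by rewrite invr_ge0.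
have le1 (n : nat) : (n.+1%:R^-1 : R) ^+ 2 <= n.+1%:R^-1.
  by rewrite expr2 ler_piMl// invf_le1// ler1n.
have aDL (P : plane -> Prop) : {ae mu, forall p, D p -> P p} -> {ae mu, forall p, DL p -> P p}.
  by apply: filterS => p h [Dp _]; exact: h.
have nb n (f g h : plane -> R) : L2 mu DL f -> L2 mu DL g -> L2 mu DL h ->
    {ae mu, forall p, D p -> g p = h (xper L p)} ->
    ip mu DL (f \- h) (f \- h) < (n.+1%:R^-1) ^+ 2 -> (norm2 DL (f \- g)%R <= (n.+1%:R^-1 : R)%:E)%E.
  move=> Lf Lg Lh gh lt; apply: norm2_le => //; first exact: L2B.
  apply: le_trans (ltW lt); rewrite le_eqVlt; apply/orP; left; apply/eqP.
  have a : {ae mu, forall p, DL p -> (f \- g) p = (f \- h) p}.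
    apply: filterS gh => p gh [Dp sp] /=.
    by rewrite gh// xper_id.
  by apply: ae_ip => //; apply: L2B.
split.
- apply: cvge0_le => n; first exact: Lnorm_ge0.
  have [C P nn _ _] := Hphi n; have [s1 s2 s3] := L2_smooth L bl_C1 br_C1 bl_B br_B C.
  apply: (nb n _ _ _ s1 Lu1 L1); first by apply: aeW.
  apply: le_lt_trans nn; rewrite /nrm2 /=.
  by apply: ler_wpDr (ip_ge0 _ _ _) (ler_wpDr (ip_ge0 _ _ _) (lexx _)).
- apply: cvge0_le => n; first exact: Lnorm_ge0.
  have [C P nn _ _] := Hphi n; have [s1 s2 s3] := L2_smooth L bl_C1 br_C1 bl_B br_B C.
  apply: (nb n _ _ _ s2 Lu2 L2' ax).
  apply: le_lt_trans nn; rewrite /nrm2 /=.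
  by apply: ler_wpDr (ip_ge0 _ _ _) (ler_wpDl (ip_ge0 _ _ _) (lexx _)).
- apply: cvge0_le => n; first exact: Lnorm_ge0.
  have [C P nn _ _] := Hphi n; have [s1 s2 s3] := L2_smooth L bl_C1 br_C1 bl_B br_B C.
  apply: (nb n _ _ _ s3 Lu3 L3 ay).
  apply: le_lt_trans nn; rewrite /nrm2 /=.
  by apply: ler_wpDl (addr_ge0 (ip_ge0 _ _ _) (ip_ge0 _ _ _)) (lexx _).
- apply: cvge0_le => n; first exact: graph_norm_ge0.
  have [C P _ gg _] := Hphi n; apply: le_trans (ltW gg) _.
  by rewrite lee_fin.
- apply: cvge0_le => n; first exact: graph_norm_ge0.
  have [C P _ _ gg] := Hphi n; apply: le_trans (ltW gg) _.
  by rewrite lee_fin.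
Qed.

End Bridge.

(** * Weak formulations on the energy space; decoupling of the vector problem *)

Section WeakSolutions.
Context {R : realType}.
Local Notation plane := (R * R)%type.
Local Notation mplane := (measurableTypeR R * measurableTypeR R)%type.
Local Notation mu := (plane_measure R).
Variables (L : R) (bl br : R -> R) (B : R) (fl fr : R).
Hypothesis L_gt0 : 0 < L.
Hypotheses (bl_per : periodic bl L) (br_per : periodic br L).
Hypotheses (bl_C1 : C1_line bl) (br_C1 : C1_line br).
Hypotheses (bl_B : forall x, `|bl x| <= B) (br_B : forall x, `|br x| <= B).
Hypotheses (bl_fl : forall x, bl x < fl) (fl_fr : fl < fr) (fr_br : forall x, fr < br x).

Let D : set plane := channel bl br.
Let DL : set mplane := unit_region L D.
Let OmL : set mplane := unit_region L (band fl fr).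
Let Ex : set mplane := DL `\` OmL.
Local Notation space := (space L bl br).
Local Notation nrm2 := (nrm2 L bl br).
Local Notation form := (form L bl br fl fr).
Local Notation tri := (grad_triple bl br).

Let mDL : measurable DL := measurable_unit_channel L bl_C1 br_C1.
Let mOm : measurable OmL := measurable_unit_band L fl fr.
Let mEx : measurable Ex := measurable_unit_exterior L fl fr bl_C1 br_C1.
Let OmDL : OmL `<=` DL := unit_band_sub bl_fl fr_br.
Let ExDL : Ex `<=` DL. Proof. by move=> p []. Qed.

Let L2_Om (f : plane -> R) : L2 mu DL f -> L2 mu OmL f.
Proof. exact: L2S. Qed.
Let L2_Ex (f : plane -> R) : L2 mu DL f -> L2 mu Ex f.
Proof. exact: L2S. Qed.

Lemma L2_mulD (A : set mplane) (f g h k : plane -> R) : measurable A ->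
  L2 mu A f -> L2 mu A g -> L2 mu A h -> L2 mu A k ->
  mu.-integrable A (EFin \o (fun p => f p * g p + h p * k p)).
Proof.
by move=> mA Lf Lg Lh Lk; apply: (integrableD mA (L2_mul mA Lf Lg) (L2_mul mA Lh Lk)).
Qed.

Lemma Rintegral_mulD (A : set mplane) (f g h k : plane -> R) : measurable A ->
  L2 mu A f -> L2 mu A g -> L2 mu A h -> L2 mu A k ->
  \int[mu]_(p in A) (f p * g p + h p * k p) = ip mu A f g + ip mu A h k.
Proof.
by move=> mA Lf Lg Lh Lk; rewrite (RintegralD mA (L2_mul mA Lf Lg) (L2_mul mA Lh Lk)).
Qed.

Lemma unit_bandE : OmL = `[0, L[%classic `*` `]fl, fr[%classic.
Proof.
apply/seteqP; split => -[x y]; rewrite /OmL /unit_region /band /strip /= !in_itv /=.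
  by move=> [[-> ->] [-> ->]].
by move=> [/andP[-> ->] /andP[-> ->]].
Qed.

Lemma unit_band_measure : mu OmL = (L * (fr - fl))%:E.
Proof.
rewrite unit_bandE plane_measure_prod//; try exact: measurable_itv.
by rewrite !lebesgue_measure_itv/= !lte_fin L_gt0 fl_fr -!EFinB subr0 -EFinM.
Qed.

Lemma L2_cst (c : R) : L2 mu OmL (cst c).
Proof.
apply: L2P => //; rewrite (_ : (fun p => ((cst c p) ^+ 2)%:E) = cst (c ^+ 2)%:E)//.
by rewrite integral_cst// unit_band_measure -EFinM ltry.
Qed.

Lemma ip_cst (c : R) : ip mu OmL (cst c) (cst c) = c ^+ 2 * (L * (fr - fl)).
Proof.
apply: EFin_inj; have Lc := L2_cst c; rewrite ip_EFin//.
rewrite (_ : (fun p => (cst c p * cst c p)%:E) = cst (c ^+ 2)%:E)//.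
by rewrite integral_cst// unit_band_measure -EFinM.
Qed.

Lemma ip1 (f : plane -> R) : ip mu OmL f (cst 1) = \int[mu]_(p in OmL) f p.
Proof. by apply: eq_Rintegral => p _; rewrite mulr1. Qed.

Lemma ip_sub (A : set mplane) (f : plane -> R) : measurable A -> A `<=` DL ->
  L2 mu DL f -> ip mu A f f <= ip mu DL f f.
Proof.
move=> mA AD Lf; have LA := L2S mDL mA AD Lf; rewrite -lee_fin !ip_EFin//.
apply: ge0_subset_integral => //; last by move=> p _; rewrite lee_fin -expr2 sqr_ge0.
by apply/measurable_EFinP; apply: measurable_funM; case: Lf.
Qed.

Lemma ip_comp_le e : [/\ ip mu DL e.1.1 e.1.1 <= nrm2 e, ip mu DL e.1.2 e.1.2 <= nrm2 e &
  ip mu DL e.2 e.2 <= nrm2 e].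
Proof.
have := ip_ge0 mu DL e.1.1; have := ip_ge0 mu DL e.1.2; have := ip_ge0 mu DL e.2.
by rewrite /nrm2 -/D -/DL; split; lra.
Qed.

Definition load (e : @triple R) : R := \int[mu]_(p in OmL) e.2 p.

Lemma load_lin k e f : space e -> space f -> load (k *: e + f) = k * load e + load f.
Proof.
move=> [[_ _ e3] _] [[_ _ f3] _]; rewrite /load -!ip1.
exact: ip_linl mOm (L2_Om e3) (L2_Om f3) (L2_cst 1).
Qed.

Lemma load_bound e : space e -> load e ^+ 2 <= L * (fr - fl) * nrm2 e.
Proof.
move=> [[_ _ e3] _]; rewrite /load -ip1.
apply: le_trans (ip_cauchy_schwarz mOm (L2_Om e3) (L2_cst 1)) _.
rewrite ip_cst expr1n mul1r mulrC; apply: ler_wpM2l.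
  by rewrite mulr_ge0 ?subr_ge0 ?ltW.
by apply: le_trans (ip_sub mOm OmDL e3) _; have [_ _] := ip_comp_le e.
Qed.

Definition cross_load (e : @triple R) : R := \int[mu]_(p in OmL) e.1.2 p.

Lemma integral_band_dx e : space e -> cross_load e = 0.
Proof.
move=> Se; have [[_ e2 _] He] := Se; rewrite /cross_load -ip1.
have Le := L2_Om e2; have L1 := L2_cst 1.
apply/eqP; rewrite -sqrf_eq0 eq_le sqr_ge0 andbT.
have LT : 0 <= L * (fr - fl) by rewrite mulr_ge0 ?subr_ge0 ?ltW.
apply: (le0_eps LT) => eps eps0.
have [phi [C P n _ _]] := He _ eps0; have [s1 s2 s3] := L2_smooth L bl_C1 br_C1 bl_B br_B C.
have Lp := L2_Om s2.
have E0 : ip mu OmL ('D_e_x phi) (cst 1) = 0.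
  have C1 := C1_planeP C; have [_ _ cx _] := C1.
  rewrite ip1 /Rintegral unit_bandE.
  have mA : measurable (`[0, L[%classic : set (measurableTypeR R)) by exact: measurable_itv.
  have mB : measurable (`]fl, fr[%classic : set (measurableTypeR R)) by exact: measurable_itv.
  have I : mu.-integrable (`[0, L[ `*` `]fl, fr[ : set mplane) (EFin \o 'D_e_x phi).
    have I1 := L2_mul mOm Lp L1; rewrite unit_bandE in I1.
    by apply: eq_integrable I1 => //= [|p _]; [exact: measurable_box|rewrite /= mulr1].
  have [_ ->] := fubini_rect mA mB I.
  rewrite integral0_eq//= => y _.
  have Cy := C1_sliceX y C1; have [_ cy] := Cy.
  have P0 : phi (L, y) = phi (0, y) by rewrite -(P (0, y)); congr phi; congr (_, _); rewrite /= ?add0r ?addr0.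
  have F0 := FTC Cy (ltW L_gt0); rewrite P0 subrr in F0; rewrite -[RHS]F0.
  apply: integral_itv_bndo_bndc.
  by apply/measurable_EFinP; apply: measurable_funTS; exact: continuous_measurable_fun.
have M := L2B mOm Le Lp.
have -> : ip mu OmL e.1.2 (cst 1) = ip mu OmL (e.1.2 \- 'D_e_x phi) (cst 1).
  by rewrite ipBl// E0 subr0.
apply: le_trans (ip_cauchy_schwarz mOm M L1) _.
rewrite ip_cst expr1n mul1r mulrC; apply: ler_wpM2l => //.
have -> : ip mu OmL (e.1.2 \- 'D_e_x phi) (e.1.2 \- 'D_e_x phi) =
    ip mu OmL ('D_e_x phi \- e.1.2) ('D_e_x phi \- e.1.2).
  by apply: eq_Rintegral => p _ /=; rewrite -mulrNN !opprB.
apply: le_trans (ltW n).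
have [_ h _] := ip_comp_le (smooth_triple phi - e).
exact: le_trans (ip_sub mOm OmDL (L2B mDL s2 e2)) h.
Qed.

Definition triple_ae (e f : @triple R) := {ae mu, forall p, DL p ->
  [/\ e.1.1 p = f.1.1 p, e.1.2 p = f.1.2 p & e.2 p = f.2 p]}.

Lemma form_ae a e f f' : L2_triple L bl br e -> L2_triple L bl br f -> L2_triple L bl br f' ->
  triple_ae f f' -> form a e f = form a e f'.
Proof.
move=> [e1 e2 e3] [f1 f2 f3] [g1 g2 g3] fg; rewrite /form.
have a2 : {ae mu, forall p, DL p -> f.1.2 p = f'.1.2 p} by apply: filterS fg => p H /H[].
have a3 : {ae mu, forall p, DL p -> f.2 p = f'.2 p} by apply: filterS fg => p H /H[].
have a1 : {ae mu, forall p, Ex p -> f.1.1 p = f'.1.1 p} by apply: filterS fg => p H /ExDL /H[].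
have r (g : plane -> R) A : {ae mu, forall p, A p -> g p = g p} by apply: aeW.
rewrite (ae_ip mDL e2 e2 f2 g2 (r _ _) a2) (ae_ip mDL e3 e3 f3 g3 (r _ _) a3).
by rewrite (ae_ip mEx (L2_Ex e1) (L2_Ex e1) (L2_Ex f1) (L2_Ex g1) (r _ _) a1).
Qed.

Lemma load_ae f f' : L2_triple L bl br f -> L2_triple L bl br f' -> triple_ae f f' ->
  load f = load f'.
Proof.
move=> [f1 f2 f3] [g1 g2 g3] fg; rewrite /load -!ip1.
have a3 : {ae mu, forall p, OmL p -> f.2 p = f'.2 p} by apply: filterS fg => p H /OmDL /H[].
have r (g : plane -> R) A : {ae mu, forall p, A p -> g p = g p} by apply: aeW.
exact: (ae_ip mOm (L2_Om f3) (L2_Om g3) (L2_cst 1) (L2_cst 1) a3 (r _ _)).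
Qed.

Let H10S u : H10per L bl br u -> space (tri u) :=
  @H10per_space _ L bl br B bl_C1 br_C1 bl_B br_B u.

(* Every triple of the energy space comes from a test function: the periodic extension of its first component. *)
Lemma space_tri e : space e -> exists u, [/\ H10per L bl br u, u = e.1.1 \o xper L & triple_ae (tri u) e].
Proof.
move=> Se; have [Hu ax ay] := space_H10per L_gt0 bl_per br_per bl_C1 br_C1 bl_B br_B Se.
exists (e.1.1 \o xper L); split => //.
apply: filterS2 ax ay => p hx hy [Dp sp]; rewrite /grad_triple /=.
by rewrite hx// hy// xper_id.
Qed.

Lemma grad_dotE S u : H10per L bl br S -> H10per L bl br u ->
  \int[mu]_(p in DL) grad_dot bl br S u p =
  ip mu DL (tri S).1.2 (tri u).1.2 + ip mu DL (tri S).2 (tri u).2.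
Proof.
move=> /H10S[[S1 S2 S3] _] /H10S[[u1 u2 u3] _].
exact: Rintegral_mulD mDL S2 u2 S3 u3.
Qed.

Lemma scalar_solutionP a S : scalar_solution L bl br fl fr a S <->
  H10per L bl br S /\ forall f, space f -> form a (tri S) f = load f.
Proof.
split => -[HS eqS]; (split; first exact: HS).
  move=> f Sf; have [u [Hu _ uf]] := space_tri Sf.
  have [LS _] := H10S HS; have [Lu _] := H10S Hu; have [Lf _] := Sf.
  rewrite -(form_ae _ LS Lu Lf uf) -(load_ae Lu Lf uf).
  by have := eqS u Hu; rewrite (grad_dotE HS Hu).
by move=> u Hu; rewrite (grad_dotE HS Hu); exact: eqS _ (H10S Hu).
Qed.

(** The Frobenius product pairs equal components and [cross_load] drops out, so the two components
    of the test field act independently. This justifies quantifying over unrelated triples [f] and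
    [g]. *)
Lemma vector_solutionP a s : vector_solution L bl br fl fr a s <->
  H10per_vec L bl br s /\ forall f g, space f -> space g ->
    form a (tri (fst \o s)) f + form a (tri (snd \o s)) g = load g.
Proof.
have key (u : plane -> plane) : H10per_vec L bl br s -> H10per_vec L bl br u ->
    a * (\int[mu]_(p in DL) grad_frobenius bl br s u p) +
    \int[mu]_(p in Ex) ((s p).1 * (u p).1 + (s p).2 * (u p).2) =
    form a (tri (fst \o s)) (tri (fst \o u)) + form a (tri (snd \o s)) (tri (snd \o u)) /\
    \int[mu]_(p in OmL) divergence bl br u p = load (tri (snd \o u)).
  move=> [Hs1 Hs2] [Hu1 Hu2].
  have [[s1 s2 s3] _] := H10S Hs1; have [[t1 t2 t3] _] := H10S Hs2.
  have Su1 := H10S Hu1.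
  have [[u1 u2 u3] _] := Su1; have [[v1 v2 v3] _] := H10S Hu2.
  split.
    rewrite /grad_frobenius (RintegralD mDL (L2_mulD mDL s2 u2 s3 u3) (L2_mulD mDL t2 v2 t3 v3)).
    rewrite !grad_dotE//.
    rewrite (Rintegral_mulD mEx (L2_Ex s1) (L2_Ex u1) (L2_Ex t1) (L2_Ex v1)).
    by rewrite /form [in LHS]mulrDr addrACA.
  have I1 (f : plane -> R) : L2 mu OmL f -> mu.-integrable OmL (EFin \o f).
    move=> Lf; apply: eq_integrable (L2_mul mOm Lf (L2_cst 1)) => //= p _.
    by rewrite /= mulr1.
  apply: (@etrans _ _ (cross_load (tri (fst \o u)) + load (tri (snd \o u)))).
    exact: (RintegralD mOm (I1 _ (L2_Om u2)) (I1 _ (L2_Om v3))).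
  by rewrite (integral_band_dx Su1) add0r.
split => -[Hs eqs]; (split; first exact: Hs).
  move=> f g Sf Sg; have [u [Hu _ uf]] := space_tri Sf; have [v [Hv _ vg]] := space_tri Sg.
  have [Ls1 _] := H10S Hs.1; have [Ls2 _] := H10S Hs.2.
  have [Lu _] := H10S Hu; have [Lv _] := H10S Hv; have [Lf _] := Sf; have [Lg _] := Sg.
  rewrite -(form_ae _ Ls1 Lu Lf uf) -(form_ae _ Ls2 Lv Lg vg) -(load_ae Lv Lg vg).
  have Hw : H10per_vec L bl br (fun p => (u p, v p)) by split; [exact: Hu|exact: Hv].
  have [E1 E2] := key _ Hs Hw.
  exact: etrans (esym E1) (etrans (eqs _ Hw) E2).
move=> u Hu; have [E1 E2] := key _ Hs Hu; apply: etrans E1 (etrans _ (esym E2)).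
by case: Hu => Hu1 Hu2; exact: eqs (H10S Hu1) (H10S Hu2).
Qed.

Lemma space_ae e f : space e -> space f -> nrm2 (e - f) = 0 -> triple_ae e f.
Proof.
move=> Se Sf E; have Sd := spaceB bl_C1 br_C1 bl_B br_B Se Sf.
have := nrm2_eq0_ae bl_C1 br_C1 Sd E; apply: filterS => p H /H[h1 h2 h3].
by split; apply/eqP; rewrite -subr_eq0; apply/eqP.
Qed.

(** The energy sees one period, whereas uniqueness is claimed on the whole channel; almost
    periodicity of both functions transports the equality. *)
Lemma H10per_ae u v : H10per L bl br u -> H10per L bl br v ->
  {ae mu, forall p, DL p -> u p = v p} -> {ae mu, forall p, D p -> u p = v p}.
Proof.
move=> [[pu _ _ _] _] [[pv _ _ _] _] uv.
have D_per := channel_per bl_per br_per.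
have /= := @ae_xper _ L L_gt0 D D_per (fun p => u p = v p) uv.
have := ae_periodic D_per pu; have := ae_periodic D_per pv.
move=> v1 u1 uv'; apply: filterS3 v1 u1 uv' => p hv hu huv Dp.
by rewrite -hu// -hv// huv.
Qed.

Lemma scalar_exists a : 0 < a -> exists S, scalar_solution L bl br fl fr a S.
Proof.
move=> a0; have LT : 0 <= L * (fr - fl) by rewrite mulr_ge0 ?subr_ge0 ?ltW.
have [e Se eqe] := weak_problem_exists bl_C1 br_C1 bl_B br_B bl_fl fl_fr fr_br a0 LT load_lin load_bound.
have [u [Hu _ ue]] := space_tri Se; exists u; apply/scalar_solutionP; split => // f Sf.
have [Lu _] := H10S Hu; have [Le _] := Se; have [Lf _] := Sf.
by rewrite formC (form_ae _ Lf Lu Le ue) formC eqe.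
Qed.

Lemma form_unique (a : R) e f : 0 < a -> space e -> space f ->
  (forall g, space g -> form a e g = form a f g) -> triple_ae e f.
Proof.
move=> a0 Se Sf E; have := @weak_problem_unique _ L bl br B fl fr bl_C1 br_C1 bl_B br_B bl_fl fl_fr
  fr_br a e f a0 Se Sf E.
exact: space_ae.
Qed.

Lemma scalar_unique a S S' : 0 < a -> scalar_solution L bl br fl fr a S ->
  scalar_solution L bl br fl fr a S' -> triple_ae (tri S) (tri S').
Proof.
move=> a0 /scalar_solutionP[HS eqS] /scalar_solutionP[HS' eqS'].
apply: (form_unique a0 (H10S HS) (H10S HS')) => g Sg.
by rewrite eqS// eqS'.
Qed.

Lemma vector_components a s : 0 < a -> vector_solution L bl br fl fr a s ->
  triple_ae (tri (fst \o s)) 0 /\ scalar_solution L bl br fl fr a (snd \o s).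
Proof.
move=> a0 /vector_solutionP[[H1 H2] eqs]; have S0 := space0 L bl_C1 br_C1.
have S1 := H10S H1; have S2 := H10S H2.
have f0 e : space e -> form a e 0 = 0.
  move=> Se; have := formL fl fr bl_C1 br_C1 a (-1) S0 S0 Se; rewrite scaler0 addr0.
  by rewrite ![form a 0 e]formC mulN1r addNr.
have l0 : load 0 = 0 by rewrite /load /Rintegral integral0_eq.
split.
  apply: (form_unique a0 S1 S0) => g Sg; have := eqs g 0 Sg S0.
  by rewrite (f0 _ S2) addr0 l0 => ->; rewrite formC (f0 _ Sg).
apply/scalar_solutionP; split => // g Sg; have := eqs 0 g S0 Sg.
by rewrite (f0 _ S1) add0r.
Qed.

Lemma vector_of_scalar a S : scalar_solution L bl br fl fr a S ->
  vector_solution L bl br fl fr a (fun p => (0, S p)).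
Proof.
move=> /scalar_solutionP[HS eqS]; have S0 := space0 L bl_C1 br_C1.
(* Membership of the zero function in [H10per] is obtained from the zero triple, whose periodic
   extension is literally zero; its selected weak derivatives vanish only almost everywhere, hence
   [z0]. *)
have [z [Hz zE z0]] := space_tri S0.
have Ez : fst \o (fun p : plane => (0 : R, S p)) = z by rewrite zE.
have Hs : H10per_vec L bl br (fun p => (0, S p)) by split; [rewrite Ez; exact: Hz|exact: HS].
apply/vector_solutionP; split; first exact: Hs.
move=> f g Sf Sg; rewrite Ez; have [Lz _] := H10S Hz; have [Lf _] := Sf; have [L0 _] := S0.
rewrite formC (form_ae _ Lf Lz L0 z0).
have -> : form a f 0 = 0.
  have := formL fl fr bl_C1 br_C1 a (-1) S0 S0 Sf; rewrite scaler0 addr0.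
  by rewrite ![form a 0 f]formC mulN1r addNr.
by rewrite add0r; exact: eqS.
Qed.

End WeakSolutions.

(** * One-dimensional Sobolev functions of the transversal variable *)

Section TransversalSobolev.
Context {R : realType}.
Local Notation plane := (R * R)%type.
Local Notation mline := (measurableTypeR R).
Local Notation mplane := (measurableTypeR R * measurableTypeR R)%type.
Local Notation mu := (plane_measure R).
Variables (L : R) (bl br : R -> R) (B : R).
Hypotheses (bl_C1 : C1_line bl) (br_C1 : C1_line br).
Hypotheses (bl_B : forall x, `|bl x| <= B) (br_B : forall x, `|br x| <= B).

Let DL : set mplane := unit_region L (channel bl br).
Let mDL : measurable DL := measurable_unit_channel L bl_C1 br_C1.
Local Notation space := (space L bl br).
Local Notation nrm2 := (nrm2 L bl br).

Let B0 : 0 <= B := le_trans (normr_ge0 _) (bl_B 0).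

Let DL_B p : DL p -> `|p.2| <= B.
Proof.
move=> /(unit_channel_box bl_B br_B)[_]; rewrite /= in_itv /= => /andP[h1 h2].
by rewrite ler_norml h1.
Qed.

(* One-dimensional H^1, by approximation with C^1 functions: the piecewise C^1 comparison profile below
   must be a member. *)
Definition H1_line (F dF : R -> R) := [/\ continuous F, measurable_fun [set: mline] dF,
  exists M : R, forall y, `|y| <= B -> `|F y| <= M /\ `|dF y| <= M &
  forall eps : R, 0 < eps -> exists G dG, [/\ C1_fun G dG,
    forall y, `|y| <= B -> `|G y - F y| <= eps &
    ip mu DL (fun p => dG p.2 - dF p.2) (fun p => dG p.2 - dF p.2) <= eps]].

Lemma measurable_snd_comp (f : R -> R) : measurable_fun [set: mline] f ->
  measurable_fun (DL : set mplane) (fun p : plane => f p.2).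
Proof. by move=> mf; apply: measurable_funTS; apply: measurableT_comp mf _; exact: measurable_snd. Qed.

Lemma measurable_line (f : R -> R) : continuous f -> measurable_fun [set: mline] f.
Proof. by move=> cf; exact: continuous_measurable_fun. Qed.

Lemma bounded_L2 (f : plane -> R) (M : R) : measurable_fun (DL : set mplane) f ->
  (forall p, DL p -> `|f p| <= M) -> L2 mu DL f.
Proof.
move=> mf fM; have L1 : L2 mu DL (fun=> 1) by apply: (L2_continuous L bl_C1 br_C1 bl_B br_B) => p;
  exact: cvg_cst.
have -> : f = (fun p => f p * 1) by apply/funext => p; rewrite mulr1.
exact: (L2M mDL L1 mf fM).
Qed.

Lemma C1_fun_bounded G dG : C1_fun G dG -> exists M : R, forall y, `|y| <= B -> `|G y| <= M /\ `|dG y| <= M.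
Proof.
move=> C; have cG := C1_fun_continuous C; have [_ cd] := C.
have bd (f : R -> R) : continuous f -> exists M : R, forall y, `|y| <= B -> `|f y| <= M.
  move=> cf; have [|M M0 HM] := @continuous_compact_bounded _ (fun p : plane => f p.2) _ _ (@compact_box
    _ 0 0 (- B) B).
    by move=> p; apply: (@continuous_comp _ _ _ snd f); [exact: cvg_snd|exact: cf].
  exists M => y yB; apply: (HM (0, y)); split; rewrite /= in_itv /= ?lexx//.
  by rewrite -ler_norml.
have [M1 H1] := bd _ cG; have [M2 H2] := bd _ cd.
exists (Num.max M1 M2) => y yB; rewrite !le_max H1// H2// orbT; by [].
Qed.

Lemma C1_L2 G dG : C1_fun G dG -> L2 mu DL (fun p => dG p.2).
Proof.
move=> C; have [M HM] := C1_fun_bounded C; have [_ cd] := C.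
apply: (@bounded_L2 _ M); first by apply: measurable_snd_comp; exact: measurable_line.
by move=> p /DL_B /HM[].
Qed.

Lemma H1_line_L2 F dF : H1_line F dF -> L2 mu DL (fun p => F p.2) /\ L2 mu DL (fun p => dF p.2).
Proof.
move=> [cF md [M HM] _]; split; apply: (@bounded_L2 _ M).
- by apply: measurable_snd_comp; exact: measurable_line.
- by move=> p /DL_B /HM[].
- exact: measurable_snd_comp.
- by move=> p /DL_B /HM[].
Qed.

Lemma H1_line_C1 F dF : C1_fun F dF -> H1_line F dF.
Proof.
move=> C; have cF := C1_fun_continuous C; have [_ cd] := C.
split; [exact: cF|exact: measurable_line|exact: C1_fun_bounded C|].
move=> eps e0; exists F, dF; split => //; first by move=> y _; rewrite subrr normr0 ltW.
have -> : (fun p : plane => dF p.2 - dF p.2) = (fun=> 0) by apply/funext => p; rewrite subrr.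
by rewrite /ip /Rintegral integral0_eq ?ltW// => p _; rewrite mulr0.
Qed.

Lemma H1_line_lin a b F dF G dG : H1_line F dF -> H1_line G dG ->
  H1_line (fun y => a * F y + b * G y) (fun y => a * dF y + b * dG y).
Proof.
move=> gF gG; have [_ LF] := H1_line_L2 gF; have [_ LG] := H1_line_L2 gG.
move: gF gG => [cF mF [M HM] aF] [cG mG [N HN] aG]; split.
- by move=> y; apply: cvgD; apply: cvgM; try exact: cvg_cst; [exact: cF|exact: cG].
- by apply: measurable_funD; apply: measurable_funM.
- exists (`|a| * M + `|b| * N) => y yB; have [h1 h2] := HM y yB; have [h3 h4] := HN y yB.
  by split; apply: le_trans (ler_normD _ _) _; apply: lerD; rewrite normrM ler_wpM2l.
move=> eps e0; set K := `|a| + `|b| + 2 * a ^+ 2 + 2 * b ^+ 2 + 1.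
have := normr_ge0 a; have := normr_ge0 b; have := sqr_ge0 a; have := sqr_ge0 b => b2 a2 b1 a1.
have K0 : 0 < K by rewrite /K; lra.
have d0 : 0 < eps / K by rewrite divr_gt0.
have Ke : eps = K * (eps / K) by rewrite mulrC divfK// gt_eqF.
have [F1 [dF1 [CF nF iF]]] := aF _ d0; have [G1 [dG1 [CG nG iG]]] := aG _ d0.
exists (fun y => a * F1 y + b * G1 y), (fun y => a * dF1 y + b * dG1 y); split.
- exact: C1_fun_lin.
- move=> y yB; have -> : a * F1 y + b * G1 y - (a * F y + b * G y) = a * (F1 y - F y) + b * (G1 y - G y)
  by ring.
  apply: le_trans (ler_normD _ _) _; rewrite !normrM.
  have h1 := ler_wpM2l a1 (nF y yB); have h2 := ler_wpM2l b1 (nG y yB).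
  by rewrite Ke /K; apply: le_trans (lerD h1 h2) _; nra.
have L1 := L2B mDL (C1_L2 CF) LF; have L2' := L2B mDL (C1_L2 CG) LG.
have -> : (fun p : plane => a * dF1 p.2 + b * dG1 p.2 - (a * dF p.2 + b * dG p.2)) =
   (fun p => a * (dF1 p.2 - dF p.2) + b * (dG1 p.2 - dG p.2)) by apply/funext => p; ring.
apply: le_trans (ip_lin_le a mDL L1 (L2Z b mDL L2')) _.
rewrite ipZl ?ipZr//; last exact: L2Z.
by rewrite Ke /K; move: iF iG; rewrite -/DL; nra.
Qed.

Lemma H1_line_exp F dF : H1_line F dF -> H1_line (fun y => expR (F y)) (fun y => dF y * expR (F y)).
Proof.
move=> gF; have [_ LF] := H1_line_L2 gF; move: gF => [cF mF [M HM] aF].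
have M0 : 0 <= M by have [h _] := HM 0 ltac:(by rewrite normr0); exact: le_trans (normr_ge0 _) h.
have mE : measurable_fun [set: mline] (fun y => expR (F y)).
  by apply: measurable_line => y; apply: continuous_comp; [exact: cF|exact: continuous_expR].
split.
- by move=> y; apply: continuous_comp; [exact: cF|exact: continuous_expR].
- by apply: measurable_funM => //.
- exists ((1 + M) * expR M) => y yB; have [h1 h2] := HM y yB.
  have e1 : expR (F y) <= expR M by rewrite ler_expR; apply: le_trans (ler_norm _) h1.
  rewrite normrM !(ger0_norm (expR_ge0 _)); split; last by apply: ler_pM; rewrite ?expR_ge0//; lra.
  by apply: le_trans e1 _; rewrite ler_peMl ?expR_ge0//; lra.
(* The approximant [G] will be within distance 1 of [F], so [E] bounds both exponentials and is a
   Lipschitz constant for [expR] on the range of both. *)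
move=> eps e0; set E := expR (M + 1); have E1 : 1 <= E by have := expR_ge1Dx (M + 1); rewrite /E; lra.
set N := ip mu DL (fun p => dF p.2) (fun p => dF p.2); have N0 : 0 <= N by exact: ip_ge0.
(* The uniform error costs [E * d]. The derivative error is a sum of two parts, [expR G] times the
   error of [dG] and the error of [expR G] times [dF], which together cost
   [2 * E ^+ 2 * (1 + N) * d]. *)
set K := 2 * E ^+ 2 * (1 + N) + E + 1.
have E20 := sqr_ge0 E.
have EN : 0 <= E ^+ 2 * N by exact: mulr_ge0.
have K0 : 0 < K by rewrite /K; lra.
have d0 : 0 < Num.min 1 (eps / K) by rewrite lt_min ltr01 divr_gt0.
have [G [dG [CG nG iG]]] := aF _ d0; set d := Num.min 1 (eps / K) in d0 nG iG.
have d1 : d <= 1 by rewrite ge_min lexx.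
have dK : K * d <= eps.
  have h : d <= eps / K by rewrite ge_min lexx orbT.
  by rewrite -(ler_pdivlMl _ _ K0) mulrC.
have lip x y : `|x| <= M + 1 -> `|y| <= M + 1 -> `|expR x - expR y| <= E * `|x - y|.
  have aux (u v : R) : u <= v -> `|v| <= M + 1 -> `|expR v - expR u| <= E * `|v - u|.
    move=> uv vM; rewrite !ger0_norm ?subr_ge0 ?ler_expR//.
    have -> : expR v - expR u = expR v * (1 - expR (u - v)).
      by rewrite mulrBr mulr1 -expRD [v + _]addrC subrK.
    have h1 := expR_ge1Dx (u - v).
    apply: (@le_trans _ _ (expR v * (v - u))).
      by rewrite ler_wpM2l ?expR_ge0//; lra.
    rewrite ler_wpM2r ?subr_ge0// ler_expR; apply: le_trans (ler_norm _) vM.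
  move=> xM yM; case: (leP x y) => [|/ltW] xy; last exact: aux.
  by rewrite distrC [`|x - y|]distrC; exact: aux.
have GM y : `|y| <= B -> `|G y| <= M + 1 /\ `|F y| <= M + 1.
  move=> yB; have [h1 _] := HM y yB; have h2 := nG y yB; split; last lra.
  have -> : G y = F y + (G y - F y) by ring.
  by apply: le_trans (ler_normD _ _) _; apply: lerD h1 (le_trans h2 d1).
have CE := C1_fun_comp C1_fun_exp CG.
have CE' : C1_fun (fun y => expR (G y)) (fun y => dG y * expR (G y)).
  by apply: C1_fun_eq CE _ => y; rewrite mulrC.
exists (fun y => expR (G y)), (fun y => dG y * expR (G y)); split => //.
- move=> y yB; have [h1 h2] := GM y yB; apply: le_trans (lip _ _ h1 h2) _.
  apply: le_trans (ler_wpM2l (le_trans ler01 E1) (nG y yB)) _.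
  by apply: le_trans dK; rewrite ler_wpM2r ?(ltW d0)// /K; nra.
have L1 := L2B mDL (C1_L2 CG) LF.
have mG : measurable_fun [set: mline] (fun y => expR (G y)).
  by apply: measurable_line; exact: C1_fun_continuous CE.
have LA : L2 mu DL (fun p => expR (G p.2) * (dG p.2 - dF p.2)).
  apply: (@L2M _ _ _ _ _ _ _ E mDL L1); first exact: (measurable_snd_comp mG).
  move=> p /DL_B /GM[h _]; rewrite ger0_norm ?expR_ge0// ler_expR.
  by apply: le_trans (ler_norm _) h.
have bB p : DL p -> `|expR (G p.2) - expR (F p.2)| <= E * d.
  move=> /DL_B yB; have [h1 h2] := GM _ yB; apply: le_trans (lip _ _ h1 h2) _.
  by rewrite ler_wpM2l ?nG//; lra.
have LB : L2 mu DL (fun p => (expR (G p.2) - expR (F p.2)) * dF p.2).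
  apply: (@L2M _ _ _ _ _ _ _ (E * d) mDL LF) => //.
  exact: (measurable_funB (measurable_snd_comp mG) (measurable_snd_comp mE)).
have -> : (fun p : plane => dG p.2 * expR (G p.2) - dF p.2 * expR (F p.2)) =
    (fun p => expR (G p.2) * (dG p.2 - dF p.2) + (expR (G p.2) - expR (F p.2)) * dF p.2).
  by apply/funext => p; ring.
apply: le_trans (ip_add_le mDL LA LB) _.
have iA : ip mu DL (fun p => expR (G p.2) * (dG p.2 - dF p.2)) (fun p => expR (G p.2) * (dG p.2 - dF p.2)) <=
    E ^+ 2 * d.
  apply: (@le_trans _ _ (E ^+ 2 * ip mu DL (fun p => dG p.2 - dF p.2) (fun p => dG p.2 - dF p.2)));
    last first.
    by rewrite ler_wpM2l.
  have -> : E ^+ 2 * ip mu DL (fun p => dG p.2 - dF p.2) (fun p => dG p.2 - dF p.2) =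
     ip mu DL (E \*o (fun p => dG p.2 - dF p.2)) (E \*o (fun p => dG p.2 - dF p.2)).
    by rewrite ipZl ?ipZr ?expr2 ?mulrA//; exact: L2Z.
  apply: ip_le => //; first exact: L2Z.
  move=> p /DL_B /GM[h _]; rewrite /= !exprMn ler_wpM2r ?sqr_ge0//.
  rewrite ler_sqr ?nnegrE ?expR_ge0//.
  by rewrite ler_expR; apply: le_trans (ler_norm _) h.
have iB : ip mu DL (fun p => (expR (G p.2) - expR (F p.2)) * dF p.2)
     (fun p => (expR (G p.2) - expR (F p.2)) * dF p.2) <= E ^+ 2 * d * N.
  apply: (@le_trans _ _ ((E * d) ^+ 2 * N)).
    have -> : (E * d) ^+ 2 * N = ip mu DL ((E * d) \*o (fun p => dF p.2)) ((E * d) \*o (fun p => dF p.2)).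
      by rewrite ipZl ?ipZr ?expr2 ?mulrA//; exact: L2Z.
    apply: ip_le => //; first exact: L2Z.
    move=> p Dp; rewrite /= !exprMn ler_wpM2r ?sqr_ge0// -exprMn -real_normK ?num_real//.
    by rewrite ler_sqr ?nnegrE ?bB// mulr_ge0//; lra.
  rewrite exprMn; apply: ler_wpM2r => //; apply: ler_wpM2l => //.
  by rewrite expr2 ler_piMl// ltW.
apply: le_trans dK; rewrite /K; nra.
Qed.

End TransversalSobolev.

(** * Positive parts as Sobolev functions *)

Section Profiles.
Context {R : realType}.
Local Notation plane := (R * R)%type.
Local Notation mline := (measurableTypeR R).
Local Notation mplane := (measurableTypeR R * measurableTypeR R)%type.
Local Notation mu := (plane_measure R).
Variables (L : R) (bl br : R -> R) (B : R).
Hypothesis L_gt0 : 0 < L.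
Hypotheses (bl_C1 : C1_line bl) (br_C1 : C1_line br).
Hypotheses (bl_B : forall x, `|bl x| <= B) (br_B : forall x, `|br x| <= B).

Let DL : set mplane := unit_region L (channel bl br).
Let mDL : measurable DL := measurable_unit_channel L bl_C1 br_C1.
Local Notation space := (space L bl br).
Local Notation nrm2 := (nrm2 L bl br).
Local Notation H1_line := (H1_line L bl br B).

Let B0 : 0 <= B := le_trans (normr_ge0 _) (bl_B 0).

Definition pos_from (c y : R) : R := Num.max (y - c) 0.
(** Left-continuous: the value at the jump is 0. This decides on which side of each edge the
    explicit formulas for the profiles remain valid. *)
Definition step (c y : R) : R := if c < y then 1 else 0.

Lemma C1_fun_translate (c : R) : C1_fun (fun y => y - c) (cst 1).
Proof.
have := C1_fun_lin 1 (- c) (@C1_fun_id R) (C1_fun_cst 1).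
have -> : (fun x : R => 1 * id x + - c * cst 1 x) = (fun y => y - c).
  by apply/funext => y /=; rewrite mul1r mulr1.
by move=> h; apply: C1_fun_eq h _ => y /=; rewrite mulr1 mulr0 addr0.
Qed.

Lemma C1_fun_pos_sqr (c : R) : C1_fun (fun y => pos_from c y ^+ 2) (fun y => 2 * pos_from c y).
Proof.
have C : C1_fun (fun t : R => t ^+ 2) (fun t => 2 * t).
  by apply: C1_fun_eq (C1_funM (@C1_fun_id R) (@C1_fun_id R)) _ => t /=;
    rewrite mul1r mulr1 mulr2n mulrDl !mul1r.
have z1 : (0 : R) ^+ 2 = 0 by rewrite expr0n.
have z2 : (2 : R) * 0 = 0 by rewrite mulr0.
have P := C1_fun_pos C z1 z2.
by apply: C1_fun_eq (C1_fun_comp P (C1_fun_translate c)) _ => y /=; rewrite mulr1.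
Qed.

Lemma measurable_step (c : R) : measurable_fun [set: mline] (step c).
Proof. by apply: measurable_fun_if => //; exact: measurable_fun_ltr. Qed.

(** The kink is smoothed by [(pos_from c y ^+ 2 - pos_from (c + d) y ^+ 2) / (2 * d)], whose
    derivative is a ramp from 0 to 1. It differs from [step c] only between [c] and [c + d] and by
    at most 1, so the squared error is at most [L * d]. *)
Lemma H1_line_pos (c : R) : H1_line (pos_from c) (step c).
Proof.
split.
- move=> y; apply: (@continuous_comp _ _ _ (fun y => y - c) (fun t => Num.max t 0));
  last exact: continuous_max0.
  exact: C1_fun_continuous (C1_fun_translate c) y.
- exact: measurable_step.
- exists (B + `|c| + 1) => y yB; have := normr_ge0 c; have c1 := ler_normD y (- c).
  rewrite normrN in c1; move=> c0; have n1 := ler_norm (y - c); split; last first.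
    by rewrite /step; case: ifP => _; rewrite ?normr1 ?normr0; have := B0; lra.
  rewrite ger0_norm /pos_from ?le_max ?lexx ?orbT// ge_max; apply/andP; split; have := B0; lra.
move=> eps e0; set d := eps / (L + 1).
have L1 : 0 < L + 1 by rewrite ltr_wpDr// ltW.
have d0 : 0 < d by rewrite divr_gt0.
have Ed : eps = (L + 1) * d by rewrite /d mulrC divfK// gt_eqF.
have C := C1_fun_lin (2 * d)^-1 (- (2 * d)^-1) (C1_fun_pos_sqr c) (C1_fun_pos_sqr (c + d)).
pose G y := (2 * d)^-1 * pos_from c y ^+ 2 + - (2 * d)^-1 * pos_from (c + d) y ^+ 2.
pose dG y := (2 * d)^-1 * (2 * pos_from c y) + - (2 * d)^-1 * (2 * pos_from (c + d) y).
have posE (b y : R) : pos_from b y = if b < y then y - b else 0.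
  rewrite /pos_from; case: ltP => h; first by rewrite max_l// subr_ge0 ltW.
  by rewrite max_r// subr_le0.
have d2 : 2 * d != 0 by rewrite mulf_neq0// gt_eqF.
have dn : d != 0 by rewrite gt_eqF.
have dGE y : dG y - step c y = if c < y < c + d then (y - c) / d - 1 else 0.
  rewrite /dG !posE /step; case: (ltP c y) => h1 /=; last first.
    have -> : (c + d < y) = false by apply/negbTE; rewrite -leNgt; have := d0; lra.
    by rewrite !mulr0; ring.
  case: (ltP y (c + d)) => h2.
    have -> : (c + d < y) = false by apply/negbTE; rewrite -leNgt ltW.
    by field.
  case: (ltP (c + d) y) => h3; first by field.
  have -> : y = c + d by apply/eqP; rewrite eq_le h2 h3.
  by field.
have dG1 y : (dG y - step c y) ^+ 2 <= 1 /\ (~ (c < y < c + d) -> dG y - step c y = 0).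
  rewrite dGE; case: ifP => [/andP[h1 h2]|h]; last first.
    by rewrite expr0n.
  split; last by move=> /(_ isT).
  have t0 : 0 < (y - c) / d by rewrite divr_gt0// subr_gt0.
  have t1 : (y - c) / d < 1 by rewrite ltr_pdivrMr// mul1r ltrBlDl.
  move: t0 t1; set t := _ / d; nra.
have CG : C1_fun G dG by exact: C.
exists G, dG; split; first exact: CG.
- move=> y _; apply: (@le_trans _ _ d); last by rewrite Ed; have := L_gt0; nra.
  rewrite /G !posE; case: (ltP c y) => h1.
    case: (ltP (c + d) y) => h2.
      have -> : (2 * d)^-1 * (y - c) ^+ 2 + - (2 * d)^-1 * (y - (c + d)) ^+ 2 - (y - c) = - (d / 2) by field.
      by rewrite normrN ger0_norm; have := d0; lra.
    have -> : (2 * d)^-1 * (y - c) ^+ 2 + - (2 * d)^-1 * 0 ^+ 2 - (y - c) = (y - c) * ((y - c) / d / 2 -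
      1) by field.
    have t0 : 0 < (y - c) / d by rewrite divr_gt0// subr_gt0.
    have t1 : (y - c) / d <= 1 by rewrite ler_pdivrMr// mul1r lerBlDl.
    rewrite normrM ger0_norm; last by rewrite subr_ge0 ltW.
    rewrite ler0_norm; last lra.
    have u1 : y - c <= d by rewrite lerBlDl.
    have u0 : 0 < y - c by rewrite subr_gt0.
    apply: (@le_trans _ _ ((y - c) * 1)); last by rewrite mulr1.
    by rewrite ler_wpM2l ?ltW//; lra.
  have -> : (c + d < y) = false by apply/negbTE; rewrite -leNgt; have := d0; lra.
  by rewrite expr0n !mulr0 addr0 subr0 normr0 ltW.
have mS := measurable_step c.
have md : measurable_fun (DL : set mplane) (fun p : plane => dG p.2 - step c p.2).
  apply: (measurable_snd_comp (f := fun y => dG y - step c y)).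
  by apply: measurable_funB => //; apply: measurable_line; case: CG.
have Ld : L2 mu DL (fun p => dG p.2 - step c p.2).
  apply: (bounded_L2 bl_C1 br_C1 bl_B br_B (M := 1) md) => p _.
  by have [h _] := dG1 p.2; rewrite -ler_sqr ?nnegrE// expr1n real_normK ?num_real.
rewrite -lee_fin ip_EFin//.
pose bx : set mplane := `[0, L] `*` `[c, c + d].
have mbx : measurable bx by exact: measurable_box.
rewrite (@integral_vanish _ DL (DL `&` bx)); first last.
- move=> p Dp np; rewrite (dG1 p.2).2 ?mul0r// => /andP[h1 h2]; apply: np; split => //.
  have [p1 _] := unit_channel_box bl_B br_B Dp; split => //.
  by rewrite /= in_itv /= !ltW.
- by move=> p [].
have mI : measurable (DL `&` bx) by exact: measurableI.
apply: (@le_trans _ _ (\int[mu]_(p in DL `&` bx) (cst 1%:E) p)%E).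
  apply: ge0_le_integral => //.
  - by move=> p _; rewrite lee_fin -expr2 sqr_ge0.
  - apply/measurable_EFinP; apply: measurable_funS (measurable_funM md md) => // p [] //.
  - by move=> p _; rewrite lee_fin -expr2; have [] := dG1 p.2.
rewrite integral_cst// mul1e; apply: (@le_trans _ _ (mu bx)).
  by apply: le_measure; rewrite ?inE// => p [].
rewrite /bx plane_measure_prod; try exact: measurable_itv.
rewrite !lebesgue_measure_itv/= !lte_fin L_gt0 ltrDl d0 -!EFinB -EFinM lee_fin subr0.
by rewrite [c + d]addrC addrK Ed ler_wpM2r ?(ltW d0)// lerDl.
Qed.

End Profiles.

(** The error budget of [multiply_space]. The left-hand side adds up to 12 copies of [K * eta], 8 of
    [d ^+ 2 * N] and 4 of [P * d]; the factors 20 leave room. *)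
Lemma multiply_estimate (R : realFieldType) (K eta d N P eps : R) : 0 < eta ->
  (20 * K + 1) * eta = eps -> 0 <= d -> d <= 1 -> 0 <= N -> 0 <= P ->
  (20 * N + 20 * P + 1) * d <= eps / 10 ->
  2 * (K * eta) + 2 * (d ^+ 2 * N) + (2 * (K * eta) + 2 * (d ^+ 2 * N)) +
  (2 * (2 * (K * eta) + 2 * (d ^+ 2 * N)) + 2 * (2 * (K * eta) + 2 * (P * d))) < eps.
Proof.
move=> eta0 Ke d0 d1 N0 P0 dQ.
have d2 : d ^+ 2 * N <= d * N by rewrite ler_wpM2r// expr2 ler_piMl.
have Pd : 0 <= P * d by exact: mulr_ge0.
have Nd : 0 <= d * N by exact: mulr_ge0.
have Ke' : 20 * (K * eta) + eta = eps by rewrite -Ke; ring.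
have dQ' : 20 * (d * N) + 20 * (P * d) + d <= eps / 10 by apply: le_trans dQ; lra.
move: (K * eta) (d ^+ 2 * N) (d * N) (P * d) d2 Pd Nd Ke' dQ' => u v w x; lra.
Qed.

(** * Products with functions of the transversal variable *)

Section Multipliers.
Context {R : realType}.
Local Notation plane := (R * R)%type.
Local Notation mplane := (measurableTypeR R * measurableTypeR R)%type.
Local Notation mu := (plane_measure R).
Variables (L : R) (bl br : R -> R) (B : R).
Hypotheses (bl_C1 : C1_line bl) (br_C1 : C1_line br).
Hypotheses (bl_B : forall x, `|bl x| <= B) (br_B : forall x, `|br x| <= B).

Let D : set plane := channel bl br.
Let DL : set mplane := unit_region L D.
Let mDL : measurable DL := measurable_unit_channel L bl_C1 br_C1.
Local Notation space := (space L bl br).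
Local Notation nrm2 := (nrm2 L bl br).
Local Notation H1_line := (H1_line L bl br B).

Let DL_B p : DL p -> `|p.2| <= B.
Proof.
move=> /(unit_channel_box bl_B br_B)[_]; rewrite /= in_itv /= => /andP[h1 h2].
by rewrite ler_norml h1.
Qed.

Lemma C1_on_snd (G dG : R -> R) : C1_fun G dG ->
  C1_on (fun p => G p.2) (fun=> 0) (fun p => dG p.2).
Proof.
move=> C; have := C1_on_tensor (C1_fun_cst 1) C.
have -> : (fun p : plane => cst 1 p.1 * G p.2) = (fun p => G p.2) by apply/funext => p; rewrite mul1r.
have -> : (fun p : plane => cst 0 p.1 * G p.2) = (fun=> 0) by apply/funext => p; rewrite mul0r.
by have -> : (fun p : plane => cst 1 p.1 * dG p.2) = (fun p => dG p.2) by apply/funext => p; rewrite mul1r.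
Qed.

Lemma graph_norm_fin (b : R -> R) : C1_line b -> exists2 r : R, 0 <= r & graph_norm L b (cst 1) = r%:E.
Proof.
move=> Cb; have g0 := graph_norm_ge0 L b (cst 1); have gf := graph_norm_cst1 L Cb.
by exists (fine (graph_norm L b (cst 1))); [exact: fine_ge0|rewrite fineK// ge0_fin_numE].
Qed.

Lemma graph_norm_scale (b : R -> R) (phi psi : plane -> R) (M eps : R) : C1_line b -> continuous phi ->
  continuous psi ->
  0 <= M -> 0 < eps -> (forall x, `|phi (x, b x)| <= M * `|psi (x, b x)|) ->
  (graph_norm L b psi < (eps / (M ^+ 2 + 1))%:E)%E -> (graph_norm L b phi < eps%:E)%E.
Proof.
move=> Cb cphi cpsi M0 e0 le lt.
have c0 : continuous (cst 0 : plane -> R) by move=> p; exact: cvg_cst.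
have M2 : 0 <= M ^+ 2 by exact: sqr_ge0.
apply: (@le_lt_trans _ _ ((M ^+ 2)%:E * graph_norm L b psi + 0%:E * graph_norm L b (cst 0%R))%E).
  apply: graph_norm_le => // x; rewrite mul0r addr0 -exprMn -[leLHS]real_normK ?num_real//.
  rewrite -[leRHS]real_normK ?num_real// ler_sqr ?nnegrE// normrM (ger0_norm M0).
  exact: le.
rewrite mul0e adde0; have fin : graph_norm L b psi \is a fin_num.
  by rewrite ge0_fin_numE ?graph_norm_ge0//; apply: lt_trans lt (ltry _).
move: lt; rewrite -(fineK fin); have := fine_ge0 (graph_norm_ge0 L b psi).
set r := fine _ => r0; rewrite -EFinM !lte_fin ltr_pdivlMr; last lra.
nra.
Qed.

Lemma ip_scale_le (A : set mplane) (f h : plane -> R) (M : R) : measurable A -> L2 mu A f ->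
  measurable_fun A h -> 0 <= M -> (forall p, A p -> `|h p| <= M) ->
  ip mu A (fun p => h p * f p) (fun p => h p * f p) <= M ^+ 2 * ip mu A f f.
Proof.
move=> mA Lf mh M0 hM.
have -> : M ^+ 2 * ip mu A f f = ip mu A (M \*o f) (M \*o f).
  by rewrite ipZl ?ipZr ?expr2 ?mulrA//; exact: L2Z.
apply: ip_le => //; [exact: L2M mA Lf mh hM|exact: L2Z|].
move=> p Ap; rewrite /= !exprMn ler_wpM2r ?sqr_ge0// -real_normK ?num_real//.
by rewrite ler_sqr ?nnegrE ?hM.
Qed.

Definition multiply (F dF : R -> R) (e : @triple R) : @triple R :=
  (fun p => F p.2 * e.1.1 p, fun p => F p.2 * e.1.2 p, fun p => F p.2 * e.2 p + dF p.2 * e.1.1 p).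

Lemma multiply_L2 F dF e : H1_line F dF -> L2_triple L bl br e -> L2_triple L bl br (multiply F dF e).
Proof.
move=> [cF md [M HM] _] [e1 e2 e3].
have mF := @measurable_snd_comp R L bl br _ (measurable_line cF).
have mdF := @measurable_snd_comp R L bl br _ md.
have bF p : DL p -> `|F p.2| <= M by move=> /DL_B /HM[].
have bd p : DL p -> `|dF p.2| <= M by move=> /DL_B /HM[].
by split; [exact: L2M mDL e1 mF bF|exact: L2M mDL e2 mF bF|
  exact: L2D mDL (L2M mDL e3 mF bF) (L2M mDL e1 mdF bd)].
Qed.

(** [dG] is close to [dF] only in L^2, so their difference may be multiplied only by a bounded
    function. This dictates the order of choices: a smooth [phi] near [e] first, then its bound [Kp]
    on the period, and [G] near [F] last, with a tolerance depending on [Kp]. *)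
Lemma multiply_space F dF e : H1_line F dF -> space e -> space (multiply F dF e).
Proof.
move=> gF [Le He]; have LF := H1_line_L2 bl_C1 br_C1 bl_B br_B gF; have Lm := multiply_L2 gF Le; split => //.
move=> eps e0; have [cF md [M HM] aF] := gF; have [e1 e2 e3] := Le.
have mF := @measurable_snd_comp R L bl br _ (measurable_line cF).
have mdF := @measurable_snd_comp R L bl br _ md.
have B0 : 0 <= B := le_trans (normr_ge0 _) (bl_B 0).
have M0 : 0 <= M by have [|h _] := HM 0; [rewrite normr0|exact: le_trans (normr_ge0 _) h].
set N := nrm2 e; have N0 : 0 <= N by exact: nrm2_ge0.
set K := (M + 1) ^+ 2; have K1 : 1 <= K by rewrite expr_ge1//; lra.
have KM : M ^+ 2 <= K by rewrite /K ler_sqr ?nnegrE//; lra.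
set eta := eps / (20 * K + 1); have eta0 : 0 < eta by rewrite divr_gt0//; lra.
have Keta : (20 * K + 1) * eta = eps by rewrite /eta mulrC divfK// gt_eqF//; lra.
have lt20 : eps / (20 * K + 1) <= eps / (K + 1) by rewrite ler_pM2l// lef_pV2 ?posrE; lra.
have [phi [C P n1 g1 g2]] := He _ eta0.
have [Lp1 Lp2 Lp3] := L2_smooth L bl_C1 br_C1 bl_B br_B C.
have cphi := C1_on_continuous (C1_planeP C).
have [Kp Kp0 HKp] := continuous_compact_bounded cphi (@compact_box _ 0 L (- B) B).
have phiK p : DL p -> `|phi p| <= Kp by move=> /(unit_channel_box bl_B br_B); exact: HKp.
set Q := 20 * N + 20 * Kp ^+ 2 + 1; have Q0 : 0 < Q by have := sqr_ge0 Kp; rewrite /Q; lra.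
have d0 : 0 < Num.min 1 (eps / 10 / Q) by rewrite lt_min ltr01 !divr_gt0.
have [G [dG [CG nG iG]]] := aF _ d0; set d := Num.min 1 (eps / 10 / Q) in d0 nG iG.
have d1 : d <= 1 by rewrite ge_min lexx.
have dQ : Q * d <= eps / 10.
  have h : d <= eps / 10 / Q by rewrite ge_min lexx orbT.
  by rewrite -(ler_pdivlMl _ _ Q0) mulrC.
have GM y : `|y| <= B -> `|G y| <= M + 1.
  move=> yB; have [h1 _] := HM y yB; have h2 := nG y yB.
  have -> : G y = F y + (G y - F y) by ring.
  by apply: le_trans (ler_normD _ _) _; apply: lerD h1 (le_trans h2 d1).
have CC := C1_onM (C1_on_snd CG) (C1_planeP C).
have [Cpsi Ex Ey] := C1_onE CC.
exists (fun p => G p.2 * phi p); split.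
- exact: Cpsi.
- by move=> p; rewrite P /= addr0.
- have cG := C1_fun_continuous CG; have [_ cdG] := CG.
  have mG := @measurable_snd_comp R L bl br _ (measurable_line cG).
  have mdG := @measurable_snd_comp R L bl br _ (measurable_line cdG).
  have M1 : 0 <= M + 1 by lra.
  have bG p : DL p -> `|G p.2| <= M + 1 by move=> /DL_B /GM.
  have bGF p : DL p -> `|G p.2 - F p.2| <= d by move=> /DL_B /nG.
  have bd p : DL p -> `|dF p.2| <= M by move=> /DL_B /HM[].
  have mGF := measurable_funB mG mF.
  have [k1 k2 k3] : [/\ ip mu DL (phi \- e.1.1) (phi \- e.1.1) <= eta,
      ip mu DL ('D_e_x phi \- e.1.2) ('D_e_x phi \- e.1.2) <= eta &
      ip mu DL ('D_e_y phi \- e.2) ('D_e_y phi \- e.2) <= eta].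
    have [h1 h2 h3] := ip_comp_le L bl br (smooth_triple phi - e).
    by split; [apply: le_trans h1 (ltW n1)|apply: le_trans h2 (ltW n1)|apply: le_trans h3 (ltW n1)].
  have key (u v : plane -> R) : L2 mu DL u -> L2 mu DL v -> ip mu DL (u \- v) (u \- v) <= eta ->
      ip mu DL v v <= N ->
      L2 mu DL (fun p => G p.2 * u p - F p.2 * v p) /\
      ip mu DL (fun p => G p.2 * u p - F p.2 * v p) (fun p => G p.2 * u p - F p.2 * v p) <=
      2 * (K * eta) + 2 * (d ^+ 2 * N).
    move=> Lu Lv uv vN; have Luv := L2B mDL Lu Lv.
    have -> : (fun p => G p.2 * u p - F p.2 * v p) =
        ((fun p => G p.2 * (u \- v) p) \+ (fun p => (G p.2 - F p.2) * v p)) by apply/funext => p /=; ring.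
    have A1 := L2M mDL Luv mG bG; have A2 := L2M mDL Lv mGF bGF.
    split; first exact: L2D mDL A1 A2.
    apply: le_trans (ip_add_le mDL A1 A2) _; apply: lerD; rewrite ler_wpM2l//.
      apply: le_trans (ip_scale_le mDL Luv mG M1 bG) _.
      by rewrite ler_wpM2l// sqr_ge0.
    apply: le_trans (ip_scale_le mDL Lv mGF (ltW d0) bGF) _.
    by rewrite ler_wpM2l// sqr_ge0.
  have [N1 N2 N3] := ip_comp_le L bl br e.
  have [_ q1] := key _ _ Lp1 e1 k1 N1; have [_ q2] := key _ _ Lp2 e2 k2 N2;
    have [Lq q3] := key _ _ Lp3 e3 k3 N3.
  have Lpe := L2B mDL Lp1 e1.
  have LdG := C1_L2 L bl_C1 br_C1 bl_B br_B CG.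
  have Ldd := L2B mDL LdG LF.2.
  have A3 := L2M mDL Lpe mdF bd.
  have mphi : measurable_fun (DL : set mplane) phi by case: Lp1.
  have A4 := L2M mDL Ldd mphi phiK.
  have q4 : ip mu DL (fun p => dG p.2 * phi p - dF p.2 * e.1.1 p) (fun p => dG p.2 * phi p - dF p.2 *
    e.1.1 p) <=
      2 * (K * eta) + 2 * (Kp ^+ 2 * d).
    have -> : (fun p => dG p.2 * phi p - dF p.2 * e.1.1 p) =
        ((fun p => dF p.2 * (phi \- e.1.1) p) \+ (fun p => phi p * (dG p.2 - dF p.2))) by apply/funext
          => p /=; ring.
    apply: le_trans (ip_add_le mDL A3 A4) _; apply: lerD; rewrite ler_wpM2l//.
      apply: le_trans (ip_scale_le mDL Lpe mdF M0 bd) _.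
      exact: ler_pM (sqr_ge0 M) (ip_ge0 _ _ _) KM k1.
    apply: le_trans (ip_scale_le mDL Ldd mphi Kp0 phiK) _.
    by rewrite ler_wpM2l ?sqr_ge0.
  have L4 : L2 mu DL (fun p => dG p.2 * phi p - dF p.2 * e.1.1 p).
    have -> : (fun p => dG p.2 * phi p - dF p.2 * e.1.1 p) =
        ((fun p => dF p.2 * (phi \- e.1.1) p) \+ (fun p => phi p * (dG p.2 - dF p.2))) by apply/funext
          => p /=; ring.
    exact: L2D mDL A3 A4.
  have E : smooth_triple (fun p => G p.2 * phi p) - multiply F dF e =
     (fun p => G p.2 * phi p - F p.2 * e.1.1 p, fun p => G p.2 * 'D_e_x phi p - F p.2 * e.1.2 p,
      (fun p => G p.2 * 'D_e_y phi p - F p.2 * e.2 p) \+ (fun p => dG p.2 * phi p - dF p.2 * e.1.1 p)).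
    rewrite /smooth_triple Ex Ey; apply: injective_projections; [apply: injective_projections => //|];
      apply/funext => p.
      have z : 0 * phi p + G p.2 * 'D_e_x phi p - F p.2 * e.1.2 p = G p.2 * 'D_e_x phi p - F p.2 * e.1.2 p.
        by rewrite mul0r add0r.
      exact: z.
    have z : dG p.2 * phi p + G p.2 * 'D_e_y phi p - (F p.2 * e.2 p + dF p.2 * e.1.1 p) =
      (G p.2 * 'D_e_y phi p - F p.2 * e.2 p) + (dG p.2 * phi p - dF p.2 * e.1.1 p) by ring.
    exact: z.
  have q5 := ip_add_le mDL Lq L4.
  rewrite E /nrm2 /=; apply: (@le_lt_trans _ _ (2 * (K * eta) + 2 * (d ^+ 2 * N) + (2 * (K * eta) + 2 *
    (d ^+ 2 * N)) +
     (2 * (2 * (K * eta) + 2 * (d ^+ 2 * N)) + 2 * (2 * (K * eta) + 2 * (Kp ^+ 2 * d))))).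
    apply: lerD; first exact: lerD q1 q2.
    apply: le_trans q5 _; apply: lerD; rewrite ler_wpM2l//.
  exact: multiply_estimate eta0 Keta (ltW d0) d1 N0 (sqr_ge0 Kp) dQ.
- apply: (graph_norm_scale (M := M + 1) bl_C1 (C1_on_continuous CC) cphi) => //; first lra.
    by move=> x; rewrite /= normrM ler_wpM2r// GM.
  by apply: lt_le_trans g1 _; rewrite lee_fin.
- apply: (graph_norm_scale (M := M + 1) br_C1 (C1_on_continuous CC) cphi) => //; first lra.
    by move=> x; rewrite /= normrM ler_wpM2r// GM.
  by apply: lt_le_trans g2 _; rewrite lee_fin.
Qed.

End Multipliers.

(** * Transversal profiles as members of the space; integrals of y-derivatives *)

Section TransversalProfiles.
Context {R : realType}.
Local Notation plane := (R * R)%type.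
Local Notation mline := (measurableTypeR R).
Local Notation mplane := (measurableTypeR R * measurableTypeR R)%type.
Local Notation mu := (plane_measure R).
Local Notation leb := (@lebesgue_measure R).
Variables (L : R) (bl br : R -> R) (B : R).
Hypothesis L_gt0 : 0 < L.
Hypotheses (bl_C1 : C1_line bl) (br_C1 : C1_line br).
Hypothesis bl_br : forall x, bl x < br x.
Hypotheses (bl_B : forall x, `|bl x| <= B) (br_B : forall x, `|br x| <= B).

Let D : set plane := channel bl br.
Let DL : set mplane := unit_region L D.
Let mDL : measurable DL := measurable_unit_channel L bl_C1 br_C1.
Local Notation space := (space L bl br).
Local Notation nrm2 := (nrm2 L bl br).
Local Notation H1_line := (H1_line L bl br B).

Let DL_B p : DL p -> `|p.2| <= B.
Proof.
move=> /(unit_channel_box bl_B br_B)[_]; rewrite /= in_itv /= => /andP[h1 h2].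
by rewrite ler_norml h1.
Qed.

Let L21 : L2 mu DL (fun=> 1).
Proof. by apply: (L2_continuous L bl_C1 br_C1 bl_B br_B) => p; exact: cvg_cst. Qed.

Let ip0 : ip mu DL (fun=> 0) (fun=> 0) = 0.
Proof. by rewrite /ip /Rintegral integral0_eq// => p _; rewrite mulr0. Qed.

(** [G] is uniformly within [d] of [F], which vanishes on both graphs, so its squared boundary norms
    are at most [d ^+ 2] times the arc length of one period. *)
Lemma profile_space F dF : H1_line F dF -> (forall x, F (bl x) = 0) -> (forall x, F (br x) = 0) ->
  space (fun p => F p.2, fun=> 0, fun p => dF p.2).
Proof.
move=> gF Fl Fr; have [LF LdF] := H1_line_L2 bl_C1 br_C1 bl_B br_B gF.
have [cF md [M HM] aF] := gF; split; first by split; [exact: LF|exact: L20|exact: LdF].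
move=> eps e0; have [r1 r10 E1] := graph_norm_fin L bl_C1; have [r2 r20 E2] := graph_norm_fin L br_C1.
set A := ip mu DL (fun=> 1) (fun=> 1); have A0 : 0 <= A by exact: ip_ge0.
set K := A + 2 + 1; have K0 : 0 < K by rewrite /K; lra.
(* The bound 1 gives [J ^+ 2 <= J]; the other three entries serve the norm in the interior and the
   two boundary norms. *)
set J := Num.min 1 (Num.min (eps / (2 * K)) (Num.min (eps / (2 * (r1 + 1))) (eps / (2 * (r2 + 1))))).
have d0 : 0 < J by rewrite /J !lt_min ltr01 !divr_gt0//; lra.
have [G [dG [CG nG iG]]] := aF _ d0.
have d1 : J <= 1 by rewrite /J ge_min lexx.
have dK : J <= eps / (2 * K) by rewrite /J !ge_min lexx !orbT.
have dr1 : J <= eps / (2 * (r1 + 1)) by rewrite /J !ge_min lexx !orbT.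
have dr2 : J <= eps / (2 * (r2 + 1)) by rewrite /J !ge_min lexx !orbT.
have JJ : J ^+ 2 <= J by rewrite expr2 ler_piMl// ltW.
clearbody J; set d := J in nG iG d0 d1 dK dr1 dr2 JJ.
have C := C1_on_snd CG; have [Cp Ex Ey] := C1_onE C.
have cp := C1_on_continuous C; have cG := C1_fun_continuous CG.
have c1 : continuous (cst 1 : plane -> R) by move=> p; exact: cvg_cst.
have gr (b : R -> R) (r : R) : C1_line b -> graph_norm L b (cst 1) = r%:E -> 0 <= r ->
    d <= eps / (2 * (r + 1)) -> (forall x, `|b x| <= B) -> (forall x, F (b x) = 0) ->
    (graph_norm L b (fun p => G p.2) < eps%:E)%E.
  move=> Cb Er r0 dr bB Fb.
  apply: (@le_lt_trans _ _ ((d ^+ 2)%:E * graph_norm L b (cst 1%R) + 0%:E * graph_norm L b (cst 1%R))%E).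
    apply: graph_norm_le => //; first exact: sqr_ge0.
    move=> x; rewrite /= mul0r addr0 expr1n mulr1 -real_normK ?num_real//.
    rewrite ler_sqr ?nnegrE ?(ltW d0)//; have := nG (b x) (bB x).
    by rewrite Fb subr0.
  rewrite mul0e adde0 Er -EFinM lte_fin.
  have h : d * (2 * (r + 1)) <= eps by rewrite -ler_pdivlMr//; lra.
  have h2 : d ^+ 2 * r <= d * r by rewrite ler_wpM2r.
  by apply: le_lt_trans h2 _; apply: lt_le_trans h; nra.
exists (fun p => G p.2); split; [exact: Cp|by move=> p;
  rewrite /= addr0| |exact: gr bl_C1 E1 r10 dr1 bl_B Fl|exact: gr br_C1 E2 r20 dr2 br_B Fr].
have LG : L2 mu DL (fun p => G p.2) by exact: L2_continuous.
have i1 : ip mu DL (fun p => G p.2 - F p.2) (fun p => G p.2 - F p.2) <= d ^+ 2 * A.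
  have mGF : measurable_fun (DL : set mplane) (fun p => G p.2 - F p.2) by case: (L2B mDL LG LF).
  have := @ip_scale_le _ _ _ _ d mDL L21 mGF (ltW d0) (fun p Dp => nG _ (DL_B Dp)).
  by under eq_fun do rewrite mulr1.
have E : smooth_triple (fun p : plane => G p.2) - (fun p : plane => F p.2, fun=> 0 : R^o,
  fun p : plane => dF p.2) =
    (fun p => G p.2 - F p.2, fun=> 0, fun p => dG p.2 - dF p.2) :> @triple R.
  rewrite /smooth_triple Ex Ey; apply: injective_projections; [apply: injective_projections => //|by []].
  by apply/funext => p; exact: (subrr 0).
rewrite E /nrm2 /= ip0 addr0.
have h : d * (2 * K) <= eps by rewrite -ler_pdivlMr//; lra.
have h3 : d ^+ 2 * A <= d * A by rewrite ler_wpM2r.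
apply: le_lt_trans (lerD i1 iG) _; apply: lt_le_trans h.
by move: h3 d0; rewrite /K; nra.
Qed.

(** Applied to products [multiply F dF e], this is integration by parts in y. For an approximant,
    the fundamental theorem on vertical slices leaves boundary values of squared mean at most
    [4 * L * eps]; passing to [e] adds [A * eps], and both are doubled by the square of a
    difference. *)
Lemma integral_dy e : space e -> \int[mu]_(p in DL) e.2 p = 0.
Proof.
move=> [[e1 e2 e3] He].
have i1 (f : plane -> R) : ip mu DL f (fun=> 1) = \int[mu]_(p in DL) f p.
  by apply: eq_Rintegral => p _; rewrite mulr1.
rewrite -i1; apply/eqP; rewrite -sqrf_eq0 eq_le sqr_ge0 andbT.
set A := ip mu DL (fun=> 1) (fun=> 1); have A0 : 0 <= A by exact: ip_ge0.
have K0 : 0 <= 2 * A + 8 * L by have := L_gt0; lra.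
apply: (le0_eps K0) => eps eps0.
have [phi [C P n g1 g2]] := He _ eps0; have [s1 s2 s3] := L2_smooth L bl_C1 br_C1 bl_B br_B C.
have Lp := s3; have M := L2B mDL s3 e3; have Cp := C1_planeP C.
have [_ _ _ cdy] := Cp; have cphi := C1_on_continuous Cp.
pose g x := phi (x, br x) - phi (x, bl x).
have cg : continuous g by move=> x; apply: cvgB; apply: continuous_on_graph.
have mI : measurable (`[0, L[%classic : set mline) by exact: measurable_itv.
have sq (h : R -> R) : continuous h -> leb.-integrable `[0, L[ (EFin \o (fun x => h x ^+ 2)).
  move=> ch; apply: (integrableS _ _ _ (@continuous_itv_integrable _ (fun x => h x ^+ 2) 0 L _)) => //.
    by apply: subset_itvl; rewrite bnd_simp.
  by move=> x; apply: cvgM; exact: ch.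
have l2 (h : R -> R) : continuous h -> L2 leb `[0, L[ h.
  by move=> ch; split; [apply: measurable_funTS; exact: measurable_line|exact: sq].
have Lg := l2 g cg.
have L1 : L2 leb `[0, L[ (fun=> 1) by apply: l2 => x; exact: cvg_cst.
have E0 : ip mu DL ('D_e_y phi) (fun=> 1) = ip leb `[0, L[ g (fun=> 1).
  rewrite i1 /Rintegral.
  have I : mu.-integrable DL (EFin \o 'D_e_y phi).
    by apply: eq_integrable (L2_mul mDL s3 L21) => // p _; rewrite /= mulr1.
  have [-> _] := fubini_region mDL I.
  rewrite /ip /Rintegral [in RHS]integral_mkcond; congr fine; apply: eq_integral => x _.
  rewrite section_unit_channel patchE.
  have -> : (x \in `[0, L[%classic) = (0 <= x < L) by rewrite mem_setE in_itv.
  case: ifP => _; last by rewrite integral_set0.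
  have Cs := C1_sliceY x Cp; have [_ cs] := Cs.
  have := FTC Cs (ltW (bl_br x)); rewrite -/(g x) /= mulr1 => <-.
  apply/esym/integral_itv_bndoo.
  by apply/measurable_EFinP; apply: measurable_funTS; exact: measurable_line.
have E2 : ip mu DL ('D_e_y phi) (fun=> 1) ^+ 2 <= 4 * L * eps.
  rewrite E0; apply: le_trans (ip_cauchy_schwarz mI Lg L1) _.
  have -> : ip leb `[0, L[ (fun=> 1) (fun=> 1) = L.
    apply: EFin_inj; rewrite ip_EFin//.
    have -> : (fun=> (1 * 1 : R)%:E) = cst 1%E :> (R -> \bar R) by apply/funext => x; rewrite mulr1.
    apply: etrans (integral_cst leb mI 1%E) _.
    have := @lebesgue_measure_itv R (`[0, L[)%R; rewrite /= lte_fin L_gt0 -EFinB subr0 => EL.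
    by rewrite mul1e; exact: EL.
  have graphle (b : R -> R) : C1_line b -> (graph_norm L b phi < eps%:E)%E ->
      ip leb `[0, L[ (fun x => phi (x, b x)) (fun x => phi (x, b x)) <= eps.
    move=> Cb lt; have cb := continuous_on_graph Cb cphi; have Lb := l2 _ cb.
    rewrite -lee_fin ip_EFin//; apply: le_trans _ (ltW lt).
    apply: (le_trans _ (@graph_norm_ge _ L b Cb phi cphi)).
    by under eq_integral do rewrite -expr2.
  have cb1 := continuous_on_graph br_C1 cphi; have cb2 := continuous_on_graph bl_C1 cphi.
  have cb3 : continuous (fun x => - phi (x, bl x)) by move=> x; apply: cvgN; exact: cb2.
  have h1 := graphle _ br_C1 g2; have h2 := graphle _ bl_C1 g1.
  have h3 := ip_add_le mI (l2 _ cb1) (l2 _ cb3).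
  have h4 : ip leb `[0, L[ (fun x => - phi (x, bl x)) (fun x => - phi (x, bl x)) =
      ip leb `[0, L[ (fun x => phi (x, bl x)) (fun x => phi (x, bl x)).
    by apply: eq_Rintegral => x _; rewrite mulrNN.
  rewrite h4 in h3; have h5 : ip leb `[0, L[ g g <= 2 * eps + 2 * eps by apply: le_trans h3 _; lra.
  have := L_gt0; nra.
have -> : ip mu DL e.2 (fun=> 1) = ip mu DL ('D_e_y phi) (fun=> 1) - ip mu DL ('D_e_y phi \- e.2) (fun=> 1).
  by rewrite ipBl//; ring.
have h6 := ip_cauchy_schwarz mDL M L21.
have [_ _ h7] := ip_comp_le L bl br (smooth_triple phi - e).
have h8 : ip mu DL ('D_e_y phi \- e.2) ('D_e_y phi \- e.2) * A <= eps * A.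
  by apply: ler_wpM2r => //; exact: le_trans h7 (ltW n).
have h9 := le_trans h6 h8; move: E2 h9.
set u := ip mu DL _ _; set v := ip mu DL _ _ => E2 h9.
have := sqr_ge0 (u + v); nra.
Qed.

End TransversalProfiles.

(** * Combinations of three exponentials *)

Section ExpCombination.
Context {R : realType}.

Definition exp_comb (A B C s : R) : R := A * expR s + B * expR (- s) + C * expR (- (3 * s)).

Lemma expR_neg3 (s : R) : expR (- (3 * s)) = expR (- s) ^+ 3.
Proof. by rewrite -[3]/(3%:R) -mulrN mulrC expRM_natr. Qed.

Variables (L : R) (bl br : R -> R) (B : R).
Hypotheses (bl_C1 : C1_line bl) (br_C1 : C1_line br).
Hypotheses (bl_B : forall x, `|bl x| <= B) (br_B : forall x, `|br x| <= B).
Local Notation H1_line := (H1_line L bl br B).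

Lemma H1_line_ext F dF G dG : H1_line F dF -> F =1 G -> dF =1 dG -> H1_line G dG.
Proof. by move=> gF /funext <- /funext <-. Qed.

Lemma H1_line_exp_comb (A C E : R) S dS : H1_line S dS ->
  H1_line (fun y => exp_comb A C E (S y)) (fun y => exp_comb A (- C) (- (3 * E)) (S y) * dS y).
Proof.
move=> gS.
have g1 := H1_line_exp bl_C1 br_C1 bl_B br_B gS.
have gz := H1_line_C1 L bl br B (C1_fun_cst 0).
have lin := @H1_line_lin R L bl br B bl_C1 br_C1 bl_B br_B.
have g2 := H1_line_exp bl_C1 br_C1 bl_B br_B (lin (-1) 0 _ _ _ _ gS gz).
have g3 := H1_line_exp bl_C1 br_C1 bl_B br_B (lin (-3) 0 _ _ _ _ gS gz).
have := lin 1 1 _ _ _ _ (lin A C _ _ _ _ g1 g2) (lin E 0 _ _ _ _ g3 gz).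
move=> g; apply: (H1_line_ext g) => y; rewrite /exp_comb /= !mulr0 !addr0 !mulN1r !mul1r ?mulNr//.
ring.
Qed.

End ExpCombination.

(** * The explicit comparison profile and its flux *)

Section ComparisonProfile.
Context {R : realType}.
Variables (fl T m sa : R).
Hypotheses (T_gt0 : 0 < T) (m_gt0 : 0 < m) (sa_gt0 : 0 < sa).
Let fr := fl + T.

Definition kappa := m / sa.
(* decay s = (e^s - 2 e^-s + e^-3s) * amp is close to e^(s - kappa); the coefficients make it vanish together
   with its derivative at s = 0 and take the value 1 at s = kappa. *)
Definition amp : R := (expR kappa * (1 - expR (- kappa) ^+ 2) ^+ 2)^-1.
Definition decay := exp_comb amp (- 2 * amp) amp.
Definition decay1 := exp_comb amp (2 * amp) (- 3 * amp).
Definition decay2 := exp_comb amp (- 2 * amp) (9 * amp).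
(** The value of [decay1] at [kappa]. It exceeds 1 by [4 * q / (1 - q)] with
    [q = expR (- kappa) ^+ 2], so it is exponentially close to the slope of the pure exponential. *)
Definition slope : R := (1 + 3 * expR (- kappa) ^+ 2) / (1 - expR (- kappa) ^+ 2).
(* The value of W at the upper edge of the band. *)
Definition height : R := (sa * (2 * sa / T + slope))^-1.

Lemma kappa_gt0 : 0 < kappa. Proof. exact: divr_gt0. Qed.

Lemma expRN_kappa : 0 < expR (- kappa) < 1.
Proof. by rewrite expR_gt0 -expR0 ltr_expR oppr_lt0 kappa_gt0. Qed.

Lemma q_bounds : 0 < expR (- kappa) ^+ 2 < 1.
Proof.
have /andP[w0 w1] := expRN_kappa; rewrite exprn_gt0//= expr_lt1//; exact: ltW.
Qed.

Lemma slope_ge1 : 1 <= slope.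
Proof.
have /andP[q0 q1] := q_bounds; rewrite /slope ler_pdivlMr ?subr_gt0//; lra.
Qed.

Lemma height_gt0 : 0 < height.
Proof.
have s0 : 0 < slope := lt_le_trans ltr01 slope_ge1.
rewrite invr_gt0; apply: mulr_gt0 => //; apply: addr_gt0 => //.
by rewrite divr_gt0 ?mulr_gt0.
Qed.

Lemma decay_0 : decay 0 = 0.
Proof. by rewrite /decay /exp_comb mulr0 oppr0 expR0; ring. Qed.

Lemma decay1_0 : decay1 0 = 0.
Proof. by rewrite /decay1 /exp_comb mulr0 oppr0 expR0; ring. Qed.

(** The first two exponentials solve u'' = u; the third is multiplied by 9, which leaves 9 - 1 =
    8. *)
Lemma decay2E s : decay2 s = decay s + 8 * amp * expR (- (3 * s)).
Proof. by rewrite /decay2 /decay /exp_comb; ring. Qed.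

Let expK : expR kappa = (expR (- kappa))^-1.
Proof. by rewrite expRN invrK. Qed.

Lemma decay_kappa : decay kappa = 1.
Proof.
have /andP[w0 w1] := expRN_kappa; have /andP[q0 q1] := q_bounds.
rewrite /decay /exp_comb expR_neg3 /amp expK; set w := expR (- kappa) in w0 w1 q0 q1 *.
by field; rewrite !gt_eqF// subr_gt0.
Qed.

Lemma decay1_kappa : decay1 kappa = slope.
Proof.
have /andP[w0 w1] := expRN_kappa; have /andP[q0 q1] := q_bounds.
rewrite /decay1 /exp_comb expR_neg3 /amp /slope expK; set w := expR (- kappa) in w0 w1 q0 q1 *.
by field; rewrite !gt_eqF// subr_gt0.
Qed.

(* The slope condition that makes the flux of the comparison profile continuous across the boundary of the band. *)
Lemma height_slope : 2 * sa ^+ 2 * height / T - 1 = - (sa * height * slope).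
Proof.
have s1 := slope_ge1; rewrite /height.
have : 2 * sa / T + slope != 0.
  rewrite gt_eqF//; apply: addr_gt0 (lt_le_trans ltr01 s1).
  by rewrite divr_gt0 ?mulr_gt0.
have T0 : T != 0 by rewrite gt_eqF.
have s0 : sa != 0 by rewrite gt_eqF.
move=> h; have h' : 2 * sa + slope * T != 0.
  by have := mulf_neq0 h T0; rewrite mulrDl divfK.
by field; rewrite T0 s0 h'.
Qed.

(* At distance t <= m above (below) the band sR (sL) is (m - t) / sqrt a; it is clamped to 0 beyond this
   distance and to m / sqrt a on the other side, so that one formula gives W on the whole line. *)
Definition sR y := (pos_from (fr + m) y - pos_from fr y + m) / sa.
Definition dsR y := (step (fr + m) y - step fr y) / sa.
Definition sL y := (pos_from (fl - m) y - pos_from fl y) / sa.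
Definition dsL y := (step (fl - m) y - step fl y) / sa.
Definition sB y := sL y + sR y - kappa.

(** Odd about the middle of the band. A clamped argument [kappa] contributes
    [height * decay kappa = height]: inside the band the two contributions cancel each other, and
    outside one of them cancels the affine part, which is constant there. *)
Definition comparison y := 2 * height / T * (pos_from fl y - pos_from fr y - T / 2) +
  height * decay (sR y) - height * decay (sL y).
Definition dcomparison y := 2 * height / T * (step fl y - step fr y) +
  height * (decay1 (sR y) * dsR y) - height * (decay1 (sL y) * dsL y).
(** This is [sa ^+ 2 * dcomparison] minus the indicator of the band, off the line at [fr]. Outside
    the band [sB] is whichever of [sL] and [sR] is not at [kappa], and inside it is [kappa], so one
    continuous formula results although [dcomparison] jumps at the edges of the band; hence it can
    be differentiated across them. *)
Definition flux y := - (sa * height) * decay1 (sB y).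
Definition dflux y := - (sa * height) * (decay2 (sB y) * (dsL y + dsR y)).
(** [pos_from fl y - (y - fl)] is the positive part of [fl - y], so the exponent involves the
    distance to the band on either side. *)
Definition weight y := expR (- ((pos_from fl y - (y - fl) + pos_from fr y) / sa)).
Definition dweight y := - ((step fl y - 1 + step fr y) / sa) * weight y.

Let posE (b y : R) : pos_from b y = if b < y then y - b else 0.
Proof.
rewrite /pos_from; case: ltP => h; first by rewrite max_l// subr_ge0 ltW.
by rewrite max_r// subr_le0.
Qed.

Let s0 : sa != 0. Proof. by rewrite gt_eqF. Qed.
Let Tn0 : T != 0. Proof. by rewrite gt_eqF. Qed.

Lemma profile_inside y : fl < y -> y < fr ->
  [/\ dcomparison y = 2 * height / T, sa ^+ 2 * dcomparison y = flux y + 1, dflux y = 0,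
    weight y = 1 & dweight y = 0].
Proof.
move=> h1 h2; have := m_gt0 => m0.
have e1 : (fl - m < y) = true by apply/idP; lra.
have e2 : (fr < y) = false by apply/negbTE; rewrite -leNgt ltW.
have e3 : (fr + m < y) = false by apply/negbTE; rewrite -leNgt; lra.
have sRE : sR y = kappa by rewrite /sR !posE e2 e3 subr0 add0r.
have sLE : sL y = kappa by rewrite /sL !posE e1 h1 /kappa; congr (_ / _); ring.
have sBE : sB y = kappa by rewrite /sB sRE sLE; ring.
have dR : dsR y = 0 by rewrite /dsR /step e2 e3 subrr mul0r.
have dL : dsL y = 0 by rewrite /dsL /step e1 h1 subrr mul0r.
have rE : weight y = 1.
  by rewrite /weight !posE h1 e2 subrr addr0 mul0r oppr0 expR0.
have dWE : dcomparison y = 2 * height / T.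
  by rewrite /dcomparison dR dL /step h1 e2; ring.
split => //; last by rewrite /dweight /step h1 e2 subrr addr0 mul0r oppr0 mul0r.
  rewrite dWE /flux sBE decay1_kappa mulNr -height_slope; ring.
by rewrite /dflux dR dL addr0 !mulr0.
Qed.

Lemma profile_right y : fr < y -> y <= fr + m ->
  let s := kappa - (y - fr) / sa in
  [/\ sa ^+ 2 * dcomparison y = flux y, dflux y - comparison y = 8 * height * amp * expR (- (3 * s)) &
    weight y = expR (s - kappa)].
Proof.
move=> h1 h2 s; have := m_gt0 => m0; have T0 := T_gt0; have frT : fr = fl + T by [].
have e1 : (fl - m < y) = true by apply/idP; lra.
have e2 : (fl < y) = true by apply/idP; lra.
have e3 : (fr + m < y) = false by apply/negbTE; rewrite -leNgt.
have sRE : sR y = s by rewrite /sR !posE h1 e3 /s /kappa; field.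
have sLE : sL y = kappa by rewrite /sL !posE e1 e2 /kappa; congr (_ / _); ring.
have sBE : sB y = s by rewrite /sB sRE sLE; ring.
have dR : dsR y = - sa^-1 by rewrite /dsR /step h1 e3; field.
have dL : dsL y = 0 by rewrite /dsL /step e1 e2 subrr mul0r.
have WE : comparison y = height * decay s.
  rewrite /comparison sRE sLE decay_kappa !posE e2 h1 frT; field.
  exact: Tn0.
split.
- rewrite /dcomparison dR dL sRE /flux sBE /step e2 h1; field.
  by rewrite s0 Tn0.
- by rewrite WE /dflux sBE dR dL decay2E; field.
- rewrite /weight !posE e2 h1; congr expR; rewrite /s; ring.
Qed.

Lemma profile_left y : fl - m < y -> y <= fl ->
  let s := kappa - (fl - y) / sa in
  [/\ sa ^+ 2 * dcomparison y = flux y, dflux y - comparison y = - (8 * height * amp * expR (- (3 * s)))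
    & weight y = expR (s - kappa)].
Proof.
move=> h1 h2 s; have := m_gt0 => m0; have T0 := T_gt0; have frT : fr = fl + T by [].
have e1 : (fl < y) = false by apply/negbTE; rewrite -leNgt.
have e2 : (fr < y) = false by apply/negbTE; rewrite -leNgt; lra.
have e3 : (fr + m < y) = false by apply/negbTE; rewrite -leNgt; lra.
have sRE : sR y = kappa by rewrite /sR !posE e2 e3 subr0 add0r.
have sLE : sL y = s by rewrite /sL !posE e1 h1 /s /kappa; field.
have sBE : sB y = s by rewrite /sB sRE sLE; ring.
have dR : dsR y = 0 by rewrite /dsR /step e2 e3 subrr mul0r.
have dL : dsL y = sa^-1 by rewrite /dsL /step e1 h1; field.
have WE : comparison y = - (height * decay s).
  rewrite /comparison sRE sLE decay_kappa !posE e1 e2; field.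
  exact: Tn0.
split.
- rewrite /dcomparison dR dL sLE /flux sBE /step e1 e2; field.
  by rewrite s0 Tn0.
- by rewrite WE /dflux sBE dR dL decay2E; field.
- rewrite /weight !posE e1 e2; congr expR; rewrite /s; ring.
Qed.

Lemma profile_far y : y <= fl - m \/ fr + m < y ->
  [/\ sa ^+ 2 * dcomparison y = flux y, comparison y = 0 & dflux y = 0].
Proof.
have := m_gt0 => m0; have T0 := T_gt0; have frT : fr = fl + T by [].
case=> h.
  have e1 : (fl < y) = false by apply/negbTE; rewrite -leNgt; lra.
  have e2 : (fr < y) = false by apply/negbTE; rewrite -leNgt; lra.
  have e3 : (fr + m < y) = false by apply/negbTE; rewrite -leNgt; lra.
  have e4 : (fl - m < y) = false by apply/negbTE; rewrite -leNgt.
  have sRE : sR y = kappa by rewrite /sR !posE e2 e3 subr0 add0r.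
  have sLE : sL y = 0 by rewrite /sL !posE e1 e4 subrr mul0r.
  have sBE : sB y = 0 by rewrite /sB sRE sLE; ring.
  have dR : dsR y = 0 by rewrite /dsR /step e2 e3 subrr mul0r.
  have dL : dsL y = 0 by rewrite /dsL /step e1 e4 subrr mul0r.
  split.
  - by rewrite /dcomparison dR dL /flux sBE decay1_0 /step e1 e2; ring.
  - by rewrite /comparison sRE sLE decay_kappa decay_0 !posE e1 e2; field.
  - by rewrite /dflux dR dL addr0 !mulr0.
have e1 : (fl < y) = true by apply/idP; lra.
have e2 : (fr < y) = true by apply/idP; lra.
have e4 : (fl - m < y) = true by apply/idP; lra.
have sRE : sR y = 0 by rewrite /sR !posE e2 h /fr; field.
have sLE : sL y = kappa by rewrite /sL !posE e1 e4 /kappa; congr (_ / _); ring.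
have sBE : sB y = 0 by rewrite /sB sRE sLE; ring.
have dR : dsR y = 0 by rewrite /dsR /step e2 h subrr mul0r.
have dL : dsL y = 0 by rewrite /dsL /step e1 e4 subrr mul0r.
split.
- by rewrite /dcomparison dR dL /flux sBE decay1_0 /step e1 e2; ring.
- by rewrite /comparison sRE sLE decay_kappa decay_0 !posE e1 e2 frT; field.
- by rewrite /dflux dR dL addr0 !mulr0.
Qed.

(** The boundary of the channel may touch the line at [fr + m], so the boundary condition needs the
    value there; [profile_far], which also speaks of derivatives, leaves that line to
    [profile_right]. *)
Lemma W_far y : y <= fl - m \/ fr + m <= y -> comparison y = 0.
Proof.
case=> [h|]; first by have [] := profile_far (or_introl h).
rewrite le_eqVlt => /orP[/eqP <-|h]; last by have [] := profile_far (or_intror h).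
have := m_gt0 => m0; have T0 := T_gt0; have frT : fr = fl + T by [].
have e1 : (fl < fr + m) = true by apply/idP; lra.
have e2 : (fr < fr + m) = true by apply/idP; lra.
have e4 : (fl - m < fr + m) = true by apply/idP; lra.
have sRE : sR (fr + m) = 0 by rewrite /sR !posE e2 ltxx; field.
have sLE : sL (fr + m) = kappa by rewrite /sL !posE e1 e4 /kappa; congr (_ / _); ring.
by rewrite /comparison sRE sLE decay_kappa decay_0 !posE e1 e2 frT; field.
Qed.

Lemma norm_dweight_le y : `|dweight y| <= weight y / sa.
Proof.
have r0 : 0 <= weight y by exact: expR_ge0.
rewrite /dweight normrM (ger0_norm r0) mulrC ler_wpM2l// normrN normrM.
have si : 0 <= sa^-1 by rewrite invr_ge0 ltW.
rewrite (ger0_norm si) ler_piMl// /step.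
have T0 := T_gt0; have frT : fr = fl + T by [].
case: (ltP fl y) => h1; case: (ltP fr y) => h2; rewrite ?subrr ?add0r ?addr0 ?normr1 ?normr0 ?ler01//.
  by lra.
by rewrite normrN normr1.
Qed.

End ComparisonProfile.

Lemma eq_le_refl d (T : porderType d) (x y : T) : x = y -> (x <= y)%O.
Proof. by move=> ->. Qed.

(** * Scalar inequalities behind the constants *)

Section NumericalBounds.
Context {R : realType}.
Variables (k : R).
Hypothesis k_gt0 : 0 < k.
Let w := expR (- k).
Let q := w ^+ 2.

Let w01 : 0 < w < 1.
Proof. by rewrite expR_gt0 -expR0 ltr_expR oppr_lt0. Qed.
Let q01 : 0 < q < 1.
Proof. have /andP[w0 w1] := w01; rewrite exprn_gt0//= expr_lt1//; exact: ltW. Qed.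

Lemma two_kq_le : 2 * k * q <= 1 - q.
Proof.
have /andP[q0 q1] := q01.
have e : expR (2 * k) * q = 1.
  by rewrite /q /w -expRM_natl -expRD mulrN subrr expR0.
have := expR_ge1Dx (2 * k); nra.
Qed.

(** A rational substitute for the maximum 1 / e of [k * expR (- k)]. The exponential is bounded
    below by [(1 + k / 3) ^+ 3], which touches the line [9 * k / 4] at [k = 3 / 2]; this is the
    double root of the polynomial used. *)
Lemma kw_le : 9 * (k * w) <= 4.
Proof.
have /andP[w0 w1] := w01; have k0 := k_gt0.
have e : expR (k / 3) ^+ 3 * w = 1.
  rewrite -expRM_natl -expRD -[X in expR X](_ : 0 = _) ?expR0//.
  by field.
have h1 := expR_ge1Dx (k / 3).
have h2 : (1 + k / 3) ^+ 3 <= expR (k / 3) ^+ 3.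
  by rewrite lerXn2r ?nnegrE ?expR_ge0//; lra.
have h3 : 9 * k <= 4 * (1 + k / 3) ^+ 3.
  have : 0 <= (2 * k - 3) ^+ 2 * (k + 12) by rewrite mulr_ge0 ?sqr_ge0//; lra.
  have -> : (2 * k - 3) ^+ 2 * (k + 12) = 27 * (4 * (1 + k / 3) ^+ 3 - 9 * k) by field.
  by rewrite pmulr_rge0// subr_ge0.
have -> : 4 = 4 * expR (k / 3) ^+ 3 * w :> R by rewrite -mulrA e mulr1.
rewrite mulrA ler_wpM2r ?(ltW w0)//; apply: le_trans h3 _.
by rewrite ler_wpM2l.
Qed.

(** Two regimes, separated where [(1 - q) * (1 + 3 * q)] falls below 1, that is at [q = 2 / 3].
    Below, [kw_le] gives 128 / 9 against 15. Above, [k] is small: [two_kq_le] bounds it by a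
    multiple of [1 - q], and both sides are compared with [(1 - q) ^+ 2]. *)
Lemma residual_numeric : 32 * k * (w - w ^+ 6) <= 15 * ((1 - q) ^+ 2 * (1 + 3 * q) ^+ 2).
Proof.
have /andP[w0 w1] := w01; have /andP[q0 q1] := q01; have k0 := k_gt0.
have w60 : 0 < w ^+ 6 by exact: exprn_gt0.
have kw := kw_le; have kq := two_kq_le; rewrite -exprMn.
case: (leP q (2 / 3)) => h.
  have h1 : 1 <= (1 - q) * (1 + 3 * q) by nra.
  have h2 : 1 <= ((1 - q) * (1 + 3 * q)) ^+ 2 by rewrite expr_ge1//; lra.
  have h3 : 0 <= k * w ^+ 6 by rewrite mulr_ge0// ltW.
  rewrite -mulrA mulrBr; lra.
have w5 : w - w ^+ 6 <= 1 - q ^+ 3.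
  have -> : q ^+ 3 = w ^+ 6 by rewrite /q -exprM.
  by rewrite lerD2r ltW.
have q3 : 1 - q ^+ 3 <= 3 * (1 - q).
  have -> : 1 - q ^+ 3 = (1 + q + q ^+ 2) * (1 - q) by ring.
  by rewrite ler_wpM2r ?subr_ge0 ?ltW//; nra.
have kb : k <= 3 / 4 * (1 - q) by nra.
have s0 : 0 <= 1 - q by rewrite subr_ge0 ltW.
apply: (@le_trans _ _ (32 * (3 / 4 * (1 - q)) * (3 * (1 - q)))).
  apply: ler_pM; rewrite ?mulr_ge0 ?(ltW k0)//.
  - by rewrite subr_ge0 -[leRHS]mulr1 exprS ler_wpM2l ?(ltW w0)// exprn_ile1 // ltW.
  - by rewrite ler_wpM2l.
  - exact: le_trans w5 q3.
have -> : 32 * (3 / 4 * (1 - q)) * (3 * (1 - q)) = 72 * (1 - q) ^+ 2 by field.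
have -> : 15 * ((1 - q) * (1 + 3 * q)) ^+ 2 = 15 * (1 + 3 * q) ^+ 2 * (1 - q) ^+ 2 by ring.
by rewrite ler_wpM2r ?sqr_ge0//; nra.
Qed.

End NumericalBounds.

Lemma sqrt_ip_add_le d (T : measurableType d) (R : realType) (mu : {measure set T -> \bar R})
    (A : set T) (f g : T -> R) : measurable A -> L2 mu A f -> L2 mu A g ->
  Num.sqrt (ip mu A (f \+ g) (f \+ g)) <= Num.sqrt (ip mu A f f) + Num.sqrt (ip mu A g g).
Proof.
move=> mA Lf Lg; have L := L2D mA Lf Lg.
have s0 : 0 <= Num.sqrt (ip mu A f f) + Num.sqrt (ip mu A g g) by rewrite addr_ge0 ?sqrtr_ge0.
rewrite -[leRHS](ger0_norm s0) -sqrtr_sqr; apply: ler_wsqrtr.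
rewrite ipDl// !ipDr// sqrrD !sqr_sqrtr ?ip_ge0// (ipC mu A g f).
have := le_trans (ler_norm _) (norm_ip_le mA Lf Lg); rewrite -mulr_natr; lra.
Qed.

(** * Horizontal lines are null; integrals of exponentials over boxes *)

Section LineNull.
Context {R : realType}.
Local Notation plane := (R * R)%type.
Local Notation mline := (measurableTypeR R).
Local Notation mplane := (measurableTypeR R * measurableTypeR R)%type.
Local Notation mu := (plane_measure R).
Local Notation leb := (@lebesgue_measure R).

Lemma ae_horizontal (c : R) : {ae mu, forall p : plane, p.2 <> c}.
Proof.
have m1 : measurable ([set: R] : set mline) by [].
have m2 : measurable ([set c] : set mline) by exact: measurable_set1.
exists ([set: R] `*` [set c]); split.
- exact: measurableX.
- by rewrite plane_measure_prod// lebesgue_measure_set1 mule0.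
- by move=> p /= /contrapT h; split.
Qed.

Lemma integral_exp_box (L u v C al : R) : 0 < L -> u <= v -> 0 <= C -> al != 0 ->
  (\int[mu]_(p in `[0%R, L] `*` `[u, v]) (C * expR (al * p.2))%:E =
   (L * (C / al * (expR (al * v) - expR (al * u))))%:E)%E.
Proof.
move=> L0 uv C0 al0.
have CF : C1_fun (fun y : R => C / al * expR (al * y)) (fun y => C * expR (al * y)).
  have ca := C1_fun_lin al 0 (@C1_fun_id R) (C1_fun_cst 0).
  have cl := C1_fun_lin (C / al) 0 (C1_fun_comp (@C1_fun_exp R) ca) (C1_fun_cst 0).
  have -> : (fun y : R => C / al * expR (al * y)) =
      (fun x : R => C / al * expR (al * id x + 0 * cst 0 x) + 0 * cst 0 x).
    by apply/funext => y /=; rewrite !mulr0 !addr0.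
  apply: C1_fun_eq cl _ => y /=; rewrite !mulr0 !addr0.
  by field.
have mA : measurable (`[0, L]%classic : set mline) by exact: measurable_itv.
have mB : measurable (`[u, v]%classic : set mline) by exact: measurable_itv.
have [_ cF] := CF.
have mf : measurable_fun [set: mplane] (fun p : plane => (C * expR (al * p.2))%:E).
  apply/measurable_EFinP; apply: continuous_plane_measurable => p.
  by apply: (@continuous_comp _ _ _ snd (fun y => C * expR (al * y))); [exact: cvg_snd|exact: cF].
rewrite tonelli_rect//; first last.
- by move=> p _; rewrite lee_fin mulr_ge0 ?expR_ge0.
- exact: measurable_funTS.
under eq_integral do rewrite /= (FTC CF uv).
have := integral_cst leb mA ((C / al * expR (al * v) - C / al * expR (al * u))%:E).
move=> E; apply: etrans E _; have := @lebesgue_measure_itv R (`[0, L])%R.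
rewrite /= lte_fin L0 -EFinB subr0 => EL.
have -> : leb (`[0, L]%classic : set mline) = L%:E by exact: EL.
by rewrite -EFinM; congr EFin; ring.
Qed.

End LineNull.

(** The pointwise inequality behind the weighted energy estimate: [x] is the error, [g] its
    y-derivative, [r] the residual, [w] the weight and [d] its derivative. Young's inequality on the
    mixed term uses up all of [a * g ^+ 2] and a quarter of [x ^+ 2]; the maximum of
    [r * x - 3 / 4 * x ^+ 2] over [x] is [r ^+ 2 / 3]. *)
Lemma weighted_young (R : realFieldType) (s a w d r x g : R) : 0 < s -> s ^+ 2 = a ->
  `|d| <= w / s -> 0 <= w ->
  (r - x) * (w * x) + (- a * g) * (w * g + d * x) <= 3^-1 * (w * r) * r.
Proof.
move=> s0 sa dw w0.
have b1 : - (a * g * d * x) <= w * (a * g ^+ 2 + x ^+ 2 / 4).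
  have dx : `|d * s| <= w.
    by rewrite normrM (ger0_norm (ltW s0)) -ler_pdivlMr.
  have n1 : - (a * g * d * x) <= `|d * s| * (s * `|g * x|).
    apply: le_trans (ler_norm _) _; rewrite normrN -sa.
    have -> : s ^+ 2 * g * d * x = (d * s) * (s * (g * x)) by ring.
    by rewrite !normrM (ger0_norm (ltW s0)).
  apply: le_trans n1 _; apply: le_trans (ler_wpM2r _ dx) _; first by rewrite mulr_ge0// ltW.
  apply: ler_wpM2l => //; rewrite normrM -sa.
  have := sqr_ge0 (s * `|g| - `|x| / 2).
  by rewrite -[in X in _ -> X](real_normK (num_real g)) -[in X in _ -> X](real_normK (num_real x)); lra.
have b2 : 0 <= w * (r - 3 / 2 * x) ^+ 2 by rewrite mulr_ge0// sqr_ge0.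
have -> : (r - x) * (w * x) + (- a * g) * (w * g + d * x) =
  w * (r * x) - w * x ^+ 2 - w * (a * g ^+ 2) + - (a * g * d * x) by ring.
by move: b1 b2; rewrite !(mulrDr, mulrA); lra.
Qed.

(** * Comparison of a solution with the profile *)

Section Comparison.
Context {R : realType}.
Local Notation plane := (R * R)%type.
Local Notation mplane := (measurableTypeR R * measurableTypeR R)%type.
Local Notation mu := (plane_measure R).
Variables (L : R) (bl br : R -> R) (B : R) (fl fr m a : R).
Hypothesis L_gt0 : 0 < L.
Hypotheses (bl_C1 : C1_line bl) (br_C1 : C1_line br).
Hypotheses (bl_B : forall x, `|bl x| <= B) (br_B : forall x, `|br x| <= B).
Hypotheses (m_gt0 : 0 < m) (a_gt0 : 0 < a) (fl_fr : fl < fr).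
Hypotheses (bl_fl : forall x, bl x <= fl - m) (fr_br : forall x, fr + m <= br x).

Let T := fr - fl.
Let sa := Num.sqrt a.
Let T_gt0 : 0 < T. Proof. by rewrite subr_gt0. Qed.
Let sa_gt0 : 0 < sa. Proof. by rewrite sqrtr_gt0. Qed.
Let saE : sa ^+ 2 = a. Proof. by rewrite sqr_sqrtr// ltW. Qed.
Let flT : fl + T = fr. Proof. by rewrite addrC subrK. Qed.
Let bl_fl' x : bl x < fl. Proof. by apply: le_lt_trans (bl_fl x) _; rewrite ltrBlDr ltrDl. Qed.
Let fr_br' x : fr < br x. Proof. by apply: lt_le_trans (fr_br x); rewrite ltrDl. Qed.
Let bl_br x : bl x < br x. Proof. exact: bl_lt_br bl_fl' fl_fr fr_br' x. Qed.

Let D : set plane := channel bl br.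
Let DL : set mplane := unit_region L D.
Let OmL : set mplane := unit_region L (band fl fr).
Let Ex : set mplane := DL `\` OmL.
Local Notation space := (space L bl br).
Local Notation H1_line := (H1_line L bl br B).
Local Notation form := (form L bl br fl fr a).
Local Notation load := (load L fl fr).
Let mDL : measurable DL := measurable_unit_channel L bl_C1 br_C1.
Let mOm : measurable OmL := measurable_unit_band L fl fr.
Let mEx : measurable Ex := measurable_unit_exterior L fl fr bl_C1 br_C1.
Let OmDL : OmL `<=` DL := unit_band_sub bl_fl' fr_br'.
Let ExDL : Ex `<=` DL. Proof. by move=> p []. Qed.
Let L2_Om (f : plane -> R) : L2 mu DL f -> L2 mu OmL f. Proof. exact: L2S. Qed.
Let L2_Ex (f : plane -> R) : L2 mu DL f -> L2 mu Ex f. Proof. exact: L2S. Qed.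

Local Notation W := (comparison fl T m sa).
Local Notation dW := (dcomparison fl T m sa).
Local Notation V := (flux fl T m sa).
Local Notation dV := (dflux fl T m sa).
Local Notation rho := (weight fl T sa).
Local Notation drho := (dweight fl T sa).
Local Notation c := (height T m sa).
Local Notation P := (amp m sa).
Local Notation k := (kappa m sa).

Let lin := @H1_line_lin R L bl br B bl_C1 br_C1 bl_B br_B.
Let gpos := @H1_line_pos R L bl br B L_gt0 bl_C1 br_C1 bl_B br_B.
Let g1 := H1_line_C1 L bl br B (C1_fun_cst 1).
Let gid := H1_line_C1 L bl br B (@C1_fun_id R).
Let gcomb := @H1_line_exp_comb R L bl br B bl_C1 br_C1 bl_B br_B.

Lemma H1_line_sR : H1_line (sR fl T m sa) (dsR fl T m sa).
Proof.
have := lin sa^-1 (m / sa) (lin 1 (-1) (gpos (fl + T + m)) (gpos (fl + T))) g1.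
by move=> g; apply: (H1_line_ext g) => y; rewrite /sR /dsR /=; ring.
Qed.

Lemma H1_line_sL : H1_line (sL fl m sa) (dsL fl m sa).
Proof.
have := lin sa^-1 (- sa^-1) (gpos (fl - m)) (gpos fl).
by move=> g; apply: (H1_line_ext g) => y; rewrite /sL /dsL /=; ring.
Qed.

Lemma H1_line_W : H1_line W dW.
Proof.
have gh S dS : H1_line S dS -> H1_line (fun y => decay m sa (S y)) (fun y => decay1 m sa (S y) * dS y).
  move=> gS; apply: (H1_line_ext (gcomb P (- 2 * P) P gS)) => y //.
  by rewrite /decay1 !mulNr opprK.
have gR := gh _ _ H1_line_sR; have gL := gh _ _ H1_line_sL.
have gc := lin 1 (- (T / 2)) (lin 1 (-1) (gpos fl) (gpos (fl + T))) g1.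
have := lin (2 * c / T) 1 gc (lin c (- c) gR gL).
by move=> g; apply: (H1_line_ext g) => y; rewrite /comparison /dcomparison /=; ring.
Qed.

Lemma H1_line_V : H1_line V dV.
Proof.
have gs : H1_line (sB fl T m sa) (fun y => dsL fl m sa y + dsR fl T m sa y).
  have := lin 1 (- k) (lin 1 1 H1_line_sL H1_line_sR) g1.
  by move=> g; apply: (H1_line_ext g) => y; rewrite /sB /=; ring.
have gh : H1_line (fun y => decay1 m sa (sB fl T m sa y))
    (fun y => decay2 m sa (sB fl T m sa y) * (dsL fl m sa y + dsR fl T m sa y)).
  apply: (H1_line_ext (gcomb P (2 * P) (- 3 * P) gs)) => y //.
  rewrite /decay2 /exp_comb; ring.
have := lin (- (sa * c)) 0 gh g1.
by move=> g; apply: (H1_line_ext g) => y; rewrite mul0r addr0.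
Qed.

Lemma H1_line_rho : H1_line rho drho.
Proof.
have gt : H1_line (fun y => - ((pos_from fl y - (y - fl) + pos_from (fl + T) y) / sa))
    (fun y => - ((step fl y - 1 + step (fl + T) y) / sa)).
  have := lin (- sa^-1) (- (fl / sa)) (lin 1 1 (lin 1 (-1) (gpos fl) gid) (gpos (fl + T))) g1.
  by move=> g; apply: (H1_line_ext g) => y; rewrite /=; ring.
have g := @H1_line_exp R L bl br B bl_C1 br_C1 bl_B br_B _ _ gt.
by apply: (H1_line_ext g) => y.
Qed.

(** The exterior contains the line at [fr], on which the left-continuous steps still take their
    values from inside the band, so the exterior formula for the flux fails there. The line is null;
    the remaining edges are covered by the non-strict inequalities. *)
Lemma region_cases p : DL p -> p.2 <> fr ->
  OmL p \/ Ex p /\ ((fl - m < p.2 /\ p.2 <= fl) \/ (fr < p.2 /\ p.2 <= fr + m) \/ (p.2 <=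
    fl - m \/ fr + m < p.2)).
Proof.
move=> Dp nfr; have [h|h] := pselect (OmL p); [by left|right; split; first by split].
have nb : ~ (fl < p.2 /\ p.2 < fr) by move=> b; apply: h; split => //; case: Dp.
case: (leP p.2 fl) => h1.
  by case: (leP p.2 (fl - m)) => h2; [right; right; left|left].
have h2 : fr <= p.2 by rewrite leNgt; apply/negP => h2; apply: nb.
have h3 : fr < p.2 by rewrite lt_neqAle h2 andbT; apply/eqP => h3; apply: nfr.
by case: (leP p.2 (fr + m)) => h4; [right; left|right; right; right].
Qed.

Let inside p : OmL p -> [/\ dW p.2 = 2 * c / T, a * dW p.2 = V p.2 + 1, dV p.2 = 0,
  rho p.2 = 1 & drho p.2 = 0].
Proof.
move=> [[h1 h2] _]; rewrite -saE.
by apply: (@profile_inside R fl T m sa T_gt0 m_gt0 sa_gt0); rewrite ?flT.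
Qed.

Lemma flux_outside p : Ex p -> p.2 <> fr -> a * dW p.2 = V p.2.
Proof.
move=> [Dp nO] nfr; case: (region_cases Dp nfr) => [//|[_ [[h1 h2]|[[h1 h2]|h]]]]; rewrite -saE.
- by have [] := profile_left T_gt0 m_gt0 sa_gt0 h1 h2.
- by rewrite -flT in h1 h2; have [] := profile_right T_gt0 m_gt0 sa_gt0 h1 h2.
- by rewrite -flT in h; have [] := profile_far T_gt0 m_gt0 sa_gt0 h.
Qed.

Definition profile : @triple R := (fun p => W p.2, fun=> 0, fun p => dW p.2).

Lemma profile_in_space : space profile.
Proof.
apply: (profile_space bl_C1 br_C1 bl_B br_B H1_line_W) => x.
  by apply: (W_far T_gt0 m_gt0 sa_gt0); left.
by apply: (W_far T_gt0 m_gt0 sa_gt0); right; rewrite flT.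
Qed.

Lemma ip_split (f g : plane -> R) : L2 mu DL f -> L2 mu DL g ->
  ip mu DL f g = ip mu OmL f g + ip mu Ex f g.
Proof.
move=> Lf Lg.
have E : OmL `|` Ex = DL by exact: setDUK OmDL.
have I := L2_mul mDL Lf Lg; rewrite -E in I.
rewrite {1}/ip -{1}E Rintegral_setU//.
by rewrite disj_set2E /Ex setDIK.
Qed.

Definition res y := dV y - W y.

Let LW := H1_line_L2 bl_C1 br_C1 bl_B br_B H1_line_W.
Let LV := H1_line_L2 bl_C1 br_C1 bl_B br_B H1_line_V.

(** [integral_dy] for the product of the flux with [f] moves the derivative onto the flux; this is
    legitimate because the flux has no jump. The difference between [a * dW] and the flux is the
    indicator of the band, which produces the load. *)
Lemma profile_form f : space f ->
  form profile f = load f - ip mu Ex (fun p => res p.2) f.1.1.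
Proof.
move=> Sf; have [[f1 f2 f3] _] := Sf.
have [W1 W2] := LW; have [V1 V2] := LV.
have z : ip mu DL (fun p => V p.2) f.2 + ip mu DL (fun p => dV p.2) f.1.1 = 0.
  have := integral_dy L_gt0 bl_C1 br_C1 bl_br bl_B br_B (multiply_space bl_C1 br_C1 bl_B br_B H1_line_V Sf).
  by move=> <-; rewrite -(Rintegral_mulD mDL V1 f3 V2 f1).
have i0 : ip mu DL (fun=> 0) f.1.2 = 0.
  by rewrite /ip /Rintegral integral0_eq// => p _; rewrite mul0r.
have aO : a * ip mu OmL (fun p => dW p.2) f.2 = ip mu OmL (fun p => V p.2) f.2 + load f.
  have L1 : L2 mu OmL (cst 1) by exact: L2_cst.
  rewrite -ipZl//; [|exact: L2_Om W2|exact: L2_Om f3].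
  have -> : load f = ip mu OmL (cst 1) f.2.
    by rewrite ipC; apply: eq_Rintegral => p _; rewrite mulr1.
  rewrite -ipDl//; [|exact: L2_Om V1|exact: L2_Om f3].
  apply: eq_Rintegral => p /set_mem /inside[_ E _ _ _].
  by congr (_ * _); exact: E.
have aE : a * ip mu Ex (fun p => dW p.2) f.2 = ip mu Ex (fun p => V p.2) f.2.
  rewrite -ipZl//; [|exact: L2_Ex W2|exact: L2_Ex f3].
  have r (g : plane -> R) A : {ae mu, forall p, A p -> g p = g p} by apply: aeW.
  apply: (ae_ip mEx (L2Z a mEx (L2_Ex W2)) (L2_Ex V1) (L2_Ex f3) (L2_Ex f3)) (r _ _).
  by apply: filterS (ae_horizontal fr) => p np Ep; exact: flux_outside.
have dO : ip mu OmL (fun p => dV p.2) f.1.1 = 0.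
  rewrite /ip /Rintegral integral0_eq// => p /inside[_ _ E _ _].
  by rewrite E mul0r.
have rE : ip mu Ex (fun p => res p.2) f.1.1 = ip mu Ex (fun p => dV p.2) f.1.1 - ip mu Ex (fun p => W
  p.2) f.1.1.
  by rewrite -ipBl//; [exact: L2_Ex V2|exact: L2_Ex W1|exact: L2_Ex f1].
move: z; rewrite /form /profile /= i0 add0r -/DL -/OmL -/Ex rE.
rewrite (ip_split W2 f3) (ip_split V1 f3) (ip_split V2 f1) mulrDr aO aE dO.
by move=> z; lra.
Qed.

(* Test the equation of e = S - W with weight * e: by Young's inequality the weight absorbs the exterior terms. *)
Lemma error_bound eS : space eS -> (forall f, space f -> form eS f = load f) ->
  a * ip mu OmL (eS.2 \- (fun p => dW p.2)) (eS.2 \- (fun p => dW p.2)) <=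
  3^-1 * ip mu Ex (fun p => rho p.2 * res p.2) (fun p => res p.2).
Proof.
move=> Se eqS; have Sp := profile_in_space.
pose e : @triple R := eS - profile.
have Sd : space e := spaceB bl_C1 br_C1 bl_B br_B Se Sp.
have [[e1 e2 e3] _] := Sd.
have e2E : eS.2 \- (fun p => dW p.2) = e.2 by [].
rewrite e2E.
have form_e f : space f -> form e f = ip mu Ex (fun p => res p.2) f.1.1.
  move=> Sf; have E : e = -1 *: profile + eS by rewrite scaleN1r addrC.
  rewrite E (formL fl fr bl_C1 br_C1 a (-1) Sp Se Sf) eqS// profile_form//.
  by rewrite mulN1r opprB subrK.
have [r1 r2] := H1_line_L2 bl_C1 br_C1 bl_B br_B H1_line_rho.
have Sm := multiply_space bl_C1 br_C1 bl_B br_B H1_line_rho Sd.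
have [[m1 m2 m3] _] := Sm; have key := form_e _ Sm.
have Lr : L2 mu DL (fun p => res p.2) by exact: (L2B mDL LV.2 LW.1).
have [cr _ [M HM] _] := H1_line_rho.
have bR p : DL p -> `|rho p.2| <= M.
  move=> Dp; have yB : `|p.2| <= B.
    have [_] := unit_channel_box bl_B br_B Dp; rewrite /= in_itv /= => /andP[h1 h2].
    by rewrite ler_norml h1.
  by have [] := HM _ yB.
have mR : measurable_fun (DL : set mplane) (fun p => rho p.2) :=
  @measurable_snd_comp R L bl br _ (measurable_line cr).
have Lrr := L2M mDL Lr mR bR.
have g1ge : 0 <= ip mu DL e.1.2 (multiply rho drho e).1.2.
  rewrite /ip; apply: Rintegral_ge0 => p _ /=.
  rewrite [rho p.2 * _]mulrC mulrA -expr2 mulr_ge0 ?sqr_ge0//.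
  exact: expR_ge0.
have inO : ip mu OmL e.2 (multiply rho drho e).2 = ip mu OmL e.2 e.2.
  apply: eq_Rintegral => p /set_mem /inside[_ _ _ E1 E2].
  by rewrite /= E1 E2 mul1r mul0r addr0.
have X1 := L2_Ex e1; have X3 := L2_Ex e3; have Xm1 := L2_Ex m1; have Xm3 := L2_Ex m3.
have Xr := L2_Ex Lr; have Xrr := L2_Ex Lrr.
have J : ip mu Ex (fun p => res p.2) (multiply rho drho e).1.1 - ip mu Ex e.1.1 (multiply rho drho e).1.1
    - a * ip mu Ex e.2 (multiply rho drho e).2 <= 3^-1 * ip mu Ex (fun p => rho p.2 * res p.2) (fun p =>
      res p.2).
  have F1 := ipBl mEx Xr X1 Xm1; have F2 := ipZl (- a) mEx X3 Xm3.
  have F3 := Rintegral_mulD mEx (L2B mEx Xr X1) Xm1 (L2Z (- a) mEx X3) Xm3.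
  rewrite -F1 -mulNr -F2 -F3 -(ipZl _ mEx Xrr Xr).
  apply: le_Rintegral => //.
  - exact: (L2_mulD mEx (L2B mEx Xr X1) Xm1 (L2Z (- a) mEx X3) Xm3).
  - exact: (L2_mul mEx (L2Z 3^-1 mEx Xrr) Xr).
  move=> p Ep /=.
  exact: (weighted_young _ _ _ sa_gt0 saE (norm_dweight_le fl T_gt0 sa_gt0 p.2) (expR_ge0 _)).
have := key; rewrite /form -/DL -/OmL -/Ex (ip_split e3 m3) inO => key'.
have := a_gt0; move: J key' g1ge.
set x1 := ip mu Ex _ _; set x2 := ip mu Ex _ _; set x3 := ip mu Ex _ _; set x4 := ip mu DL _ _.
set x5 := ip mu OmL _ _; set x6 := ip mu Ex _ _ => J key' g1ge a0.
have : 0 <= a * x4 by rewrite mulr_ge0// ltW.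
move: key'; rewrite !mulrDr; lra.
Qed.

Let w := expR (- k).

(** On either side of the band the integrand is [64 * c ^+ 2 * P ^+ 2] times [expR (- k - 5 * s)]:
    the weight contributes [s - k], the squared residual [- 6 * s]. In [y] this is an exponential of
    rate [5 / sa], and the integral over the distance [m] is [sa / 5 * (w - w ^+ 6)]. *)
Lemma residual_integral :
  ip mu Ex (fun p => rho p.2 * res p.2) (fun p => res p.2) <=
  2 * L * (64 * c ^+ 2 * P ^+ 2) * (sa / 5 * (w - w ^+ 6)).
Proof.
set Q := 64 * c ^+ 2 * P ^+ 2; have Q0 : 0 <= Q by apply: mulr_ge0; [apply: mulr_ge0|]; rewrite ?sqr_ge0.
set al := 5 / sa; have al0 : al != 0 by rewrite mulf_neq0 ?invr_neq0 ?gt_eqF.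
pose C1 := Q * w ^+ 6 * expR (- (al * fr)); pose C2 := Q * w ^+ 6 * expR (al * fl).
have w0 : 0 <= w := expR_ge0 _.
have C10 : 0 <= C1 by apply: mulr_ge0; [apply: mulr_ge0; rewrite ?exprn_ge0|exact: expR_ge0].
have C20 : 0 <= C2 by apply: mulr_ge0; [apply: mulr_ge0; rewrite ?exprn_ge0|exact: expR_ge0].
pose b1 : set mplane := `[0, L] `*` `[fr, fr + m]; pose b2 : set mplane := `[0, L] `*` `[fl - m, fl].
pose f1 (p : plane) := C1 * expR (al * p.2); pose f2 (p : plane) := C2 * expR (- al * p.2).
have mb1 : measurable b1 by exact: measurable_box.
have mb2 : measurable b2 by exact: measurable_box.
have mf (C be : R) : measurable_fun [set: mplane] (fun p : plane => C * expR (be * p.2)).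
  apply: continuous_plane_measurable => p.
  apply: (@continuous_comp _ _ _ snd (fun y => C * expR (be * y))); first exact: cvg_snd.
  apply: cvgM; first exact: cvg_cst.
  by apply: continuous_comp; [apply: cvgM; [exact: cvg_cst|exact: cvg_id]|exact: continuous_expR].
have f10 p : 0 <= f1 p by rewrite mulr_ge0 ?expR_ge0.
have f20 p : 0 <= f2 p by rewrite mulr_ge0 ?expR_ge0.
have p10 p : 0 <= (f1 \_ b1) p by rewrite patchE; case: ifP.
have p20 p : 0 <= (f2 \_ b2) p by rewrite patchE; case: ifP.
have wE n : w ^+ n = expR (- (n%:R * k)) by rewrite /w -expRM_natl mulrN.
have pt p : Ex p -> p.2 <> fr -> rho p.2 * res p.2 * res p.2 <= (f1 \_ b1) p + (f2 \_ b2) p.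
  move=> Ep nfr; have Dp := ExDL Ep.
  have [h|[_ [[h1 h2]|[[h1 h2]|h]]]] := region_cases Dp nfr; first by case: Ep.
  - have [_ r1 r2] := profile_left T_gt0 m_gt0 sa_gt0 h1 h2.
    apply: ler_wpDl => //; rewrite patchE mem_set; last first.
      by split; [have [h _] := unit_channel_box bl_B br_B Dp|rewrite /= in_itv /= (ltW h1) h2].
    rewrite /res r1 r2 /f2 /C2 wE; apply: eq_le_refl.
    set s := k - _; have -> : expR (s - k) * - (8 * c * P * expR (- (3 * s))) * - (8 * c * P * expR (-
      (3 * s))) =
      Q * (expR (s - k) * expR (- (3 * s)) * expR (- (3 * s))) by rewrite /Q; ring.
    have -> : expR (s - k) * expR (- (3 * s)) * expR (- (3 * s)) =
      expR (- (6 * k)) * expR (al * fl) * expR (- al * p.2).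
      by rewrite -!expRD; congr expR; rewrite /s /al; field; rewrite gt_eqF.
    ring.
  - rewrite -flT in h1 h2; have [_ r1 r2] := profile_right T_gt0 m_gt0 sa_gt0 h1 h2.
    apply: ler_wpDr => //; rewrite patchE mem_set; last first.
      by split; [have [h _] := unit_channel_box bl_B br_B Dp|rewrite /= in_itv /= -flT (ltW h1) h2].
    rewrite /res r1 r2 /f1 /C1 wE; apply: eq_le_refl.
    set s := k - _; have -> : expR (s - k) * (8 * c * P * expR (- (3 * s))) * (8 * c * P * expR (- (3 * s))) =
      Q * (expR (s - k) * expR (- (3 * s)) * expR (- (3 * s))) by rewrite /Q; ring.
    have -> : expR (s - k) * expR (- (3 * s)) * expR (- (3 * s)) =
      expR (- (6 * k)) * expR (- (al * fr)) * expR (al * p.2).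
      by rewrite -!expRD; congr expR; rewrite /s /al -flT; field; rewrite gt_eqF.
    ring.
  - rewrite -flT in h; have [_ r1 r2] := profile_far T_gt0 m_gt0 sa_gt0 h.
    by rewrite /res r1 r2 subrr mulr0 addr_ge0.
have [r1 r2] := H1_line_L2 bl_C1 br_C1 bl_B br_B H1_line_rho.
have Lr : L2 mu DL (fun p => res p.2) by exact: (L2B mDL LV.2 LW.1).
have [cr _ [M HM] _] := H1_line_rho.
have bR p : DL p -> `|rho p.2| <= M.
  move=> Dp; have yB : `|p.2| <= B.
    have [_] := unit_channel_box bl_B br_B Dp; rewrite /= in_itv /= => /andP[h1 h2].
    by rewrite ler_norml h1.
  by have [] := HM _ yB.
have mR : measurable_fun (DL : set mplane) (fun p => rho p.2) :=
  @measurable_snd_comp R L bl br _ (measurable_line cr).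
have Lrr := L2_Ex (L2M mDL Lr mR bR); have Xr := L2_Ex Lr.
have mp (C be : R) (b : set mplane) : measurable b ->
    measurable_fun Ex (fun p => (((fun q : plane => C * expR (be * q.2)) \_ b) p)%:E).
  move=> mb; apply/measurable_EFinP; apply: measurable_funTS.
  by apply: (measurable_restrictT _ mb).1; apply: measurable_funTS; exact: mf.
have bx (C be u v : R) (b : set mplane) : b = `[0, L] `*` `[u,
  v] -> measurable b -> u <= v -> 0 <= C -> be != 0 ->
    (\int[mu]_(p in Ex) (((fun q : plane => C * expR (be * q.2)) \_ b) p)%:E <=
     (L * (C / be * (expR (be * v) - expR (be * u))))%:E)%E.
  move=> bE mb uv C0 be0; rewrite -(integral_exp_box L_gt0 uv C0 be0) -bE.
  rewrite [leRHS]integral_mkcond; have -> : (fun p : plane => (C * expR (be * p.2))%:E) \_ b =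
      (fun p : plane => (((fun q : plane => C * expR (be * q.2)) \_ b) p)%:E).
    by apply/funext => p; rewrite !patchE; case: ifP.
  apply: ge0_subset_integral => //.
  - by apply/measurable_EFinP; apply: (measurable_restrictT _ mb).1; apply: measurable_funTS; exact: mf.
  - by move=> p _; rewrite lee_fin patchE; case: ifP => // _; rewrite mulr_ge0 ?expR_ge0.
have m1 := mp C1 al b1 mb1; have m2 := mp C2 (- al) b2 mb2.
rewrite -lee_fin ip_EFin//.
apply: (@le_trans _ _ (\int[mu]_(p in Ex) (((f1 \_ b1) p)%:E + ((f2 \_ b2) p)%:E))%E).
  apply: ae_ge0_le_integral => //.
  - move=> p _; rewrite lee_fin -mulrA -expr2 mulr_ge0 ?sqr_ge0//; exact: expR_ge0.
  - by apply/measurable_EFinP; apply: measurable_funM; [case: Lrr|case: Xr].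
  - by move=> p _; rewrite -EFinD lee_fin addr_ge0.
  - exact: emeasurable_funD.
  - by apply: filterS (ae_horizontal fr) => p np Ep; rewrite -EFinD lee_fin; exact: pt.
rewrite ge0_integralD//; try by move=> p _; rewrite lee_fin.
have m0 := m_gt0.
have le1 : fr <= fr + m by lra.
have le2 : fl - m <= fl by lra.
have al0' : - al != 0 by rewrite oppr_eq0.
apply: le_trans (leeD (bx C1 al _ _ b1 erefl mb1 le1 C10 al0) (bx C2 (- al) _ _ b2 erefl mb2 le2 C20 al0')) _.
rewrite -EFinD lee_fin; apply: eq_le_refl.
have cancel (A u v : R) : u = v + m -> A = Q * w ^+ 6 * expR (- (al * v)) ->
    A * (expR (al * u) - expR (al * v)) = Q * (w - w ^+ 6).
  move=> uv ->.
  have X1 : w ^+ 6 * (expR (- (al * v)) * expR (al * u)) = w.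
    rewrite wE -!expRD /w; congr expR.
    rewrite uv.
    by rewrite /al /kappa; field; rewrite gt_eqF.
  have X0 : expR (- (al * v)) * expR (al * v) = 1 by rewrite -expRD addNr expR0.
  transitivity (Q * (w ^+ 6 * (expR (- (al * v)) * expR (al * u)) - w ^+ 6 * (expR (- (al * v)) * expR
    (al * v)))).
    by ring.
  by rewrite X1 X0 mulr1.
have z1 : C1 * (expR (al * (fr + m)) - expR (al * fr)) = Q * (w - w ^+ 6) by exact: cancel.
have z2 : C2 * (expR (- al * (fl - m)) - expR (- al * fl)) = Q * (w - w ^+ 6).
  have E1 : - al * (fl - m) = al * (- fl + m) by ring.
  have E2 : - al * fl = al * - fl by ring.
  by rewrite E1 E2; apply: cancel => //; rewrite mulrN opprK.
have -> : L * (C1 / al * (expR (al * (fr + m)) - expR (al * fr))) = L / al * (Q * (w - w ^+ 6)).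
  by rewrite -z1; ring.
have -> : L * (C2 / - al * (expR (- al * fl) - expR (- al * (fl - m)))) = L / al * (Q * (w - w ^+ 6)).
  by rewrite -z2 invrN; ring.
rewrite /al invf_div; ring.
Qed.

Let w01 : 0 < w < 1. Proof. exact: expRN_kappa. Qed.
Let q01 : 0 < w ^+ 2 < 1. Proof. exact: q_bounds. Qed.
Let k_gt0 : 0 < k. Proof. exact: kappa_gt0. Qed.

Lemma height_le : c <= (1 - w ^+ 2) / (sa * (1 + 3 * w ^+ 2)).
Proof.
have /andP[q0 q1] := q01; have s1 := slope_ge1 m_gt0 sa_gt0.
rewrite /height -/w; have -> : (1 - w ^+ 2) / (sa * (1 + 3 * w ^+ 2)) = (sa * slope m sa)^-1.
  rewrite /slope -/k -/w; field; rewrite !gt_eqF//; lra.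
have s0 := sa_gt0; have b0 : 0 < slope m sa := lt_le_trans ltr01 s1.
have x0 : 0 < 2 * sa / T by rewrite divr_gt0 ?mulr_gt0.
rewrite lef_pV2 ?posrE; [|exact: mulr_gt0 s0 (addr_gt0 x0 b0)|exact: mulr_gt0].
by rewrite ler_wpM2l ?(ltW s0)// lerDr ltW.
Qed.

(** Once [height] and [amp] are replaced by their bounds, the ratio of the two sides is exactly the
    quantity of [residual_numeric]. The target is such that [sa / 2] times the L^2 error inside the
    band is at most [sqrt (L / m) * w]. *)
Lemma error_energy eS : space eS -> (forall f, space f -> form eS f = load f) ->
  a * ip mu OmL (eS.2 \- (fun p => dW p.2)) (eS.2 \- (fun p => dW p.2)) <= 4 * (L / m * w ^+ 2).
Proof.
move=> Se eqS; apply: le_trans (error_bound Se eqS) _.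
apply: le_trans (ler_wpM2l _ residual_integral) _; first by rewrite invr_ge0.
have /andP[q0 q1] := q01; have /andP[w0 w1] := w01.
have num := residual_numeric k_gt0; rewrite -/w in num.
have P2 : P ^+ 2 = w ^+ 2 / (1 - w ^+ 2) ^+ 4.
  have -> : P = w / (1 - w ^+ 2) ^+ 2.
    rewrite /amp; have -> : expR k = w^-1 by rewrite /w expRN invrK.
    rewrite -/w; field; rewrite !gt_eqF//; lra.
  by rewrite expr_div_n -exprM.
have c2 : c ^+ 2 <= ((1 - w ^+ 2) / (sa * (1 + 3 * w ^+ 2))) ^+ 2.
  rewrite ler_sqr ?nnegrE ?height_le//; first by apply: ltW; exact: height_gt0.
  by rewrite divr_ge0 ?mulr_ge0 ?ltW//; lra.
have w6 : 0 <= w - w ^+ 6.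
  by rewrite subr_ge0 -[leRHS]mulr1 exprS ler_wpM2l ?(ltW w0)// exprn_ile1 // ltW.
have P20 : 0 <= P ^+ 2 by exact: sqr_ge0.
have s0 := sa_gt0; have m0 := m_gt0; have L0 := L_gt0.
apply: (@le_trans _ _ (3^-1 * (2 * L * (64 * ((1 - w ^+ 2) / (sa * (1 + 3 * w ^+ 2))) ^+ 2 * P ^+ 2) *
  (sa / 5 * (w - w ^+ 6))))).
  apply: ler_wpM2l; first by rewrite invr_ge0.
  apply: ler_wpM2r; first by rewrite mulr_ge0// divr_ge0// ltW.
  apply: ler_wpM2l; first by rewrite mulr_ge0// ltW.
  by apply: ler_wpM2r => //; rewrite ler_wpM2l.
set A := (1 - w ^+ 2) ^+ 2 * (1 + 3 * w ^+ 2) ^+ 2 in num.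
have A0 : 0 < A by rewrite mulr_gt0// exprn_gt0//; lra.
have -> : 3^-1 * (2 * L * (64 * ((1 - w ^+ 2) / (sa * (1 + 3 * w ^+ 2))) ^+ 2 * P ^+ 2) * (sa / 5 * (w -
  w ^+ 6))) =
    4 * (L / m * w ^+ 2) * (32 * k * (w - w ^+ 6) / (15 * A)).
  rewrite P2 /A /kappa; field; rewrite !gt_eqF//; lra.
have A15 : 0 < 15 * A by rewrite mulr_gt0.
have B1 : 32 * k * (w - w ^+ 6) / (15 * A) <= 1 by rewrite (ler_pdivrMr _ _ A15) mul1r.
have B0 : 0 <= 4 * (L / m * w ^+ 2).
  by apply: mulr_ge0 => //; apply: mulr_ge0; [apply: divr_ge0; exact: ltW|exact: ltW].
by apply: le_trans (ler_wpM2l B0 B1) _; rewrite mulr1.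
Qed.

(** With [x = 2 * sa / T] and [be] the slope, [1 - sa * c] is [(x + (be - 1)) / (x + be)]. The part
    [x / (x + be)] is at most [x] and gives the term linear in [sa]. The other part must be bounded
    by [sqrt (L / m) * w] whatever [T] is: [4 * x * be <= (x + be) ^+ 2] removes [T], and
    [two_kq_le] brings in [m] through [(be - 1) ^+ 2 * k <= 8 * w ^+ 2 * be]. *)
Lemma profile_slope_le : 0 <= 1 - sa * c /\
  Num.sqrt (L / T) * (1 - sa * c) <= 2 * (Num.sqrt (L * T) / T ^+ 2) * sa + Num.sqrt L / Num.sqrt m * w.
Proof.
have /andP[q0 q1] := q01; have /andP[w0 w1] := w01; have s1 := slope_ge1 m_gt0 sa_gt0.
have s0 := sa_gt0; have m0 := m_gt0; have L0 := L_gt0; have T0 := T_gt0.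
set x := 2 * sa / T; have x0 : 0 < x by rewrite divr_gt0 ?mulr_gt0.
set be := slope m sa in s1.
have xb : 0 < x + be by lra.
have E : 1 - sa * c = (x + (be - 1)) / (x + be).
  rewrite /height -/x -/be; field; rewrite !gt_eqF//.
have E1 : 1 - sa * c = x / (x + be) + (be - 1) / (x + be) by rewrite E mulrDl.
split; first by rewrite E divr_ge0 ?ltW//; lra.
rewrite E1 mulrDr; apply: lerD.
  have -> : Num.sqrt (L * T) = Num.sqrt (L / T) * T.
    have -> : L * T = (L / T) * T ^+ 2 by field; rewrite gt_eqF.
    by rewrite sqrtrM ?divr_ge0 ?ltW// sqrtr_sqr ger0_norm ?ltW.
  have -> : 2 * (Num.sqrt (L / T) * T / T ^+ 2) * sa = Num.sqrt (L / T) * x.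
    by rewrite /x; field; rewrite gt_eqF.
  by rewrite ler_wpM2l ?sqrtr_ge0// ler_pdivrMr// ler_peMr ?(ltW x0)//; lra.
have -> : Num.sqrt L / Num.sqrt m = Num.sqrt (L / m) by rewrite sqrtrM ?ltW// sqrtrV ?ltW.
have be0 : 0 <= (be - 1) / (x + be) by apply: divr_ge0; [rewrite subr_ge0|exact: ltW].
rewrite -[(be - 1) / _](ger0_norm be0) -[w in leRHS](ger0_norm (ltW w0)) -!sqrtr_sqr.
have LT0 : 0 <= L / T by apply: divr_ge0; exact: ltW.
have Lm0 : 0 <= L / m by apply: divr_ge0; exact: ltW.
rewrite -(sqrtrM _ LT0) -(sqrtrM _ Lm0); apply: ler_wsqrtr.
have TE : T = 2 * sa / x by rewrite /x; field; rewrite !gt_eqF.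
have kq := two_kq_le k_gt0; rewrite -/w in kq.
have b1 : (be - 1) ^+ 2 * k <= 8 * w ^+ 2 * be.
  have -> : be - 1 = 4 * w ^+ 2 / (1 - w ^+ 2).
    rewrite /be /slope -/w; field; rewrite gt_eqF//; lra.
  have -> : be = (1 + 3 * w ^+ 2) / (1 - w ^+ 2) by [].
  set q := w ^+ 2 in q0 q1 kq *.
  have -> : (4 * q / (1 - q)) ^+ 2 * k = 8 * q * (2 * k * q) / (1 - q) ^+ 2.
    by field; rewrite gt_eqF//; lra.
  have -> : 8 * q * ((1 + 3 * q) / (1 - q)) = 8 * q * ((1 + 3 * q) * (1 - q)) / (1 - q) ^+ 2.
    by field; rewrite gt_eqF//; lra.
  apply: ler_wpM2r; first by rewrite invr_ge0 sqr_ge0.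
  apply: ler_wpM2l; first by apply: mulr_ge0 => //; exact: ltW.
  by apply: le_trans kq _; rewrite ler_peMl; lra.
have b2 : 4 * (x * be) <= (x + be) ^+ 2 by have := sqr_ge0 (x - be); lra.
have -> : L / T * ((be - 1) / (x + be)) ^+ 2 = L / m * ((be - 1) ^+ 2 * k * x / (2 * (x + be) ^+ 2)).
  by rewrite TE /kappa; field; rewrite !gt_eqF.
have xb2 : 0 < 2 * (x + be) ^+ 2 by apply: mulr_gt0 => //; exact: exprn_gt0.
apply: (ler_wpM2l Lm0); rewrite (ler_pdivrMr _ _ xb2).
have h1 : (be - 1) ^+ 2 * k * x <= 8 * w ^+ 2 * be * x by rewrite ler_wpM2r// ltW.
apply: le_trans h1 _.
have h2 : 2 * w ^+ 2 * (4 * (x * be)) <= 2 * w ^+ 2 * (x + be) ^+ 2.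
  by rewrite ler_wpM2l// mulr_ge0// ltW.
by apply: le_trans _ (le_trans h2 _); rewrite le_eqVlt; apply/orP; left; apply/eqP; ring.
Qed.

Lemma comparison_bound eS : space eS -> (forall f, space f -> form eS f = load f) ->
  Num.sqrt (ip mu OmL (fun p => sa / 2 * eS.2 p - T^-1) (fun p => sa / 2 * eS.2 p - T^-1)) <=
  2 * (Num.sqrt (L * T) / T ^+ 2) * sa + 2 * (Num.sqrt L / Num.sqrt m) * w.
Proof.
move=> Se eqS; have [[_ _ e3] _] := Se; have [_ LdW] := LW.
have Le := L2_Om e3; have Lw := L2_Om LdW.
have Lg := L2Z (sa / 2) mOm (L2B mOm Le Lw).
have Lh : L2 mu OmL (fun p => sa / 2 * dW p.2 - T^-1).
  have L1 := L2_cst L_gt0 fl_fr (T^-1).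
  exact: L2B mOm (L2Z (sa / 2) mOm Lw) L1.
have -> : (fun p => sa / 2 * eS.2 p - T^-1) =
    ((fun p => sa / 2 * dW p.2 - T^-1) \+ ((sa / 2) \*o (eS.2 \- (fun p => dW p.2)))).
  by apply/funext => p /=; ring.
have T0 := T_gt0; have L0 := L_gt0; have s0 := sa_gt0; have m0 := m_gt0.
have /andP[w0 w1] := w01.
have [sc sle] := profile_slope_le.
have h1 : Num.sqrt (ip mu OmL (fun p => sa / 2 * dW p.2 - T^-1) (fun p => sa / 2 * dW p.2 - T^-1)) <=
    2 * (Num.sqrt (L * T) / T ^+ 2) * sa + Num.sqrt L / Num.sqrt m * w.
  apply: le_trans sle; have -> : ip mu OmL (fun p => sa / 2 * dW p.2 - T^-1) (fun p => sa / 2 * dW p.2 -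
    T^-1) =
      (L / T) * (1 - sa * c) ^+ 2.
    have -> : L / T * (1 - sa * c) ^+ 2 = ((sa * c - 1) / T) ^+ 2 * (L * T) by field; rewrite gt_eqF.
    rewrite -(ip_cst L_gt0 fl_fr); apply: eq_Rintegral => p /set_mem /inside[E _ _ _ _].
    have -> : sa / 2 * dW p.2 - T^-1 = (sa * c - 1) / T by rewrite E; field; rewrite gt_eqF.
    by [].
  by rewrite (sqrtrM _ (ltW (divr_gt0 L0 T0))) sqrtr_sqr (ger0_norm sc).
have h2 : Num.sqrt (ip mu OmL ((sa / 2) \*o (eS.2 \- (fun p => dW p.2))) ((sa / 2) \*o (eS.2 \- (fun p
  => dW p.2)))) <=
    Num.sqrt L / Num.sqrt m * w.
  have LB := L2B mOm Le Lw.
  rewrite ipZl ?ipZr//.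
  have -> : Num.sqrt L / Num.sqrt m * w = Num.sqrt (L / m * w ^+ 2).
    by rewrite (sqrtrM _ (ltW (divr_gt0 L0 m0))) sqrtr_sqr (ger0_norm (ltW w0)) (sqrtrM _ (ltW L0))
      (sqrtrV (ltW m0)).
  apply: ler_wsqrtr; have := error_energy Se eqS.
  set I := ip mu OmL _ _ => h; have : sa / 2 * (sa / 2 * I) = (a * I) / 4 by rewrite -saE; field.
  by move=> ->; lra.
apply: le_trans (sqrt_ip_add_le mOm Lh Lg) _; apply: le_trans (lerD h1 h2) _.
by rewrite -addrA lerD2l; lra.
Qed.

End Comparison.

Lemma cauchy_schwarz2 (R : realDomainType) (x y A1 A2 B1 B2 : R) : 0 <= A1 -> 0 <= A2 -> 0 <= B1 -> 0 <= B2 ->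
  `|x| <= A1 * B1 -> `|y| <= A2 * B2 -> (x + y) ^+ 2 <= (A1 ^+ 2 + A2 ^+ 2) * (B1 ^+ 2 + B2 ^+ 2).
Proof.
move=> a1 a2 b1 b2 h1 h2.
have h : `|x + y| <= A1 * B1 + A2 * B2 by apply: le_trans (ler_normD _ _) (lerD h1 h2).
have h' : (x + y) ^+ 2 <= (A1 * B1 + A2 * B2) ^+ 2.
  by rewrite -[leLHS]real_normK ?num_real// ler_sqr ?nnegrE// addr_ge0// mulr_ge0.
apply: le_trans h' _; rewrite -subr_ge0.
have -> : (A1 ^+ 2 + A2 ^+ 2) * (B1 ^+ 2 + B2 ^+ 2) - (A1 * B1 + A2 * B2) ^+ 2 = (A1 * B2 - A2 * B1) ^+
  2 by ring.
exact: sqr_ge0.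
Qed.

Lemma pow_shift (R : comNzRingType) (t x : R) n :
  (t ^+ n.+1) ^+ 2 * (x ^+ 2) ^+ n = t ^+ 2 * ((t * x) ^+ 2) ^+ n.
Proof. by rewrite [t ^+ n.+1]exprS [(t * t ^+ n) ^+ 2]exprMn -mulrA (exprAC t n 2) -exprMn -exprMn. Qed.

Lemma pow_shiftS (R : comNzRingType) (t x : R) n :
  (t ^+ n.+1) ^+ 2 * (x ^+ 2) ^+ n.+1 = (t * x) ^+ 2 * ((t * x) ^+ 2) ^+ n.
Proof. by rewrite (exprAC t n.+1 2) -exprMn -exprMn exprS. Qed.

Lemma bounded_series_cvg0 (R : realType) (u : nat -> R) (M : R) :
  (forall N, \sum_(n < N) `|u n| <= M) -> u n @[n --> \oo] --> (0 : R).
Proof.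
by move=> h; apply: norm_cvg0; apply: cvg_series_cvg_0; exact: bounded_series_cvg h.
Qed.

Lemma cvg_shifted_error (R : realType) (u e : nat -> R) (s : R) :
  (forall N, u N.+1 = s - e N) -> e N @[N --> \oo] --> (0 : R) -> u N @[N --> \oo] --> s.
Proof.
move=> ue ce; have c1 : (s : R) @[N --> \oo] --> (s : R) by exact: cvg_cst.
have c2 : (fun N => u N.+1) @ \oo --> s.
  have -> : (fun N => u N.+1) = (fun N => s - e N) by apply/funext.
  have c3 : (fun N => s - e N) @ \oo --> s - 0 by exact: cvgB c1 ce.
  by rewrite subr0 in c3.
by move: c2; rewrite (cvg_shiftS u).
Qed.

(** * Power series of the solution in the parameter *)

Section Resolvent.
Context {R : realType}.
Local Notation plane := (R * R)%type.
Local Notation mplane := (measurableTypeR R * measurableTypeR R)%type.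
Local Notation mu := (plane_measure R).
Variables (L : R) (bl br : R -> R) (B : R) (fl fr : R).
Hypotheses (bl_C1 : C1_line bl) (br_C1 : C1_line br).
Hypotheses (bl_B : forall x, `|bl x| <= B) (br_B : forall x, `|br x| <= B).
Hypotheses (bl_fl : forall x, bl x < fl) (fl_fr : fl < fr) (fr_br : forall x, fr < br x).

Let D : set plane := channel bl br.
Let DL : set mplane := unit_region L D.
Let OmL : set mplane := unit_region L (band fl fr).
Let Ex : set mplane := DL `\` OmL.
Local Notation space := (space L bl br).
Local Notation form := (form L bl br fl fr).
Local Notation load := (load L fl fr).
Let mDL : measurable DL := measurable_unit_channel L bl_C1 br_C1.

Definition grad_product (e f : @triple R) : R := ip mu DL e.1.2 f.1.2 + ip mu DL e.2 f.2.

Lemma grad_product_ge0 e : 0 <= grad_product e e.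
Proof. by rewrite addr_ge0 ?ip_ge0. Qed.

Lemma gprodC e f : grad_product e f = grad_product f e.
Proof. by rewrite /grad_product (ipC mu DL e.1.2) (ipC mu DL e.2). Qed.

Lemma gprodL k e f g : space e -> space f -> space g ->
  grad_product (k *: e + f) g = k * grad_product e g + grad_product f g.
Proof.
move=> [[_ e2 e3] _] [[_ f2 f3] _] [[_ g2 g3] _]; rewrite /grad_product.
have -> := ip_linl k mDL e2 f2 g2; have -> := ip_linl k mDL e3 f3 g3; ring.
Qed.

Lemma grad_product_cauchy_schwarz e f : space e -> space f -> grad_product e f ^+ 2 <=
  grad_product e e * grad_product f f.
Proof.
move=> [[_ e2 e3] _] [[_ f2 f3] _]; rewrite /grad_product.
have h2 := norm_ip_le mDL e2 f2; have h3 := norm_ip_le mDL e3 f3.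
have := cauchy_schwarz2 (sqrtr_ge0 _) (sqrtr_ge0 _) (sqrtr_ge0 _) (sqrtr_ge0 _) h2 h3.
by rewrite !sqr_sqrtr ?ip_ge0.
Qed.

Lemma formE a e f : form a e f = a * grad_product e f + ip mu Ex e.1.1 f.1.1.
Proof. by []. Qed.

(** Lowering the parameter perturbs the form by a multiple of the Dirichlet product, so solving for
    the lower parameter is a Neumann series for the map [resolvent_step]. *)
Lemma form_sub a t e f : form (a - t) e f = form a e f - t * grad_product e f.
Proof. by rewrite !formE; ring. Qed.

(** Test with [e], drop the exterior term and use Cauchy-Schwarz: in the Dirichlet seminorm the
    resolvent has norm at most [a^-1]. With [t = 1] this bounds the iterates, with a power of [t]
    the remainder of the series. *)
Lemma energy_le a t e r : 0 < a -> space e -> space r ->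
  (forall f, space f -> form a e f = t * grad_product r f) ->
  a ^+ 2 * grad_product e e <= t ^+ 2 * grad_product r r.
Proof.
move=> a0 Se Sr /(_ e Se); rewrite formE => E.
have := grad_product_cauchy_schwarz Sr Se; have e0 := grad_product_ge0 e; have r0 := grad_product_ge0 r.
have x0 := ip_ge0 mu Ex e.1.1.
move: E e0 r0 x0; move: (grad_product e e) (grad_product r r) (grad_product r e) (ip _ _ _ _) => X Y Z U
  E X0 Y0 U0 CS.
have aX0 : 0 <= a * X by rewrite mulr_ge0// ltW.
have h1 : a * X <= t * Z by lra.
have h2 : (a * X) ^+ 2 <= (t * Z) ^+ 2 by rewrite ler_sqr ?nnegrE//; exact: le_trans aX0 h1.
have h3 : a ^+ 2 * X * X <= t ^+ 2 * Y * X.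
  have -> : a ^+ 2 * X * X = (a * X) ^+ 2 by ring.
  apply: le_trans h2 _; rewrite exprMn -mulrA; apply: ler_wpM2l => //; exact: sqr_ge0.
move: X0; rewrite le_eqVlt => /orP[/eqP X0|X0]; last by rewrite ler_pM2r in h3.
by rewrite -X0 mulr0 mulr_ge0// sqr_ge0.
Qed.

Lemma resolvent_step_exists a r : 0 < a -> space r ->
  exists2 e, space e & forall f, space f -> form a e f = grad_product r f.
Proof.
move=> a0 Sr.
apply: (weak_problem_exists bl_C1 br_C1 bl_B br_B bl_fl fl_fr fr_br a0 (grad_product_ge0 r)).
  by move=> k e f Se Sf; rewrite gprodC gprodL// [grad_product e r]gprodC [grad_product f r]gprodC.
move=> e Se; apply: le_trans (grad_product_cauchy_schwarz Sr Se) _.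
apply: ler_wpM2l; first exact: grad_product_ge0.
by rewrite /grad_product /nrm2 -addrA lerDr ip_ge0.
Qed.

Variables (a : R) (S : @triple R).
Hypotheses (a_gt0 : 0 < a) (S_space : space S).
Hypothesis S_sol : forall f, space f -> form a S f = load f.

(** Selecting one solution fixes representatives of all iterates independently of the parameter
    shift, without which pointwise statements for uncountably many shifts would make no sense. *)
Definition resolvent_step (r : @triple R) : @triple R :=
  xget 0 [set e | space e /\ forall f, space f -> form a e f = grad_product r f].

Lemma resolvent_stepP r : space r -> space (resolvent_step r) /\ forall f,
  space f -> form a (resolvent_step r) f = grad_product r f.
Proof.
move=> /(resolvent_step_exists a_gt0)[e Se He].
exact: (@xgetPex _ 0 [set e | space e /\ forall f,
  space f -> form a e f = grad_product r f] (ex_intro _ e (conj Se He))).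
Qed.

Definition iterate n : @triple R := iter n resolvent_step S.

Lemma iterate_space n : space (iterate n).
Proof. by elim: n => [|n IH] //=; have [] := resolvent_stepP IH. Qed.

Lemma iterate_sol n f : space f -> form a (iterate n.+1) f = grad_product (iterate n) f.
Proof. by move=> Sf; have [_ ->] := resolvent_stepP (iterate_space n). Qed.

Lemma iterate_gprod n : grad_product (iterate n) (iterate n) <= (a^-1 ^+ 2) ^+ n * grad_product S S.
Proof.
elim: n => [|n IH]; first by rewrite expr0 mul1r.
have E := energy_le a_gt0 (iterate_space n.+1) (iterate_space n) (t := 1)
  (fun f Sf => etrans (iterate_sol n Sf) (esym (mul1r _))).
have a2 : 0 < a ^+ 2 by rewrite exprn_gt0.
rewrite exprS -mulrA [X in _ <= X * _]exprVn ler_pdivlMl//.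
by apply: le_trans E _; rewrite expr1n mul1r.
Qed.

Definition partial_sum (t : R) N : @triple R := \sum_(n < N) t ^+ n *: iterate n.

Lemma partial_sum_space t N : space (partial_sum t N).
Proof.
rewrite /partial_sum; elim: N => [|N IH]; first by rewrite big_ord0; exact: space0.
by rewrite big_ord_recr /= addrC; apply: space_lin => //; exact: iterate_space.
Qed.

Lemma partial_sum_dy t N p : (partial_sum t N).2 p = \sum_(n < N) t ^+ n * (iterate n).2 p.
Proof.
by rewrite /partial_sum; elim: N => [|N IH]; rewrite ?big_ord0// !big_ord_recr /= -IH.
Qed.

Lemma partial_sum_sol t N f : space f ->
  form (a - t) (partial_sum t N.+1) f = load f - t ^+ N.+1 * grad_product (iterate N) f.
Proof.
move=> Sf; elim: N => [|N IH].
  by rewrite /partial_sum big_ord1 expr0 scale1r form_sub S_sol// expr1.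
have Se := partial_sum_space t N.+1; have Si := iterate_space N.+1.
have -> : partial_sum t N.+2 = t ^+ N.+1 *: iterate N.+1 + partial_sum t N.+1.
  by rewrite /partial_sum big_ord_recr addrC.
rewrite (formL fl fr bl_C1 br_C1 _ _ Si Se Sf) IH form_sub iterate_sol// [t ^+ N.+2]exprS; ring.
Qed.

Lemma partial_sum_error t N Sb : 0 < a - t -> space Sb -> (forall f, space f -> form (a - t) Sb f = load f) ->
  (a - t) ^+ 2 * grad_product (Sb - partial_sum t N.+1) (Sb - partial_sum t N.+1) <=
  (t ^+ N.+1) ^+ 2 * ((a^-1 ^+ 2) ^+ N * grad_product S S).
Proof.
move=> b0 SSb Sbsol; have Sp := partial_sum_space t N.+1.
have Sd := spaceB bl_C1 br_C1 bl_B br_B SSb Sp.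
apply: le_trans (energy_le b0 Sd (iterate_space N) (t := t ^+ N.+1) _) _.
  move=> f Sf; have -> : Sb - partial_sum t N.+1 = -1 *: partial_sum t N.+1 + Sb by rewrite scaleN1r addrC.
  rewrite (formL fl fr bl_C1 br_C1 _ _ Sp SSb Sf) Sbsol// partial_sum_sol//; ring.
by apply: ler_wpM2l; [exact: sqr_ge0|exact: iterate_gprod].
Qed.

Definition series_dy (t : R) (p : plane) : R := limn (fun N => (partial_sum t N).2 p).

Lemma quarter_le (x : R) n : 0 <= x -> x <= 2^-1 -> (x ^+ 2) ^+ n <= 4^-1 ^+ n.
Proof.
move=> x0 x2; rewrite lerXn2r ?nnegrE ?sqr_ge0//.
have : x * x <= 2^-1 * 2^-1 by apply: ler_pM.
by rewrite expr2; lra.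
Qed.

Lemma ip_dy_le e : ip mu DL e.2 e.2 <= grad_product e e.
Proof. by rewrite lerDr ip_ge0. Qed.

(** For [t <= a / 2] the squared remainder gains a factor 4 per term, the rate at which L^2
    convergence becomes convergence almost everywhere. The null set may depend on [t] here, since
    the sum is compared with a representative of the solution at this one parameter. *)
Lemma series_dy_sol t Sb : 0 <= t -> t <= a / 2 -> space Sb ->
  (forall f, space f -> form (a - t) Sb f = load f) ->
  {ae mu, forall p, DL p -> (partial_sum t N).2 p @[N --> \oo] --> Sb.2 p}.
Proof.
move=> t0 ta SSb Sbsol; have b0 : 0 < a - t by have := a_gt0; lra.
pose f N := (Sb - partial_sum t N.+1).2.
have Lf N : L2 mu DL (f N).
  by have [[_ _ h] _] := spaceB bl_C1 br_C1 bl_B br_B SSb (partial_sum_space t N.+1).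
set C := t ^+ 2 * grad_product S S / (a - t) ^+ 2.
have C0 : 0 <= C := divr_ge0 (mulr_ge0 (sqr_ge0 _) (grad_product_ge0 _)) (sqr_ge0 _).
have bd N : ip mu DL (f N) (f N) <= C * 4^-1 ^+ N.
  apply: le_trans (ip_dy_le _) _.
  have h := partial_sum_error N b0 SSb Sbsol.
  have b2 : 0 < (a - t) ^+ 2 by rewrite exprn_gt0.
  rewrite -(ler_pM2l b2); apply: le_trans h _.
  have -> : (a - t) ^+ 2 * (C * 4^-1 ^+ N) = t ^+ 2 * grad_product S S * 4^-1 ^+ N.
    by rewrite /C; field; rewrite gt_eqF.
  have -> : (t ^+ N.+1) ^+ 2 * (a^-1 ^+ 2 ^+ N * grad_product S S) = t ^+ 2 * grad_product S S * ((t /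
    a) ^+ 2) ^+ N.
    by rewrite mulrA pow_shift; ring.
  apply: ler_wpM2l; first exact: mulr_ge0 (sqr_ge0 _) (grad_product_ge0 _).
  by apply: quarter_le; [rewrite divr_ge0// ltW|rewrite ler_pdivrMr// mulrC].
have [h [mh h0 _ hN]] := L2_series_ae mDL Lf C0 bd.
apply: filterS hN => p hp Dp.
have cv : f N p @[N --> \oo] --> (0 : R).
  apply: (@bounded_series_cvg0 _ _ (Num.sqrt (h p))) => N.
  rewrite -[leLHS]ger0_norm ?sumr_ge0// -sqrtr_sqr; apply: ler_wsqrtr; exact: hp.
apply: (cvg_shifted_error _ cv) => N.
by rewrite /f /= opprB addrC subrK.
Qed.

(** The terms at the largest shift [d] dominate those at every shift between 0 and [d], so one null
    set serves all of them. The term of order 0 is left out: the rest measures the departure from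
    [S], whence the factor [(d / a) ^+ 2]. *)
Lemma iterate_tail d : 0 <= d -> d <= a / 2 -> exists h : plane -> R,
  [/\ measurable_fun (DL : set mplane) h, forall p, DL p -> 0 <= h p,
      (\int[mu]_(p in DL) (h p)%:E <= (4 * ((d / a) ^+ 2 * grad_product S S))%:E)%E &
      {ae mu, forall p, DL p -> forall N, (\sum_(n < N) `|d ^+ n.+1 * (iterate n.+1).2 p|) ^+ 2 <= h p}].
Proof.
move=> d0 da.
apply: (@L2_series_ae _ _ _ mu DL (fun n p => d ^+ n.+1 * (iterate n.+1).2 p) ((d / a) ^+ 2 *
  grad_product S S) mDL).
- by move=> n; apply: L2Z => //; have [[_ _ h] _] := iterate_space n.+1.
- exact: mulr_ge0 (sqr_ge0 _) (grad_product_ge0 _).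
move=> n; have [[_ _ Ln] _] := iterate_space n.+1.
have -> : ip mu DL (fun p => d ^+ n.+1 * (iterate n.+1).2 p) (fun p => d ^+ n.+1 * (iterate n.+1).2 p) =
    (d ^+ n.+1) ^+ 2 * ip mu DL (iterate n.+1).2 (iterate n.+1).2.
  have LZ := L2Z (d ^+ n.+1) mDL Ln.
  by rewrite -[LHS]/(ip mu DL (_ \*o _) (_ \*o _)) ipZl ?ipZr// mulrA -expr2.
apply: le_trans (ler_wpM2l (sqr_ge0 _) (le_trans (ip_dy_le _) (iterate_gprod n.+1))) _.
have -> : (d ^+ n.+1) ^+ 2 * (a^-1 ^+ 2 ^+ n.+1 * grad_product S S) = (d / a) ^+ 2 * grad_product S S *
  ((d / a) ^+ 2) ^+ n.
  by rewrite mulrA pow_shiftS mulrAC.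
apply: ler_wpM2l; first exact: mulr_ge0 (sqr_ge0 _) (grad_product_ge0 _).
by apply: quarter_le; [rewrite divr_ge0// ltW|rewrite ler_pdivrMr// mulrC].
Qed.

Lemma series_dy_tail d t p (M : R) : 0 <= t -> t <= d -> 0 <= M ->
  (forall N, (\sum_(n < N) `|d ^+ n.+1 * (iterate n.+1).2 p|) ^+ 2 <= M ^+ 2) ->
  `|series_dy t p - S.2 p| <= M.
Proof.
move=> t0 td M0 H; have d0 : 0 <= d := le_trans t0 td.
pose u n := t ^+ n.+1 * (iterate n.+1).2 p.
have bd N : \sum_(n < N) `|u n| <= M.
  have := H N; rewrite ler_sqr ?nnegrE ?sumr_ge0// => h; apply: le_trans h; apply: ler_sum => n _.
  by rewrite /u !normrM ler_wpM2r// !ger0_norm ?exprn_ge0// lerXn2r.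
have cu : cvgn (series u) by apply: normed_cvg; exact: bounded_series_cvg bd.
have E N : (partial_sum t N.+1).2 p = S.2 p + series u N.
  rewrite partial_sum_dy big_ord_recl expr0 mul1r; congr (_ + _).
  by rewrite /series /= big_mkord; apply: eq_bigr => i _.
have lE : series_dy t p = S.2 p + limn (series u).
  apply: cvg_lim => //; have c0 : S.2 p + limn (series u) - (S.2 p + series u N) @[N --> \oo] --> (0 : R).
    rewrite -(subrr (S.2 p + limn (series u))).
    by apply: cvgB; [exact: cvg_cst|apply: cvgD; [exact: cvg_cst|exact: cu]].
  by apply: (cvg_shifted_error _ c0) => N; rewrite E subKr.
rewrite lE addrC addKr.
have h N : `|series u N| <= M.
  apply: le_trans _ (bd N); rewrite /series /= big_mkord; exact: ler_norm_sum.
rewrite ler_norml; apply/andP; split.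
- apply: limr_ge => //; apply: nearW => N; by have := h N; rewrite ler_norml => /andP[].
- apply: limr_le => //; apply: nearW => N; by have := h N; rewrite ler_norml => /andP[].
Qed.

End Resolvent.

(** * Convergence to zero from summable integrals *)

Section SummableAe.
Context d (T : measurableType d) (R : realType) (mu : {measure set T -> \bar R}).

(** The bound by differences of a nonnegative sequence makes summability of the integrals a
    telescoping sum, so no convergence test for a concrete series is needed. *)
Lemma ae_summable_cvg0 (A : set T) (g : nat -> T -> R) (K : R) (c : nat -> R) : measurable A ->
  (forall n, measurable_fun A (g n)) -> (forall n x, A x -> 0 <= g n x) -> 0 <= K -> (forall n, 0 <= c n) ->
  (forall n, (\int[mu]_(x in A) (g n x)%:E <= (K * (c n - c n.+1))%:E)%E) ->
  {ae mu, forall x, A x -> g n x @[n --> \oo] --> (0 : R)}.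
Proof.
move=> mA mg g0 K0 c0 gK.
have tel N : \sum_(n < N) (K * (c n - c n.+1)) = K * (c 0%N - c N).
  by elim: N => [|N IH]; rewrite ?big_ord0 ?subrr ?mulr0// big_ord_recr /= IH; ring.
have [|H [_ _ _ aeH]] := @ge0_series_ae _ _ _ mu A g (K * c 0%N) mA mg g0.
  move=> N; apply: (@le_trans _ _ (\sum_(n < N) (K * (c n - c n.+1))%:E)%E).
    by apply: lee_sum => n _.
  rewrite sumEFin lee_fin tel; apply: ler_wpM2l => //.
  by rewrite lerBlDr lerDl.
apply: filterS aeH => x Hx Ax; apply: (@bounded_series_cvg0 _ _ (H x)) => N.
by under eq_bigr do rewrite (ger0_norm (g0 _ _ Ax)); exact: Hx.
Qed.

End SummableAe.

(** * The harmonic nodes *)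

Section Nodes.
Context {R : realType}.

Definition node (i : nat) : R := i.+1%:R^-1.

Lemma node_gt0 i : 0 < node i.
Proof. by rewrite invr_gt0. Qed.

Lemma node_le1 i : node i <= 1.
Proof. by rewrite invf_le1// ler1n. Qed.

Lemma node_diff i : node i - node i.+1 = node i.+1 * node i.
Proof.
have p1 : i.+1%:R != 0 :> R by rewrite pnatr_eq0.
have p2 : i.+2%:R != 0 :> R by rewrite pnatr_eq0.
have E : i.+2%:R = i.+1%:R + 1 :> R by rewrite -natr1.
rewrite /node E; rewrite E in p2; move: p1 p2; move: (i.+1%:R : R) => x x0 x1.
by field; rewrite x0 x1.
Qed.

(** The relative gap between consecutive nodes, which tends to 0; it is the ratio [d / a] of
    [iterate_tail]. *)
Lemma node_step i : (node i - node i.+1) / node i = node i.+1.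
Proof. by rewrite node_diff mulfK// gt_eqF// node_gt0. Qed.

Lemma node_half i : node i.+1 <= 2^-1.
Proof. by rewrite lef_pV2 ?posrE// ler_nat. Qed.

Lemma node_decr i : node i.+1 <= node i.
Proof. by rewrite lef_pV2 ?posrE// ler_nat. Qed.

Lemma node_sqr_le i : node i ^+ 2 <= 2 * (node i - node i.+1).
Proof.
have n0 := node_gt0 i; rewrite node_diff.
rewrite expr2 mulrA ler_wpM2r ?(ltW n0)// /node ler_pdivlMr//.
rewrite mulrC ler_pdivrMr// -natrM ler_nat; lia.
Qed.

Lemma cvg_node : node i @[i --> \oo] --> (0 : R).
Proof. exact: cvg_harmonic. Qed.

(* The terms (i+2)^-2 (i+1)^(1/2) are compared with the telescoping differences (i+1)^(-1/2) - (i+2)^(-1/2). *)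
Lemma node_sqrt_le i : node i.+1 ^+ 2 / Num.sqrt (node i) <= 2 * (Num.sqrt (node i) - Num.sqrt (node i.+1)).
Proof.
set u := Num.sqrt (node i); set v := Num.sqrt (node i.+1).
have u0 : 0 < u by rewrite sqrtr_gt0 node_gt0.
have v0 : 0 < v by rewrite sqrtr_gt0 node_gt0.
have uE : u ^+ 2 = node i by rewrite sqr_sqrtr// ltW// node_gt0.
have vE : v ^+ 2 = node i.+1 by rewrite sqr_sqrtr// ltW// node_gt0.
have vu : v <= u by apply: ler_wsqrtr; exact: node_decr.
have E : u ^+ 2 - v ^+ 2 = v ^+ 2 * u ^+ 2.
  by rewrite uE vE node_diff.
rewrite -vE ler_pdivrMr//.
have uv0 : 0 < u + v by rewrite addr_gt0.
rewrite -(ler_pM2r uv0).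
have -> : 2 * (u - v) * u * (u + v) = 2 * u * (v ^+ 2 * u ^+ 2) by rewrite -E; ring.
have -> : 2 * u * (v ^+ 2 * u ^+ 2) = v ^+ 2 * (2 * u * u ^+ 2) by ring.
have -> : (v ^+ 2) ^+ 2 * (u + v) = v ^+ 2 * (v ^+ 2 * (u + v)) by ring.
apply: ler_wpM2l; first exact: sqr_ge0.
have h1 : v ^+ 2 <= u ^+ 2 by rewrite ler_sqr ?nnegrE// ltW.
have h2 : u + v <= 2 * u by lra.
rewrite [leRHS]mulrC; apply: ler_pM => //; [exact: sqr_ge0|exact: ltW].
Qed.

(** The predecessor compensates for [node i] being the inverse of [i.+1]: the result is the last
    node not below [b], provided [b <= 1]. *)
Definition node_index (b : R) : nat := (Num.truncn b^-1).-1.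

Lemma node_indexP b : 0 < b -> b <= 1 -> node (node_index b).+1 < b <= node (node_index b).
Proof.
move=> b0 b1; have i0 : 0 <= b^-1 by rewrite invr_ge0 ltW.
have i1 : 1%:R <= b^-1 by rewrite invf_ge1.
have n1 : (0 < Num.truncn b^-1)%N by rewrite truncn_ge_nat.
have /andP[h1 h2] := truncn_itv i0.
rewrite /node /node_index prednK//; apply/andP; split.
- by rewrite -[ltRHS]invrK ltf_pV2 ?posrE ?invr_gt0.
- by rewrite -[leLHS]invrK lef_pV2 ?posrE ?invr_gt0 ?ltr0n.
Qed.

Lemma node_index_ge b N : 0 < b -> b < node N -> (N <= node_index b)%N.
Proof.
move=> b0 bN; have i0 : 0 <= b^-1 by rewrite invr_ge0 ltW.
suff h : (N.+1 <= Num.truncn b^-1)%N by rewrite /node_index -ltnS prednK// (leq_trans _ h).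
rewrite truncn_ge_nat//; apply: ltW; rewrite -[ltLHS]invrK ltf_pV2 ?posrE ?invr_gt0//.
Qed.

End Nodes.

(** The fourth power is what summability asks for: with [k = m / sqrt a] the bound is a multiple of
    [a ^+ 2], and squares of the nodes are summable. *)
Lemma expN_sqr_le (R : realType) (k : R) : 0 < k -> expR (- k) ^+ 2 <= 16 / k ^+ 4.
Proof.
move=> k0; have k4 : 0 < k ^+ 4 by exact: exprn_gt0.
have E : expR (- k) ^+ 2 * expR (k / 2) ^+ 4 = 1.
  by rewrite -!expRM_natl -expRD -[RHS]expR0; congr expR; field.
have h1 : k / 2 <= expR (k / 2) by apply: le_trans (expR_ge1Dx _); lra.
have h2 : (k / 2) ^+ 4 <= expR (k / 2) ^+ 4 by rewrite lerXn2r ?nnegrE ?expR_ge0//; lra.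
rewrite ler_pdivlMr//; have -> : k ^+ 4 = 16 * (k / 2) ^+ 4 by field.
rewrite mulrCA -[leRHS]mulr1 ler_wpM2l// -[leRHS]E ler_wpM2l// exprn_ge0// expR_ge0 //.
Qed.

(** * Almost everywhere convergence along the full limit *)

Section FamilyConvergence.
Context {R : realType}.
Local Notation plane := (R * R)%type.
Local Notation mplane := (measurableTypeR R * measurableTypeR R)%type.
Local Notation mu := (plane_measure R).
Variables (L : R) (bl br : R -> R) (B : R) (fl fr m : R).
Hypothesis L_gt0 : 0 < L.
Hypotheses (bl_C1 : C1_line bl) (br_C1 : C1_line br).
Hypotheses (bl_B : forall x, `|bl x| <= B) (br_B : forall x, `|br x| <= B).
Hypotheses (m_gt0 : 0 < m) (fl_fr : fl < fr).
Hypotheses (bl_fl : forall x, bl x <= fl - m) (fr_br : forall x, fr + m <= br x).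

Let T := fr - fl.
Let T_gt0 : 0 < T. Proof. by rewrite subr_gt0. Qed.
Let T_ge0 : 0 <= T := ltW T_gt0.
Let L_ge0 : 0 <= L := ltW L_gt0.
Let m_ge0 : 0 <= m := ltW m_gt0.
Let bl_fl' x : bl x < fl. Proof. by apply: le_lt_trans (bl_fl x) _; rewrite ltrBlDr ltrDl. Qed.
Let fr_br' x : fr < br x. Proof. by apply: lt_le_trans (fr_br x); rewrite ltrDl. Qed.

Let D : set plane := channel bl br.
Let DL : set mplane := unit_region L D.
Let OmL : set mplane := unit_region L (band fl fr).
Local Notation space := (space L bl br).
Local Notation form := (form L bl br fl fr).
Local Notation load := (load L fl fr).
Local Notation grad_product := (grad_product L bl br).
Let mDL : measurable DL := measurable_unit_channel L bl_C1 br_C1.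
Let mOm : measurable OmL := measurable_unit_band L fl fr.
Let OmDL : OmL `<=` DL := unit_band_sub bl_fl' fr_br'.
Let L2_Om (f : plane -> R) : L2 mu DL f -> L2 mu OmL f. Proof. exact: L2S. Qed.

Variable SS : R -> @triple R.
Hypothesis SS_space : forall a : R, 0 < a -> space (SS a).
Hypothesis SS_sol : forall a : R, 0 < a -> forall f, space f -> form a (SS a) f = load f.

(** Testing the equation with its solution bounds the left-hand side by the load, hence by a
    multiple of the L^2 norm of the y-derivative in the band; [comparison_bound] shows that this
    norm is at most a multiple of the inverse of [Num.sqrt a]. *)
Lemma energy_growth : exists2 C : R, 0 <= C & forall a, 0 < a -> a <= 1 ->
  a * grad_product (SS a) (SS a) <= C / Num.sqrt a.
Proof.
have T0 := T_gt0; have L0 := L_gt0; have m0 := m_gt0.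
set K1 := 2 * (Num.sqrt (L * T) / T ^+ 2); set K2 := 2 * (Num.sqrt L / Num.sqrt m).
have K10 : 0 <= K1 by rewrite mulr_ge0// divr_ge0 ?sqrtr_ge0 ?sqr_ge0.
have K20 : 0 <= K2 by rewrite mulr_ge0// divr_ge0 ?sqrtr_ge0.
set s1 := Num.sqrt (L * T); have s10 : 0 <= s1 := sqrtr_ge0 _.
set K := K1 + K2 + s1 / T.
have sT : 0 <= s1 / T by rewrite divr_ge0.
have K0 : 0 <= K by rewrite !addr_ge0.
exists (2 * K * s1); first by rewrite mulr_ge0// mulr_ge0.
move=> a a0 a1; have sa0 : 0 < Num.sqrt a by rewrite sqrtr_gt0.
have sa1 : Num.sqrt a <= 1 by rewrite -sqrtr1; exact: ler_wsqrtr.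
have [[_ _ e3] _] := SS_space a0; have Le := L2_Om e3.
have cb := comparison_bound L_gt0 bl_C1 br_C1 bl_B br_B m_gt0 a0 fl_fr bl_fl fr_br (SS_space a0) (SS_sol a0).
have w1 : expR (- kappa m (Num.sqrt a)) <= 1 by rewrite -expR0 ler_expR oppr_le0 divr_ge0// sqrtr_ge0.
set I := ip mu OmL (SS a).2 (SS a).2.
have E : Num.sqrt a / 2 * Num.sqrt I <= K.
  have Lc := L2_cst L_gt0 fl_fr (T^-1).
  have Lm := L2B mOm (L2Z (Num.sqrt a / 2) mOm Le) Lc.
  have := sqrt_ip_add_le mOm Lm Lc.
  have -> : ((Num.sqrt a / 2) \*o (SS a).2 \- cst T^-1) \+ cst T^-1 = (Num.sqrt a / 2) \*o (SS a).2.
    by apply/funext => p /=; rewrite subrK.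
  rewrite ipZl ?ipZr//; last exact: L2Z.
  rewrite mulrA -expr2 sqrtrM ?sqr_ge0// sqrtr_sqr ger0_norm; last by rewrite divr_ge0// sqrtr_ge0.
  move=> h; apply: le_trans h _; rewrite /K; apply: lerD.
    apply: le_trans cb _; rewrite -/T -/K1 -/K2; apply: lerD.
      by rewrite ler_piMr.
    by rewrite ler_piMr.
  rewrite (ip_cst L_gt0 fl_fr) -/T mulrC sqrtrM; last by rewrite mulr_ge0.
  by rewrite sqrtr_sqr ger0_norm// invr_ge0.
have lE : load (SS a) <= Num.sqrt I * s1.
  rewrite /load -(ip1 L fl fr); apply: le_trans (ler_norm _) _.
  apply: le_trans (norm_ip_le mOm Le (L2_cst L_gt0 fl_fr 1)) _.
  by rewrite (ip_cst L_gt0 fl_fr) expr1n mul1r.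
apply: (@le_trans _ _ (load (SS a))).
  by rewrite -(SS_sol a0 (SS_space a0)) formE lerDl ip_ge0.
apply: le_trans lE _; rewrite [leRHS]mulrAC; apply: ler_wpM2r => //.
by rewrite ler_pdivlMr//; move: E; lra.
Qed.

Definition err_dy (i : nat) : plane -> R :=
  (SS (node i)).2 \- (fun p => dcomparison fl T m (Num.sqrt (node i)) p.2).

Let Lerr i : L2 mu OmL (err_dy i).
Proof.
have a0 := @node_gt0 R i; have [[_ _ e3] _] := SS_space a0.
have gW := H1_line_W fl fr m (node i) L_gt0 bl_C1 br_C1 bl_B br_B.
have [_ LW] := H1_line_L2 bl_C1 br_C1 bl_B br_B gW.
exact: (L2B mOm (L2_Om e3) (L2_Om LW)).
Qed.

(** The integrals are at most [4 * (L / m)] times a squared exponential, which [expN_sqr_le] and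
    [node_sqr_le] turn into telescoping differences of nodes. *)
Lemma node_error_ae : {ae mu, forall p, OmL p -> node i * err_dy i p ^+ 2 @[i --> \oo] --> (0 : R)}.
Proof.
have m0 := m_gt0; have L0 := L_gt0; have K0 : 0 <= L / m := divr_ge0 L_ge0 m_ge0.
have K1 : 0 <= 16 / m ^+ 4 by apply: divr_ge0 => //; exact: exprn_ge0.
apply: (@ae_summable_cvg0 _ _ _ mu OmL (fun i p => node i * err_dy i p ^+ 2) (2 * (4 * (L / m * (16 / m
  ^+ 4)))) node mOm).
- move=> i; apply: measurable_funM => //; apply: measurable_funX; case: (Lerr i) => //.
- by move=> i p _; rewrite mulr_ge0 ?sqr_ge0// ltW// node_gt0.
- by apply: mulr_ge0 => //; apply: mulr_ge0 => //; exact: mulr_ge0 K0 K1.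
- by move=> i; rewrite ltW// (@node_gt0 R).
move=> i; have a0 := @node_gt0 R i; set sa := Num.sqrt (@node R i).
have sa0 : 0 < sa by rewrite sqrtr_gt0.
have ee := error_energy L_gt0 bl_C1 br_C1 bl_B br_B m_gt0 a0 fl_fr bl_fl fr_br (SS_space a0) (SS_sol a0).
rewrite -/sa in ee.
have Lz := L2Z sa mOm (Lerr i).
have -> : (\int[mu]_(p in OmL) (node i * err_dy i p ^+ 2)%:E = (node i * ip mu OmL (err_dy i) (err_dy
  i))%:E)%E.
  have -> : node i * ip mu OmL (err_dy i) (err_dy i) = ip mu OmL (sa \*o err_dy i) (sa \*o err_dy i).
    by rewrite ipZl ?ipZr// mulrA -expr2 sqr_sqrtr// ltW.
  rewrite ip_EFin//; apply: eq_integral => p _ /=; congr EFin.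
  by rewrite -[in LHS](sqr_sqrtr (ltW a0)) -/sa; ring.
rewrite lee_fin; apply: le_trans ee _.
have -> : 2 * (4 * (L / m * (16 / m ^+ 4))) * (node i - node i.+1) = 4 * (L / m * ((16 / m ^+ 4) * (2 *
  (node i - node i.+1)))) by ring.
apply: ler_wpM2l => //; apply: ler_wpM2l => //.
apply: le_trans (ler_wpM2l K1 (node_sqr_le i)).
have k0 : 0 < kappa m sa by exact: divr_gt0.
have kE : kappa m sa ^+ 4 = m ^+ 4 / node i ^+ 2.
  by rewrite /kappa expr_div_n; congr (_ / _); rewrite -(sqr_sqrtr (ltW a0)) -/sa -exprM.
apply: le_trans (expN_sqr_le k0) _; rewrite kE; have n0 : node i != 0 :> R by rewrite gt_eqF.
have mn0 : m != 0 by rewrite gt_eqF.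
rewrite le_eqVlt; apply/orP; left; apply/eqP; move: n0; move: (node i : R) => x x0; field.
by rewrite x0 mn0.
Qed.

Lemma height_cvg : Num.sqrt (node i : R) * height T m (Num.sqrt (node i : R)) @[i --> \oo] --> (1 : R).
Proof.
have m0 := m_gt0; have L0 := L_gt0; have T0 := T_gt0.
set K1 := 2 * (Num.sqrt (L * T) / T ^+ 2); set K2 := Num.sqrt L / Num.sqrt m.
have sLT : 0 < Num.sqrt (L / T) by rewrite sqrtr_gt0 divr_gt0.
have K20 : 0 <= K2 by rewrite divr_ge0 ?sqrtr_ge0.
have sn : Num.sqrt (node i : R) @[i --> \oo] --> (0 : R).
  rewrite -(sqrtr0 R); apply: continuous_cvg; [exact: sqrt_continuous|exact: cvg_node].
have bd : forall i, `|1 - Num.sqrt (node i) * height T m (Num.sqrt (node i))| <=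
    (K1 + K2 / m) / Num.sqrt (L / T) * Num.sqrt (node i).
  move=> i; have a0 := @node_gt0 R i; set sa := Num.sqrt (@node R i).
  have sa0 : 0 < sa by rewrite sqrtr_gt0.
  have [h1 h2] := profile_slope_le L_gt0 m_gt0 a0 fl_fr.
  rewrite ger0_norm// mulrAC ler_pdivlMr// mulrC; apply: le_trans h2 _.
  rewrite -/T -/K1 -/K2 -/sa [leRHS]mulrDl; apply: lerD => //; rewrite -[leRHS]mulrA; apply: ler_wpM2l => //.
  (* The exponential is replaced by the inverse of [kappa], that is by a multiple of [sa], to obtain
     one bound that visibly tends to 0. *)
  have k0 : 0 < kappa m sa by exact: divr_gt0.
  have -> : m^-1 * sa = (kappa m sa)^-1 by rewrite /kappa invf_div mulrC.
  rewrite expRN lef_pV2 ?posrE ?expR_gt0//.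
  by apply: le_trans (expR_ge1Dx _); lra.
have c0 : 1 - Num.sqrt (node i) * height T m (Num.sqrt (node i)) @[i --> \oo] --> (0 : R).
  apply: norm_cvg0; apply: (@squeeze_cvgr _ _ _ _ (fun=> 0) (fun i => (K1 + K2 / m) / Num.sqrt (L / T) *
    Num.sqrt (node i))).
  - by apply: nearW => i; rewrite normr_ge0 bd.
  - exact: cvg_cst.
  - rewrite -[X in _ --> X](mulr0 ((K1 + K2 / m) / Num.sqrt (L / T))).
    by apply: cvgM; [exact: cvg_cst|exact: sn].
have c1 : 1 - (1 - Num.sqrt (node i) * height T m (Num.sqrt (node i))) @[i --> \oo] --> (1 - 0 : R).
  by apply: cvgB; [exact: cvg_cst|exact: c0].
rewrite subr0 in c1; move: c1; under eq_fun do rewrite subKr.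
exact.
Qed.

(** The integral of [node i * h i] is at most a constant times [node i.+1 ^+ 2], the squared
    relative gap, times the inverse square root of [node i] from [energy_growth]. This has the order
    of the power -3/2 of the index, which is summable. *)
Lemma tail_exists : exists h : nat -> plane -> R, [/\ forall i, measurable_fun (DL : set mplane) (h i),
  forall i p, DL p -> 0 <= h i p,
  {ae mu, forall p, DL p -> node i * h i p @[i --> \oo] --> (0 : R)} &
  {ae mu, forall p, DL p -> forall i N, (\sum_(n < N) `|(node i - node i.+1) ^+ n.+1 *
     (iterate L bl br fl fr (node i) (SS (node i)) n.+1).2 p|) ^+ 2 <= h i p}].
Proof.
have [C C0 HC] := energy_growth.
have ex i := iterate_tail bl_C1 br_C1 bl_B br_B bl_fl' fl_fr fr_br' (@node_gt0 R i) (SS_space (@node_gt0 R i))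
   (d := node i - node i.+1) (eq_ind_r (fun t => 0 <=
     t) (mulr_ge0 (ltW (@node_gt0 R _)) (ltW (@node_gt0 R _))) (node_diff i))
   (eq_ind_r (fun t => t <= node i / 2) (eq_ind_r (fun t => _ <=
     t) (ler_wpM2r (ltW (@node_gt0 R i)) (node_half i)) (mulrC _ _)) (node_diff i)).
pose h i := projT1 (cid (ex i)); have hP i := projT2 (cid (ex i)).
exists h; split.
- by move=> i; case: (hP i).
- by move=> i; case: (hP i).
- apply: (@ae_summable_cvg0 _ _ _ mu DL (fun i p => node i * h i p) (2 * (4 * C)) (fun i => Num.sqrt
  (node i)) mDL).
  + by move=> i; apply: measurable_funM => //; case: (hP i).
  + by move=> i p Dp; rewrite mulr_ge0 ?(ltW (@node_gt0 R _))//; case: (hP i) => _ H _ _; exact: H.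
  + by rewrite !mulr_ge0.
  + by move=> i; exact: sqrtr_ge0.
  move=> i; have [mh h0 ih _] := hP i; have a0 := @node_gt0 R i.
  under eq_integral do rewrite EFinM.
  rewrite ge0_integralZl//; first last.
  - by rewrite lee_fin ltW.
  - exact/measurable_EFinP.
  apply: (@le_trans _ _ ((node i)%:E * (4 * (((node i - node i.+1) / node i) ^+ 2 * grad_product (SS
    (node i)) (SS (node i))))%:E)%E).
    by rewrite lee_pmul2l// ?lte_fin// fin_numE.
  rewrite node_step -EFinM lee_fin.
  have H1 := HC _ a0 (node_le1 i).
  have -> : node i * (4 * (node i.+1 ^+ 2 * grad_product (SS (node i)) (SS (node i)))) =
    4 * node i.+1 ^+ 2 * (node i * grad_product (SS (node i)) (SS (node i))) by ring.
  apply: le_trans (ler_wpM2l _ H1) _; first by rewrite mulr_ge0// sqr_ge0.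
  have -> : 4 * node i.+1 ^+ 2 * (C / Num.sqrt (node i)) = 4 * C * (node i.+1 ^+ 2 / Num.sqrt (node i))
    by ring.
  apply: le_trans (ler_wpM2l _ (node_sqrt_le i)) _; first by rewrite mulr_ge0.
  by rewrite le_eqVlt; apply/orP; left; apply/eqP; ring.
- have : {ae mu, forall p, forall i, DL p -> forall N, (\sum_(n < N) `|(node i - node i.+1) ^+ n.+1 *
     (iterate L bl br fl fr (node i) (SS (node i)) n.+1).2 p|) ^+ 2 <= h i p}.
    by apply: ae_foralln => i; have [_ _ _ H] := hP i; exact: H.
  by apply: filterS => p H Dp i; exact: H.
Qed.

(* One representative of (S_b)_y for each b, read off the expansion at the node just above b. *)
Definition family (b : R) (p : plane) : R :=
  if b <= 1 then let i := node_index b in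
    series_dy L bl br fl fr (node i) (SS (node i)) (node i - b) p
  else (SS b).2 p.

Lemma family_sol (b : R) : 0 < b -> {ae mu, forall p, DL p -> family b p = (SS b).2 p}.
Proof.
move=> b0; have [b1|b1] := leP b 1; last by apply: aeW => p _; rewrite /family leNgt b1.
have /andP[h1 h2] := node_indexP b0 b1; set i := node_index b in h1 h2 *.
have a0 := @node_gt0 R i.
have t0 : 0 <= node i - b by rewrite subr_ge0.
have td : node i - b <= node i - node i.+1 by rewrite lerD2l lerN2 ltW.
have ta : node i - b <= node i / 2.
  by apply: le_trans td _; rewrite node_diff mulrC ler_wpM2l ?(ltW a0)// node_half.
have bE : node i - (node i - b) = b by rewrite subKr.
have := series_dy_sol bl_C1 br_C1 bl_B br_B bl_fl' fl_fr fr_br' a0 (SS_space a0) (SS_sol a0) t0 ta (Sb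
  := SS b).
rewrite bE => /(_ (SS_space b0) (SS_sol b0)); apply: filterS => p H Dp.
by rewrite /family b1; apply: cvg_lim => //; exact: H.
Qed.

(** With [i] the index of [b] and [r = sqrt (b / node i)], the deviation from [2 / T] splits into
    the oscillation between the nodes, [r] times the deviation at the node, and [(1 - r) * (2 / T)].
    All three are bounded by the sequence [z], which depends on [b] through its index only, so a
    limit of sequences yields the full limit. *)
Lemma family_cvg : {ae mu, forall p, OmL p ->
  Num.sqrt b * family b p @[b --> 0^'+] --> 2 / T}.
Proof.
have [h [_ h0 hc hN]] := tail_exists; have T0 := T_gt0.
apply: filterS3 node_error_ae hc hN => p ne hc' hN' Op.
have Dp := OmDL Op; have {}ne := ne Op; have {}hc' := hc' Dp; have {}hN' := hN' Dp.
pose x (i : nat) : R := Num.sqrt (node i) * (SS (node i)).2 p.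
pose z (i : nat) : R := Num.sqrt (node i * h i p) + `|x i - 2 / T| + node i.+1 * (2 / T).
have sc (u : nat -> R) : u i @[i --> \oo] --> (0 : R) -> Num.sqrt (u i) @[i --> \oo] --> (0 : R).
  by move=> cu; rewrite -(sqrtr0 R); apply: continuous_cvg; [exact: sqrt_continuous|exact: cu].
have cx : x i - 2 / T @[i --> \oo] --> (0 : R).
  pose v (i : nat) := Num.sqrt (node i) * err_dy i p.
  have cv : v i @[i --> \oo] --> (0 : R).
    apply: norm_cvg0; have := sc _ ne; apply: cvg_trans; apply: near_eq_cvg; apply: nearW => i.
    by rewrite /v sqrtrM ?(ltW (@node_gt0 R i))// sqrtr_sqr normrM (ger0_norm (sqrtr_ge0 _)).
  have cH := height_cvg.
  have E i : x i - 2 / T = v i + (Num.sqrt (node i) * height T m (Num.sqrt (node i)) - 1) * (2 / T).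
    rewrite /x /v /err_dy /=; have [h1 h2] := Op.1.
    have [-> _ _ _ _] := @profile_inside R fl T m (Num.sqrt (node i)) T_gt0 m_gt0 ltac:(by rewrite
      sqrtr_gt0 node_gt0) p.2 h1 ltac:(by rewrite /T addrC subrK).
    by field; rewrite gt_eqF.
  have -> : (fun i => x i - 2 / T) = (fun i => v i + (Num.sqrt (node i) * height T m (Num.sqrt (node i))
    - 1) * (2 / T)).
    by apply/funext => i; exact: E.
  have c1 : Num.sqrt (node i) * height T m (Num.sqrt (node i)) - 1 @[i --> \oo] --> (1 - 1 : R).
    by apply: cvgB; [exact: cH|exact: cvg_cst].
  have c2 : v i + (Num.sqrt (node i) * height T m (Num.sqrt (node i)) - 1) * (2 / T) @[i --> \oo] -->
    0 + (1 - 1) * (2 / T).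
    by apply: cvgD; [exact: cv|apply: cvgM; [exact: c1|exact: cvg_cst]].
  by rewrite subrr mul0r addr0 in c2.
have cz : z i @[i --> \oo] --> (0 : R).
  have c1 := sc _ hc'; have c2 : `|x i - 2 / T| @[i --> \oo] --> (`|0 : R| : R) by exact: (cvg_norm cx).
  have c3 : node i.+1 @[i --> \oo] --> (0 : R) by have := @cvg_node R; rewrite -(cvg_shiftS (@node R)).
  have c4 : node i.+1 * (2 / T) @[i --> \oo] --> (0 * (2 / T) : R) by apply: cvgM; [exact: c3|exact: cvg_cst].
  rewrite normr0 in c2; rewrite mul0r in c4.
  have c5 : Num.sqrt (node i * h i p) + `|x i - 2 / T| @[i --> \oo] --> (0 + 0 : R) by apply: cvgD;
    [exact: c1|exact: c2].
  have c6 : Num.sqrt (node i * h i p) + `|x i - 2 / T| + node i.+1 * (2 / T) @[i --> \oo] -->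
    (0 + 0 + 0 : R) by apply: cvgD; [exact: c5|exact: c4].
  by rewrite !addr0 in c6.
have bd b : 0 < b -> b <= 1 -> `|Num.sqrt b * family b p - 2 / T| <= z (node_index b).
  move=> b0 b1; rewrite /family b1.
  have /andP[h1 h2] := node_indexP b0 b1; set i := node_index b in h1 h2 *.
  have a0 := @node_gt0 R i.
  have t0 : 0 <= node i - b by rewrite subr_ge0.
  have td : node i - b <= node i - node i.+1 by rewrite lerD2l lerN2 ltW.
  have hi0 : 0 <= h i p by exact: h0.
  have tail := @series_dy_tail R L bl br fl fr (node i) (SS (node i)) (node i - node i.+1) (node i - b)
    p (Num.sqrt (h i p)) t0 td (sqrtr_ge0 _).
  have {}tail := tail (fun N => eq_ind_r (fun t => _ <= t) (hN' i N) (sqr_sqrtr hi0)).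
  set u := series_dy _ _ _ _ _ _ _ _ _ in tail *.
  have -> : Num.sqrt b * u - 2 / T = Num.sqrt b * (u - (SS (node i)).2 p) + (Num.sqrt b * (SS (node
    i)).2 p - 2 / T) by ring.
  apply: le_trans (ler_normD _ _) _; rewrite /z -addrA; apply: lerD.
    rewrite normrM (ger0_norm (sqrtr_ge0 _)) sqrtrM ?(ltW a0)//.
    by apply: ler_pM => //; exact: ler_wsqrtr.
  set r := Num.sqrt (b / node i).
  have rE : Num.sqrt b = r * Num.sqrt (node i).
    by rewrite /r -sqrtrM ?divr_ge0 ?(ltW b0) ?(ltW a0)// divfK// gt_eqF.
  have ba : b / node i <= 1 by rewrite ler_pdivrMr// mul1r.
  have r1 : r <= 1 by rewrite -sqrtr1; exact: ler_wsqrtr.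
  have r0 : 0 <= r := sqrtr_ge0 _.
  (* Since [0 <= r <= 1], [1 - r] is at most [1 - r ^+ 2], which is at most the relative gap. *)
  have rr : 1 - r <= node i.+1.
    have r2 : r ^+ 2 = b / node i by rewrite sqr_sqrtr// divr_ge0 ?(ltW b0) ?(ltW a0).
    have r3 : r ^+ 2 <= r by rewrite expr2 ler_piMl.
    have r4 : 1 - b / node i <= node i.+1.
      rewrite -node_step -[X in X - _](divff (lt0r_neq0 a0)) -mulrBl.
      by rewrite ler_wpM2r ?invr_ge0 ?(ltW a0).
    by lra.
  have -> : Num.sqrt b * (SS (node i)).2 p - 2 / T = r * (x i - 2 / T) + - ((1 - r) * (2 / T)).
    by rewrite rE /x; ring.
  have T2 : 0 <= 2 / T by rewrite divr_ge0.
  apply: le_trans (ler_normD _ _) _; apply: lerD.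
    by rewrite normrM (ger0_norm r0) ler_piMl.
  have h5 : 0 <= (1 - r) * (2 / T) by apply: mulr_ge0 => //; rewrite subr_ge0.
  by rewrite normrN (ger0_norm h5); exact: ler_wpM2r.
apply/cvgrPdist_lt => eps e0.
have /cvgrPdist_lt/(_ _ e0) [N _ HN] := cz.
near=> b.
have b0 : 0 < b by near: b; exact: nbhs_right_gt.
have bN : b < node N by near: b; apply: nbhs_right_lt; exact: node_gt0.
have b1 : b <= 1 by apply: ltW; apply: lt_le_trans bN (node_le1 N).
rewrite distrC; apply: le_lt_trans (bd b b0 b1) _.
have := HN _ (node_index_ge b0 bN); rewrite /= sub0r normrN; apply: le_lt_trans; exact: ler_norm.
Unshelve. all: by end_near. Qed.

End FamilyConvergence.

(** The supremum is not attained: a closed disk inside the open band has diameter below [fr - fl].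
    Centres on the midline at the abscissa of [p] suffice, with radii approaching half the width. *)
Lemma thickness_band (R : realType) (fl fr : R) (p : R * R) : fl < fr -> band fl fr p ->
  thickness (band fl fr) p = fr - fl.
Proof.
move=> flr [p1 p2]; rewrite /thickness; set A := [set d | _].
have ubA : ubound A (fr - fl).
  move=> _ [c [r [r0 -> _ sub]]].
  have [|_] := sub (c.1, c.2 + r); first by rewrite /disk /= subrr addrAC subrr add0r expr0n add0r.
  have [|+ _] := sub (c.1, c.2 - r).
    by rewrite /disk /= subrr addrAC subrr add0r expr0n add0r sqrrN.
  rewrite /=; lra.
have sqle (x r : R) : 0 <= r -> (x ^+ 2 <= r ^+ 2) = (`|x| <= r).
  by move=> r0; rewrite -(real_normK (num_real x)) ler_sqr ?nnegrE ?normr_ge0.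
have sA d : d < fr - fl -> exists2 x, A x & d < x.
  move=> dT; set c := (fl + fr) / 2; set h := (fr - fl) / 2.
  (* The radius must reach [p] and exceed [d / 2]; halfway between [q] and [h] it does both strictly
     and still fits. *)
  set q := Num.max `|p.2 - c| (d / 2).
  have qc : `|p.2 - c| <= q by rewrite le_max lexx.
  have qd : d / 2 <= q by rewrite le_max lexx orbT.
  have qh : q < h by rewrite gt_max ltr_norml /h /c; apply/andP; split; [apply/andP; split|]; lra.
  have q0 : 0 <= q by exact: le_trans (normr_ge0 _) qc.
  exists (2 * ((q + h) / 2)); last by lra.
  exists (p.1, c), ((q + h) / 2); split=> //; first by lra.
    rewrite /disk /= subrr expr0n add0r sqle; lra.
  move=> z; rewrite /disk /= => hz.
  have : (z.2 - c) ^+ 2 <= ((q + h) / 2) ^+ 2 by apply: le_trans hz; rewrite lerDr sqr_ge0.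
  rewrite sqle; last by lra.
  move=> hz'; have : `|z.2 - c| < h by lra.
  by rewrite ltr_norml => /andP[]; rewrite /h /c /band /=; split; lra.
have hsA : has_sup A.
  split; last by exists (fr - fl).
  have [x Ax _] := sA (fr - fl - 1) ltac:(lra); by exists x.
apply/eqP; rewrite eq_le ge_sup//=; last by case: hsA.
rewrite leNgt; apply/negP => /sA[x Ax]; rewrite ltNge => /negP; apply.
by apply: ub_le_sup => //; case: hsA.
Qed.

Lemma is_weak_partial_ae (R : realType) (D : set (R * R)) (v : R * R) (u u' g : R * R -> R) :
  open D -> v = e_x \/ v = e_y -> loc_integrable D u' ->
  {ae plane_measure R, forall p, D p -> u p = u' p} ->
  is_weak_partial D v u g -> is_weak_partial D v u' g.
Proof.
move=> oD hv lu' uu' [lu lg H]; split => // phi Cphi; rewrite -H//.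
have [/C1_planeP[_ _ cx cy] _] := Cphi.
have cv : continuous ('D_v phi) by case: hv => ->; [exact: cx|exact: cy].
have mv : measurable_fun (D : set (measurableTypeR R * measurableTypeR R)) ('D_v phi).
  by apply: measurable_funTS; exact: continuous_plane_measurable.
have mD := open_plane_measurable oD.
congr fine; apply: (@ae_eq_integral _ _ _ (plane_measure R)) => //.
- by apply/measurable_EFinP; apply: measurable_funM => //; exact: loc_integrable_measurable.
- by apply/measurable_EFinP; apply: measurable_funM => //; exact: loc_integrable_measurable.
- by apply: filterS uu' => p E Dp; rewrite /= E.
Qed.

(** * Periodicity of the selected weak derivatives *)

Section PeriodicGradient.
Context {R : realType}.
Local Notation plane := (R * R)%type.
Local Notation mu := (plane_measure R).
Variables (L : R) (bl br : R -> R) (B : R).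
Hypothesis L_gt0 : 0 < L.
Hypotheses (bl_per : periodic bl L) (br_per : periodic br L).
Hypotheses (bl_C1 : C1_line bl) (br_C1 : C1_line br).
Hypotheses (bl_B : forall x, `|bl x| <= B) (br_B : forall x, `|br x| <= B).

Let D : set plane := channel bl br.
Let DL : set plane := unit_region L D.

(** Nothing in the selection makes the representative periodic. It is compared with the weak
    derivative of the periodic extension of [u], which is known explicitly; the two functions agree
    almost everywhere, hence so do their weak derivatives. *)
Lemma weak_partial_xper (v : plane) (u : plane -> R) : v = e_x \/ v = e_y -> H10per L bl br u ->
  {ae mu, forall p, D p -> weak_partial D v u p = weak_partial D v u (xper L p)}.
Proof.
move=> hv Hu; have D_per := channel_per bl_per br_per.
have oD := open_channel bl_C1 br_C1; have [[pu ex ey _] _] := Hu.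
have Su := H10per_space bl_C1 br_C1 bl_B br_B Hu.
have [[[_ [g1 wg1] _ _] _] ax ay] := space_H10per L_gt0 bl_per br_per bl_C1 br_C1 bl_B br_B Su.
have uU : {ae mu, forall p, D p -> u p = (u \o xper L) p}.
  by apply: filterS (ae_periodic D_per pu) => p H /H.
have [lU _ _] := wg1.
have key (g : plane -> R) : is_weak_partial D v u g ->
    {ae mu, forall p, D p -> weak_partial D v u p = weak_partial D v (u \o xper L) p}.
  move=> wg; have [_ E1] := weak_partialP oD wg.
  have [_ E2] := weak_partialP oD (is_weak_partial_ae oD hv lU uU wg).
  by apply: filterS2 E1 E2 => p h1 h2 Dp; rewrite h1// h2.
case: hv key => -> key.
  have [g wg] := ex; apply: filterS2 (key _ wg) ax => p h1 h2 Dp; by rewrite h1// h2.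
have [g wg] := ey; apply: filterS2 (key _ wg) ay => p h1 h2 Dp; by rewrite h1// h2.
Qed.

Lemma weak_partial_cell (v : plane) (u h : plane -> R) : v = e_x \/ v = e_y -> H10per L bl br u ->
  {ae mu, forall p, DL p -> weak_partial D v u p = h p} ->
  {ae mu, forall p, D p -> weak_partial D v u p = h (xper L p)}.
Proof.
move=> hv Hu uh; have D_per := channel_per bl_per br_per.
have := @ae_xper _ L L_gt0 D D_per (fun p => weak_partial D v u p = h p) uh.
by apply: filterS2 (weak_partial_xper hv Hu) => p h1 h2 Dp; rewrite h1// h2.
Qed.

End PeriodicGradient.

(** * Error estimate and convergence for the inverse thickness and the thickness *)

Section Thickness.
Context {R : realType}.
Local Notation plane := (R * R)%type.
Local Notation mplane := (measurableTypeR R * measurableTypeR R)%type.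
Local Notation mu := (plane_measure R).
Variables (L : R) (bl br : R -> R) (B : R) (fl fr m : R).
Hypothesis L_gt0 : 0 < L.
Hypotheses (bl_per : periodic bl L) (br_per : periodic br L).
Hypotheses (bl_C1 : C1_line bl) (br_C1 : C1_line br).
Hypotheses (bl_B : forall x, `|bl x| <= B) (br_B : forall x, `|br x| <= B).
Hypotheses (m_gt0 : 0 < m) (fl_fr : fl < fr).
Hypotheses (bl_fl : forall x, bl x <= fl - m) (fr_br : forall x, fr + m <= br x).

Let T := fr - fl.
Let T_gt0 : 0 < T. Proof. by rewrite subr_gt0. Qed.
Let bl_fl' x : bl x < fl. Proof. by apply: le_lt_trans (bl_fl x) _; rewrite ltrBlDr ltrDl. Qed.
Let fr_br' x : fr < br x. Proof. by apply: lt_le_trans (fr_br x); rewrite ltrDl. Qed.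

Let D : set plane := channel bl br.
Let Om : set plane := band fl fr.
Let DL : set mplane := unit_region L D.
Let OmL : set mplane := unit_region L Om.
Let OmDL : OmL `<=` DL := unit_band_sub bl_fl' fr_br'.
Let OmD : Om `<=` D.
Proof. by move=> p [h1 h2]; split; [exact: lt_trans h1|exact: lt_trans (fr_br' _)]. Qed.
Local Notation vsol := (vector_solution L bl br fl fr).
Local Notation ssol := (scalar_solution L bl br fl fr).

Lemma scalar_solution_unique a S S' : 0 < a -> ssol a S -> ssol a S' ->
  {ae mu, forall p, D p -> S' p = S p}.
Proof.
move=> a0 HS HS'; apply: (H10per_ae L_gt0 bl_per br_per HS'.1 HS.1).
have := scalar_unique L_gt0 bl_per br_per bl_C1 br_C1 bl_B br_B bl_fl' fl_fr fr_br' a0 HS' HS.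
by apply: filterS => p H /H[].
Qed.

Lemma vector_componentsD a s : 0 < a -> vsol a s ->
  [/\ {ae mu, forall p, D p -> (s p).1 = 0}, ssol a (snd \o s) &
      {ae mu, forall p, D p -> divergence bl br s p = weak_partial D e_y (snd \o s) p}].
Proof.
move=> a0 Hs; have [z Hss] :=
  vector_components L_gt0 bl_per br_per bl_C1 br_C1 bl_B br_B bl_fl' fl_fr fr_br' a0 Hs.
have H1 : H10per L bl br (fst \o s) := Hs.1.1.
have H0 : H10per L bl br (fun=> 0).
  exact: (vector_of_scalar L_gt0 bl_per br_per bl_C1 br_C1 bl_B br_B bl_fl' fl_fr fr_br' Hss).1.1.
split=> //.
  have := @H10per_ae _ L bl br L_gt0 bl_per br_per (fst \o s) (fun=> 0) H1 H0.
  by apply; apply: filterS z => p H /H[].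
have zx : {ae mu, forall p, DL p -> weak_partial D e_x (fst \o s) p = 0}.
  by apply: filterS z => p H Dp; have [_ h _] := H Dp; exact: h.
have := weak_partial_cell L_gt0 bl_per br_per bl_C1 br_C1 bl_B br_B (or_introl erefl) H1 zx.
by apply: filterS => p H Dp; rewrite /divergence -/D H// add0r.
Qed.

Lemma vector_solution_scalar a S s : 0 < a -> ssol a S -> vsol a s ->
  {ae mu, forall p, D p -> s p = (0, S p)}.
Proof.
move=> a0 HS /(vector_componentsD a0)[s1 s2 _].
apply: filterS2 s1 (scalar_solution_unique a0 HS s2) => p h1 h2 Dp.
by rewrite [LHS]surjective_pairing h1// -h2.
Qed.

Lemma inv_thickness_error a s : 0 < a -> vsol a s ->
  (norm2 OmL (pde_inv_thickness bl br a s \- (fun p => (thickness Om p)^-1))%R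
    <= (2 * (Num.sqrt (L * T) / T ^+ 2) * Num.sqrt a +
        2 * (Num.sqrt L / Num.sqrt m) * expR (- (m / Num.sqrt a)))%:E)%E.
Proof.
move=> a0 Hs; have [_ Hss dv] := vector_componentsD a0 Hs.
have mDL := measurable_unit_channel L bl_C1 br_C1.
have mOm := measurable_unit_band L fl fr.
have mD := measurable_channel bl_C1 br_C1.
have [H2 eqS] := (scalar_solutionP L_gt0 bl_per br_per bl_C1 br_C1 bl_B br_B bl_fl' fl_fr fr_br' _ _).1 Hss.
have Sp := H10per_space bl_C1 br_C1 bl_B br_B H2.
have bd := comparison_bound L_gt0 bl_C1 br_C1 bl_B br_B m_gt0 a0 fl_fr bl_fl fr_br Sp eqS.
have [[_ _ L2y] _] := Sp; have [[_ L1x _] _] := H10per_space bl_C1 br_C1 bl_B br_B Hs.1.1.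
set w := fun p : plane => _ - _ in bd.
set g := (_ \- _)%R.
have Ldiv : L2 mu OmL (divergence bl br s).
  exact: L2S mDL mOm OmDL (L2D mDL L1x L2y).
have Lw : L2 mu OmL w.
  apply: (L2B mOm); last exact: (L2_cst L_gt0 fl_fr).
  exact: (L2Z (Num.sqrt a / 2) mOm (L2S mDL mOm OmDL L2y)).
have gE : norm2 OmL g = norm2 OmL (fun p => Num.sqrt a / 2 * divergence bl br s p - T^-1).
  congr ('N[_]_(_)[_])%E; apply/funext => p; congr EFin; rewrite !patchE.
  by case: ifP => // /set_mem[Op _]; rewrite /g /= thickness_band.
have Lg : L2 mu OmL (fun p => Num.sqrt a / 2 * divergence bl br s p - T^-1).
  by apply: (L2B mOm); [exact: (L2Z (Num.sqrt a / 2) mOm Ldiv)|exact: (L2_cst L_gt0 fl_fr)].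
rewrite gE (norm2_L2 mOm Lg) lee_fin; apply: le_trans bd.
suff -> : ip mu OmL (fun p => Num.sqrt a / 2 * divergence bl br s p - T^-1)
  (fun p => Num.sqrt a / 2 * divergence bl br s p - T^-1) = ip mu OmL w w by [].
have aew : {ae mu, forall p, OmL p ->
    Num.sqrt a / 2 * divergence bl br s p - T^-1 = w p}.
  by apply: filterS dv => p H [Op _]; rewrite H//; exact: OmD.
exact: (ae_ip mOm Lg Lw Lg Lw aew aew).
Qed.

(** The representatives in [family] are controlled on one period; they are extended by [xper L], and
    agree with the divergence on the whole band by periodicity of the weak derivatives. *)
Lemma pde_thickness_cvg (s : R -> plane -> plane) : (forall a, 0 < a -> vsol a (s a)) ->
  ae_cvg_at_right0 Om (fun a => pde_thickness bl br a (s a)) (thickness Om).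
Proof.
move=> Hs; pose SS a := grad_triple bl br (snd \o s a).
have Hss a (a0 : 0 < a) : ssol a (snd \o s a) by have [] := vector_componentsD a0 (Hs a a0).
have SS_space a : 0 < a -> space L bl br (SS a).
  by move=> a0; exact: (H10per_space bl_C1 br_C1 bl_B br_B (Hss a a0).1).
have SS_sol a : 0 < a -> forall f, space L bl br f ->
    form L bl br fl fr a (SS a) f = load L fl fr f.
  move=> a0.
  exact: ((scalar_solutionP L_gt0 bl_per br_per bl_C1 br_C1 bl_B br_B bl_fl' fl_fr fr_br' _ _).1 (Hss a
    a0)).2.
pose v a (p : plane) : R := 2 / (Num.sqrt a * family L bl br fl fr SS a (xper L p)).
exists v; split.
  move=> a a0; have [_ _ dv] := vector_componentsD a0 (Hs a a0).
  have fs := family_sol bl_C1 br_C1 bl_B br_B m_gt0 fl_fr bl_fl fr_br SS_space SS_sol a0.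
  have fs' : {ae mu, forall p, DL p -> weak_partial D e_y (snd \o s a) p = family L bl br fl fr SS a p}.
    by apply: filterS fs => p H Dp; rewrite H.
  have := weak_partial_cell L_gt0 bl_per br_per bl_C1 br_C1 bl_B br_B (or_intror erefl) (Hss a a0).1 fs'.
  apply: filterS2 dv => p h1 h2 Op; have Dp := OmD Op.
  by rewrite /v /pde_thickness h1// h2.
have Om_per p : Om (p + (L, 0)) <-> Om p by rewrite /Om /band /= addr0.
have fc := family_cvg L_gt0 bl_C1 br_C1 bl_B br_B m_gt0 fl_fr bl_fl fr_br SS_space SS_sol.
have := @ae_xper _ L L_gt0 Om Om_per (fun p => Num.sqrt b * family L bl br fl fr SS b p @[b --> 0^'+]
  --> 2 / T) fc.
apply: filterS => p H Op; have {}H := H Op; rewrite thickness_band// -/T.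
(* The limit of the denominators is nonzero, so inversion is continuous there and the value 0 of a
   division by zero does not interfere. *)
have T2 : 2 / T != 0 by rewrite gt_eqF// divr_gt0.
have -> : T = 2 * (2 / T)^-1 by rewrite invf_div mulrC divfK// pnatr_eq0.
by apply: cvgM; [exact: cvg_cst|exact: cvgV].
Qed.

End Thickness.

Theorem theorem4p2 (R : realType) (L : R) (bl br : R -> R) (fl fr : R)
    (L_gt0 : 0 < L)
    (bl_per : periodic bl L) (br_per : periodic br L)
    (bl_C1 : C1_line bl) (br_C1 : C1_line br)
    (bl_fl : sup (range bl) < fl) (fl_fr : fl < fr)
    (fr_br : fr < inf (range br)) :
  let mu := plane_measure R in
  let D := channel bl br in
  let Om := band fl fr in
  let OmL := unit_region L Om in
  let T := fr - fl in
  let m := Num.min (inf (range br) - fr) (fl - sup (range bl)) in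
  [/\
      forall a : R, 0 < a ->
        exists s, vector_solution L bl br fl fr a s /\
          forall s', vector_solution L bl br fl fr a s' ->
            {ae mu, forall p, D p -> s' p = s p},
      forall a : R, 0 < a ->
        exists S, [/\ scalar_solution L bl br fl fr a S,
          forall S', scalar_solution L bl br fl fr a S' ->
            {ae mu, forall p, D p -> S' p = S p} &
          forall s, vector_solution L bl br fl fr a s ->
            {ae mu, forall p, D p -> s p = (0, S p)}],
      (forall p, Om p -> thickness Om p = T) /\
      forall s : R -> R * R -> R * R,
        (forall a : R, 0 < a -> vector_solution L bl br fl fr a (s a)) ->
        ae_cvg_at_right0 Om (fun a => pde_thickness bl br a (s a))
          (thickness Om) &
      forall (a : R) (s : R * R -> R * R), 0 < a -> vector_solution L bl br fl fr a s ->
        (norm2 OmL (pde_inv_thickness bl br a s \- (fun p => (thickness Om p)^-1))%R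
          <= (2 * (Num.sqrt (L * T) / T ^+ 2) * Num.sqrt a +
              2 * (Num.sqrt L / Num.sqrt m) * expR (- (m / Num.sqrt a)))%:E)%E].
Proof.
move=> mu D Om OmL T m.
have [Ml _ hl] := periodic_continuous_bounded L_gt0 bl_per (C1_line_continuous bl_C1).
have [Mr _ hr] := periodic_continuous_bounded L_gt0 br_per (C1_line_continuous br_C1).
(* This bound gives the channel finite width, and it makes the real-valued [sup] and [inf] in the
   hypotheses genuine bounds of the ranges. *)
set B := Num.max Ml Mr.
have bl_B x : `|bl x| <= B by rewrite le_max hl.
have br_B x : `|br x| <= B by rewrite le_max hr orbT.
have m_gt0 : 0 < m by rewrite lt_min !subr_gt0 fr_br bl_fl.
have bl_m x : bl x <= fl - m.
  have h : bl x <= sup (range bl).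
    apply: ub_le_sup; last by exists x.
    by exists B => _ [y _ <-]; exact: le_trans (ler_norm _) (bl_B y).
  by apply: le_trans h _; rewrite lerBrDl -lerBrDr ge_min lexx orbT.
have br_m x : fr + m <= br x.
  have h : inf (range br) <= br x.
    apply: ge_inf; last by exists x.
    by exists (- B) => _ [y _ <-]; have := br_B y; rewrite ler_norml => /andP[].
  by apply: le_trans h; rewrite -lerBrDl ge_min lexx.
have bl_lt x : bl x < fl by apply: le_lt_trans (bl_m x) _; rewrite ltrBlDr ltrDl.
have lt_br x : fr < br x by apply: lt_le_trans (br_m x); rewrite ltrDl.
have ex a (a0 : 0 < a) : exists S, scalar_solution L bl br fl fr a S.
  exact: (scalar_exists L_gt0 bl_per br_per bl_C1 br_C1 bl_B br_B bl_lt fl_fr lt_br a0).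
have vs a (a0 : 0 < a) S s : scalar_solution L bl br fl fr a S ->
    vector_solution L bl br fl fr a s -> {ae mu, forall p, D p -> s p = (0, S p)}.
  exact: (vector_solution_scalar L_gt0 bl_per br_per bl_C1 br_C1 bl_B br_B m_gt0 fl_fr bl_m br_m a0).
split.
- move=> a a0; have [S HS] := ex a a0; exists (fun p => (0, S p)); split.
    exact: (vector_of_scalar L_gt0 bl_per br_per bl_C1 br_C1 bl_B br_B bl_lt fl_fr lt_br HS).
  by move=> s' Hs'; exact: vs HS Hs'.
- move=> a a0; have [S HS] := ex a a0; exists S; split=> //.
    move=> S'.
    exact: (scalar_solution_unique L_gt0 bl_per br_per bl_C1 br_C1 bl_B br_B m_gt0 fl_fr bl_m br_m a0 HS).
  by move=> s Hs; exact: vs HS Hs.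
- split=> [p Op|s Hs]; first exact: thickness_band.
  exact: (pde_thickness_cvg L_gt0 bl_per br_per bl_C1 br_C1 bl_B br_B m_gt0 fl_fr bl_m br_m Hs).
- move=> a s a0 Hs.
  exact: (inv_thickness_error L_gt0 bl_per br_per bl_C1 br_C1 bl_B br_B m_gt0 fl_fr bl_m br_m a0 Hs).
Qed.
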